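(* Assume that for each $x\in\partial C$ there exist $u_x\in U$, $r>0$ and $\eta>0$ such that $$\sigma(z,u_x)=0\quad \forall z\in B(x,\eta)\cap C,\qquad\text{and}\qquad B(z+t\,b(z,u_x),rt)\subseteq C^\circ\quad\forall z\in B(x,\eta)\cap C,\ \forall t\in(0,r).$$ Then the upper semicontinuous envelope $(V^\circ)^\star$ is of class $R(C^\circ)$.
   Context: Setting. $T>0$; $\Omega=C([0,T],\mathbb{R}^N)$ with Wiener measure $\mathbb{P}$, canonical process $W_t(\omega)=\omega_t$, and $\mathbb{F}$ the $\mathbb{P}$-augmentation of the filtration generated by $W$. $U$ is a compact subset of a finite-dimensional space, $\mathcal{U}$ is the set of $U$-valued predictable processes. For $t\in[0,T]$, $\mathbb{F}^t=(\mathcal{F}^t_s)_{s}$ is the augmentation of $\sigma(W_r-W_t,\ t\le r\le s)$, and $\mathcal{U}_t=\{\nu\in\mathcal{U}:\nu\text{ is }\mathbb{F}^t\text{-predictable}\}$. $b:\mathbb{R}^d\times U\to\mathbb{R}^d$ and $\sigma:\mathbb{R}^d\times U\to\mathbb{R}^{d,N}$ are Lipschitz continuous; $X^{\nu,t,x}$ is the unique strong solution of $X_s=x+\int_t^s b(X_\tau,\nu_\tau)\,\mathrm{d}\tau+\int_t^s\sigma(X_\tau,\nu_\tau)\,\mathrm{d}W_\tau$, with $X^{\nu,t,x}_r=x$ for $r\le t$. $f:\mathbb{R}^d\times U\to\mathbb{R}_+$ is continuous and Lipschitz in the space variable uniformly in $u$. $C\subseteq\mathbb{R}^d$ has nonempty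 interior $C^\circ$ and $\overline{C^\circ}=C$. $J(\nu;t,x)=\mathbb{E}\big[\int_t^T f(X^{\nu,t,x}_s,\nu_s)\,\mathrm{d}s\big]$ and $$V^\circ(t,x)=\inf\{J(\nu;t,x):\nu\in\mathcal{U}_t,\ X^{\nu,t,x}_s\in C^\circ\ \forall s\in[0,T]\ \mathbb{P}\text{-a.s.}\},\qquad \inf\emptyset=+\infty .$$ For $(t,x)\in[0,T]\times C$, $(V^\circ)^\star(t,x)=\limsup V^\circ(s,y)$ as $(s,y)\to(t,x)$ with $(s,y)\in[0,T]\times C^\circ$. $B(x,\gamma)$ is the Euclidean ball with center $x$ and radius $\gamma$. Class $R(O)$. For an open set $O\subseteq\mathbb{R}^d$, a function $w:[0,T]\times\overline O\to\mathbb{R}$ is of class $R(O)$ if for any $(t,x)\in[0,T)\times\partial O$: (i) there exist $r>0$, an open neighborhood $B$ of $x$ in $\mathbb{R}^d$ and a function $l:\mathbb{R}_+\to\mathbb{R}^d$ such that $\liminf_{\varepsilon\to0}\varepsilon^{-1}|l(\varepsilon)|<\infty$ and $y+l(\varepsilon)+o(\varepsilon)\in O$ for all $y\in O\cap B$ and $\varepsilon\in(0,r)$ (where $o(\varepsilon)$ is any function with $o(\varepsilon)/\varepsilon\to0$, the inclusion being understood for $\varepsilon$ small enough depending on that function); (ii) there exists $\lambda:\mathbb{R}_+\to\mathbb{R}_+$ such that $\lim_{\varepsilon\to0}\lambda(\varepsilon)=0$ and $\lim_{\varepsilon\to0}w(t+\lambda(\varepsilon),x+l(\varepsilon))=w(t,x)$.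 *)

(* Defs.v *)
From HB Require Import structures.
From mathcomp Require Import all_boot all_order all_algebra.
From mathcomp Require Import all_classical all_reals all_analysis.

Set Implicit Arguments.
Unset Strict Implicit.
Unset Printing Implicit Defensive.

Import Order.TTheory GRing.Theory Num.Theory.
Import numFieldNormedType.Exports.

Local Open Scope classical_set_scope.
Local Open Scope ring_scope.

(* Euclidean (Frobenius) norm; the library norm `|A| on matrices is the maximum
   norm, which defines the same topology and the same Lipschitz functions. *)
Definition enorm {R : realType} {p q : nat} (A : 'M[R]_(p, q)) : R :=
  Num.sqrt (\sum_i \sum_j A i j ^+ 2).

Definition eball {R : realType} {p : nat} (x : 'cV[R]_p) (r : R)
    : set 'cV[R]_p :=
  [set y | enorm (y - x) < r].

Definition boundary {X : topologicalType} (A : set X) : set X :=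
  closure A `\` A°.

(* C([0,T], R^N): functions on R that are continuous on [0,T], extended by 0
   outside [0,T], so that two paths are equal iff they agree on [0,T]. *)
Record cpath (R : realType) (T : R) (N : nat) := CPath {
  cpath_fun :> R -> 'cV[R]_N ;
  cpath_continuous : {within `[0, T], continuous cpath_fun} ;
  cpath_off : forall s, ~ (0 <= s <= T) -> cpath_fun s = 0 }.

Section cpath_instances.
Context (R : realType) (T : R) (N : nat).

HB.instance Definition _ := gen_eqMixin (cpath T N).
HB.instance Definition _ := gen_choiceMixin (cpath T N).

Lemma cpath0_continuous :
  {within `[0, T], continuous (fun _ : R => 0 : 'cV[R]_N)}.
Proof. by apply: continuous_subspaceT => x; exact: cvg_cst. Qed.

Definition cpath0 : cpath T N := CPath cpath0_continuous (fun _ _ => erefl).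

HB.instance Definition _ := isPointed.Build (cpath T N) cpath0.
End cpath_instances.

Section canonical_space.
Context {R : realType} {T : R} {N : nat}.

Definition W (s : R) (w : cpath T N) : 'cV[R]_N := w s.

Definition events_of (Y : cpath T N -> 'cV[R]_N) : set (set (cpath T N)) :=
  [set A | exists (i : 'I_N) (B : set R),
     measurable B /\ A = [set w | B (Y w i ord0)]].

Definition path_events (s : R) : set (set (cpath T N)) :=
  \bigcup_(r in [set r | 0 <= r <= s]) events_of (W r).

Definition increment_events (t s : R) : set (set (cpath T N)) :=
  \bigcup_(r in [set r | t <= r <= s]) events_of (fun w => W r w - W t w).

End canonical_space.

Arguments path_events {R} T N s.
Arguments increment_events {R} T N t s.

Notation Omega T N := (g_sigma_algebraType (path_events T N T)).

(* The second parameter of normal_prob is the standard deviation. *)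
Definition wiener_measure (R : realType) (T : R) (N : nat)
    (P : probability (Omega T N) R) : Prop :=
  P [set w | W 0 w = 0] = 1%E /\
  forall (s t : R) (A : set (cpath T N)) (B : 'I_N -> set R),
    0 <= s -> s < t -> t <= T ->
    <<s path_events T N s >> A -> (forall i, measurable (B i)) ->
    P (A `&` [set w | forall i, B i (W t w i ord0 - W s w i ord0)]) =
    (P A * \prod_(i < N) normal_prob 0%R (Num.sqrt (t - s)) (B i))%E.

Section stochastic_calculus.
Context {R : realType} {T : R} {N : nat} (P : probability (Omega T N) R).

Let filtration := R -> set (set (cpath T N)).

Definition augmentation (G : set (set (cpath T N))) : set (set (cpath T N)) :=
  <<s G `|` P.-negligible >>.

Definition FW : filtration := fun s => augmentation (path_events T N s).

(* For s < t there is no generating increment and Ft t s is the P-trivial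
   sigma-algebra. *)
Definition Ft (t : R) : filtration :=
  fun s => augmentation (increment_events T N t s).

(* Random variables are measurable only for the completed sigma-algebra, hence
   the expectation is taken under the completion of P. *)
Definition expectation_bar (Y : cpath T N -> \bar R) : \bar R :=
  (\int[@completed_measure_extension _ (Omega T N) R P]_w Y w)%E.

Definition rv_measurable (G : set (set (cpath T N))) (p q : nat)
    (Y : cpath T N -> 'M[R]_(p, q)) : Prop :=
  forall i j (B : set R), measurable B -> G [set w | B (Y w i j)].

Definition adapted (F : filtration) (p q : nat)
    (Y : R -> cpath T N -> 'M[R]_(p, q)) : Prop :=
  forall s, 0 <= s <= T -> rv_measurable (F s) (Y s).

Definition continuous_process (p q : nat)
    (Y : R -> cpath T N -> 'M[R]_(p, q)) : Prop :=
  forall w, {within `[0, T], continuous (fun s => Y s w)}.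

Definition time_space : set (R * cpath T N) := [set z | 0 <= z.1 <= T].

Definition predictable_rectangles (F : filtration) : set (set (R * cpath T N)) :=
  [set D | (exists2 A, F 0 A & D = [set 0] `*` A) \/
           (exists s r A, [/\ 0 <= s, s <= r, r <= T, F s A &
              D = [set a | s < a <= r] `*` A])].

Definition predictable (F : filtration) (p q : nat)
    (H : R -> cpath T N -> 'M[R]_(p, q)) : Prop :=
  forall i j (B : set R), measurable B ->
    <<s time_space, predictable_rectangles F >>
      (time_space `&` [set z | B (H z.1 z.2 i j)]).

(* The integrand \sum_(k < n) xi_k 1_(t_k, t_k.+1] and its stochastic integral. *)
Record simple_integrand (p : nat) := SimpleIntegrand {
  si_size : nat ;
  si_time : nat -> R ;
  si_coef : nat -> cpath T N -> 'M[R]_(p, N) ;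
  si_time_range : forall k, 0 <= si_time k <= T ;
  si_time_mono : forall k, si_time k <= si_time k.+1 ;
  si_coef_measurable : forall k, rv_measurable (FW (si_time k)) (si_coef k) ;
  si_coef_bounded : exists K : R, forall k w, enorm (si_coef k w) <= K }.

Definition si_process (p : nat) (S : simple_integrand p)
    (s : R) (w : cpath T N) : 'M[R]_(p, N) :=
  \sum_(k < si_size S)
    if si_time S k < s <= si_time S k.+1 then si_coef S k w else 0.

Definition si_integral (p : nat) (S : simple_integrand p)
    (s : R) (w : cpath T N) : 'cV[R]_p :=
  \sum_(k < si_size S) si_coef S k w *m
    (W (Num.min (si_time S k.+1) s) w - W (Num.min (si_time S k) s) w).

(* M is (a continuous version of) the Ito integral \int_0^. H dW of the
   predictable, square-integrable process H. *)
Definition is_ito_integral (p : nat) (H : R -> cpath T N -> 'M[R]_(p, N))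
    (M : R -> cpath T N -> 'cV[R]_p) : Prop :=
  [/\ predictable FW H, adapted FW M, continuous_process M &
   exists S : nat -> simple_integrand p,
     (fun n => expectation_bar (fun w =>
        \int[lebesgue_measure]_(s in `[0%R, T])
          ((enorm (si_process (S n) s w - H s w)) ^+ 2)%:E)%E) @ \oo --> 0%E /\
     forall s, 0 <= s <= T ->
       (fun n => expectation_bar (fun w =>
          ((enorm (si_integral (S n) s w - M s w)) ^+ 2)%:E)) @ \oo --> 0%E].

Section controlled_sde.
Context {d m : nat} (U : set 'cV[R]_m).
Context (b : 'cV[R]_d -> 'cV[R]_m -> 'cV[R]_d).
Context (sigma : 'cV[R]_d -> 'cV[R]_m -> 'M[R]_(d, N)).
Context (f : 'cV[R]_d -> 'cV[R]_m -> R).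
Context (C : set 'cV[R]_d).

Let control := R -> cpath T N -> 'cV[R]_m.
Let process := R -> cpath T N -> 'cV[R]_d.

Definition controls : set control :=
  [set nu | predictable FW nu /\ forall s w, 0 <= s <= T -> U (nu s w)].

Definition controls_from (t : R) : set control :=
  [set nu | controls nu /\ predictable (Ft t) nu].

Definition sde_solution (nu : control) (t : R) (x : 'cV[R]_d) (Y : process)
    : Prop :=
  [/\ adapted FW Y, continuous_process Y &
   exists M : process,
     is_ito_integral
       (fun s w => if t < s then sigma (Y s w) (nu s w) else 0) M /\
     {ae P, forall w,
        (forall s, 0 <= s <= t -> Y s w = x) /\
        (forall s, t <= s <= T ->
           Y s w = x + (\col_i \int[lebesgue_measure]_(a in `[t, s])
                          (b (Y a w) (nu a w) i ord0)) + M s w)}].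

Definition unique_sde_solution (nu : control) (t : R) (x : 'cV[R]_d)
    (Y : process) : Prop :=
  sde_solution nu t x Y /\
  forall Z, sde_solution nu t x Z ->
    {ae P, forall w, forall s, 0 <= s <= T -> Z s w = Y s w}.

(* X nu t x plays the role of the solution X^{nu,t,x}. *)
Context (X : control -> R -> 'cV[R]_d -> process).

Definition cost (nu : control) (t : R) (x : 'cV[R]_d) : \bar R :=
  expectation_bar (fun w =>
    \int[lebesgue_measure]_(s in `[t, T]) (f (X nu t x s w) (nu s w))%:E)%E.

Definition value (t : R) (x : 'cV[R]_d) : \bar R :=
  ereal_inf [set cost nu t x | nu in
    [set nu | controls_from t nu /\
      {ae P, forall w, forall s, 0 <= s <= T -> C° (X nu t x s w)}]].

Definition value_usc (t : R) (x : 'cV[R]_d) : \bar R :=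
  limf_esup (fun z : R * 'cV[R]_d => value z.1 z.2)
    (within [set z | 0 <= z.1 <= T /\ C° z.2] (nbhs (t, x))).

End controlled_sde.
End stochastic_calculus.

(* Only the values of w on [0,T] * closure O matter: since t < T and
   y + l e \in O for y \in O near x (take o = 0), the points
   (t + lam e, x + l e) lie in that set for small e > 0. *)
Definition class_R (R : realType) (T : R) (d : nat) (O : set 'cV[R]_d)
    (w : R -> 'cV[R]_d -> R) : Prop :=
  forall (t : R) (x : 'cV[R]_d), 0 <= t < T -> boundary O x ->
  exists l : R -> 'cV[R]_d,
    (exists (r : R) (B : set 'cV[R]_d),
      [/\ 0 < r, open_nbhs x B,
          (limf_einf (fun e : R => (e^-1 * enorm (l e))%:E) 0^'+ < +oo)%E &
          forall o : R -> 'cV[R]_d,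
            e^-1 *: o e @[e --> 0^'+] --> (0 : 'cV[R]_d) ->
            exists2 delta : R, 0 < delta &
              forall (y : 'cV[R]_d) (e : R), O y -> B y ->
                0 < e < Num.min r delta -> O (y + l e + o e)]) /\
    (exists lam : R -> R,
      [/\ forall e, 0 <= e -> 0 <= lam e,
          lam e @[e --> 0^'+] --> (0 : R) &
          w (t + lam e) (x + l e) @[e --> 0^'+] --> w t x]).

(* Main.v *)
(* Viability. C is covered by countably many balls on which some constant control keeps the
   state in the interior: near an interior point any control does until exit from the ball;
   near a boundary point u_x switches the noise off, the state follows an ODE, and the cone
   condition excludes an exit. Patching these controls at successive exit times, with every
   ball recurring infinitely often, reaches T, since the exit times cannot accumulate.
   Exchanging the increments of W on [0, t] and [t, T] preserves Wiener measure and turns a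
   control started at 0 into an F^t-control started at t. A moment estimate then bounds V.

   Regularity. Near x in the boundary let phi(y, e) be the flow of b(., u_x) from an interior
   point y, and let x + l(e) be its limit as y tends to x. Using u_x during [s, s + e] and an
   arbitrary admissible control afterwards gives V(s, y) <= C e + V(s + e, phi(y, e)), hence
   V^*(t, x) <= C e + V^*(t + e, x + l(e)); the converse inequality in the limit is the upper
   semicontinuity of V^*. As l(e) = e b(x, u_x) + O(e^2), the cone condition gives (i). *)

From HB Require Import structures.
From mathcomp Require Import all_boot all_order all_algebra.
From mathcomp Require Import all_classical all_reals all_analysis.
From mathcomp Require Import measurable_realfun.
From mathcomp Require Import ring lra.
Require Import Defs.
Set Implicit Arguments.
Unset Strict Implicit.
Unset Printing Implicit Defensive.
Import Order.TTheory GRing.Theory Num.Theory.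
Import numFieldNormedType.Exports.
Local Open Scope classical_set_scope.
Local Open Scope ring_scope.

(** * Sub-sigma-algebras *)

(** The Ito integral is given only as an $L^2$ limit of simple integrals, and [hX] gives uniqueness
    only for one control on all of [0, T]. Patching needs more: solutions for two controls that
    agree up to a stopping time must agree up to it, and a diffusion coefficient that vanishes on a
    random interval must leave no noise there. All of this, and the moment bound, comes from one
    estimate: for A in F a, E[1_A N_b^2] is at most E[1_A N_a^2] plus [v0] times the energy of the
    integrand on A. As an inequality it survives $L^2$ limits and, by Fatou's lemma, stopping; the
    value 16/3 of [v0] stems from a crude Gaussian tail bound. Stages start at random times, whereas
    the noise-free equation is available from deterministic times on; rational times bridge the gap.
    The ODE is not solved separately: its flow is one path of the given solution for a constant
    control. Such a path is controlled only when started in the interior, so the flow from the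
    boundary point is a limit, which McShane's extension formula provides. *)

Definition gmeas {Om : Type} {R : realType} (G : set (set Om)) (f : Om -> R) :=
  forall B : set R, measurable B -> G (f @^-1` B).

(** With y replaced by -y this also describes the negative part of a product; it reduces signed
    integrands to products of non-negative ones. *)
Lemma maxr0M (R : realDomainType) (z y : R) : Num.max (z * y) 0 =
  Num.max z 0 * Num.max y 0 + Num.max (- z) 0 * Num.max (- y) 0.
Proof.
by rewrite /Num.max; do 5 case: ltrP => ?; nra.
Qed.

Section sub_sigma_algebra.
Context d (Om : measurableType d) (R : realType).
Context (mu : {measure set Om -> \bar R}).
Context (G : set (set Om)) (Gs : sigma_algebra setT G) (Gm : G `<=` measurable).

Local Notation GT := (g_sigma_algebraType G).

Lemma gmeasP (f : Om -> R) : gmeas G f <-> measurable_fun setT (f : GT -> R).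
Proof.
split=> [h _ B mB|h B mB].
  by rewrite setTI; apply: sub_sigma_algebra; exact: h.
by have := h measurableT B mB; rewrite setTI /measurable/= sigma_algebra_id.
Qed.

Lemma gmeas_measurable (f : Om -> R) : gmeas G f -> measurable_fun setT f.
Proof. by move=> h _ B mB; rewrite setTI; apply: Gm; exact: h. Qed.

Import HBNNSimple.

(** Y1 and Y2 have the same conditional expectation given G. Equality over the events of G extends
    to G-measurable weights by linearity for simple weights and by monotone convergence in general;
    conditional expectations themselves are never formed. *)
Lemma ge0_integral_sub_eq (Y1 Y2 Z : Om -> R) :
  measurable_fun setT Y1 -> measurable_fun setT Y2 ->
  (forall w, 0 <= Y1 w) -> (forall w, 0 <= Y2 w) ->
  (forall D, G D ->
     \int[mu]_(w in D) (Y1 w)%:E = \int[mu]_(w in D) (Y2 w)%:E)%E ->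
  gmeas G Z -> (forall w, 0 <= Z w) ->
  (\int[mu]_w (Z w * Y1 w)%:E = \int[mu]_w (Z w * Y2 w)%:E)%E.
Proof.
move=> mY1 mY2 Y10 Y20 H gZ Z0.
(* The approximation is built on the space that carries G, so that the level sets of the simple
   functions are events of G. *)
have mZ : @measurable_fun _ _ GT _ setT (fun w => (Z w)%:E).
  by apply/measurable_EFinP/gmeasP.
pose h := nnsfun_approx (@measurableT _ GT) mZ.
have hG n r : G (h n @^-1` [set r]).
  suff : measurable (h n @^-1` [set r] : set GT).
    by rewrite /measurable/= sigma_algebra_id.
  exact: measurable_funPTI.
have mh n : measurable_fun setT (h n : Om -> R).
  by apply: gmeas_measurable; apply/gmeasP; exact: measurable_funP.
have Hlim (Y : Om -> R) : measurable_fun setT Y -> (forall w, 0 <= Y w) ->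
  (\int[mu]_w (Z w * Y w)%:E = limn (fun n => \int[mu]_w (h n w * Y w)%:E))%E.
  move=> mY Y0.
  rewrite -monotone_convergence//.
  - apply: eq_integral => w _.
    apply/esym/cvg_lim => //.
    rewrite (_ : (fun n => _) = (fun n => (h n w)%:E * (Y w)%:E)%E) ?EFinM//.
    apply: cvgeZr => //.
    apply: (@cvg_nnsfun_approx _ GT _ _ (@measurableT _ GT) _ mZ) => // x _.
    by rewrite lee_fin.
  - by move=> n; apply/measurable_EFinP; exact: measurable_funM.
  - by move=> n w _; rewrite lee_fin mulr_ge0.
  - move=> w _ a b ab; rewrite lee_fin ler_wpM2r//.
    by have /lefP := nd_nnsfun_approx (@measurableT _ GT) mZ ab; exact.
rewrite !Hlim//; congr (limn _); apply/funext => n.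
have Hn (Y : Om -> R) : measurable_fun setT Y -> (forall w, 0 <= Y w) ->
  (\int[mu]_w (h n w * Y w)%:E = \sum_(r \in range (h n))
    r%:E * \int[mu]_(w in h n @^-1` [set r]) (Y w)%:E)%E.
  move=> mY Y0.
  transitivity (\int[mu]_w (\sum_(r \in range (h n))
      (r * \1_(h n @^-1` [set r]) w * Y w)%:E))%E.
    apply: eq_integral => w _; rewrite fsumEFin//.
    by congr EFin; rewrite {1}[h n w]fimfunE mulr_fsuml.
  have mr r : measurable (h n @^-1` [set r] : set Om) by apply: Gm.
  rewrite ge0_integral_fsum//; last 2 first.
  - move=> r; apply/measurable_EFinP; apply: measurable_funM => //.
    apply: measurable_funM => //; exact: measurable_indic.
  - move=> r w _; rewrite lee_fin mulr_ge0//.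
    have [<-|hr] := eqVneq (h n w) r; first by rewrite mulr_ge0.
    rewrite indicE memNset ?mulr0//= => hh; move: hr; rewrite hh.
    by rewrite eqxx.
  apply: eq_fsbigr => r; rewrite inE => -[t _ <-].
  under eq_integral do rewrite -mulrA EFinM.
  rewrite ge0_integralZl//; last 3 first.
  - apply/measurable_EFinP; apply: measurable_funM => //; exact: measurable_indic.
  - by move=> w _; rewrite lee_fin mulr_ge0.
  - by rewrite lee_fin.
  congr (_ * _)%E.
  rewrite [RHS]integral_mkcond; apply: eq_integral => w _.
  by rewrite epatch_indic/= muleC.
rewrite !Hn//; apply: eq_fsbigr => r _; congr (_ * _)%E.
by apply: H; exact: hG.
Qed.

Lemma ge0_integral_indep (Y Z : Om -> R) (c : R) :
  measurable_fun setT Y -> (forall w, 0 <= Y w) -> 0 <= c ->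
  (forall D, G D -> \int[mu]_(w in D) (Y w)%:E = c%:E * mu D)%E ->
  gmeas G Z -> (forall w, 0 <= Z w) ->
  (\int[mu]_w (Z w * Y w)%:E = c%:E * \int[mu]_w (Z w)%:E)%E.
Proof.
move=> mY Y0 c0 H gZ Z0.
rewrite (@ge0_integral_sub_eq Y (cst c))//; last first.
  by move=> D GD; rewrite H//= (integral_cst _ (Gm GD) c%:E).
under eq_integral do rewrite /= mulrC EFinM.
rewrite ge0_integralZl//.
- by apply/measurable_EFinP; exact: gmeas_measurable.
- by move=> *; rewrite lee_fin.
Qed.

(** Given G, the positive and negative parts of Y have the same conditional mean. Exchanging them
    against the weights Z^+ and Z^- turns the integral of the positive part of Z Y into that of its
    negative part; integrability makes the difference meaningful. *)
Lemma integral_indep0 (Y Z : Om -> R) :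
  mu.-integrable setT (EFin \o Y) ->
  (forall D, G D -> \int[mu]_(w in D) (Y w)%:E = 0)%E ->
  gmeas G Z -> mu.-integrable setT (fun w => (Z w * Y w)%:E) ->
  (\int[mu]_w (Z w * Y w)%:E = 0)%E.
Proof.
move=> iY H gZ iZY.
have mY : measurable_fun setT Y.
  by apply/measurable_EFinP; exact: measurable_int iY.
have mZ := gmeas_measurable gZ.
pose pos (f : Om -> R) := f^\+; pose neg (f : Om -> R) := f^\-.
have mp f : measurable_fun setT f -> measurable_fun setT (pos f).
  exact: measurable_funrpos.
have mn f : measurable_fun setT f -> measurable_fun setT (neg f).
  exact: measurable_funrneg.
have p0 f w : 0 <= pos f w by exact: funrpos_ge0.
have n0 f w : 0 <= neg f w by exact: funrneg_ge0.
have eqY (U : Om -> R) : gmeas G U -> (forall w, 0 <= U w) ->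
    (\int[mu]_w (U w * pos Y w)%:E = \int[mu]_w (U w * neg Y w)%:E)%E.
  move=> gU U0; apply: ge0_integral_sub_eq => //; [exact: mp|exact: mn|].
  move=> D GD; have mD := Gm GD.
  have iYD : mu.-integrable D (EFin \o Y).
    by apply: integrableS iY.
  have := H D GD; rewrite integralE.
  have := integrable_pos_fin_num mD iYD; have := integrable_neg_fin_num mD iYD.
  have -> : (\int[mu]_(w in D) (pos Y w)%:E =
      \int[mu]_(w in D) (EFin \o Y)^\+ w)%E.
    by apply: eq_integral => w _; rewrite funeposE /= -EFin_max.
  have -> : (\int[mu]_(w in D) (neg Y w)%:E =
      \int[mu]_(w in D) (EFin \o Y)^\- w)%E.
    by apply: eq_integral => w _; rewrite funenegE /= ?EFinN -EFin_max.
  move=> f1 f2; rewrite -(fineK f1) -(fineK f2) -EFinB => -[/eqP].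
  by rewrite subr_eq0 => /eqP ->.
have gp : gmeas G (pos Z).
  by apply/gmeasP; apply: measurable_funrpos; exact/gmeasP.
have gn : gmeas G (neg Z).
  by apply/gmeasP; apply: measurable_funrneg; exact/gmeasP.
have pE : (\int[mu]_w ((fun w => (Z w * Y w)%:E)^\+ w) =
    \int[mu]_w (pos Z w * pos Y w)%:E + \int[mu]_w (neg Z w * neg Y w)%:E)%E.
  rewrite -ge0_integralD//; last 4 first.
  - by move=> w _; rewrite lee_fin mulr_ge0.
  - by apply/measurable_EFinP; apply: measurable_funM; exact: mp.
  - by move=> w _; rewrite lee_fin mulr_ge0.
  - by apply/measurable_EFinP; apply: measurable_funM; exact: mn.
  by apply: eq_integral => w _; rewrite funeposE -EFinD -EFin_max maxr0M.
have nE : (\int[mu]_w ((fun w => (Z w * Y w)%:E)^\- w) =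
    \int[mu]_w (pos Z w * neg Y w)%:E + \int[mu]_w (neg Z w * pos Y w)%:E)%E.
  rewrite -ge0_integralD//; last 4 first.
  - by move=> w _; rewrite lee_fin mulr_ge0.
  - by apply/measurable_EFinP; apply: measurable_funM; [exact: mp|exact: mn].
  - by move=> w _; rewrite lee_fin mulr_ge0.
  - by apply/measurable_EFinP; apply: measurable_funM; [exact: mn|exact: mp].
  apply: eq_integral => w _; rewrite funenegE -EFinD -EFinN -EFin_max -mulrN.
  by rewrite maxr0M opprK.
have fp := integrable_pos_fin_num measurableT iZY.
by rewrite integralE nE -(eqY (pos Z))// (eqY (neg Z))// -pE subee.
Qed.

End sub_sigma_algebra.

Section square_integrable.
Context d (Om : measurableType d) (R : realType) (mu : probability Om R).
Implicit Types f g : Om -> R.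

Definition sqi f :=
  measurable_fun setT f /\ (\int[mu]_w (f w ^+ 2)%:E < +oo)%E.

Lemma integral_indicM (A : set Om) f : measurable A ->
  (\int[mu]_(w in A) (f w)%:E = \int[mu]_w (\1_A w * f w)%:E)%E.
Proof.
move=> mA; rewrite integral_mkcond; apply: eq_integral => w _.
by rewrite epatch_indic/= muleC -EFinM.
Qed.

Lemma sqi_bounded f (K : R) : measurable_fun setT f ->
  (forall w, `|f w| <= K) -> sqi f.
Proof.
move=> mf fK; split=> //.
apply: (@le_lt_trans _ _ (\int[mu]_w (cst (K ^+ 2)%:E w))%E).
  apply: ge0_le_integral => //.
  - by move=> w _; rewrite lee_fin sqr_ge0.
  - by apply/measurable_EFinP; apply: measurable_funX.
  - move=> w _; rewrite lee_fin -real_normK ?num_real//.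
    by rewrite lerXn2r ?nnegrE//; exact: le_trans (normr_ge0 _) (fK w).
by rewrite integral_cst//= probability_setT mule1 ltry.
Qed.

Lemma sqiD f g : sqi f -> sqi g -> sqi (fun w => f w + g w).
Proof.
move=> [mf sf] [mg sg]; split; first exact: measurable_funD.
apply: (@le_lt_trans _ _ (\int[mu]_w (2%:E * (f w ^+ 2)%:E +
    2%:E * (g w ^+ 2)%:E))%E).
  apply: ge0_le_integral => //.
  - by move=> w _; rewrite lee_fin sqr_ge0.
  - by apply/measurable_EFinP; apply: measurable_funX; exact: measurable_funD.
  - apply: emeasurable_funD; apply: measurable_funeM; apply/measurable_EFinP;
    exact: measurable_funX.
  - move=> w _; rewrite -!EFinM -EFinD lee_fin -subr_ge0.
    by have -> : 2 * f w ^+ 2 + 2 * g w ^+ 2 - (f w + g w) ^+ 2 =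
      (f w - g w) ^+ 2; [ring|exact: sqr_ge0].
rewrite ge0_integralD//; last 4 first.
- by move=> w _; rewrite -EFinM lee_fin mulr_ge0// sqr_ge0.
- by apply: measurable_funeM; apply/measurable_EFinP; exact: measurable_funX.
- by move=> w _; rewrite -EFinM lee_fin mulr_ge0// sqr_ge0.
- by apply: measurable_funeM; apply/measurable_EFinP; exact: measurable_funX.
rewrite !ge0_integralZl//; first by rewrite lte_add_pinfty// lte_mul_pinfty.
all: try by move=> w _; rewrite lee_fin sqr_ge0.
all: by apply/measurable_EFinP; exact: measurable_funX.
Qed.

Lemma sqiM f g (K : R) : measurable_fun setT f -> (forall w, `|f w| <= K) ->
  sqi g -> sqi (fun w => f w * g w).
Proof.
move=> mf fK [mg sg]; split; first exact: measurable_funM.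
apply: (@le_lt_trans _ _ (\int[mu]_w ((K ^+ 2)%:E * (g w ^+ 2)%:E))%E).
  apply: ge0_le_integral => //.
  - by move=> w _; rewrite lee_fin sqr_ge0.
  - by apply/measurable_EFinP; apply: measurable_funX; exact: measurable_funM.
  - by apply: measurable_funeM; apply/measurable_EFinP; exact: measurable_funX.
  - move=> w _; rewrite lee_fin exprMn ler_wpM2r ?sqr_ge0//.
    rewrite -(real_normK (num_real (f w))).
    by rewrite lerXn2r ?nnegrE//; exact: le_trans (normr_ge0 _) (fK w).
rewrite ge0_integralZl//.
- by rewrite lte_mul_pinfty// lee_fin sqr_ge0.
- by apply/measurable_EFinP; exact: measurable_funX.
- by move=> w _; rewrite lee_fin sqr_ge0.
- by rewrite lee_fin sqr_ge0.
Qed.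

Lemma sqi_sum I (s : seq I) (P : pred I) (f : I -> Om -> R) :
  (forall i, sqi (f i)) -> sqi (fun w => \sum_(i <- s | P i) f i w).
Proof.
move=> H; elim: s => [|i s ih].
  rewrite (_ : (fun w => _) = cst 0); last first.
    by apply/funext => w; rewrite big_nil.
  by apply: (@sqi_bounded _ 0) => // w; rewrite normr0.
under eq_fun do rewrite big_cons.
by case: (P i) => //; apply: sqiD.
Qed.

Lemma sqiMi f g : sqi f -> sqi g ->
  mu.-integrable setT (fun w => (f w * g w)%:E).
Proof.
move=> [mf sf] [mg sg]; apply/integrableP; split.
  by apply/measurable_EFinP; exact: measurable_funM.
apply: (@le_lt_trans _ _ (\int[mu]_w ((f w ^+ 2)%:E + (g w ^+ 2)%:E))%E).
  apply: ge0_le_integral => //.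
  - apply/measurable_EFinP; apply: measurableT_comp => //.
    exact: measurable_funM.
  - by apply: emeasurable_funD; apply/measurable_EFinP; exact: measurable_funX.
  - move=> w _; rewrite -EFinD lee_fin normrM.
    rewrite -(real_normK (num_real (f w))) -(real_normK (num_real (g w))).
    have := sqr_ge0 (`|f w| - `|g w|).
    have := mulr_ge0 (normr_ge0 (f w)) (normr_ge0 (g w)).
    by nra.
rewrite ge0_integralD//; first by rewrite lte_add_pinfty.
all: try by move=> w _; rewrite lee_fin sqr_ge0.
all: by apply/measurable_EFinP; exact: measurable_funX.
Qed.

Lemma sqi_cst (c : R) : sqi (cst c).
Proof. by apply: sqi_bounded (fun=> lexx `|c|). Qed.

Lemma sqi_integrable f : sqi f -> mu.-integrable setT (EFin \o f).
Proof.
move=> sf; have := sqiMi sf (sqi_cst 1).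
by apply: eq_integrable => // w _; rewrite /= mulr1.
Qed.

End square_integrable.

(* The conditional Ito isometry on an interval without partition points. *)
Lemma integral_sqr_one_step d (Om : measurableType d) (R : realType)
    (mu : probability Om R) (G : set (set Om)) (Gs : sigma_algebra setT G)
    (Gm : G `<=` measurable) (n : nat) (I0 : Om -> R) (g D : 'I_n -> Om -> R)
    (v K : R) (A : set Om) : 0 <= v -> G A -> gmeas G I0 -> sqi mu I0 ->
  (forall j, gmeas G (g j)) -> (forall j w, `|g j w| <= K) ->
  (forall j, sqi mu (D j)) ->
  (forall j B, G B -> \int[mu]_(w in B) (D j w)%:E = 0)%E ->
  (forall j l B, j != l -> G B -> \int[mu]_(w in B) (D j w * D l w)%:E = 0)%E ->
  (forall j B, G B -> \int[mu]_(w in B) (D j w ^+ 2)%:E = v%:E * mu B)%E ->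
  (\int[mu]_(w in A) ((I0 w + \sum_j g j w * D j w) ^+ 2)%:E =
   \int[mu]_(w in A) (I0 w ^+ 2)%:E +
   v%:E * \int[mu]_(w in A) (\sum_j g j w ^+ 2)%:E)%E.
Proof.
move=> v0 GA gI sI gg gK sD D1 D2 D3.
have mA := Gm _ GA.
have mG (f : Om -> R) : gmeas G f -> measurable_fun setT f.
  exact: gmeas_measurable.
have gu : gmeas G (\1_A : Om -> R).
  apply/gmeasP => //; apply: measurable_indic.
  by rewrite /measurable/= sigma_algebra_id.
have u1 w : `|\1_A w : R| <= 1 by rewrite indicE; case: (_ \in _); rewrite ?normr1 ?normr0.
have gM (f h : Om -> R) : gmeas G f -> gmeas G h -> gmeas G (fun w => f w * h w).
  by move=> gf gh; apply/gmeasP => //; apply: measurable_funM; exact/gmeasP.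
rewrite !(integral_indicM _ _ mA).
have sg j : sqi mu (g j) by apply: sqi_bounded (gK j); exact: mG.
have sgD j : sqi mu (fun w => g j w * D j w) by apply: sqiM (gK j) _ => //; exact: mG.
have su (f : Om -> R) : sqi mu f -> sqi mu (fun w => \1_A w * f w).
  by move=> sf; apply: sqiM u1 sf; exact: mG.
have i1 : mu.-integrable setT (fun w => (\1_A w * I0 w ^+ 2)%:E).
  have := sqiMi (su _ sI) sI.
  by apply: eq_integrable => // w _; rewrite expr2 mulrA.
(* All factors known at the left end of the interval are grouped in front of the increments, the
   shape required by [integral_indep0]. *)
have i2 j : mu.-integrable setT (fun w => ((\1_A w * I0 w * g j w) * D j w)%:E).
  have := sqiMi (su _ sI) (sgD j).
  by apply: eq_integrable => // w _; rewrite !mulrA.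
have i3 j l : mu.-integrable setT
    (fun w => ((\1_A w * g j w * g l w) * (D j w * D l w))%:E).
  have := sqiMi (su _ (sgD j)) (sgD l).
  by apply: eq_integrable => // w _; congr EFin; ring.
have z2 j : (\int[mu]_w ((\1_A w * I0 w * g j w) * D j w)%:E = 0)%E.
  apply: (integral_indep0 Gs Gm) => //.
  - exact: sqi_integrable.
  - exact: D1.
  - by apply: (gM) => //; exact: gM.
have z3 j l : j != l ->
    (\int[mu]_w ((\1_A w * g j w * g l w) * (D j w * D l w))%:E = 0)%E.
  move=> jl; apply: (integral_indep0 Gs Gm) => //.
  - exact: sqiMi.
  - by move=> B GB; exact: D2.
  - by apply: (gM) => //; exact: gM.
have z4 j : (\int[mu]_w ((\1_A w * g j w * g j w) * (D j w * D j w))%:E =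
    v%:E * \int[mu]_w (\1_A w * g j w ^+ 2)%:E)%E.
  transitivity (\int[mu]_w (\1_A w * g j w ^+ 2 * D j w ^+ 2)%:E)%E.
    by apply: eq_integral => w _; rewrite !expr2 !mulrA.
  apply: (ge0_integral_indep Gs Gm) => //.
  - by apply: measurable_funX; exact: (sD j).1.
  - by move=> w; exact: sqr_ge0.
  - exact: D3.
  - by apply: (gM) => //; under eq_fun do rewrite expr2; exact: gM.
  - by move=> w; rewrite mulr_ge0// ?sqr_ge0// indicE.
have i4 j : mu.-integrable setT (fun w => (\sum_l
    (\1_A w * g j w * g l w) * (D j w * D l w))%:E).
  under eq_fun do rewrite -sumEFin.
  exact: integrable_sum.
have i5 : mu.-integrable setT (fun w => (\sum_j
    2 * ((\1_A w * I0 w * g j w) * D j w))%:E).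
  under eq_fun do rewrite -sumEFin.
  apply: integrable_sum => // j _.
  by under eq_fun do rewrite EFinM; exact: integrableZl.
have i6 : mu.-integrable setT (fun w => (\sum_j \sum_l
    (\1_A w * g j w * g l w) * (D j w * D l w))%:E).
  under eq_fun do rewrite -sumEFin.
  exact: integrable_sum.
transitivity (\int[mu]_w ((\1_A w * I0 w ^+ 2)%:E + ((\sum_j
    2 * ((\1_A w * I0 w * g j w) * D j w))%:E + (\sum_j \sum_l
    (\1_A w * g j w * g l w) * (D j w * D l w))%:E)))%E.
  apply: eq_integral => w _; rewrite -!EFinD; congr EFin.
  rewrite sqrrD mulrDr mulrDr -addrA; congr (_ + (_ + _)).
    rewrite mulr_sumr -sumrMnl mulr_sumr; apply: eq_bigr => j _.
    by rewrite mulr2n; ring.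
  rewrite expr2 mulr_suml mulr_sumr; apply: eq_bigr => j _.
  rewrite mulr_sumr mulr_sumr; apply: eq_bigr => l _; ring.
rewrite integralD//; last exact: integrableD.
congr (_ + _)%E.
rewrite integralD//.
rewrite (_ : (\int[mu]_w (\sum_j _)%:E = 0)%E) ?add0e; last first.
  under eq_integral do rewrite -sumEFin.
  rewrite integral_sum//.
    rewrite big1// => j _; under eq_integral do rewrite EFinM.
    by rewrite integralZl// z2 mule0.
  by move=> j; under eq_fun do rewrite EFinM; exact: integrableZl.
under eq_integral do rewrite -sumEFin.
rewrite integral_sum//.
transitivity (\sum_j v%:E * \int[mu]_w (\1_A w * g j w ^+ 2)%:E)%E.
  apply: eq_bigr => j _; under eq_integral do rewrite -sumEFin.
  rewrite integral_sum// (bigD1 j)//= z4 big1 ?adde0// => l lj.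
  by rewrite z3// eq_sym.
rewrite -ge0_sume_distrr//; last first.
  by move=> j _; apply: integral_ge0 => w _; rewrite lee_fin mulr_ge0 ?sqr_ge0// indicE.
congr (_ * _)%E; rewrite -ge0_integral_sum//.
- by apply: eq_integral => w _; rewrite sumEFin mulr_sumr.
- move=> j; apply/measurable_EFinP; apply: measurable_funM; first exact: mG.
  by apply: measurable_funX; exact: mG.
- by move=> j w _; rewrite lee_fin mulr_ge0 ?sqr_ge0// indicE.
Qed.

(** * Integrals of simple processes *)

Record filtered d (Om : measurableType d) (R : realType) (T : R)
    (F : R -> set (set Om)) : Prop := {
  filt_sigma : forall s, sigma_algebra setT (F s) ;
  filt_meas : forall s, 0 <= s <= T -> F s `<=` measurable ;
  filt_mono : forall s t, 0 <= s -> s <= t -> t <= T -> F s `<=` F t }.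

Section iterated_integral.
Context d (Om : measurableType d) (R : realType) (mu : probability Om R).
Local Notation leb := (@lebesgue_measure R).
Implicit Types h k : R -> Om -> R.

(** Joint measurability is required on the whole time line. Processes that are only controlled on
    [0, T] are first multiplied by an indicator or evaluated at a clamped time. *)
Definition jmeas h := measurable_fun setT (fun z : R * Om => h z.1 z.2).

Lemma jmeas_cst c : jmeas (fun _ _ => c). Proof. exact: measurable_cst. Qed.

Lemma jmeasD h k : jmeas h -> jmeas k -> jmeas (fun s w => h s w + k s w).
Proof. by move=> mh mk; exact: measurable_funD. Qed.

Lemma jmeasB h k : jmeas h -> jmeas k -> jmeas (fun s w => h s w - k s w).
Proof. by move=> mh mk; exact: measurable_funB. Qed.

Lemma jmeasM h k : jmeas h -> jmeas k -> jmeas (fun s w => h s w * k s w).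
Proof. by move=> mh mk; exact: measurable_funM. Qed.

Lemma jmeasX h m : jmeas h -> jmeas (fun s w => h s w ^+ m).
Proof. by move=> mh; exact: measurable_funX. Qed.

Lemma jmeas_sum I (r : seq I) (P : pred I) (h : I -> R -> Om -> R) :
  (forall i, jmeas (h i)) -> jmeas (fun s w => \sum_(i <- r | P i) h i s w).
Proof.
move=> H; elim: r => [|i r ih].
  rewrite (_ : (fun s w => _) = (fun _ _ => 0)); first exact: jmeas_cst.
  by apply/funext => s; apply/funext => w; rewrite big_nil.
have [Pi|Pi] := boolP (P i).
  rewrite (_ : (fun s w => _) =
      (fun s w => h i s w + \sum_(i <- r | P i) h i s w)); first exact: jmeasD.
  by apply/funext => s; apply/funext => w; rewrite big_cons Pi.
rewrite (_ : (fun s w => _) = (fun s w => \sum_(i <- r | P i) h i s w))//.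
by apply/funext => s; apply/funext => w; rewrite big_cons (negbTE Pi).
Qed.

Lemma jmeas_l (f : Om -> R) : measurable_fun setT f -> jmeas (fun _ w => f w).
Proof. by move=> mf; apply: (measurableT_comp mf). Qed.

Lemma jmeas_r (f : R -> R) : measurable_fun setT f -> jmeas (fun s _ => f s).
Proof. by move=> mf; apply: (measurableT_comp mf). Qed.

Lemma jmeas_le (f : Om -> R) : measurable_fun setT f ->
  jmeas (fun s w => (s <= f w)%R%:R).
Proof.
move=> mf; pose D := [set z : R * Om | z.1 <= f z.2].
have mD : measurable D.
  rewrite -[D]setTI; apply: measurable_fun_le => //.
  by apply: (measurableT_comp mf).
rewrite /jmeas (_ : (fun _ => _) = \1_D); first exact: measurable_indic.
by apply/funext => z; rewrite indicE /D; congr (nat_of_bool _)%:R; apply/idP/idP;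
  rewrite inE.
Qed.

Lemma jmeas_itv (a b : R) : jmeas (fun s _ => (a < s <= b)%R%:R).
Proof.
apply: jmeas_r; rewrite (_ : (fun _ => _) = \1_(`]a, b])).
  exact: measurable_indic.
by apply/funext => s; rewrite indicE; congr (nat_of_bool _)%:R; apply/idP/idP;
  rewrite inE /= in_itv.
Qed.

Lemma jmeas_sect h w : jmeas h -> measurable_fun setT (h ^~ w).
Proof. by move=> mh; exact: (measurableT_comp mh (measurable_pair2 w)). Qed.

Lemma jmeas_sectr h s : jmeas h -> measurable_fun setT (h s).
Proof. by move=> mh; exact: (measurableT_comp mh (measurable_pair1 s)). Qed.

(** Half-open intervals make consecutive pieces disjoint, and extended real values allow splitting
    and comparison before finiteness is known. *)
Definition sint h (a b : R) (w : Om) : \bar R :=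
  (\int[leb]_(s in `]a, b]) (h s w)%:E)%E.

Definition dint h (A : set Om) (a b : R) : \bar R :=
  (\int[mu]_(w in A) sint h a b w)%E.

Lemma sintE h a b w : sint h a b w = (\int[leb]_(s in `]a, b]) (h s w)%:E)%E.
Proof. by []. Qed.

Lemma dintE h A a b : dint h A a b = (\int[mu]_(w in A) sint h a b w)%E.
Proof. by []. Qed.

Lemma sint_mkcond h a b w :
  sint h a b w = (\int[leb]_s ((a < s <= b)%R%:R * h s w)%:E)%E.
Proof.
rewrite /sint integral_mkcond; apply: eq_integral => s _.
rewrite epatch_indic/= indicE -EFinM mulrC; congr EFin; congr (_ * _).
by congr (nat_of_bool _)%:R; apply/idP/idP; rewrite inE /= in_itv.
Qed.

Lemma sint_ge0 h a b w : (forall s w, 0 <= h s w) -> (0 <= sint h a b w)%E.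
Proof. by move=> h0; apply: integral_ge0 => s _; rewrite lee_fin. Qed.

Lemma measurable_sint h a b : jmeas h -> (forall s w, 0 <= h s w) ->
  measurable_fun setT (sint h a b).
Proof.
move=> mh h0.
have mf : measurable_fun setT
    (fun z : R * Om => ((a < z.1 <= b)%R%:R * h z.1 z.2)%:E).
  by apply/measurable_EFinP; exact: (jmeasM (jmeas_itv a b) mh).
have := @measurable_fun_fubini_tonelli_G _ _ _ _ _ leb _ mf.
have f0 (z : R * Om) : (0 <= ((a < z.1 <= b)%R%:R * h z.1 z.2)%:E)%E.
  by rewrite lee_fin mulr_ge0.
move=> /(_ f0); congr measurable_fun.
by apply/funext => w; rewrite sint_mkcond.
Qed.

Lemma dint_ge0 h A a b : (forall s w, 0 <= h s w) -> (0 <= dint h A a b)%E.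
Proof. by move=> h0; apply: integral_ge0 => w _; exact: sint_ge0. Qed.

Lemma sint_split h a c b w : jmeas h -> (forall s w, 0 <= h s w) ->
  a <= c -> c <= b -> (sint h a b w = sint h a c w + sint h c b w)%E.
Proof.
move=> mh h0 ac cb; rewrite /sint -ge0_integral_setU//=.
- congr (integral _ _ _); apply/seteqP; split => s /=; rewrite !in_itv/=.
    by move=> /andP[as_ sb]; case: (leP s c) => sc; [left|right];
       rewrite ?as_ ?sb ?sc.
  by case=> /andP[h1 h2]; apply/andP; split => //;
     [exact: le_trans cb|exact: le_lt_trans h1].
- by apply/measurable_EFinP; apply: measurable_funTS; exact: jmeas_sect.
- by move=> s _; rewrite lee_fin.
- rewrite disj_set2E; apply/eqP/seteqP; split => // s /=.
  by rewrite !in_itv/= => -[/andP[_ sc] /andP[cs _]]; move: sc; rewrite leNgt cs.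
Qed.

Lemma dint_split h A a c b : measurable A -> jmeas h ->
  (forall s w, 0 <= h s w) -> a <= c -> c <= b ->
  (dint h A a b = dint h A a c + dint h A c b)%E.
Proof.
move=> mA mh h0 ac cb; rewrite /dint -ge0_integralD//.
- by apply: eq_integral => w _; rewrite (sint_split _ mh h0 ac cb).
- by move=> w _; exact: sint_ge0.
- by apply: measurable_funTS; exact: measurable_sint.
- by move=> w _; exact: sint_ge0.
- by apply: measurable_funTS; exact: measurable_sint.
Qed.

Lemma sint_le h k a b w : jmeas h -> jmeas k -> (forall s w, 0 <= h s w) ->
  (forall s, a < s <= b -> h s w <= k s w) -> (sint h a b w <= sint k a b w)%E.
Proof.
move=> mh mk h0 hk; apply: ge0_le_integral => //.
- by move=> s _; rewrite lee_fin.
- by apply/measurable_EFinP; apply: measurable_funTS; exact: jmeas_sect.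
- by apply/measurable_EFinP; apply: measurable_funTS; exact: jmeas_sect.
Qed.

Lemma dint_le h k A a b : measurable A -> jmeas h -> jmeas k ->
  (forall s w, 0 <= h s w) -> (forall s w, 0 <= k s w) ->
  (forall s w, A w -> a < s <= b -> h s w <= k s w) ->
  (dint h A a b <= dint k A a b)%E.
Proof.
move=> mA mh mk h0 k0 hk; apply: ge0_le_integral => //.
- by move=> w _; exact: sint_ge0.
- by apply: measurable_funTS; exact: measurable_sint.
- by apply: measurable_funTS; exact: measurable_sint.
- by move=> w Aw; apply: sint_le => // s; exact: hk.
Qed.

Lemma sintD h k a b w : jmeas h -> jmeas k -> (forall s w, 0 <= h s w) ->
  (forall s w, 0 <= k s w) ->
  (sint (fun s w => h s w + k s w)%R a b w = sint h a b w + sint k a b w)%E.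
Proof.
move=> mh mk h0 k0; rewrite /sint -ge0_integralD//.
- by move=> s _; rewrite lee_fin.
- by apply/measurable_EFinP; apply: measurable_funTS; exact: jmeas_sect.
- by move=> s _; rewrite lee_fin.
- by apply/measurable_EFinP; apply: measurable_funTS; exact: jmeas_sect.
Qed.

Lemma dintD h k A a b : measurable A -> jmeas h -> jmeas k ->
  (forall s w, 0 <= h s w) -> (forall s w, 0 <= k s w) ->
  (dint (fun s w => h s w + k s w)%R A a b = dint h A a b + dint k A a b)%E.
Proof.
move=> mA mh mk h0 k0; rewrite /dint -ge0_integralD//.
- by apply: eq_integral => w _; rewrite sintD.
- by move=> w _; exact: sint_ge0.
- by apply: measurable_funTS; exact: measurable_sint.
- by move=> w _; exact: sint_ge0.
- by apply: measurable_funTS; exact: measurable_sint.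
Qed.

Lemma sintZw (c : Om -> R) h a b w : jmeas h -> (forall s w, 0 <= h s w) ->
  0 <= c w -> (sint (fun s w => c w * h s w)%R a b w = (c w)%:E * sint h a b w)%E.
Proof.
move=> mh h0 c0; rewrite /sint; under eq_integral do rewrite EFinM.
rewrite ge0_integralZl//.
- by apply/measurable_EFinP; apply: measurable_funTS; exact: jmeas_sect.
- by move=> s _; rewrite lee_fin.
Qed.

Lemma sintZ c h a b w : jmeas h -> (forall s w, 0 <= h s w) -> 0 <= c ->
  (sint (fun s w => c * h s w)%R a b w = c%:E * sint h a b w)%E.
Proof. by move=> mh h0 c0; exact: (@sintZw (fun=> c)). Qed.

Lemma dintZ c h A a b : measurable A -> jmeas h -> (forall s w, 0 <= h s w) ->
  0 <= c -> (dint (fun s w => c * h s w)%R A a b = c%:E * dint h A a b)%E.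
Proof.
move=> mA mh h0 c0; rewrite /dint.
under eq_integral do rewrite sintZ//.
rewrite ge0_integralZl//.
- by apply: measurable_funTS; exact: measurable_sint.
- by move=> w _; exact: sint_ge0.
Qed.

Local Notation RO := (measurableTypeR R * Om)%type.

Let weight h a b (z : RO) : \bar R := ((a < z.1 <= b)%R%:R * h z.1 z.2)%:E.

Let weight_meas h a b : jmeas h -> measurable_fun setT (weight h a b).
Proof.
move=> mh; apply/measurable_EFinP.
exact: (jmeasM (jmeas_itv a b) mh : @measurable_fun _ _ RO R setT _).
Qed.

Let weight_ge0 h a b z : (forall s w, 0 <= h s w) -> (0 <= weight h a b z)%E.
Proof. by move=> h0; rewrite lee_fin mulr_ge0. Qed.

Let dint_weight h a b : jmeas h -> (forall s w, 0 <= h s w) ->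
  dint h setT a b = (\int[(leb \x mu)%E]_z weight h a b z)%E.
Proof.
move=> mh h0.
rewrite (@fubini_tonelli2 _ _ _ _ _ leb mu (weight h a b) (weight_meas a b mh)).
  by apply: eq_integral => w _; rewrite sint_mkcond.
by move=> z; exact: weight_ge0.
Qed.

Lemma dint_tonelli h a b : jmeas h -> (forall s w, 0 <= h s w) ->
  dint h setT a b = (\int[leb]_(s in `]a, b]) \int[mu]_w (h s w)%:E)%E.
Proof.
move=> mh h0; rewrite dint_weight//.
rewrite (@fubini_tonelli1 _ _ _ _ _ leb mu (weight h a b) (weight_meas a b mh)).
  rewrite [RHS]integral_mkcond.
  apply: eq_integral => s _; rewrite epatch_indic/= indicE /fubini_F /weight/=.
  under eq_integral do rewrite EFinM.
  rewrite ge0_integralZl//.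
  - rewrite muleC; congr (_ * _%:E)%E; congr (nat_of_bool _)%:R; apply/idP/idP.
      by rewrite inE/= in_itv.
    by rewrite inE /= in_itv.
  - by apply/measurable_EFinP; exact: jmeas_sectr.
  - by move=> w _; rewrite lee_fin.
by move=> z; exact: weight_ge0.
Qed.

Lemma dint_cvg (h : nat -> R -> Om -> R) (k g : R -> Om -> R) a b :
  (forall n, jmeas (h n)) -> jmeas k -> jmeas g ->
  (forall n s w, 0 <= h n s w <= g s w) -> (forall s w, 0 <= k s w) ->
  (dint g setT a b < +oo)%E ->
  (forall s w, h ^~ s ^~ w @ \oo --> k s w) ->
  (dint (h n) setT a b @[n --> \oo] --> dint k setT a b)%E.
Proof.
move=> mh mk mg hg k0 gfin hk.
have g0 s w : 0 <= g s w by have /andP[] := hg 0%N s w; exact: le_trans.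
have -> : (fun n => dint (h n) setT a b) =
    (fun n => \int[(leb \x mu)%E]_z weight (h n) a b z)%E.
  by apply/funext => n; rewrite dint_weight// => s w; case/andP: (hg n s w).
rewrite dint_weight//.
apply: (@dominated_cvg _ _ _ _ _ _ _ _ (weight g a b)) => //.
- by move=> n; exact: weight_meas.
- move=> z _; apply: cvg_EFin; first exact: nearW.
  by apply: cvgMr; exact: hk.
- apply/integrableP; split; first exact: weight_meas.
  under eq_integral => z _ do rewrite gee0_abs ?lee_fin ?mulr_ge0//.
  by rewrite -dint_weight.
- move=> n z _; case/andP: (hg n z.1 z.2) => h1 h2.
  by rewrite gee0_abs ?lee_fin ?mulr_ge0// ler_wpM2l.
Qed.

End iterated_integral.
Global Opaque sint dint.

(** The increments enter only through their conditional first and second moments given the past. The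
    variance v stays abstract below the linear bound [v0] h, which turns isometries into
    inequalities and spares the exact second moment of the normal law. *)
Record brownian d (Om : measurableType d) (R : realType) (mu : probability Om R)
    (T : R) (F : R -> set (set Om)) (n : nat) (W : 'I_n -> R -> Om -> R)
    (v : R -> R) (v0 : R) : Prop := {
  bm_meas : forall j s, 0 <= s <= T -> gmeas (F s) (W j s) ;
  bm_sqi : forall j a b, 0 <= a -> a <= b -> b <= T ->
    sqi mu (fun w => W j b w - W j a w) ;
  bm_mean : forall j a b A, 0 <= a -> a <= b -> b <= T -> F a A ->
    (\int[mu]_(w in A) (W j b w - W j a w)%:E = 0)%E ;
  bm_cov : forall j l a b A, j != l -> 0 <= a -> a <= b -> b <= T -> F a A ->
    (\int[mu]_(w in A) ((W j b w - W j a w) * (W l b w - W l a w))%:E = 0)%E ;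
  bm_var : forall j a b A, 0 <= a -> a < b -> b <= T -> F a A ->
    (\int[mu]_(w in A) ((W j b w - W j a w) ^+ 2)%:E = (v (b - a))%:E * mu A)%E ;
  bm_v : forall h, 0 < h -> 0 <= v h <= v0 * h }.

(** Induction on the finite list L: each point strictly inside the interval splits it in two. A
    family of terms with overlapping time intervals can thus be treated without sorting its end
    points. *)
Lemma interval_cut (R : realDomainType) (T : R) (P : R -> R -> Prop) (L : seq R) :
  (forall a c b, 0 <= a -> a < c -> c < b -> b <= T -> P a c -> P c b -> P a b) ->
  (forall a b, 0 <= a -> a < b -> b <= T ->
     (forall c, c \in L -> c <= a \/ b <= c) -> P a b) ->
  forall a b, 0 <= a -> a < b -> b <= T -> P a b.
Proof.
move=> Pt; elim: L => [|c L ih] H; first by move=> a b a0 ab bT; exact: H.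
apply: ih => a b a0 ab bT HL.
have [ca|ac] := leP c a.
  by apply: H => // c'; rewrite inE => /orP[/eqP->|/HL//]; left.
have [bc|cb] := leP b c.
  by apply: H => // c'; rewrite inE => /orP[/eqP->|/HL//]; right.
apply: (Pt _ c) => //; apply: H => //.
- exact: le_trans (ltW cb) bT.
- move=> c'; rewrite inE => /orP[/eqP->|/HL[?|bc']]; [by right|by left|right].
  exact: le_trans (ltW cb) bc'.
- exact: le_trans a0 (ltW ac).
- move=> c'; rewrite inE => /orP[/eqP->|/HL[c'a|?]]; [by left|left|by right].
  exact: le_trans c'a (ltW ac).
Qed.

Section elementary.
Context d (Om : measurableType d) (R : realType) (mu : probability Om R).
Context (T : R) (F : R -> set (set Om)) (HF : filtered T F).
Context (n : nat) (W : 'I_n -> R -> Om -> R) (v : R -> R) (v0 : R).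
Context (HW : brownian mu T F W v v0).

(* The integrand [ex * 1_(ec, ee]] in the direction [ej]. *)
Record eterm := ETerm { ej : 'I_n ; ec : R ; ee : R ; ex : Om -> R }.

Definition evalid (e : eterm) := [/\ 0 <= ec e, ec e <= ee e, ee e <= T,
  gmeas (F (ec e)) (ex e) & exists K, forall w, `|ex e w| <= K].

Definition eint (I : finType) (e : I -> eterm) (s : R) (w : Om) : R :=
  \sum_i ex (e i) w *
    (W (ej (e i)) (Num.min (ee (e i)) s) w -
     W (ej (e i)) (Num.min (ec (e i)) s) w).

Definition eproc (I : finType) (e : I -> eterm) (j : 'I_n) (s : R) (w : Om) : R :=
  \sum_(i | ej (e i) == j) (ec (e i) < s <= ee (e i))%R%:R * ex (e i) w.

Section one_family.
Context (I : finType) (e : I -> eterm) (He : forall i, evalid (e i)).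

Lemma filt_gmeasS s t (f : Om -> R) : 0 <= s -> s <= t -> t <= T ->
  gmeas (F s) f -> gmeas (F t) f.
Proof. by move=> s0 st tT gf B mB; apply: (filt_mono HF s0 st tT); exact: gf. Qed.

Lemma filt_gmeas_meas s (f : Om -> R) : 0 <= s <= T -> gmeas (F s) f ->
  measurable_fun setT f.
Proof. by move=> sT; apply: gmeas_measurable; exact: filt_meas HF s sT. Qed.

Lemma gmeas_eint s : 0 <= s <= T -> gmeas (F s) (eint e s).
Proof.
move=> /andP[s0 sT]; apply/(gmeasP (filt_sigma HF s)).
apply: measurable_sum => i; have [c0 ce eT gx _] := He i.
have [cs|sc] := leP (ec (e i)) s.
  apply: measurable_funM.
    by apply/(gmeasP (filt_sigma HF s)); exact: filt_gmeasS gx.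
  apply: measurable_funB; apply/(gmeasP (filt_sigma HF s)).
    apply: (@filt_gmeasS (Num.min (ee (e i)) s)) => //.
    - by rewrite le_min s0 (le_trans c0).
    - by rewrite ge_min lexx orbT.
    - apply: (bm_meas HW); rewrite le_min s0 (le_trans c0)//=.
      by rewrite ge_min eT.
  apply: (filt_gmeasS c0) => //; apply: (bm_meas HW).
  by rewrite c0 (le_trans ce).
rewrite (_ : (fun _ => _) = cst 0)//; apply/funext => w.
by rewrite !min_r ?subrr ?mulr0// ltW// (lt_le_trans sc).
Qed.

Lemma sqi_eint s : 0 <= s <= T -> sqi mu (eint e s).
Proof.
move=> /andP[s0 sT]; apply: sqi_sum => i; have [c0 ce eT gx [K xK]] := He i.
apply: (@sqiM _ _ _ _ _ _ K) => //.
  by apply: (@filt_gmeas_meas (ec (e i))) gx; rewrite c0 (le_trans ce).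
apply: (bm_sqi HW).
- by rewrite le_min c0.
- by rewrite le_min !ge_min ce lexx orbT.
- by rewrite ge_min eT.
Qed.

Lemma jmeas_eproc j : jmeas (eproc e j).
Proof.
apply: jmeas_sum => i; apply: jmeasM; first exact: jmeas_itv.
apply: jmeas_l; have [c0 ce eT gx _] := He i.
by apply: (@filt_gmeas_meas (ec (e i))) gx; rewrite c0 (le_trans ce).
Qed.

Let energy s w := \sum_j eproc e j s w ^+ 2.

Lemma jmeas_energy : jmeas energy.
Proof. by apply: jmeas_sum => j; apply: jmeasX; exact: jmeas_eproc. Qed.

Lemma energy_ge0 s w : 0 <= energy s w.
Proof. by apply: sumr_ge0 => j _; exact: sqr_ge0. Qed.

(** On an interval free of end points a term is either active throughout or constant. The increment
    of the integral is then a sum of coefficients known at time a times Brownian increments, and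
    [integral_sqr_one_step] applies. *)
Let one_step (a b : R) A : 0 <= a -> a < b -> b <= T ->
  (forall i, (ec (e i) <= a \/ b <= ec (e i)) /\
             (ee (e i) <= a \/ b <= ee (e i))) -> F a A ->
  (\int[mu]_(w in A) (eint e b w ^+ 2)%:E <=
   \int[mu]_(w in A) (eint e a w ^+ 2)%:E + v0%:E * dint mu energy A a b)%E.
Proof.
move=> a0 ab bT sep FA.
have aT : 0 <= a <= T by rewrite a0 (le_trans (ltW ab)).
pose act i := (ec (e i) <= a) && (b <= ee (e i)).
pose g j w : R := \sum_i ((ej (e i) == j) && act i)%:R * ex (e i) w.
have gg j : gmeas (F a) (g j).
  apply/(gmeasP (filt_sigma HF a)); apply: measurable_sum => i.
  have [c0 ce eT gx _] := He i.
  have [/andP[_ /andP[ca _]]|_] := boolP ((ej (e i) == j) && act i).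
    under eq_fun do rewrite mul1r.
    apply/(gmeasP (filt_sigma HF a)); apply: (filt_gmeasS c0) gx => //.
    by case/andP: aT.
  by under eq_fun do rewrite mul0r; exact: measurable_cst.
have /choice[K xK] : forall i, exists K, forall w, `|ex (e i) w| <= K.
  by move=> i; have [] := He i.
have gK j w : `|g j w| <= \sum_i K i.
  apply: (le_trans (ler_norm_sum _ _ _)); apply: ler_sum => i _.
  rewrite normrM normr_nat; case: (_ && _); rewrite ?mul1r ?mul0r//.
  exact: le_trans (normr_ge0 _) (xK i w).
have intE w : eint e b w = eint e a w + \sum_j g j w * (W j b w - W j a w).
  rewrite /eint.
  have -> : \sum_j g j w * (W j b w - W j a w) = \sum_i (act i)%:R * ex (e i) w *
      (W (ej (e i)) b w - W (ej (e i)) a w).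
    under eq_bigr do rewrite mulr_suml.
    rewrite exchange_big/=; apply: eq_bigr => i _.
    rewrite (bigD1 (ej (e i)))//= eqxx/= big1 ?addr0// => j /negbTE.
    by rewrite eq_sym => ->; rewrite !mul0r.
  rewrite -big_split/=; apply: eq_bigr => i _; rewrite /act.
  have [c0 ce eT _ _] := He i; have [hc he] := sep i.
  case: hc => [ca|bc].
    rewrite ca (min_l ca) (min_l (le_trans ca (ltW ab))).
    case: he => [ea|be].
      rewrite leNgt (le_lt_trans ea ab)/= !mul0r addr0.
      by rewrite (min_l ea) (min_l (le_trans ea (ltW ab))).
    rewrite be (min_r be) (min_r (le_trans (ltW ab) be)) mul1r.
    by rewrite -mulrDr; congr (_ * _); ring.
  have be := le_trans bc ce.
  rewrite (leNgt _ a) (lt_le_trans ab bc)/= !mul0r addr0.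
  rewrite (min_r be) (min_r bc) (min_r (le_trans (ltW ab) be)).
  by rewrite (min_r (le_trans (ltW ab) bc)) !subrr.
have procE j s w : a < s <= b -> eproc e j s w = g j w.
  move=> /andP[as_ sb]; rewrite /eproc /g big_mkcond/=; apply: eq_bigr => i _.
  case: ifP => _; last by rewrite mul0r.
  rewrite /act; have [hc he] := sep i.
  have -> : (ec (e i) < s) = (ec (e i) <= a).
    case: hc => [ca|bc]; first by rewrite ca (le_lt_trans ca).
    by rewrite ltNge (le_trans sb bc) (leNgt _ a) (lt_le_trans ab bc).
  have -> // : (s <= ee (e i)) = (b <= ee (e i)).
  case: he => [ea|be]; last by rewrite be (le_trans sb).
  by rewrite leNgt (le_lt_trans ea as_) leNgt (le_lt_trans ea ab).
have /andP[vb0 vb] : 0 <= v (b - a) <= v0 * (b - a).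
  by apply: (bm_v HW); rewrite subr_gt0.
have mA : measurable A by exact: (filt_meas HF aT).
under eq_integral do rewrite intE.
rewrite (@integral_sqr_one_step _ _ _ _ (F a) (filt_sigma HF a) (filt_meas HF aT)
  _ _ _ _ (v (b - a)) (\sum_i K i))//.
- rewrite leeD2l//.
  have -> : dint mu energy A a b =
      ((b - a)%:E * \int[mu]_(w in A) (\sum_j g j w ^+ 2)%:E)%E.
    rewrite dintE -ge0_integralZl//.
    + apply: eq_integral => w _; rewrite sintE.
      rewrite (eq_integral (cst (\sum_j g j w ^+ 2)%:E)).
        rewrite integral_cst//= lebesgue_measure_itv/= lte_fin ab -EFinB.
        by rewrite muleC.
      move=> s; rewrite inE/= in_itv/= => ss; congr EFin.
      by apply: eq_bigr => j _; rewrite procE.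
    + apply/measurable_EFinP; apply: measurable_sum => j.
      apply: measurable_funX; apply: measurable_funTS.
      exact: filt_gmeas_meas (gg j).
    + by move=> w _; rewrite lee_fin sumr_ge0// => j _; exact: sqr_ge0.
    + by rewrite lee_fin subr_ge0 ltW.
  rewrite muleA -EFinM lee_wpmul2r ?lee_fin//.
  by apply: integral_ge0 => w _; rewrite lee_fin sumr_ge0// => j _; exact: sqr_ge0.
- exact: gmeas_eint.
- exact: sqi_eint.
- by move=> j; apply: (bm_sqi HW) => //; exact: ltW.
- by move=> j B FB; apply: (bm_mean HW) => //; exact: ltW.
- by move=> j l B jl FB; apply: (bm_cov HW) => //; exact: ltW.
- by move=> j B FB; exact: (bm_var HW).
Qed.

Lemma eint_sqr_le (a b : R) A : 0 <= a -> a <= b -> b <= T -> F a A ->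
  (\int[mu]_(w in A) (eint e b w ^+ 2)%:E <=
   \int[mu]_(w in A) (eint e a w ^+ 2)%:E + v0%:E * dint mu energy A a b)%E.
Proof.
move=> a0; rewrite le_eqVlt => /orP[/eqP <-|ab] bT.
  move=> FA; rewrite leeDl// mule_ge0//.
    have /andP[h1 h2] := bm_v HW ltr01; rewrite lee_fin.
    by rewrite mulr1 in h2; exact: le_trans h2.
  by apply: dint_ge0; exact: energy_ge0.
have v00 : 0 <= v0.
  have /andP[h1 h2] := bm_v HW ltr01.
  by rewrite mulr1 in h2; exact: le_trans h2.
(* The cuts are the end points of all terms. The bounds on adjacent intervals add up because each is
   proved for every event known at its left end. *)
pose L := map (fun i => ec (e i)) (enum I) ++ map (fun i => ee (e i)) (enum I).
pose Pab a b := forall A, F a A ->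
  (\int[mu]_(w in A) (eint e b w ^+ 2)%:E <=
   \int[mu]_(w in A) (eint e a w ^+ 2)%:E + v0%:E * dint mu energy A a b)%E.
suff Pabab : Pab a b by exact: Pabab.
apply: (@interval_cut _ T Pab L _ _ a b a0 ab bT).
  move=> {A ab bT a0}a c {}b a0 ac cb bT Pac Pcb A FA.
  have aT : 0 <= a <= T by rewrite a0 (le_trans (ltW (lt_trans ac cb))).
  have cT := le_trans (ltW cb) bT.
  apply: (le_trans (Pcb A _)); first exact: (filt_mono HF _ (ltW ac)) FA.
  apply: (le_trans (leeD (Pac A FA) (lexx _))).
  have mA := filt_meas HF aT FA.
  have je := jmeas_energy; have e0 := energy_ge0.
  rewrite (dint_split _ mA je e0 (ltW ac) (ltW cb)) (@ge0_muleDr _ v0%:E (dint mu energy A a c)) ?dint_ge0//.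
  by rewrite addeA.
move=> {A ab bT a0}a {}b a0 ab bT HL A FA; apply: one_step => // i; split; apply: HL.
  by rewrite mem_cat map_f ?mem_enum.
by rewrite mem_cat (map_f (fun i => ee (e i))) ?mem_enum ?orbT.
Qed.

End one_family.
End elementary.

(** * Ito integrals *)

Lemma lee_sqr_factor (R : realType) (x p : \bar R) : (0 <= p)%E ->
  (forall e : R, 0 < e -> (x <= ((1 + e) ^+ 2)%:E * p)%E) -> (x <= p)%E.
Proof.
case: p => [p| |]//; last by move=> _ _; rewrite leey.
rewrite lee_fin => p0 H; apply/lee_addgt0Pr => e e0.
(* For d at most 1, (1 + d)^2 is at most 1 + 3 d, so the excess over p is at most 3 d p and hence at
   most e. *)
pose d := Num.min 1 (e / (3 * (p + 1))).
have d0 : 0 < d by rewrite lt_min ltr01 divr_gt0// mulr_gt0// ltr_wpDl.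
have d1 : d <= 1 by rewrite ge_min lexx.
have d2 : d * (3 * (p + 1)) <= e.
  by rewrite -ler_pdivlMr ?mulr_gt0 ?ltr_wpDl// ge_min lexx orbT.
apply: le_trans (H d d0) _; rewrite -EFinM -EFinD lee_fin.
by nra.
Qed.

Lemma cvge0_lt (R : realType) (u : (\bar R)^nat) (e : R) :
  u @ \oo --> 0%E -> 0 < e -> \forall k \near \oo, (u k < e%:E)%E.
Proof.
move=> cu e0; apply: (cu [set y | (y < e%:E)%E]).
by apply: open_nbhs_nbhs; split; [exact: open_ereal_lt_ereal|rewrite /= lte_fin].
Qed.

(** Young's inequality with a factor close to 1 on the retained term: an inequality between second
    moments can be carried through an $L^2$ limit, and e is sent to 0 afterwards. *)
Lemma sqr_le_young (R : realFieldType) (e x y : R) : 0 < e ->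
  x ^+ 2 <= (1 + e) * y ^+ 2 + (1 + e^-1) * (x - y) ^+ 2.
Proof.
move=> e0; rewrite -subr_ge0.
have -> : (1 + e) * y ^+ 2 + (1 + e^-1) * (x - y) ^+ 2 - x ^+ 2 =
  e^-1 * (e * y - (x - y)) ^+ 2 by field; rewrite gt_eqF.
by rewrite mulr_ge0 ?sqr_ge0// invr_ge0 ltW.
Qed.

Section young_integral.
Context d (Om : measurableType d) (R : realType) (mu : probability Om R).

Lemma integral_sqr_young (X Y : Om -> R) (A : set Om) (e : R) :
  measurable_fun setT X -> measurable_fun setT Y -> measurable A -> 0 < e ->
  (\int[mu]_(w in A) (X w ^+ 2)%:E <= (1 + e)%:E * \int[mu]_(w in A) (Y w ^+ 2)%:E
    + (1 + e^-1)%:E * \int[mu]_w ((X w - Y w) ^+ 2)%:E)%E.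
Proof.
move=> mX mY mA e0.
have e1 : 0 <= 1 + e by rewrite addr_ge0// ltW.
have e2 : 0 <= 1 + e^-1 by rewrite addr_ge0// invr_ge0 ltW.
have mXY : measurable_fun setT (fun w => ((X w - Y w) ^+ 2)%:E).
  by apply/measurable_EFinP; apply: measurable_funX; exact: measurable_funB.
have mY2 : measurable_fun setT (fun w => (Y w ^+ 2)%:E).
  by apply/measurable_EFinP; exact: measurable_funX.
apply: (@le_trans _ _ ((1 + e)%:E * \int[mu]_(w in A) (Y w ^+ 2)%:E
    + (1 + e^-1)%:E * \int[mu]_(w in A) ((X w - Y w) ^+ 2)%:E)%E); last first.
  rewrite leeD2l// lee_wpmul2l ?lee_fin//.
  by apply: ge0_subset_integral => // w _; rewrite lee_fin sqr_ge0.
rewrite -!ge0_integralZl//.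
- rewrite -ge0_integralD//.
  + apply: ge0_le_integral => //.
    * by move=> w _; rewrite lee_fin sqr_ge0.
    * by apply: measurable_funTS; apply/measurable_EFinP; exact: measurable_funX.
    * by apply: measurable_funTS; apply: emeasurable_funD; exact: measurable_funeM.
    * by move=> w _; rewrite -!EFinM -EFinD lee_fin sqr_le_young.
  + by move=> w _; rewrite -EFinM lee_fin mulr_ge0// sqr_ge0.
  + by apply: measurable_funTS; exact: measurable_funeM.
  + by move=> w _; rewrite -EFinM lee_fin mulr_ge0// sqr_ge0.
  + by apply: measurable_funTS; exact: measurable_funeM.
- exact: measurable_funTS.
- by move=> w _; rewrite lee_fin sqr_ge0.
- exact: measurable_funTS.
- by move=> w _; rewrite lee_fin sqr_ge0.
Qed.

Lemma dint_mono_itv h (A : set Om) (a b T : R) : measurable A -> jmeas h ->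
  (forall s w, 0 <= h s w) -> 0 <= a -> a <= b -> b <= T ->
  (dint mu h A a b <= dint mu h setT 0 T)%E.
Proof.
move=> mA mh h0 a0 ab bT.
apply: (@le_trans _ _ (dint mu h setT a b)).
  rewrite !dintE; apply: ge0_subset_integral => //.
    exact: measurable_sint.
  by move=> w _; exact: sint_ge0.
have aT := le_trans ab bT.
rewrite (dint_split mu measurableT mh h0 a0 aT).
rewrite (dint_split mu measurableT mh h0 ab bT).
apply: (@le_trans _ _ (dint mu h setT a b + dint mu h setT b T)%E).
  by rewrite leeDl// dint_ge0.
by rewrite leeDr// dint_ge0.
Qed.

Lemma dint_sqr_young n (X Y : 'I_n -> R -> Om -> R) (A : set Om) (a b T e : R) :
  (forall j, jmeas (X j)) -> (forall j, jmeas (Y j)) -> measurable A -> 0 < e ->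
  0 <= a -> a <= b -> b <= T ->
  (dint mu (fun s w => \sum_j X j s w ^+ 2)%R A a b <=
   (1 + e)%:E * dint mu (fun s w => \sum_j Y j s w ^+ 2)%R A a b +
   (1 + e^-1)%:E *
     dint mu (fun s w => \sum_j (X j s w - Y j s w) ^+ 2)%R setT 0 T)%E.
Proof.
move=> mX mY mA e0 a0 ab bT.
have e1 : 0 <= 1 + e by rewrite addr_ge0// ltW.
have e2 : 0 <= 1 + e^-1 by rewrite addr_ge0// invr_ge0 ltW.
have s0 (Z : 'I_n -> R -> Om -> R) s w : 0 <= \sum_j Z j s w ^+ 2.
  by apply: sumr_ge0 => j _; exact: sqr_ge0.
have jX : jmeas (fun s w => \sum_j X j s w ^+ 2).
  by apply: jmeas_sum => j; exact: jmeasX.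
have jY : jmeas (fun s w => \sum_j Y j s w ^+ 2).
  by apply: jmeas_sum => j; exact: jmeasX.
have jXY : jmeas (fun s w => \sum_j (X j s w - Y j s w) ^+ 2).
  by apply: jmeas_sum => j; apply: jmeasX; exact: jmeasB.
have s1 s w : 0 <= \sum_j (X j s w - Y j s w) ^+ 2.
  by apply: sumr_ge0 => j _; exact: sqr_ge0.
apply: (@le_trans _ _ ((1 + e)%:E * dint mu (fun s w => \sum_j Y j s w ^+ 2)%R A a b +
   (1 + e^-1)%:E *
     dint mu (fun s w => \sum_j (X j s w - Y j s w) ^+ 2)%R A a b)%E); last first.
  apply: leeD2l; apply: lee_wpmul2l; first by rewrite lee_fin.
  exact: dint_mono_itv.
rewrite -!dintZ//.
have jc (c : R) : jmeas (fun _ (_ : Om) => c) by exact: jmeas_cst.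
rewrite -dintD//.
- apply: dint_le => //.
  + by apply: jmeasD; exact: jmeasM.
  + by move=> s w; rewrite addr_ge0// mulr_ge0.
  + move=> s w _ _; rewrite !mulr_sumr -big_split/=.
    by apply: ler_sum => j _; exact: sqr_le_young.
- exact: jmeasM.
- exact: jmeasM.
- by move=> s w; rewrite mulr_ge0.
- by move=> s w; rewrite mulr_ge0.
Qed.

End young_integral.

Section ito_limit.
Context d (Om : measurableType d) (R : realType) (mu : probability Om R).
Context (T : R) (F : R -> set (set Om)) (HF : filtered T F).
Context (n : nat) (W : 'I_n -> R -> Om -> R) (v : R -> R) (v0 : R).
Context (HW : brownian mu T F W v v0).

(** A scalar integral against an n-dimensional Brownian motion. One sequence of finite families has
    to approximate the integrand and, simultaneously, the integral at every time s. *)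
Definition ito (H : 'I_n -> R -> Om -> R) (N : R -> Om -> R) :=
  exists (I : nat -> finType) (e : forall k, I k -> eterm Om R n),
  [/\ forall k i, evalid T F (e k i),
      (dint mu (fun s w => \sum_j (eproc (e k) j s w - H j s w) ^+ 2)%R setT 0 T
         @[k --> \oo] --> 0)%E &
      forall s : R, 0 <= s <= T ->
      (\int[mu]_w ((eint W (e k) s w - N s w) ^+ 2)%:E @[k --> \oo] --> 0)%E].

Lemma bm_v0_ge0 : 0 <= v0.
Proof.
have /andP[h1 h2] := bm_v HW ltr01.
by rewrite mulr1 in h2; exact: le_trans h2.
Qed.

(** Moment bounds, locality and the absence of noise are all derived from this estimate. That it
    holds on every event A of F a is what permits stopping. *)
Lemma ito_sqr_le H N (a b : R) A : (forall j, jmeas (H j)) ->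
  (forall s : R, 0 <= s <= T -> measurable_fun setT (N s)) -> ito H N ->
  0 <= a -> a <= b -> b <= T -> F a A ->
  (\int[mu]_(w in A) (N b w ^+ 2)%:E <= \int[mu]_(w in A) (N a w ^+ 2)%:E +
    v0%:E * dint mu (fun s w => \sum_j H j s w ^+ 2)%R A a b)%E.
Proof.
move=> mH mN [I [e [eV eH eN]]] a0 ab bT FA.
have aT : 0 <= a <= T by rewrite a0 (le_trans ab).
have bT' : 0 <= b <= T by rewrite bT (le_trans a0).
have mA := filt_meas HF aT FA.
have v00 := bm_v0_ge0.
set y := (\int[mu]_(w in A) (N a w ^+ 2)%:E)%E.
set z := dint mu _ A a b.
have y0 : (0 <= y)%E by apply: integral_ge0 => w _; rewrite lee_fin sqr_ge0.
have z0 : (0 <= z)%E.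
  by apply: dint_ge0 => s w; apply: sumr_ge0 => j _; exact: sqr_ge0.
have t0 : (0 <= v0%:E * z)%E by rewrite mule_ge0.
have [->|yt] := eqVneq (y + v0%:E * z)%E +oo%E; first by rewrite leey.
have fyt : (y + v0%:E * z)%E \is a fin_num.
  by rewrite ge0_fin_numE; [rewrite ltey|exact: adde_ge0].
apply: lee_sqr_factor => [|c c0]; first by rewrite adde_ge0.
have c1 : 0 <= 1 + c by rewrite addr_ge0// ltW.
have c2 : 0 <= 1 + c^-1 by rewrite addr_ge0// invr_ge0 ltW.
(* Young's inequality is used at time b, and then at time a and for the energy, which produces the
   factor (1 + c)^2; K collects all coefficients of the approximation error p. *)
pose K := (1 + c) * (1 + c^-1) + (1 + c) * v0 * (1 + c^-1) + (1 + c^-1).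
have K0 : 0 <= K.
  by apply: addr_ge0 => //; apply: addr_ge0; apply: mulr_ge0 => //; exact: mulr_ge0.
apply/lee_addgt0Pr => q q0.
pose p := q / (K + 1).
have p0 : 0 < p by rewrite divr_gt0// ltr_wpDl.
have pq : K * p <= q.
  rewrite /p mulrCA -[leRHS]mulr1 ler_wpM2l ?(ltW q0)// ler_pdivrMr ?ltr_wpDl//.
  by rewrite mul1r lerDl.
have nea := cvge0_lt (eN _ aT) p0.
have neb := cvge0_lt (eN _ bT') p0.
have neH := cvge0_lt eH p0.
near \oo => k.
have ha : (\int[mu]_w ((eint W (e k) a w - N a w) ^+ 2)%:E <= p%:E)%E.
  by apply/ltW; near: k.
have hb : (\int[mu]_w ((N b w - eint W (e k) b w) ^+ 2)%:E <= p%:E)%E.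
  under eq_integral do rewrite -sqrrN opprB.
  by apply/ltW; near: k.
have hH : (dint mu (fun s w => \sum_j (eproc (e k) j s w - H j s w) ^+ 2)%R
    setT 0 T <= p%:E)%E by apply/ltW; near: k.
have mI (s : R) : 0 <= s <= T -> measurable_fun setT (eint W (e k) s).
  by move=> sT; apply: (filt_gmeas_meas HF sT); exact: (gmeas_eint HF HW).
have mE j : jmeas (eproc (e k) j) by exact: (jmeas_eproc HF).
apply: (le_trans (integral_sqr_young mu (mN _ bT') (mI _ bT') mA c0)).
have s1 := eint_sqr_le HF HW (eV k) a0 ab bT FA.
have s2 := integral_sqr_young mu (mI _ aT) (mN _ aT) mA c0.
have s3 := dint_sqr_young mu mE mH mA c0 a0 ab bT.
rewrite -/y in s2; rewrite -/z in s3.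
have e1 : (0 <= (1 + c)%:E)%E by rewrite lee_fin.
have e2 : (0 <= (1 + c^-1)%:E)%E by rewrite lee_fin.
have e3 : (0 <= v0%:E)%E by rewrite lee_fin.
have {}s2 := le_trans s2 (leeD (lexx _) (lee_wpmul2l e2 ha)).
have {}s3 := le_trans s3 (leeD (lexx _) (lee_wpmul2l e2 hH)).
have {}s3 := lee_wpmul2l e3 s3.
have e4 : (0 <= (1 + c^-1)%:E * p%:E)%E.
  by rewrite -EFinM lee_fin mulr_ge0// ltW.
rewrite (ge0_muleDr _ (mule_ge0 e1 z0) e4) muleCA in s3.
have {}s1 := le_trans s1 (leeD s2 s3).
apply: le_trans (leeD (lee_wpmul2l e1 s1) (lee_wpmul2l e2 hb)) _.
move: fyt; rewrite fin_numD => /andP[/fineK <- /fineK <-].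
move: (fine y) (fine (v0%:E * z)%E) => y' t'.
rewrite -?EFinM -?EFinD -?EFinM -?EFinD -?EFinM -?EFinD lee_fin.
apply: (@le_trans _ _ ((1 + c) ^+ 2 * (y' + t') + K * p)).
  by rewrite /K le_eqVlt; apply/orP; left; apply/eqP; ring.
by rewrite lerD2l.
Unshelve. all: by end_near.
Qed.

End ito_limit.

(** * Stopping times and stopped second moments *)

Section sigma_algebra_closure.
Context (X : Type) (G : set (set X)) (Gs : sigma_algebra setT G).

Lemma salg0 : G set0. Proof. by case: Gs. Qed.

Lemma salgC A : G A -> G (~` A).
Proof. by rewrite -setTD; case: Gs => _ + _; exact. Qed.

Lemma salgT : G setT. Proof. by rewrite -setC0; apply: salgC; exact: salg0. Qed.

Lemma salg_bigcup (A : (set X)^nat) : (forall k, G (A k)) -> G (\bigcup_k A k).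
Proof. by case: Gs => _ _; exact. Qed.

Lemma salg_bigcap (A : (set X)^nat) : (forall k, G (A k)) -> G (\bigcap_k A k).
Proof.
move=> GA; rewrite -[\bigcap_k _]setCK setC_bigcap; apply: salgC.
by apply: salg_bigcup => k; exact: salgC.
Qed.

Lemma salgU A B : G A -> G B -> G (A `|` B).
Proof.
move=> GA GB; rewrite -bigcup2E; apply: salg_bigcup => -[|[|k]]//=.
exact: salg0.
Qed.

Lemma salgI A B : G A -> G B -> G (A `&` B).
Proof. by move=> GA GB; rewrite -[A `&` B]setCK setCI; apply: salgC; apply: salgU; exact: salgC. Qed.

End sigma_algebra_closure.

Definition stopping {Om : Type} {R : realType} (T : R) (F : R -> set (set Om))
    (th : Om -> R) :=
  (forall w, 0 <= th w <= T) /\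
  forall s : R, 0 <= s <= T -> F s [set w | th w <= s].

Lemma within_itv_cvg (R : realType) (V : topologicalType) (T : R) (f : R -> V)
    (u : nat -> R) (l : R) : {within `[0, T], continuous f} ->
  (forall k, 0 <= u k <= T) -> 0 <= l <= T -> u @ \oo --> l ->
  f (u k) @[k --> \oo] --> f l.
Proof.
move=> /subspace_continuousP cf uT lT ul.
have := cf l; rewrite /= in_itv/= => /(_ lT) cfl.
apply: (cvg_comp u f _ cfl).
move=> A HA; have uA : \forall k \near \oo, `[0, T]%classic (u k) -> A (u k).
  exact: ul _ HA.
apply: filterS uA => k; apply=> /=.
by rewrite in_itv/=; exact: uT.
Qed.

Lemma fatou_cvg_le d (Om : measurableType d) (R : realType)
    (mu : {measure set Om -> \bar R}) (f : nat -> Om -> R) (g : Om -> R)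
    (c : (\bar R)^nat) (l : \bar R) :
  (forall m, measurable_fun setT (f m)) -> (forall m w, 0 <= f m w) ->
  (forall w, f m w @[m --> \oo] --> g w) -> c @ \oo --> l ->
  (forall m, \int[mu]_w (f m w)%:E <= c m)%E ->
  (\int[mu]_w (g w)%:E <= l)%E.
Proof.
move=> mf f0 fg cl fc.
have -> : (\int[mu]_w (g w)%:E = \int[mu]_w limn_einf (fun m => (f m w)%:E))%E.
  apply: eq_integral => w _.
  have cf : (f m w)%:E @[m --> \oo] --> (g w)%:E.
    by apply: cvg_EFin; [exact: nearW|exact: fg].
  rewrite is_cvg_limn_einfE; last by apply/cvg_ex; eexists; exact: cf.
  by apply/esym/cvg_lim.
apply: le_trans (fatou _ _ _ _) _ => //.
- by move=> m; apply/measurable_EFinP.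
- by move=> m w _; rewrite lee_fin.
rewrite limn_einf_lim -(cvg_lim _ cl)//; apply: lee_lim.
- exact: is_cvg_einfs.
- by apply/cvg_ex; eexists; exact: cl.
- apply: nearW => m; apply: le_trans (fc m).
  by apply: ereal_inf_lbound; exists m => /=.
Qed.

Section stopped.
Context d (Om : measurableType d) (R : realType) (mu : probability Om R).
Context (T : R) (F : R -> set (set Om)) (HF : filtered T F).

Lemma stopping_meas th : stopping T F th -> measurable_fun setT th.
Proof.
move=> [thT thF].
apply: (measurability _ (RGenInftyO.measurableE R)) => _ [_ [x ->] <-].
rewrite setTI.
have -> : th @^-1` `]-oo, x[ = ~` [set w | x <= th w].
  apply/seteqP; split => w /=; rewrite in_itv/= ltNge => /negP//.
have -> : ~` [set w | x <= th w] =
    \bigcup_k [set w | th w <= x - k.+1%:R^-1].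
  apply/seteqP; split => [w /= /negP|w [k _ /=]].
    rewrite -ltNge => thx; have xth : 0 < x - th w by rewrite subr_gt0.
    have [k] := near_infty_natSinv_lt (PosNum xth).
    move=> _ /(_ _ (leqnn _))/= => h; exists k => //=.
    by rewrite lerBrDr -lerBrDl ltW.
  move=> h; apply/negP; rewrite -ltNge (le_lt_trans h)//.
  by rewrite ltrBlDr ltrDl invr_gt0.
apply: bigcupT_measurable => k; set y := x - _.
have [y0|y0] := ltP y 0.
  rewrite (_ : [set _ | _] = set0)//; apply/seteqP; split => // w /=.
  by case/andP: (thT w) => + _ => /le_trans/[apply]; rewrite leNgt y0.
have [yT|yT] := leP y T.
  by apply: (filt_meas HF (s := y)); rewrite ?y0//; apply: thF; rewrite y0.
rewrite (_ : [set _ | _] = setT)//; apply/seteqP; split => // w _ /=.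
by case/andP: (thT w) => _ /le_trans; apply; exact: ltW.
Qed.

Lemma stopping_minr th th' : stopping T F th -> stopping T F th' ->
  stopping T F (fun w => Num.min (th w) (th' w)).
Proof.
move=> [thT thF] [thT' thF']; split => [w|s sT].
  by rewrite le_min ge_min (andP (thT w)).1 (andP (thT w)).2 (andP (thT' w)).1.
have -> : [set w | Num.min (th w) (th' w) <= s] =
    [set w | th w <= s] `|` [set w | th' w <= s].
  by apply/seteqP; split => w /=; rewrite ge_min => /orP.
by apply: (salgU (filt_sigma HF s)); [exact: thF|exact: thF'].
Qed.

Context (v0 : R) (v00 : 0 <= v0).
Context (N h : R -> Om -> R) (jh : jmeas h) (h0 : forall s w, 0 <= h s w).
Context (hfin : (dint mu h setT 0 T < +oo)%E).
Context (mN : forall s : R, 0 <= s <= T -> measurable_fun setT (N s)).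
Context (cN : forall w, {within `[0, T], continuous (N ^~ w)}).
Context (Q : forall (a b : R) A, 0 <= a -> a <= b -> b <= T -> F a A ->
  (\int[mu]_(w in A) (N b w ^+ 2)%:E <=
   \int[mu]_(w in A) (N a w ^+ 2)%:E + v0%:E * dint mu h A a b)%E).
Context (th : Om -> R) (Hth : stopping T F th) (s : R) (sT : 0 <= s <= T).

Let q m j : R := s * j%:R / m.+1%:R.
Let dl m : R := s / m.+1%:R.

(* [N] stopped at the first point of the grid [q m] after [th]. *)
Fixpoint grid_stop m j w : R :=
  if j is j'.+1 then
    if th w <= q m j' then grid_stop m j' w else N (q m j) w
  else N 0 w.

Let s0 : 0 <= s. Proof. by case/andP: sT. Qed.

Let q0 m : q m 0 = 0. Proof. by rewrite /q mulr0 mul0r. Qed.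

Let qS m j : q m j.+1 = q m j + dl m.
Proof. by rewrite /q /dl -natr1 mulrDr mulr1 mulrDl. Qed.

Let dl_ge0 m : 0 <= dl m. Proof. by rewrite divr_ge0. Qed.

Let q_ge0 m j : 0 <= q m j.
Proof. by rewrite /q !mulr_ge0// invr_ge0. Qed.

Let q_le m j : (j <= m.+1)%N -> q m j <= T.
Proof.
move=> jm; case/andP: sT => _; apply: le_trans.
by rewrite /q ler_pdivrMr// ler_wpM2l// ler_nat.
Qed.

Let q_last m : q m m.+1 = s. Proof. by rewrite /q mulfK// pnatr_eq0. Qed.

Let grid_stop_eq m j w : q m j < th w -> grid_stop m j w = N (q m j) w.
Proof.
case: j => [|j] /=; first by rewrite q0.
by move=> h1; rewrite leNgt (le_lt_trans _ h1)// qS lerDl.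
Qed.

Let measurable_grid_stop m j : (j <= m.+1)%N ->
  measurable_fun setT (grid_stop m j).
Proof.
elim: j => [_|j ih jm] /=; first by apply: mN; rewrite lexx (le_trans s0)//; case/andP: sT.
apply: measurable_fun_ifT.
- by apply: measurable_fun_ler => //; exact: stopping_meas.
- exact: ih (ltnW jm).
- by apply: mN; rewrite q_ge0 q_le.
Qed.

(** The process is stopped on the grid and therefore late, but by no more than one mesh width. *)
Let grid_stop_time m j w : exists2 t, grid_stop m j w = N t w &
  Num.min (q m j) (th w) <= t <= Num.min (q m j) (th w + dl m).
Proof.
have /andP[th0 _] := Hth.1 w.
elim: j => [|j [t tE /andP[t1 t2]]] /=.
  by exists 0 => //; rewrite q0 (min_l th0) (min_l _) ?lexx// addr_ge0.
case: leP => thq.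
  exists t => //; apply/andP; split.
    apply: le_trans t1; rewrite (min_r thq) min_r//.
    by rewrite qS (le_trans thq)// lerDl.
  apply: (le_trans t2); rewrite le_min !ge_min lexx orbT andbT.
  by rewrite qS lerDl dl_ge0.
exists (q m j.+1) => //; apply/andP; split; first by rewrite ge_min lexx.
by rewrite le_min lexx/= qS lerD2r ltW.
Qed.

(** The energy is kept up to one mesh width after th, since the grid process stops only at the first
    grid point after th. *)
Let hth m r w : R := (r <= th w + dl m)%R%:R * h r w.

Let jhth m : jmeas (hth m).
Proof.
apply: jmeasM => //; apply: jmeas_le.
by apply: measurable_funD => //; exact: stopping_meas.
Qed.

Let hth0 m r w : 0 <= hth m r w.
Proof. by rewrite mulr_ge0. Qed.

(** Induction along the grid: on the event that th has passed nothing changes, and its complement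
    belongs to F at the current grid point, so that [Q] applies to the next step. *)
Let grid_stop_sqr_le m j : (j <= m.+1)%N ->
  (\int[mu]_w (grid_stop m j w ^+ 2)%:E <=
   \int[mu]_w (N 0 w ^+ 2)%:E + v0%:E * dint mu (hth m) setT 0 (q m j))%E.
Proof.
elim: j => [_|j ih jm].
  rewrite /= leeDl// mule_ge0 ?lee_fin//; exact: dint_ge0.
have {}ih := ih (ltnW jm).
have qT : 0 <= q m j <= T by rewrite q_ge0 q_le// ltnW.
pose A := [set w | th w <= q m j].
have FA : F (q m j) A by apply: Hth.2.
have mA : measurable A by exact: (filt_meas HF qT).
have FcA : F (q m j) (~` A).
  by rewrite -setTD; have [_ + _] := filt_sigma HF (q m j); exact.
have mcA : measurable (~` A) by exact: measurableC.
have split (f : Om -> R) : measurable_fun setT f -> (\int[mu]_w (f w ^+ 2)%:E =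
    \int[mu]_(w in A) (f w ^+ 2)%:E + \int[mu]_(w in ~` A) (f w ^+ 2)%:E)%E.
  move=> mf; rewrite -ge0_integral_setU//; first by rewrite setUv.
  - by rewrite setUv; apply/measurable_EFinP; exact: measurable_funX.
  - by move=> w _; rewrite lee_fin sqr_ge0.
  - by apply/disj_setPCl.
rewrite split; last exact: measurable_grid_stop.
have -> : (\int[mu]_(w in A) (grid_stop m j.+1 w ^+ 2)%:E =
    \int[mu]_(w in A) (grid_stop m j w ^+ 2)%:E)%E.
  by apply: eq_integral => w; rewrite inE /A/= => ->.
have -> : (\int[mu]_(w in ~` A) (grid_stop m j.+1 w ^+ 2)%:E =
    \int[mu]_(w in ~` A) (N (q m j.+1) w ^+ 2)%:E)%E.
  by apply: eq_integral => w; rewrite inE /A/= => /negP/negbTE ->.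
have q1 : q m j <= q m j.+1 by rewrite qS lerDl.
apply: (le_trans (leeD2l _ (Q (q_ge0 m j) q1 (q_le jm) FcA))).
have -> : (\int[mu]_(w in ~` A) (N (q m j) w ^+ 2)%:E =
    \int[mu]_(w in ~` A) (grid_stop m j w ^+ 2)%:E)%E.
  apply: eq_integral => w; rewrite inE /A/= => /negP; rewrite -ltNge => h1.
  by rewrite grid_stop_eq.
rewrite addeA -split; last exact: measurable_grid_stop (ltnW jm).
rewrite (dint_split mu measurableT (jhth m) (hth0 m) (q_ge0 m j) q1).
rewrite (@ge0_muleDr _ v0%:E (dint mu (hth m) setT 0 (q m j))) ?dint_ge0//.
rewrite addeA; apply: leeD => //; apply: lee_wpmul2l; first by rewrite lee_fin.
apply: (@le_trans _ _ (dint mu (hth m) (~` A) (q m j) (q m j.+1))).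
  apply: dint_le => // r w; rewrite /A/= => /negP; rewrite -ltNge => h1.
  move=> /andP[_ r2]; rewrite /hth (le_trans r2) ?mul1r//.
  by rewrite qS lerD2r ltW.
rewrite !dintE; apply: ge0_subset_integral => //.
  by apply: measurable_sint.
by move=> w _; exact: sint_ge0.
Qed.

(** The mesh tends to 0. Path continuity and Fatou's lemma handle the left side, dominated
    convergence with the bound h the right side; an inequality is all that survives, and all that is
    wanted. *)
Lemma stopped_sqr_le :
  (\int[mu]_w (N (Num.min s (th w)) w ^+ 2)%:E <=
   \int[mu]_w (N 0 w ^+ 2)%:E +
   v0%:E * dint mu (fun r w => (r <= th w)%R%:R * h r w)%R setT 0 s)%E.
Proof.
pose Z m w := grid_stop m m.+1 w.
have dl0 : dl m @[m --> \oo] --> 0.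
  rewrite -(mulr0 s); apply: cvgMr.
  exact: (@cvg_harmonic R).
have ZN w : Z m w @[m --> \oo] --> N (Num.min s (th w)) w.
  have /choice[t Ht] : forall m, exists t, Z m w = N t w /\
      Num.min s (th w) <= t <= Num.min s (th w + dl m).
    by move=> m; have [t h1 h2] := grid_stop_time m m.+1 w; exists t; rewrite -(q_last m).
  have -> : (fun m => Z m w) = (fun m => N (t m) w).
    by apply/funext => m; exact: (Ht m).1.
  have /andP[th0 thT] := Hth.1 w; have /andP[_ sT'] := sT.
  have H := @within_itv_cvg _ _ T (N^~ w) t (Num.min s (th w)) (@cN w).
  apply: H.
  - move=> m; have [_ /andP[h1 h2]] := Ht m; apply/andP; split.
      by apply: le_trans h1; rewrite le_min s0.
    by apply: (le_trans h2); rewrite ge_min sT'.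
  - by rewrite le_min s0 th0 ge_min sT'.
  - apply: (@squeeze_cvgr _ _ _ _ (fun=> Num.min s (th w))
      (fun m => Num.min s (th w) + dl m)).
    + apply: nearW => m; have [_ /andP[-> h2]] := Ht m.
      apply: (le_trans h2); rewrite ge_min.
      by case: (leP s (th w)) => _; rewrite ?lerDl ?dl_ge0// lexx orbT.
    + exact: cvg_cst.
    + rewrite -[X in _ --> X]addr0; apply: cvgD => //; exact: cvg_cst.
have cD : (dint mu (hth m) setT 0 s @[m --> \oo] -->
    dint mu (fun r w => (r <= th w)%R%:R * h r w)%R setT 0 s)%E.
  apply: (@dint_cvg _ _ _ _ hth _ h _ _ jhth _ jh) => [|m r w|r w||r w].
  - by apply: jmeasM => //; apply: jmeas_le; exact: stopping_meas.
  - by rewrite hth0 /hth/= ler_piMl//; case: (r <= _).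
  - by rewrite mulr_ge0.
  - by apply: le_lt_trans hfin; apply: dint_mono_itv => //; case/andP: sT.
  - have [rth|thr] := leP r (th w).
      rewrite (_ : (fun _ => _) = fun=> 1%:R * h r w); first exact: cvg_cst.
      by apply/funext => m; rewrite /hth (le_trans rth)// lerDl.
    apply: cvg_near_cst; near=> m; rewrite /hth leNgt.
    have -> // : th w + dl m < r.
    rewrite -ltrBrDl; near: m.
    by apply: (cvgr_lt _ dl0); rewrite subr_gt0.
have cR : (\int[mu]_w (N 0 w ^+ 2)%:E + v0%:E * dint mu (hth m) setT 0 s
    @[m --> \oo] --> \int[mu]_w (N 0 w ^+ 2)%:E + v0%:E *
    dint mu (fun r w => (r <= th w)%R%:R * h r w)%R setT 0 s)%E.
  apply: cvgeD; [|exact: cvg_cst|exact: cvgeZl].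
  apply: ge0_adde_def; rewrite inE.
    by apply: integral_ge0 => w _; rewrite lee_fin sqr_ge0.
  by apply: mule_ge0; [rewrite lee_fin|apply: dint_ge0 => r w; rewrite mulr_ge0].
apply: (@fatou_cvg_le _ _ _ mu (fun m w => Z m w ^+ 2)
  (fun w => N (Num.min s (th w)) w ^+ 2) _ _ _ _ _ cR) => [m|m w|w|m].
- by apply: measurable_funX; exact: measurable_grid_stop.
- exact: sqr_ge0.
- rewrite expr2; under eq_fun do rewrite /= expr2.
  by apply: cvgM; exact: ZN.
- by have := grid_stop_sqr_le (leqnn m.+1); rewrite (q_last m).
Unshelve. all: by end_near.
Qed.

End stopped.

(** * Gronwall's lemma and the Cauchy-Schwarz inequality *)

Section gronwall.
Context (R : realType).
Local Notation leb := (@lebesgue_measure R).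

Lemma integral_expR_itv (k s : R) : 0 < k -> 0 <= s ->
  (\int[leb]_(r in `]0%R, s]) (expR (k * r))%:E = (k^-1 * (expR (k * s) - 1))%:E)%E.
Proof.
move=> k0; rewrite le_eqVlt => /orP[/eqP <-|s0].
  by rewrite set_itvoc0 integral_set0 mulr0 expR0 subrr mulr0.
have cexp : continuous (fun r : R => expR (k * r)).
  move=> r; apply: continuous_comp; first exact: mulrl_continuous.
  exact: continuous_expR.
pose G (r : R) := k^-1 * expR (k * r).
have dG (r : R) : is_derive r 1 G (expR (k * r)).
  have H : is_derive r 1 (fun r : R => expR (k * r)) (k * expR (k * r)).
    by apply: is_derive_eq; rewrite /GRing.scale/= mulr1 mulrC.
  rewrite /G; apply: is_derive_eq.
  by rewrite /GRing.scale/= mulrA mulVf ?mul1r// gt_eqF.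
have cG : continuous G.
  by move=> r; apply: differentiable_continuous; apply/derivable1_diffP.
rewrite integral_itv_obnd_cbnd; last first.
  by apply/measurable_EFinP; apply: measurable_funTS; exact: continuous_measurable_fun.
rewrite (@continuous_FTC2 _ _ G)//.
- by rewrite -EFinB /G mulr0 expR0 mulrBr.
- exact: continuous_subspaceT.
- split; first by move=> r _; exact: ex_derive.
  + by apply: cvg_at_right_filter; exact: cG.
  + by apply: cvg_at_left_filter; exact: cG.
- by move=> r _; rewrite derive1E derive_val.
Qed.

(** The supremum of exp(-2 K s) g(s), finite because of M, is at most c0 plus half of itself: the
    weight makes the integral operator a contraction with factor 1/2. The conclusion does not
    involve M, so M may come from a localization. *)
Lemma gronwall (T K c0 M : R) (g : R -> \bar R) : 0 < K -> 0 <= c0 -> 0 <= T ->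
  measurable_fun setT g ->
  (forall s : R, 0 <= s <= T -> (0 <= g s <= M%:E)%E) ->
  (forall s : R, 0 <= s <= T ->
     (g s <= c0%:E + K%:E * \int[leb]_(r in `]0%R, s]) g r)%E) ->
  forall s : R, 0 <= s <= T -> (g s <= (2 * c0 * expR (2 * K * T))%:E)%E.
Proof.
move=> K0 c00 T0 mg gM gK.
have k0 : 0 < 2 * K by rewrite mulr_gt0.
have gfin (s : R) : 0 <= s <= T -> g s = (fine (g s))%:E.
  by move=> /gM /andP[h1 h2]; rewrite fineK// ge0_fin_numE// (le_lt_trans h2) ?ltry.
pose wt s := expR (- (2 * K * s)) * fine (g s).
pose S := [set wt s | s in [set s : R | 0 <= s <= T]].
have fg0 (s : R) : 0 <= s <= T -> 0 <= fine (g s).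
  by move=> sT; have /andP[+ _] := gM s sT; rewrite gfin// lee_fin.
have fgM (s : R) : 0 <= s <= T -> fine (g s) <= M.
  by move=> sT; have /andP[_ +] := gM s sT; rewrite gfin// lee_fin.
have hS : has_sup S.
  split; first by exists (wt 0); exists 0 => //=; rewrite lexx.
  exists M => _ [s sT <-]; rewrite /wt.
  apply: le_trans (fgM s sT); rewrite ler_piMl ?fg0//.
  rewrite -[leRHS]expR0 ler_expR oppr_le0; case/andP: sT => s0 _.
  by rewrite mulr_ge0// ltW.
have wS (s : R) : 0 <= s <= T -> wt s <= sup S.
  by move=> sT; apply: sup_ubound; [case: hS|exists s].
have S0 : 0 <= sup S.
  have h0 : 0 <= (0 : R) <= T by rewrite lexx.
  by apply: le_trans (wS 0 h0); rewrite /wt mulr_ge0 ?expR_ge0 ?fg0.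
have gS (s : R) : 0 <= s <= T -> fine (g s) <= sup S * expR (2 * K * s).
  move=> /wS; rewrite /wt expRN mulrC ler_pdivrMr ?expR_gt0//.
have key (s : R) : 0 <= s <= T -> wt s <= c0 + sup S / 2.
  move=> sT; have /andP[s0 sT'] := sT.
  have := gK s sT.
  have H : (\int[leb]_(r in `]0%R, s]) g r <=
      \int[leb]_(r in `]0%R, s]) ((sup S)%:E * (expR (2 * K * r))%:E))%E.
    apply: ge0_le_integral => //.
    - move=> r; rewrite /= in_itv/= => /andP[r0 rs].
      by have /gM/andP[] : 0 <= r <= T by rewrite ltW// (le_trans rs).
    - exact: measurable_funTS.
    - apply: measurable_funeM; apply/measurable_EFinP; apply: measurable_funTS.
      by apply: measurableT_comp => //; exact: measurable_funM.
    - move=> r; rewrite /= in_itv/= => /andP[r0 rs].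
      have rT : 0 <= r <= T by rewrite ltW// (le_trans rs).
      by rewrite gfin// -EFinM lee_fin gS.
  have ZE : (\int[leb]_(r in `]0%R, s]) ((sup S)%:E * (expR (2 * K * r))%:E) =
      (sup S)%:E * \int[leb]_(r in `]0%R, s]) (expR (2 * K * r))%:E)%E.
    rewrite ge0_integralZl//; apply/measurable_EFinP; apply: measurable_funTS.
    by apply: measurableT_comp => //; exact: measurable_funM.
  rewrite ZE in H.
  rewrite integral_expR_itv// -EFinM in H.
  have K1 : (0 <= K%:E)%E by rewrite lee_fin ltW.
  move=> h1; have := le_trans h1 (leeD2l _ (lee_wpmul2l K1 H)).
  rewrite gfin// -EFinM -EFinD lee_fin => h2.
  rewrite /wt expRN mulrC ler_pdivrMr ?expR_gt0//.
  apply: (le_trans h2).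
  have e1 : 1 <= expR (2 * K * s).
    by rewrite -[leLHS]expR0 ler_expR mulr_ge0// ltW.
  have -> : K * (sup S * ((2 * K)^-1 * (expR (2 * K * s) - 1))) =
     sup S / 2 * (expR (2 * K * s) - 1) by field; rewrite gt_eqF.
  by nra.
have supS : sup S <= 2 * c0.
  have : sup S <= c0 + sup S / 2.
    by apply: ge_sup; [case: hS|move=> _ [s sT <-]; exact: key].
  by lra.
move=> s sT; rewrite gfin// lee_fin; apply: (le_trans (gS s sT)).
apply: ler_pM => //.
by rewrite ler_expR ler_pM2l//; case/andP: sT.
Qed.

(** Integrate (f - c)^2 >= 0 with c the mean of f over the interval. If the integral of f^2 is
    infinite there is nothing to prove. *)
Lemma sqr_Rintegral_le (f : R -> R) (a b : R) : a <= b ->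
  measurable_fun `]a, b] f ->
  (((\int[leb]_(r in `]a, b]) f r) ^+ 2)%:E <=
   (b - a)%:E * \int[leb]_(r in `]a, b]) (f r ^+ 2)%:E)%E.
Proof.
rewrite le_eqVlt => /orP[/eqP <- _|ab mf].
  by rewrite set_itvoc0 Rintegral_set0 expr0n/= subrr mul0e.
set J := (X in (_ <= _ * X)%E).
have J0 : (0 <= J)%E by apply: integral_ge0 => r _; rewrite lee_fin sqr_ge0.
have ab0 : 0 < b - a by rewrite subr_gt0.
have lab : leb `]a, b]%classic = (b - a)%:E.
  by rewrite lebesgue_measure_itv/= lte_fin ab EFinB.
have mf2 : measurable_fun `]a, b] (fun r => (f r ^+ 2)%:E).
  by apply/measurable_EFinP; exact: measurable_funX.
case E : J J0 => [j| |]// j0; last by rewrite gt0_muley ?leey// lte_fin.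
have if2 : leb.-integrable `]a, b] (fun r => (f r ^+ 2)%:E).
  apply/integrableP; split => //.
  under eq_integral => r _ do rewrite gee0_abs ?lee_fin ?sqr_ge0//.
  by rewrite -/J E ltry.
have ic (c : R) : leb.-integrable `]a, b] (cst c%:E).
  by apply/integrableP; split => //; rewrite integral_cst//= lab -EFinM ltry.
have if1 : leb.-integrable `]a, b] (EFin \o f).
  apply: le_integrable (integrableD _ (ic 1) if2) => //.
    by apply/measurable_EFinP.
  move=> r _; rewrite /= lee_fin [leRHS]ger0_norm; last first.
    by rewrite addr_ge0// sqr_ge0.
  rewrite -(real_normK (num_real (f r))).
  by have := sqr_ge0 (`|f r| - 1); have := normr_ge0 (f r); nra.
set I := (\int[leb]_(r in `]a, b]) f r)%R.
pose c := I / (b - a).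
have IE : (\int[leb]_(r in `]a, b]) (f r)%:E = I%:E)%E.
  by rewrite fineK//; apply: integrable_fin_num.
have : (\int[leb]_(r in `]a, b]) ((2 * c)%:E * (f r)%:E) <=
    \int[leb]_(r in `]a, b]) ((f r ^+ 2)%:E + (c ^+ 2)%:E))%E.
  apply: le_integral => //.
  - exact: integrableZl.
  - exact: integrableD (ic _).
  - move=> r _; rewrite -EFinM -EFinD lee_fin -subr_ge0.
    by have := sqr_ge0 (f r - c); nra.
rewrite integralZl// IE integralD//; last exact: (ic (c ^+ 2)).
rewrite -/J E integral_cst//= lab -!EFinM -EFinD lee_fin.
have Ic : I = c * (b - a) by rewrite /c divfK// gt_eqF.
by rewrite lee_fin Ic; nra.
Qed.

End gronwall.

Section continuous_processes.
Context d (Om : measurableType d) (R : realType).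
Context (T : R) (hT : 0 < T).

(** The random time is rounded down to a grid. The rounded process is a finite sum of products of
    indicators and random variables, and path continuity gives pointwise convergence. *)
Lemma jmeas_continuous (N tau : R -> Om -> R) :
  (forall s : R, 0 <= s <= T -> measurable_fun setT (N s)) ->
  (forall w, {within `[0, T], continuous (N ^~ w)}) ->
  jmeas tau -> (forall s w, 0 <= tau s w <= T) ->
  jmeas (fun s w => N (tau s w) w).
Proof.
move=> mN cN jt tT.
pose q m j : R := T * j%:R / m.+1%:R.
have qT m j : (j <= m.+1)%N -> 0 <= q m j <= T.
  move=> jm; rewrite /q !mulr_ge0 ?invr_ge0 ?(ltW hT)//=.
  by rewrite ler_pdivrMr// ler_wpM2l ?(ltW hT)// ler_nat.
(* The index runs up to m + 1 because the last grid point is needed when the random time equals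
   T. *)
pose A m s w := \sum_(j < m.+2) (q m j <= tau s w)%R%:R *
  (1 - (q m j.+1 <= tau s w)%R%:R) * N (q m j) w.
have jle c : jmeas (fun s w => (c <= tau s w)%R%:R : R).
  have mD : measurable [set z : R * Om | c <= tau z.1 z.2].
    by rewrite -[X in measurable X]setTI; exact: measurable_fun_le.
  rewrite /jmeas (_ : (fun _ => _) = \1_[set z : R * Om | c <= tau z.1 z.2]).
    exact: measurable_indic.
  by apply/funext => z; rewrite indicE; congr (nat_of_bool _)%:R; apply/idP/idP;
    rewrite inE.
rewrite /jmeas; apply: (@measurable_fun_cvg _ _ _ _ (fun m z => A m z.1 z.2)).
  move=> m; suff : jmeas (A m) by [].
  apply: jmeas_sum => j; apply: jmeasM.
    by apply: jmeasM => //; apply: jmeasB => //; exact: jmeas_cst.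
  by apply: jmeas_l; apply: mN; apply: qT; rewrite -ltnS.
move=> [s w] _ /=.
have /andP[t0 t1] := tT s w.
pose x m := tau s w * m.+1%:R / T.
have x0 m : 0 <= x m by rewrite /x !mulr_ge0 ?invr_ge0 ?(ltW hT).
pose k m := Num.truncn (x m).
have qx m j : (q m j <= tau s w) = (j%:R <= x m).
  by rewrite /q /x ler_pdivrMr// ler_pdivlMr// mulrC.
have kP m : (k m)%:R <= x m < (k m).+1%:R by exact: truncn_itv.
have km m : (k m < m.+2)%N.
  rewrite ltnS -(ler_nat R); have /andP[h _] := kP m; apply: (le_trans h).
  by rewrite /x ler_pdivrMr// mulrC ler_wpM2l.
have AE m : A m s w = N (q m (k m)) w.
  rewrite /A (bigD1 (Ordinal (km m)))//= !qx; have /andP[h1 h2] := kP m.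
  rewrite h1 leNgt h2/= subr0 !mul1r big1 ?addr0// => j /eqP jk.
  rewrite !qx.
  have [jx|] := boolP (j%:R <= x m); last by rewrite !mul0r.
  have [jx'|] := boolP (j.+1%:R <= x m); first by rewrite subrr mulr0 mul0r.
  rewrite -ltNge => jx'; exfalso; apply: jk; apply: val_inj => /=.
  by apply/esym/truncn_def; rewrite jx.
under eq_fun do rewrite AE.
apply: (@within_itv_cvg _ _ T (N ^~ w) (fun m => q m (k m)) (tau s w) (@cN w)).
- by move=> m; apply: qT; have := km m; rewrite ltnS.
- exact: tT.
- apply: (@squeeze_cvgr _ _ _ _ (fun m => tau s w - T / m.+1%:R) (fun=> tau s w)).
  + apply: nearW => m; have /andP[h1 h2] := kP m; rewrite qx h1 andbT.
    rewrite lerBlDr /q -mulrDl -{2}[T]mulr1 -mulrDr natr1.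
    rewrite ler_pdivlMr//; have := ltW h2.
    by rewrite /x ler_pdivrMr// [_ * T]mulrC.
  + rewrite -[X in _ --> X]subr0; apply: cvgB; first exact: cvg_cst.
    by rewrite -(mulr0 T); apply: cvgMr; exact: (@cvg_harmonic R).
  + exact: cvg_cst.
Qed.

End continuous_processes.

(** * Hitting times *)

Section hitting.
Context d (Om : measurableType d) (R : realType) (T : R) (hT : 0 < T).
Context (F : R -> set (set Om)) (HF : filtered T F).
Context (Z : R -> Om -> R) (eps : R) (th : Om -> R).
Context (cZ : forall w, {within `[0, T], continuous (Z ^~ w)}).
Context (thT : forall w, 0 <= th w <= T).

(** The element T makes the set non-empty and gives the value T to paths that never reach the
    level. *)
Definition hit w : R :=
  inf [set s | s = T \/ (th w <= s <= T /\ eps <= Z s w)].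

Let hS w : has_inf [set s | s = T \/ (th w <= s <= T /\ eps <= Z s w)].
Proof.
split; first by exists T; left.
by exists (th w) => s [->|[/andP[]]//]; case/andP: (thT w).
Qed.

Lemma hit_ge w : th w <= hit w.
Proof.
apply: lb_le_inf; first by case: (hS w).
by move=> s [->|[/andP[]]//]; case/andP: (thT w).
Qed.

Lemma hit_le w : hit w <= T.
Proof. by apply: ge_inf; [case: (hS w)|left]. Qed.

Lemma hit_itv w : 0 <= hit w <= T.
Proof.
by rewrite hit_le (le_trans _ (hit_ge w))//; case/andP: (thT w).
Qed.

Lemma hit_before w (r : R) : th w <= r -> r < hit w -> Z r w < eps.
Proof.
move=> thr rh; rewrite ltNge; apply/negP => Zr.
have rT : r <= T by rewrite (le_trans (ltW rh))// hit_le.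
move: rh; rewrite ltNge => /negP; apply.
by apply: ge_inf; [case: (hS w)|right; rewrite thr].
Qed.

Lemma hit_reach w : hit w < T -> eps <= Z (hit w) w.
Proof.
move=> hT'.
have /choice[s Hs] : forall k : nat, exists s, [/\ hit w <= s <= T,
    s < hit w + k.+1%:R^-1 & eps <= Z s w].
  move=> k; have e0 : 0 < Num.min k.+1%:R^-1 (T - hit w).
    by rewrite lt_min invr_gt0 ltr0n subr_gt0.
  have [s Ss] := inf_adherent e0 (hS w); rewrite -/(hit w) => sh.
  have sT : s < T.
    by apply: (lt_le_trans sh); rewrite -lerBrDl ge_min lexx orbT.
  have hs : hit w <= s by apply: ge_inf => //; case: (hS w).
  exists s; split.
  - by rewrite hs ltW.
  - by apply: (lt_le_trans sh); rewrite lerD2l ge_min lexx.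
  - by case: Ss => [sE|[]//]; move: sT; rewrite sE ltxx.
have sh : s @ \oo --> hit w.
  apply: (@squeeze_cvgr _ _ _ _ (fun=> hit w) (fun k => hit w + k.+1%:R^-1)).
  - by apply: nearW => k; have [/andP[-> _] /ltW -> _] := Hs k.
  - exact: cvg_cst.
  - rewrite -[X in _ --> X]addr0; apply: cvgD; first exact: cvg_cst.
    exact: (@cvg_harmonic R).
have sT k : 0 <= s k <= T.
  have [/andP[h1 ->] _ _] := Hs k; rewrite andbT; apply: le_trans h1.
  by case/andP: (hit_itv w).
have := @within_itv_cvg _ _ T (Z ^~ w) s (hit w) (@cZ w) sT (hit_itv w) sh.
move=> cvZ; apply: (cvgr_to_ge cvZ); apply: nearW => k.
by have [] := Hs k.
Qed.

(** The event must be described by times up to s only. The hitting time exceeds s iff th does, or Z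
    stays below eps on [th, s] by a fixed margin 1/(k+1), which compactness provides; by continuity
    the margin need only be tested at countably many times. *)
Lemma hit_stopping : (forall s : R, 0 <= s <= T -> gmeas (F s) (Z s)) ->
  (forall s : R, 0 <= s <= T -> F s [set w | th w <= s]) -> stopping T F hit.
Proof.
move=> gZ Fth; split; first exact: hit_itv.
move=> s sT; have [sT'|Ts] := ltP s T; last first.
  rewrite (_ : [set _ | _] = setT); first by apply: salgT; exact: filt_sigma HF s.
  by apply/seteqP; split => // w _ /=; rewrite (le_trans (hit_le w)).
have Gs := filt_sigma HF s; have /andP[s0 _] := sT.
(* Either q comes before th or Z q is below the level by the margin; a time outside [0, s] imposes
   nothing. *)
pose Aq k (q : R) : set Om := if 0 <= q <= s then
  ~` [set w | th w <= q] `|` [set w | Z q w <= eps - k.+1%:R^-1] else setT.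
have FA k q : F s (Aq k q).
  rewrite /Aq; case: ifPn => [/andP[q0 qs]|_]; last exact: salgT.
  have qT : 0 <= q <= T by rewrite q0 (le_trans qs)// ltW.
  apply: (filt_mono HF q0 qs (ltW sT')); apply: (salgU (filt_sigma HF q)).
    by apply: (salgC (filt_sigma HF q)); exact: Fth.
  have := gZ q qT _ (@measurable_itv _ `]-oo, eps - k.+1%:R^-1]).
  by congr (F q _); apply/seteqP; split => w /=; rewrite in_itv.
(* The time s is tested separately, since no rational lies between the hitting time and s when they
   coincide. It also stands in for numbers that encode no rational. *)
pose Bk k := \bigcap_n (Aq k (if unpickle n is Some q then ratr q else s)) `&` Aq k s.
have -> : [set w | hit w <= s] =
    ~` (~` [set w | th w <= s] `|` \bigcup_k Bk k).
  rewrite -[LHS]setCK; congr (~` _); apply/seteqP; split => w /=.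
    move=> /negP; rewrite -ltNge => sh.
    have [ths|sth] := leP (th w) s; last by left; move: sth; rewrite ltNge => /negP.
    right.
    have [c cs Zc] : exists2 c, c \in `[th w, s] &
        forall r, r \in `[th w, s] -> Z r w <= Z c w.
      apply: EVT_max => //; apply: continuous_subspaceW (@cZ w) => r /=.
      rewrite !in_itv/= => /andP[h1 h2]; rewrite (le_trans _ h1)/=.
        by rewrite (le_trans h2)// ltW.
      by case/andP: (thT w).
    have Zce : Z c w < eps.
      move: cs; rewrite in_itv/= => /andP[h1 h2].
      by apply: hit_before => //; exact: le_lt_trans sh.
    have xce : 0 < eps - Z c w by rewrite subr_gt0.
    have [k _ /(_ _ (leqnn _))/= hk] := near_infty_natSinv_lt (PosNum xce).
    exists k => //; have HA q : Aq k q w.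
      rewrite /Aq; case: ifPn => // /andP[q0 qs].
      have [thq|qth] := leP (th w) q; last by left; move: qth; rewrite ltNge => /negP.
      right; rewrite /= (le_trans (Zc q _)) ?in_itv/= ?thq//.
      by rewrite lerBrDr -lerBrDl ltW.
    by split=> [n _|]; exact: HA.
  move=> H; apply/negP; rewrite -ltNge.
  case: H => [/negP|[k _ [Hq Hs]]].
    by rewrite -ltNge => /lt_le_trans; apply; exact: hit_ge.
  rewrite ltNge; apply/negP => hs.
  have hT2 : hit w < T by exact: le_lt_trans sT'.
  have /andP[h0 _] := hit_itv w.
  have Zr (q : R) : 0 <= q <= s -> th w <= q -> Aq k q w -> Z q w <= eps - k.+1%:R^-1.
    by move=> qs thq; rewrite /Aq qs => -[/=/negP|//]; rewrite thq.
  have kk : eps - k.+1%:R^-1 < eps by rewrite ltrBlDr ltrDl invr_gt0.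
  have := hit_reach hT2; apply/negP; rewrite -ltNge.
  have [hs'|sh] := ltP (hit w) s; last first.
    have -> : hit w = s by apply/eqP; rewrite eq_le hs.
    apply: le_lt_trans kk; apply: Zr => //; first by rewrite s0 lexx.
    by rewrite (le_trans (hit_ge w)).
  apply: le_lt_trans kk.
  have /choice[q Hqq] : forall m : nat, exists q : rat,
      hit w < ratr q < Num.min s (hit w + m.+1%:R^-1).
    move=> m; have /rat_in_itvoo[q] : hit w < Num.min s (hit w + m.+1%:R^-1).
      by rewrite lt_min hs' ltrDl invr_gt0 ltr0n.
    by rewrite in_itv/= => ?; exists q.
  have qh : (fun m => ratr (q m)) @ \oo --> hit w.
    apply: (@squeeze_cvgr _ _ _ _ (fun=> hit w) (fun k => hit w + k.+1%:R^-1)).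
    - apply: nearW => m; have /andP[/ltW -> h] := Hqq m.
      by rewrite ltW// (lt_le_trans h)// ge_min lexx orbT.
    - exact: cvg_cst.
    - rewrite -[X in _ --> X]addr0; apply: cvgD; first exact: cvg_cst.
      exact: (@cvg_harmonic R).
  have qs m : 0 <= (ratr (q m) : R) <= s.
    have /andP[h1 h2] := Hqq m; apply/andP; split.
      exact: ltW (le_lt_trans h0 h1).
    by apply: (le_trans (ltW h2)); rewrite ge_min lexx.
  have qT m : 0 <= (ratr (q m) : R) <= T.
    by have /andP[-> h2] := qs m; rewrite (le_trans h2)// ltW.
  have := @within_itv_cvg _ _ T (Z ^~ w) _ (hit w) (@cZ w) qT (hit_itv w) qh.
  move=> cvZ; apply: (cvgr_to_le cvZ); apply: nearW => m; apply: Zr => //.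
    by rewrite (le_trans (hit_ge w))// ltW//; case/andP: (Hqq m).
  by have := Hq (pickle (q m)) I; rewrite pickleK.
apply: (salgC Gs); apply: (salgU Gs); first by apply: (salgC Gs); exact: Fth.
apply: (salg_bigcup Gs) => k; apply: (salgI Gs); last exact: FA.
by apply: (salg_bigcap Gs) => n; exact: FA.
Qed.

End hitting.

(** * Operations on Ito integrals *)

Section ito_closure.
Context d (Om : measurableType d) (R : realType) (mu : probability Om R).
Context (T : R) (hT : 0 < T) (F : R -> set (set Om)) (HF : filtered T F).
Context (n : nat) (W : 'I_n -> R -> Om -> R) (v : R -> R) (v0 : R).
Context (HW : brownian mu T F W v v0).
Local Notation ito := (ito mu T F W).

Lemma integral_sqrD_le (f g : Om -> R) : measurable_fun setT f ->
  measurable_fun setT g -> (\int[mu]_w ((f w + g w) ^+ 2)%:E <=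
    2%:E * \int[mu]_w (f w ^+ 2)%:E + 2%:E * \int[mu]_w (g w ^+ 2)%:E)%E.
Proof.
move=> mf mg; have := integral_sqr_young mu (measurable_funD mf mg) mf
  measurableT (ltr01 : 0 < (1 : R)).
rewrite invr1 (_ : 1 + 1 = 2 :> R)// => /le_trans; apply.
by under [X in (_ + _ * X <= _)%E]eq_integral do rewrite /= addrC addKr.
Qed.

Lemma cvge0_le_2 (u a b : (\bar R)^nat) :
  (forall k, 0 <= u k)%E -> (forall k, u k <= 2%:E * a k + 2%:E * b k)%E ->
  a @ \oo --> 0%E -> b @ \oo --> 0%E -> u @ \oo --> 0%E.
Proof.
move=> u0 uab a0 b0.
apply: (@squeeze_cvge _ _ _ _ (cst 0%E) _ (fun k => 2%:E * a k + 2%:E * b k)%E).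
- by apply: nearW => k; rewrite u0 uab.
- exact: cvg_cst.
- rewrite -[X in _ --> X]adde0; apply: cvgeD => //.
    by rewrite -(mule0 2%:E); apply: cvgeZl.
  by rewrite -(mule0 2%:E); apply: cvgeZl.
Qed.

(** The integrand is at finite distance from some simple one, and simple integrands are bounded. *)
Lemma ito_integrable H N : (forall j, jmeas (H j)) -> ito H N ->
  (dint mu (fun s w => \sum_j H j s w ^+ 2)%R setT 0 T < +oo)%E.
Proof.
move=> mH [I [e [eV eH eN]]].
have ne := cvge0_lt eH ltr01.
near \oo => k.
have hk : (dint mu (fun s w => \sum_j (eproc (e k) j s w - H j s w) ^+ 2)%R
    setT 0 T < 1%:E)%E by near: k.
have mE j : jmeas (eproc (e k) j) by exact: (jmeas_eproc HF).
have := @dint_sqr_young _ _ _ mu n H (eproc (e k)) setT 0 T T 1 mH mE measurableT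
  ltr01 (lexx _) (ltW hT) (lexx _).
move=> /le_lt_trans; apply; rewrite invr1.
have -> : (fun s w => \sum_j (H j s w - eproc (e k) j s w) ^+ 2) =
    (fun s w => \sum_j (eproc (e k) j s w - H j s w) ^+ 2).
  apply/funext => s; apply/funext => w; apply: eq_bigr => j _.
  by rewrite -sqrrN opprB.
apply: lte_add_pinfty; last first.
  by apply: lte_mul_pinfty => //; rewrite (lt_trans hk) ?ltry.
apply: lte_mul_pinfty => //.
have /choice[C xC] : forall i, exists K, forall w, `|ex (e k i) w| <= K.
  by move=> i; have [] := eV k i.
pose K := \sum_i C i.
have C0 i : 0 <= C i by exact: le_trans (normr_ge0 _) (xC i point).
have EK j s w : eproc (e k) j s w ^+ 2 <= K ^+ 2.
  rewrite -(real_normK (num_real (eproc _ _ _ _))) lerXn2r ?nnegrE ?sumr_ge0//.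
  apply: (le_trans (ler_norm_sum _ _ _)); rewrite /K big_mkcond/=.
  apply: ler_sum => i _; case: ifP => _ //.
  by rewrite normrM normr_nat; case: (_ < _ <= _); rewrite ?mul1r ?mul0r.
apply: (@le_lt_trans _ _ (dint mu (fun _ _ => \sum_(j < n) K ^+ 2)%R setT 0 T)).
  apply: dint_le => //.
  - by apply: jmeas_sum => j; exact: jmeasX.
  - exact: jmeas_cst.
  - by move=> s w; apply: sumr_ge0 => j _; exact: sqr_ge0.
  - by move=> s w; apply: sumr_ge0 => j _; exact: sqr_ge0.
  - by move=> s w _ _; apply: ler_sum => j _; exact: EK.
rewrite dintE (eq_integral (cst ((\sum_(j < n) K ^+ 2) * T)%:E)).
  by rewrite integral_cst//= probability_setT mule1 ltry.
move=> w _; rewrite sintE integral_cst//= lebesgue_measure_itv/= lte_fin hT.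
by rewrite -EFinB subr0 -EFinM.
Unshelve. all: by end_near.
Qed.

Lemma ito_at0 H N : ito H N -> (\int[mu]_w (N 0 w ^+ 2)%:E = 0)%E.
Proof.
move=> [I [e [eV eH eN]]].
have h0 : 0 <= (0 : R) <= T by rewrite lexx ltW.
have := eN 0 h0.
rewrite (_ : (fun k => _) = cst (\int[mu]_w (N 0 w ^+ 2)%:E)%E).
  by move=> /(cvg_lim (@ereal_hausdorff R)); rewrite lim_cst.
apply/funext => k /=; apply: eq_integral => w _.
rewrite /eint big1 ?sub0r ?sqrrN// => i _.
have [c0 ce _ _ _] := eV k i.
by rewrite !min_r ?subrr ?mulr0// (le_trans c0).
Qed.

Lemma ito_sub H N H' N' : (forall j, jmeas (H j)) -> (forall j, jmeas (H' j)) ->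
  (forall s : R, 0 <= s <= T -> measurable_fun setT (N s)) ->
  (forall s : R, 0 <= s <= T -> measurable_fun setT (N' s)) ->
  ito H N -> ito H' N' ->
  ito (fun j s w => H j s w - H' j s w) (fun s w => N s w - N' s w).
Proof.
move=> mH mH' mN mN' [I [e [eV eH eN]]] [I' [e' [eV' eH' eN']]].
pose e2 k (i : (I k + I' k)%type) : eterm Om R n := match i with
  | inl i => e k i
  | inr i => let t := e' k i in ETerm (ej t) (ec t) (ee t) (fun w => - ex t w)
  end.
have eproc2 k j s w : eproc (e2 k) j s w = eproc (e k) j s w - eproc (e' k) j s w.
  rewrite /eproc big_sumType/=; congr (_ + _); rewrite -sumrN.
  by apply: eq_bigr => i _; rewrite mulrN.
have eint2 k s w : eint W (e2 k) s w = eint W (e k) s w - eint W (e' k) s w.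
  rewrite /eint big_sumType/=; congr (_ + _); rewrite -sumrN.
  by apply: eq_bigr => i _; rewrite mulNr.
have mE k j : jmeas (eproc (e k) j) by exact: (jmeas_eproc HF).
have mE' k j : jmeas (eproc (e' k) j) by exact: (jmeas_eproc HF).
exists (fun k => (I k + I' k)%type), e2; split.
- move=> k [i|i] /=; first exact: eV.
  have [h1 h2 h3 h4 [K hK]] := eV' k i; split => //=.
    apply/(gmeasP (filt_sigma HF _)); apply: measurableT_comp => //.
    by apply/(gmeasP (filt_sigma HF _)).
  by exists K => w; rewrite normrN.
- apply: (cvge0_le_2 _ _ eH eH') => k.
    by apply: dint_ge0 => s w; apply: sumr_ge0 => j _; exact: sqr_ge0.
  have := @dint_sqr_young _ _ _ mu n
    (fun j s w => eproc (e2 k) j s w - (H j s w - H' j s w))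
    (fun j s w => eproc (e k) j s w - H j s w) setT 0 T T 1 _ _ measurableT
    ltr01 (lexx _) (ltW hT) (lexx _).
  rewrite invr1 (_ : 1 + 1 = 2 :> R)// => /(_ _ _)/le_trans; apply.
  + move=> j; rewrite (_ : (fun s w => _) = (fun s w =>
      (eproc (e k) j s w - eproc (e' k) j s w) - (H j s w - H' j s w))).
      by apply: jmeasB; exact: jmeasB.
    by apply/funext => s; apply/funext => w; rewrite eproc2.
  + by move=> j; exact: jmeasB.
  + rewrite (_ : (fun s w => \sum_j (_ - _ - (_ - _)) ^+ 2) =
      (fun s w => \sum_j (eproc (e' k) j s w - H' j s w) ^+ 2))//.
    apply/funext => s; apply/funext => w; apply: eq_bigr => j _.
    by rewrite eproc2 -[RHS]sqrrN; congr (_ ^+ 2); ring.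
- move=> s sT.
  have mI : forall k, measurable_fun setT (eint W (e k) s).
    by move=> k; apply: (filt_gmeas_meas HF sT); exact: (gmeas_eint HF HW).
  have mI' : forall k, measurable_fun setT (eint W (e' k) s).
    by move=> k; apply: (filt_gmeas_meas HF sT); exact: (gmeas_eint HF HW).
  apply: (cvge0_le_2 _ _ (eN s sT) (eN' s sT)) => k.
    by apply: integral_ge0 => w _; rewrite lee_fin sqr_ge0.
  have -> : (\int[mu]_w ((eint W (e2 k) s w - (N s w - N' s w)) ^+ 2)%:E =
      \int[mu]_w (((eint W (e k) s w - N s w) +
        (- (eint W (e' k) s w - N' s w))) ^+ 2)%:E)%E.
    by apply: eq_integral => w _; rewrite eint2; congr (_ ^+ 2)%:E; ring.
  apply: (le_trans (integral_sqrD_le _ _)).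
  + by apply: measurable_funB => //; exact: mN.
  + by apply: measurableT_comp => //; apply: measurable_funB => //; exact: mN'.
  + by under [X in (_ + _ * X <= _)%E]eq_integral do rewrite /= sqrrN.
Qed.

(** Each term is moved to the interval from max a c to max a e and its coefficient multiplied by the
    indicator of A. It remains admissible since A is known at time a. *)
Lemma ito_after H N (a : R) (A : set Om) : (forall j, jmeas (H j)) ->
  (forall s : R, 0 <= s <= T -> measurable_fun setT (N s)) ->
  0 <= a <= T -> F a A -> ito H N ->
  ito (fun j s w => (a < s)%R%:R * \1_A w * H j s w)
      (fun s w => \1_A w * (N s w - N (Num.min a s) w)).
Proof.
move=> mH mN aT FA [I [e [eV eH eN]]].
have mA := filt_meas HF aT FA.
have /andP[a0 aT'] := aT.
have A1 w : `|\1_A w : R| <= 1.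
  by rewrite indicE; case: (_ \in _); rewrite ?normr1 ?normr0.
have jA : jmeas (fun (_ : R) (w : Om) => \1_A w : R).
  by apply: jmeas_l; exact: measurable_indic.
have ja : jmeas (fun (s : R) (_ : Om) => (a < s)%R%:R : R).
  have -> : (fun (s : R) (_ : Om) => (a < s)%R%:R : R) =
      (fun s w => 1 - (s <= (cst a : Om -> R) w)%R%:R).
    by apply/funext => s; apply/funext => w /=; case: leP => _; rewrite ?subrr ?subr0.
  by apply: jmeasB; [exact: jmeas_cst|exact: jmeas_le].
pose e2 k (i : I k) : eterm Om R n := let t := e k i in
  ETerm (ej t) (Num.max a (ec t)) (Num.max a (ee t)) (fun w => \1_A w * ex t w).
have eproc2 k j s w : eproc (e2 k) j s w =
    (a < s)%R%:R * \1_A w * eproc (e k) j s w.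
  rewrite /eproc mulr_sumr; apply: eq_bigr => i _ /=.
  rewrite gt_max le_max; case: (ltP a s) => as_ /=.
    by rewrite mul1r mulrCA.
  by rewrite !mul0r.
(* This identity exhibits the truncated integral as the difference of the original one at s and at
   min a s. *)
have Wmax j (c s : R) w : W j (Num.min (Num.max a c) s) w =
    W j (Num.min c s) w + W j (Num.min a s) w - W j (Num.min c (Num.min a s)) w.
  case: (leP a c) => ac.
    by rewrite [Num.min c (Num.min a s)]minA (min_r ac) addrK.
  by rewrite [Num.min c (Num.min a s)]minA (min_l (ltW ac)) addrC addKr.
have eint2 k s w : eint W (e2 k) s w =
    \1_A w * (eint W (e k) s w - eint W (e k) (Num.min a s) w).
  rewrite /eint -sumrB mulr_sumr; apply: eq_bigr => i _ /=.
  by rewrite !Wmax; ring.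
have mE k j : jmeas (eproc (e k) j) by exact: (jmeas_eproc HF).
exists I, e2; split.
- move=> k i; have [h1 h2 h3 h4 [K hK]] := eV k i.
  have acT : 0 <= Num.max a (ec (e k i)) <= T.
    by rewrite le_max a0/= ge_max aT' (le_trans h2).
  split => /=.
  + by case/andP: acT.
  + by rewrite ge_max !le_max lexx h2 orbT.
  + by rewrite ge_max aT' h3.
  + apply/(gmeasP (filt_sigma HF _)); apply: measurable_funM.
      apply: measurable_indic; rewrite /measurable/= (sigma_algebra_id (filt_sigma HF _)).
      apply: (filt_mono HF a0) FA; last by case/andP: acT.
      by rewrite le_max lexx.
    apply/(gmeasP (filt_sigma HF _)); apply: (filt_gmeasS HF h1) h4.
      by rewrite le_max lexx orbT.
    by case/andP: acT.
  + exists K => w; rewrite normrM; apply: le_trans (hK w).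
    by rewrite ler_piMl.
- apply: (@squeeze_cvge _ _ _ _ (cst 0%E) _ _ _ _ _ eH); last exact: cvg_cst.
  apply: nearW => k; apply/andP; split.
    by apply: dint_ge0 => s w; apply: sumr_ge0 => j _; exact: sqr_ge0.
  apply: dint_le => //.
  + apply: jmeas_sum => j; apply: jmeasX.
    rewrite (_ : (fun s w => _) = (fun s w => (a < s)%R%:R * \1_A w *
       (eproc (e k) j s w - H j s w))).
      by apply: jmeasM; [exact: jmeasM|exact: jmeasB].
    by apply/funext => s; apply/funext => w; rewrite eproc2 mulrBr.
  + by apply: jmeas_sum => j; apply: jmeasX; exact: jmeasB.
  + by move=> s w; apply: sumr_ge0 => j _; exact: sqr_ge0.
  + by move=> s w; apply: sumr_ge0 => j _; exact: sqr_ge0.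
  + move=> s w _ _; apply: ler_sum => j _; rewrite eproc2 -mulrBr exprMn.
    rewrite ler_piMl ?sqr_ge0// -(real_normK (num_real (_ * _))) expr_le1//.
    by rewrite normrM mulr_ile1// normr_nat; case: (_ < _).
- move=> s sT.
  have asT : 0 <= Num.min a s <= T.
    by case/andP: sT => s0 _; rewrite le_min a0 s0 ge_min aT'.
  have mI r : 0 <= r <= T -> forall k, measurable_fun setT (eint W (e k) r).
    by move=> rT k; apply: (filt_gmeas_meas HF rT); exact: (gmeas_eint HF HW).
  apply: (cvge0_le_2 _ _ (eN s sT) (eN _ asT)) => k.
    by apply: integral_ge0 => w _; rewrite lee_fin sqr_ge0.
  pose f w := eint W (e k) s w - N s w.
  pose g w := - (eint W (e k) (Num.min a s) w - N (Num.min a s) w).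
  have mf : measurable_fun setT f by apply: measurable_funB; [exact: mI|exact: mN].
  have mg : measurable_fun setT g.
    by apply: measurableT_comp => //; apply: measurable_funB; [exact: mI|exact: mN].
  apply: (@le_trans _ _ (\int[mu]_w ((f w + g w) ^+ 2)%:E)%E).
    apply: ge0_le_integral => //.
    + by move=> w _; rewrite lee_fin sqr_ge0.
    + apply/measurable_EFinP; apply: measurable_funX.
      have -> : (fun w => eint W (e2 k) s w - \1_A w * (N s w - N (Num.min a s) w)) =
          (fun w => \1_A w * (f w + g w)).
        by apply/funext => w; rewrite eint2 /f /g; ring.
      apply: measurable_funM; last exact: measurable_funD.
      exact: measurable_indic.
    + by apply/measurable_EFinP; apply: measurable_funX; exact: measurable_funD.
    + move=> w _; rewrite lee_fin eint2.
      have -> : \1_A w * (eint W (e k) s w - eint W (e k) (Num.min a s) w) -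
          \1_A w * (N s w - N (Num.min a s) w) = \1_A w * (f w + g w).
        by rewrite /f /g; ring.
      rewrite exprMn; apply: ler_piMl; first exact: sqr_ge0.
      by have := A1 w; rewrite ler_norml => /andP[? ?]; nra.
  apply: (le_trans (integral_sqrD_le mf mg)).
  by under [X in (_ + _ * X <= _)%E]eq_integral do rewrite /g sqrrN.
Qed.

End ito_closure.

Section hit_value.
Context d (Om : measurableType d) (R : realType) (T : R) (hT : 0 < T).
Context (Z : R -> Om -> R) (eps : R) (th : Om -> R).
Context (cZ : forall w, {within `[0, T], continuous (Z ^~ w)}).
Context (thT : forall w, 0 <= th w <= T).

Lemma hit_value_le w (r : R) : Z (th w) w < eps -> th w <= r <= hit T Z eps th w ->
  Z r w <= eps.
Proof.
move=> Zt /andP[tr]; rewrite le_eqVlt => /orP[/eqP rh|]; last first.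
  by move=> rh; apply/ltW; exact: (hit_before thT tr rh).
move: tr; rewrite le_eqVlt => /orP[/eqP <-|tr]; first exact: ltW.
have hI := hit_itv Z eps thT w; rewrite -rh in hI.
have /andP[t0 _] := thT w.
pose s k : R := r - (r - th w) * k.+1%:R^-1.
have ks k : 0 < (k.+1%:R : R)^-1 <= 1.
  by rewrite invr_gt0 ltr0n/= invf_le1 ?ltr0n// ler1n.
have sI k : th w <= s k < r.
  have /andP[a1 a2] := ks k; rewrite /s; have dr : 0 < r - th w by rewrite subr_gt0.
  have := mulr_gt0 dr a1; have := ler_piMr (ltW dr) a2; move=> h1 h2.
  by move: (_ / _) h1 h2 => z h1 h2; apply/andP; split; lra.
have sr : s @ \oo --> r.
  rewrite -[X in _ --> X]subr0; apply: cvgB; first exact: cvg_cst.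
  by rewrite -(mulr0 (r - th w)); apply: cvgMr; exact: (@cvg_harmonic R).
have cvZ : Z (s k) w @[k --> \oo] --> Z r w.
  apply: (@within_itv_cvg _ _ T (Z ^~ w)) => //; move=> k.
  have /andP[h1 h2] := sI k; case/andP: hI => _ rT.
  by rewrite (le_trans t0 h1)/= (le_trans (ltW h2) rT).
apply: (cvgr_to_le cvZ); apply: nearW => k.
have /andP[h1 h2] := sI k.
by apply/ltW/(hit_before thT h1); rewrite -rh.
Qed.

(** A continuous path is bounded on [0, T], so the levels k give a localizing sequence that is
    eventually constant along each path. *)
Lemma hit_eventually_end w :
  \forall k \near \oo, hit T Z k%:R th w = T.
Proof.
have [c _ cM] : exists2 c, c \in `[0, T]%R & forall t, t \in `[0, T]%R -> Z t w <= Z c w.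
  by apply: EVT_max; [exact: ltW|exact: cZ].
near=> k.
have Zk : Z c w < k%:R.
  by near: k; exact: nbhs_infty_gtr.
apply/eqP; rewrite eq_le hit_le//= leNgt; apply/negP => hT'.
have := hit_reach cZ thT hT'; apply/negP; rewrite -ltNge.
by apply: le_lt_trans Zk; apply: cM; rewrite in_itv/= hit_itv.
Unshelve. all: by end_near. Qed.

End hit_value.

(** * A priori second moment bound *)

Section apriori.
Context d (Om : measurableType d) (R : realType) (mu : probability Om R).
Context (T : R) (hT : 0 < T) (F : R -> set (set Om)) (HF : filtered T F).
Context (n : nat) (W : 'I_n -> R -> Om -> R) (v : R -> R) (v0 : R).
Context (HW : brownian mu T F W v v0).
Context (m : nat) (D beta N : 'I_m -> R -> Om -> R).
Context (H : 'I_m -> 'I_n -> R -> Om -> R) (x0 : 'I_m -> R).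
Context (gD : forall i (s : R), 0 <= s <= T -> gmeas (F s) (D i s)).
Context (cD : forall i w, {within `[0, T], continuous (D i ^~ w)}).
Context (gN : forall i (s : R), 0 <= s <= T -> gmeas (F s) (N i s)).
Context (cN : forall i w, {within `[0, T], continuous (N i ^~ w)}).
Context (jb : forall i, jmeas (beta i)) (jH : forall i j, jmeas (H i j)).
Context (iN : forall i, ito mu T F W (H i) (N i)).
Context (eqD : {ae mu, forall w, forall s : R, 0 <= s <= T -> forall i,
  D i s w = x0 i + \int[@lebesgue_measure R]_(a in `]0, s]) beta i a w + N i s w}).
Context (th : Om -> R) (sth : stopping T F th).
Context (kappa L : R) (k0 : 0 <= kappa) (L0 : 0 <= L).
Let G s w := \sum_i D i s w ^+ 2.
Context (bb : forall i (r : R) w, 0 < r <= th w ->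
  beta i r w ^+ 2 <= kappa + L * G r w).
Context (bH : forall i j (r : R) w, 0 < r <= th w ->
  H i j r w ^+ 2 <= kappa + L * G r w).

Let G0 s w : 0 <= G s w.
Proof. by apply: sumr_ge0 => i _; exact: sqr_ge0. Qed.

Let gG (s : R) : 0 <= s <= T -> gmeas (F s) (G s).
Proof.
move=> sT; apply/(gmeasP (filt_sigma HF s)) => //.
  apply: measurable_sum => i; apply: measurable_funX.
  by apply/(gmeasP (filt_sigma HF s)); exact: gD.
Qed.

Let mD i (s : R) : 0 <= s <= T -> measurable_fun setT (D i s).
Proof. by move=> sT; apply: (filt_gmeas_meas HF sT); exact: gD. Qed.

Let mN i (s : R) : 0 <= s <= T -> measurable_fun setT (N i s).
Proof. by move=> sT; apply: (filt_gmeas_meas HF sT); exact: gN. Qed.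

Let cG w : {within `[0, T], continuous (G ^~ w)}.
Proof.
apply: continuous_big; first exact: add_continuous.
move=> i _ s; apply: (@continuous_comp _ _ _ (D i ^~ w : subspace _ -> R) (fun x => x ^+ 2)).
  exact: cD.
exact: exprn_continuous.
Qed.

Let thT w : 0 <= th w <= T. Proof. by have [] := sth. Qed.
(** Localization: the squared size G is at most k up to this time if it starts below k, so
    Gronwall's lemma meets finite quantities. At the end k tends to infinity by Fatou's lemma. *)
Let tl (k : nat) w := Num.min (th w) (hit T G k%:R (fun=> 0) w).

Let z0T (w : Om) : 0 <= (0 : R) <= T. Proof. by rewrite lexx ltW. Qed.

Let stl k : stopping T F (tl k).
Proof.
have h0 : forall r : R, 0 <= r <= T -> F r [set w : Om | 0 <= r].
  move=> r /andP[r0 _]; rewrite r0 (_ : [set _ | _] = setT) //.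
    by apply: salgT; exact: filt_sigma HF r.
  by apply/seteqP; split.
have := @hit_stopping _ _ _ _ _ HF G k%:R (fun=> 0) cG z0T gG h0.
exact: stopping_minr.
Qed.

Let tau k (r : R) w := Num.max 0 (Num.min r (tl k w)).

Let tauE k (r : R) w : 0 <= r -> tau k r w = Num.min r (tl k w).
Proof.
move=> r0; apply/max_idPr; rewrite le_min r0/=.
by have [/(_ w)/andP[]] := stl k.
Qed.

Let tauT k r w : 0 <= tau k r w <= T.
Proof.
rewrite /tau le_max lexx/= ge_max (ltW hT)/= ge_min.
by have [/(_ w)/andP[_ ->]] := stl k; rewrite orbT.
Qed.

Let jtau k : jmeas (tau k).
Proof.
apply: measurable_maxr; first exact: measurable_cst.
apply: measurable_minr; first exact: measurable_fst.
by apply: jmeas_l; apply: (stopping_meas HF); exact: stl.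
Qed.

Let jG k : jmeas (fun r w => G (tau k r w) w).
Proof.
apply: (jmeas_continuous hT) => //.
by move=> s sT; apply: (filt_gmeas_meas HF sT); exact: gG.
Qed.

(** A common bound for the squares of the drift and of the diffusion up to [tl k]. Evaluation at the
    stopped time makes it jointly measurable on the whole line. *)
Let Pr k r w := kappa + L * G (tau k r w) w.

Let jP k : jmeas (Pr k).
Proof. apply: jmeasD; first exact: jmeas_cst.
by apply: jmeasM; [exact: jmeas_cst|exact: jG]. Qed.

Let P0 k r w : 0 <= Pr k r w.
Proof. by rewrite addr_ge0// mulr_ge0. Qed.

Let G_init : {ae mu, forall w, G 0 w = \sum_i x0 i ^+ 2}.
Proof.
have N0 : {ae mu, forall w, forall i, N i 0 w = 0}.
  apply: filter_forall => i.
  have h0 := ito_at0 hT (iN i).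
  have /ae_eq_integral_abs : (\int[mu]_w `|(N i 0 w ^+ 2)%:E| = 0)%E.
    by rewrite -[RHS]h0; apply: eq_integral => w _; rewrite gee0_abs// lee_fin sqr_ge0.
  move=> /(_ measurableT) h.
  have /h : measurable_fun setT (fun w => (N i 0 w ^+ 2)%:E).
    apply/measurable_EFinP; apply: measurable_funX; apply: mN.
    by rewrite lexx ltW.
  by apply: filterS => w /(_ I) /= /eqP; rewrite eqe sqrf_eq0 => /eqP.
have := eqD; apply: filterS2 N0 => w N0 /(_ 0) e.
apply: eq_bigr => i _; rewrite e ?lexx ?ltW// N0 addr0.
by rewrite set_itvoc0 Rintegral_set0 addr0.
Qed.

(** The factor 3 comes from squaring a sum of three terms, T from Cauchy-Schwarz for the drift, and
    [v0] n from the n noise coordinates. *)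
Let a : R := 3 * T + 3 * v0 * n%:R.

Let v00 : 0 <= v0. Proof. exact: bm_v0_ge0 HW. Qed.

Let a0 : 0 <= a.
Proof. by rewrite addr_ge0 ?mulr_ge0// ltW. Qed.

Let sqrD3 (x y z : R) : (x + y + z) ^+ 2 <= 3 * x ^+ 2 + 3 * y ^+ 2 + 3 * z ^+ 2.
Proof.
have := sqr_ge0 (x - y); have := sqr_ge0 (x - z); have := sqr_ge0 (y - z).
by nra.
Qed.

Let le_tl k r w : 0 <= r -> r <= tl k w -> tau k r w = r.
Proof. by move=> r0 rl; rewrite tauE//; apply/min_idPl. Qed.

(* The drift enters by Cauchy-Schwarz. *)
Let path_sqr_le k i (s : R) : 0 <= s <= T -> {ae mu, forall w,
  ((D i (tau k s w) w ^+ 2)%:E <= (3 * x0 i ^+ 2)%:E +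
    (3 * T)%:E * sint (Pr k) 0 s w + (3 * N i (tau k s w) w ^+ 2)%:E)%E}.
Proof.
move=> /andP[s0 sT]; apply: filterS eqD => w /(_ _ (tauT k s w)) ->.
set t := tau k s w; set J := \int[_]_(_ in _) _.
have /andP[t0 tT] := tauT k s w; rewrite -/t in t0 tT.
apply: (@le_trans _ _ (3 * x0 i ^+ 2 + 3 * J ^+ 2 + 3 * N i t w ^+ 2)%:E).
  by rewrite lee_fin sqrD3.
rewrite !EFinD leeD2r// leeD2l// !EFinM -muleA lee_pmul2l//.
rewrite -EFinM -expr2.
apply: (@le_trans _ _ ((t - 0)%R%:E * sint (fun r w => beta i r w ^+ 2)%R 0 t w)%E).
  rewrite sintE; apply: sqr_Rintegral_le => //.
  by apply: measurable_funTS; apply: (jmeas_sect (h := beta i)).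
rewrite subr0; apply: lee_pmul => //.
  by apply: sint_ge0 => *; exact: sqr_ge0.
have ts : t <= s by rewrite /t tauE// ge_min lexx.
rewrite (@sint_split _ _ _ (Pr k) 0 t s)//.
apply: le_trans (leeDl _ _); last exact: sint_ge0.
apply: sint_le => //.
- exact: jmeasX.
- by move=> *; exact: sqr_ge0.
- move=> r /andP[r0 rt].
  have rl : r <= tl k w.
    by apply: (le_trans rt); rewrite /t tauE// ge_min lexx orbT.
  rewrite /Pr le_tl ?(ltW r0)//; apply: bb; rewrite r0/=.
  by apply: (le_trans rl); rewrite ge_min lexx.
Qed.

Let stopped_noise_le k i (s : R) : 0 <= s <= T ->
  (\int[mu]_w (N i (tau k s w) w ^+ 2)%:E <=
   (v0 * n%:R)%:E * dint mu (Pr k) setT 0 s)%E.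
Proof.
move=> sT; have /andP[s0 _] := sT.
under eq_integral do rewrite tauE//.
apply: le_trans (stopped_sqr_le HF v00 (h := fun s w => \sum_j H i j s w ^+ 2)
  _ _ _ _ _ _ (stl k) sT) _ => //.
- by apply: jmeas_sum => j; exact: jmeasX.
- by move=> *; apply: sumr_ge0 => *; exact: sqr_ge0.
- exact: (ito_integrable hT HF (jH i) (iN i)).
- exact: mN.
- by move=> *; apply: (ito_sqr_le HF HW) => //; exact: mN.
rewrite (ito_at0 hT (iN i)) add0e EFinM -muleA lee_wpmul2l ?lee_fin//.
rewrite -dintZ//; apply: dint_le => //.
- apply: jmeasM; last by apply: jmeas_sum => j; exact: jmeasX.
  by apply: jmeas_le; apply: (stopping_meas HF); exact: stl.
- by apply: jmeasM => //; exact: jmeas_cst.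
- by move=> *; rewrite mulr_ge0// sumr_ge0// => *; exact: sqr_ge0.
- by move=> *; rewrite mulr_ge0.
move=> r w _ /andP[r0 rs]; have [rl|] := leP r (tl k w); last first.
  by rewrite mul0r mulr_ge0.
rewrite mul1r /Pr le_tl ?(ltW r0)//.
have -> : n%:R * (kappa + L * G r w) = \sum_(j < n) (kappa + L * G r w).
  by rewrite sumr_const card_ord mulr_natl.
apply: ler_sum => j _; apply: bH; rewrite r0/=.
by apply: (le_trans rl); rewrite ge_min lexx.
Qed.

Let g k s := (\int[mu]_w (G (tau k s w) w)%:E)%E.

Let mGt k s : measurable_fun setT (fun w => G (tau k s w) w).
Proof. exact: (jmeas_sectr s (jG k)). Qed.

Let mDt k i s : measurable_fun setT (fun w => D i (tau k s w) w).
Proof.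
apply: (jmeas_sectr s (h := fun r w => D i (tau k r w) w)).
by apply: (jmeas_continuous hT) => // r rT; exact: mD.
Qed.

Let g_eq k s : g k s = (\sum_i \int[mu]_w (D i (tau k s w) w ^+ 2)%:E)%E.
Proof.
rewrite /g /G; under eq_integral do rewrite -sumEFin.
rewrite ge0_integral_sum// => [i|i w _]; last by rewrite lee_fin sqr_ge0.
apply/measurable_EFinP; apply: measurable_funX.
exact: mDt.
Qed.

Let mNt k i s : measurable_fun setT (fun w => N i (tau k s w) w).
Proof.
apply: (jmeas_sectr s (h := fun r w => N i (tau k r w) w)).
by apply: (jmeas_continuous hT) => // r rT; exact: mN.
Qed.

Let coord_le k i (s : R) : 0 <= s <= T ->
  (\int[mu]_w (D i (tau k s w) w ^+ 2)%:E <=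
   (3 * x0 i ^+ 2)%:E + a%:E * dint mu (Pr k) setT 0 s)%E.
Proof.
move=> sT; have dP0 := dint_ge0 mu setT 0 s (P0 k).
have mS : measurable_fun setT (sint (Pr k) 0 s) by apply: measurable_sint.
have S0 w : (0 <= sint (Pr k) 0 s w)%E by apply: sint_ge0.
have h1 w : (0 <= (3 * x0 i ^+ 2)%:E + (3 * T)%:E * sint (Pr k) 0 s w)%E.
  apply: adde_ge0; first by rewrite lee_fin mulr_ge0// sqr_ge0.
  by apply: mule_ge0 => //; rewrite lee_fin mulr_ge0// ltW.
have m1 : measurable_fun setT (fun w => (3 * x0 i ^+ 2)%:E + (3 * T)%:E * sint (Pr k) 0 s w)%E.
  by apply: emeasurable_funD => //; exact: measurable_funeM.
have m2 : measurable_fun setT (fun w => (3 * N i (tau k s w) w ^+ 2)%:E).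
  by apply/measurable_EFinP; apply: measurable_funM => //; apply: measurable_funX.
apply: (le_trans (ae_ge0_le_integral (f2 := fun w => ((3 * x0 i ^+ 2)%:E +
    (3 * T)%:E * sint (Pr k) 0 s w + (3 * N i (tau k s w) w ^+ 2)%:E)%E)
  measurableT _ _ _ _ _)).
- by move=> w _; rewrite lee_fin sqr_ge0.
- by apply/measurable_EFinP; apply: measurable_funX.
- by move=> w _; apply: (adde_ge0 (h1 w)); rewrite lee_fin mulr_ge0// sqr_ge0.
- exact: emeasurable_funD m1 m2.
- by apply: filterS (path_sqr_le k i sT) => w h _; exact: h.
rewrite ge0_integralD//; last by move=> w _; rewrite lee_fin mulr_ge0// sqr_ge0.
rewrite ge0_integralD//; last 3 first.
- by move=> w _; rewrite lee_fin mulr_ge0// sqr_ge0.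
- by move=> w _; rewrite mule_ge0// lee_fin mulr_ge0// ltW.
- exact: measurable_funeM.
rewrite integral_cst//= probability_setT mule1 -addeA leeD2l//.
rewrite ge0_integralZl//; last by rewrite lee_fin mulr_ge0// ltW.
rewrite -dintE.
under [X in (_ + X <= _)%E]eq_integral do rewrite EFinM.
rewrite ge0_integralZl//; last 2 first.
- by apply/measurable_EFinP; apply: measurable_funX.
- by move=> w _; rewrite lee_fin sqr_ge0.
rewrite -[a]/(3 * T + _) [(3 * T + _)%:E]EFinD ge0_muleDl; last 2 first.
- by rewrite lee_fin mulr_ge0// ltW.
- by rewrite lee_fin !mulr_ge0.
rewrite leeD2l// -[in leRHS]mulrA [in leRHS]EFinM -muleA lee_wpmul2l//.
exact: stopped_noise_le.
Qed.

Let M : R := m%:R * a.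
Let c0 : R := 3 * (\sum_i x0 i ^+ 2) + M * kappa * T.
(** The summand 1 ensures the positivity that Gronwall's lemma asks for. *)
Let K : R := M * L + 1.

Let dP k (s : R) : 0 <= s <= T -> (dint mu (Pr k) setT 0 s =
  (kappa * s)%:E + L%:E * \int[@lebesgue_measure R]_(r in `]0%R, s]) g k r)%E.
Proof.
move=> /andP[s0 sT]; rewrite /Pr dintD//; last 3 first.
- exact: jmeas_cst.
- by apply: jmeasM => //; exact: jmeas_cst.
- by move=> r w; rewrite mulr_ge0.
rewrite dintZ// dint_tonelli//; last exact: jmeas_cst.
rewrite [in X in (_ + X)%E]dint_tonelli//.
congr (_ + _)%E.
under eq_integral do rewrite integral_cst//= probability_setT mule1.
rewrite integral_cst//= lebesgue_measure_itv/= lte_fin.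
case: ltP => [_|]; first by rewrite sube0 EFinM.
by move=> h; have -> : s = 0 by [lra]; rewrite mule0 mulr0.
Qed.

Let g_rec k (s : R) : 0 <= s <= T ->
  (g k s <= c0%:E + K%:E * \int[@lebesgue_measure R]_(r in `]0%R, s]) g k r)%E.
Proof.
move=> sT; rewrite g_eq.
have g0 : (0 <= \int[@lebesgue_measure R]_(r in `]0%R, s]) g k r)%E.
  by apply: integral_ge0 => r _; apply: integral_ge0 => w _; rewrite lee_fin.
apply: (@le_trans _ _ (\sum_(i < m) ((3 * x0 i ^+ 2)%:E + a%:E * dint mu (Pr k) setT 0 s)))%E.
  by apply: lee_sum => i _; exact: coord_le.
rewrite big_split/= sumEFin -mulr_sumr.
rewrite dP//; set I := (\int[_]_(_ in _) _)%E in g0 *.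
case: I g0 => [I||] //; last first.
  move=> _; have K0 : (0 < K%:E)%E by rewrite lte_fin ltr_wpDl// !mulr_ge0.
  by rewrite (gt0_muley K0) addey// leey.
move=> I0'; have I0 : 0 <= I by [].
rewrite -(EFinM L I) -(EFinD (kappa * s)) -(EFinM a) -(EFinM K) sumEFin.
rewrite sumr_const card_ord -[_ *+ m]mulr_natl -!EFinD lee_fin.
have /andP[s0 sT'] := sT.
have h1 : M * (kappa * s) <= M * (kappa * T).
  by rewrite ler_wpM2l ?mulr_ge0// ler_wpM2l.
rewrite /c0 /K; have -> : m%:R * (a * (kappa * s + L * I)) = M * (kappa * s) + M * L * I.
  by rewrite /M; ring.
by move: h1; nra.
Qed.

Let tT (s : R) : 0 <= s <= T -> Num.max 0 (Num.min s T) = s.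
Proof. by move=> /andP[s0 sT]; rewrite (min_idPl sT) (max_idPr s0). Qed.

(** The localization supplies the finite bound k, which leaves no trace in the conclusion. The
    initial value must lie below k, since otherwise the level is hit at time 0 with a value that may
    exceed k. *)
Let loc_bound k (s : R) : \sum_i x0 i ^+ 2 < k%:R -> 0 <= s <= T ->
  (g k s <= (2 * c0 * expR (2 * K * T))%:E)%E.
Proof.
move=> xk sT; apply: (@gronwall _ T K c0 k%:R (g k)) => //.
- by rewrite ltr_wpDl// !mulr_ge0.
- by rewrite addr_ge0 ?mulr_ge0// ?sumr_ge0// ?(ltW hT)// => i _; rewrite sqr_ge0.
- exact: ltW.
- have := @measurable_fun_fubini_tonelli_F _ _ _ _ _ mu
    (fun z : R * Om => (G (tau k z.1 z.2) z.2)%:E).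
  by apply; [apply/measurable_EFinP; exact: jG|move=> z; rewrite lee_fin].
- move=> r /andP[r0 rT]; apply/andP; split.
    by apply: integral_ge0 => w _; rewrite lee_fin.
  apply: (@le_trans _ _ (\int[mu]_w (cst k%:R%:E w)))%E.
    apply: ae_ge0_le_integral => //.
    + by move=> w _; rewrite lee_fin.
    + by apply/measurable_EFinP; exact: mGt.
    + by move=> w _; rewrite lee_fin.
    apply: filterS G_init => w Gw _; rewrite lee_fin.
    apply: (hit_value_le (th := fun=> 0) cG z0T); first by rewrite Gw.
    rewrite tauE// le_min r0/= ge_min; have [/(_ w)/andP[-> _] _]/= := stl k.
    by rewrite ge_min lexx !orbT.
  by rewrite integral_cst//= probability_setT mule1.
- by move=> r rT; exact: g_rec.
Qed.

(** Used twice: for the difference of two solutions, with [x0] and kappa equal to 0, where the bound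
    is 0 and gives local uniqueness; and for a single solution with th = T, where it gives
    moments. *)
Lemma apriori (s : R) : 0 <= s <= T ->
  (\int[mu]_w (\sum_i D i (Num.min s (th w)) w ^+ 2)%:E <=
   (2 * (3 * (\sum_i x0 i ^+ 2) + m%:R * (3 * T + 3 * v0 * n%:R) * kappa * T) *
      expR (2 * (m%:R * (3 * T + 3 * v0 * n%:R) * L + 1) * T))%:E)%E.
Proof.
move=> sT; have /andP[s0 _] := sT.
pose l0 := (Num.truncn (\sum_i x0 i ^+ 2)).+1.
have l0P : \sum_i x0 i ^+ 2 < l0%:R by exact: real_truncnS_gt (num_real _).
apply: (@fatou_cvg_le _ _ _ mu (fun k w => G (tau (l0 + k) s w) w) _
  (fun=> (2 * c0 * expR (2 * K * T))%:E)).
- by move=> k; exact: mGt.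
- by move=> k w; exact: G0.
- move=> w; apply: cvg_near_cst.
  have := hit_eventually_end hT (th := fun=> 0) cG z0T w.
  move=> [k1 _ h]; exists k1 => // k /= k1k.
  rewrite tauE// /tl h/=; last by rewrite (leq_trans k1k)// leq_addl.
  by congr (G (Num.min s _) w); apply/min_idPl; case/andP: (thT w).
- exact: cvg_cst.
- by move=> k; apply: loc_bound => //; apply: (lt_le_trans l0P); rewrite ler_nat leq_addr.
Qed.
End apriori.

Lemma within_itv_comp (R : realType) (V : topologicalType) (T : R) (f : R -> V)
    (g : R -> R) : {within `[0, T], continuous f} -> continuous g ->
  (forall s : R, 0 <= s <= T -> 0 <= g s <= T) ->
  {within `[0, T], continuous (f \o g)}.
Proof.
move=> /subspace_continuousP cf cg gT; apply/subspace_continuousP => l lT.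
have gl : `[0, T]%classic (g l) by rewrite /= in_itv/= gT//; rewrite /= in_itv in lT.
apply: cvg_comp (cf _ gl) => A hA.
have h1 := cg l _ hA; apply: (@filterS _ (nbhs l) _ _ _ _ h1) => x h.
rewrite /= in_itv/= => xT; apply: h.
by rewrite /= in_itv/= gT.
Qed.

Lemma minr_continuous (R : realType) (c : R) : continuous (fun s => Num.min c s).
Proof. by move=> s; apply: continuous_min; [exact: cvg_cst|exact: cvg_id]. Qed.

Lemma maxr_continuous (R : realType) (c : R) : continuous (fun s => Num.max c s).
Proof. by move=> s; apply: continuous_max; [exact: cvg_cst|exact: cvg_id]. Qed.

Section all_times.
Context d (Om : measurableType d) (R : realType) (mu : {measure set Om -> \bar R}).
Context (T : R) (hT : 0 < T).

Lemma grid_cvg (s : R) : 0 <= s <= T -> exists j : nat -> nat,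
  (forall k, (j k <= k.+1)%N) /\ T * (j k)%:R / k.+1%:R @[k --> \oo] --> s.
Proof.
move=> /andP[s0 sT].
pose x k := s * k.+1%:R / T.
have x0 k : 0 <= x k by rewrite /x !mulr_ge0 ?invr_ge0 ?(ltW hT).
have kP k : (Num.truncn (x k))%:R <= x k < (Num.truncn (x k)).+1%:R.
  exact: truncn_itv.
exists (fun k => Num.truncn (x k)); split.
  move=> k; rewrite -(ler_nat R); have /andP[h _] := kP k; apply: (le_trans h).
  by rewrite /x ler_pdivrMr// mulrC ler_wpM2l.
apply: (@squeeze_cvgr _ _ _ _ (fun k => s - T / k.+1%:R) (fun=> s)).
- apply: nearW => k; have /andP[h1 h2] := kP k; apply/andP; split.
    rewrite lerBlDr -mulrDl -{2}[T]mulr1 -mulrDr natr1.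
    rewrite ler_pdivlMr//; have := ltW h2.
    by rewrite /x ler_pdivrMr// [_ * T]mulrC.
  by rewrite ler_pdivrMr// mulrC -ler_pdivlMr.
- rewrite -[X in _ --> X]subr0; apply: cvgB; first exact: cvg_cst.
  by rewrite -(mulr0 T); apply: cvgMr; exact: (@cvg_harmonic R).
- exact: cvg_cst.
Qed.

(** The exceptional sets of the countably many grid times have a null union, and path continuity
    carries the equation to all times. *)
Lemma ae_all_time (Z : R -> Om -> R) :
  (forall w, {within `[0, T], continuous (Z ^~ w)}) ->
  (forall s : R, 0 <= s <= T -> {ae mu, forall w, Z s w = 0}) ->
  {ae mu, forall w, forall s : R, 0 <= s <= T -> Z s w = 0}.
Proof.
move=> cZ hZ.
have q01 k j : (j <= k.+1)%N -> 0 <= T * j%:R / k.+1%:R <= T.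
  move=> jk; rewrite !mulr_ge0 ?invr_ge0 ?(ltW hT)//=.
  by rewrite ler_pdivrMr// ler_wpM2l ?(ltW hT)// ler_nat.
have : {ae mu, forall w, forall k j, (j <= k.+1)%N -> Z (T * j%:R / k.+1%:R) w = 0}.
  apply/ae_foralln => k; apply/ae_foralln => j.
  have [jk|jk] := leqP j k.+1; last by apply: aeW => w.
  by apply: filterS (hZ _ (q01 k j jk)).
apply: filterS => w hw s sT.
have [j [jk js]] := grid_cvg sT.
have := within_itv_cvg (@cZ w) (fun k => q01 k _ (jk k)) sT js.
under eq_fun do rewrite hw//.
by move=> /(cvg_lim (@Rhausdorff R)) <-; rewrite lim_cst//; exact: Rhausdorff.
Qed.

Lemma integral_sqr_eq0 (f : Om -> R) : measurable_fun setT f ->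
  (\int[mu]_w (f w ^+ 2)%:E <= 0)%E -> {ae mu, forall w, f w = 0}.
Proof.
move=> mf h0.
have /ae_eq_integral_abs : (\int[mu]_w `|(f w ^+ 2)%:E| = 0)%E.
  apply/eqP; rewrite eq_le integral_ge0 ?andbT//.
  apply: le_trans h0; rewrite le_eqVlt; apply/orP; left; apply/eqP.
  by apply: eq_integral => w _; rewrite gee0_abs// lee_fin sqr_ge0.
move=> /(_ measurableT) h.
have /h : measurable_fun setT (fun w => (f w ^+ 2)%:E).
  by apply/measurable_EFinP; apply: measurable_funX.
by apply: filterS => w /(_ I) /= /eqP; rewrite eqe sqrf_eq0 => /eqP.
Qed.

End all_times.

(** * Stochastic integrals on intervals without noise *)

Section noise_free.
Context d (Om : measurableType d) (R : realType) (mu : probability Om R).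
Context (T : R) (hT : 0 < T) (F : R -> set (set Om)) (HF : filtered T F).
Context (n : nat) (W : 'I_n -> R -> Om -> R) (v : R -> R) (v0 : R).
Context (HW : brownian mu T F W v v0).
Context (H : 'I_n -> R -> Om -> R) (N : R -> Om -> R).
Context (jH : forall j, jmeas (H j)).
Context (mN : forall s : R, 0 <= s <= T -> measurable_fun setT (N s)).
Context (cN : forall w, {within `[0, T], continuous (N ^~ w)}).
Context (iN : ito mu T F W H N).

(** On A and after time a, the increment of N is the integral of an integrand that vanishes before
    zeta, so its second moment stopped at zeta is 0. *)
Lemma ito_noise_free (a : R) (A : set Om) (zeta : Om -> R) : 0 <= a <= T ->
  F a A -> stopping T F zeta ->
  (forall j w (r : R), A w -> a < r < zeta w -> H j r w = 0) ->
  {ae mu, forall w, A w -> forall s : R, a <= s <= zeta w -> N s w = N a w}.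
Proof.
move=> aT FA sz H0; have /andP[a0 aT'] := aT.
have mA : measurable A by exact: filt_meas HF a aT A FA.
pose N' s w := \1_A w * (N s w - N (Num.min a s) w).
pose H' j s w := (a < s)%R%:R * \1_A w * H j s w.
have iN' : ito mu T F W H' N' by exact: (ito_after HF HW jH mN aT FA iN).
have m01 (s : R) : 0 <= s <= T -> 0 <= Num.min a s <= T.
  by move=> /andP[s0 sT]; rewrite le_min a0 s0/= ge_min aT'.
have mN' (s : R) : 0 <= s <= T -> measurable_fun setT (N' s).
  move=> sT; apply: measurable_funM; first exact: measurable_indic.
  by apply: measurable_funB; apply: mN => //; exact: m01.
have jH' j : jmeas (H' j).
  apply: jmeasM => //; apply: jmeasM; last by apply: jmeas_l; exact: measurable_indic.
  apply: jmeas_r.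
  rewrite (_ : (fun _ => _) = \1_(`]a, +oo[ : set R)); first exact: measurable_indic.
  by apply/funext => s; rewrite indicE; congr (nat_of_bool _)%:R; apply/idP/idP;
    rewrite inE/= in_itv/= andbT.
have cN' w : {within `[0, T], continuous (N' ^~ w)}.
  have cm := within_itv_comp (@cN w) (@minr_continuous _ a) m01.
  move=> s; apply: cvgM; first exact: cvg_cst.
  by apply: cvgB; [exact: cN|exact: cm].
have zT w : 0 <= zeta w <= T by have [] := sz.
have zsT w (s : R) : 0 <= s <= T -> 0 <= Num.min (zeta w) s <= T.
  have /andP[z0 z1] := zT w; move=> /andP[s0 sT].
  by rewrite le_min z0 s0/= ge_min z1.
have sum0 r w : 0 <= \sum_j H' j r w ^+ 2.
  by apply: sumr_ge0 => j _; exact: sqr_ge0.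
have jsum : jmeas (fun r w => \sum_j H' j r w ^+ 2).
  by apply: jmeas_sum => j; exact: jmeasX.
have zmeas : measurable_fun setT zeta by exact: stopping_meas HF _ sz.
have : {ae mu, forall w, forall s : R, 0 <= s <= T -> N' (Num.min (zeta w) s) w = 0}.
  apply: (ae_all_time hT (Z := fun s w => N' (Num.min (zeta w) s) w)) => //.
    by move=> w; apply: (within_itv_comp (@cN' w) (@minr_continuous _ (zeta w)) (zsT w)).
  move=> s sT; apply: integral_sqr_eq0.
    pose tau (r : R) w := Num.min (zeta w) (Num.max 0 (Num.min T r)).
    have jt : jmeas tau.
      apply: measurable_minr; first by apply: jmeas_l.
      apply: measurable_maxr; first exact: measurable_cst.
      by apply: measurable_minr; [exact: measurable_cst|exact: measurable_fst].
    have tauT r w : 0 <= tau r w <= T.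
      by apply: zsT; rewrite le_max lexx/= ge_max (ltW hT) ge_min lexx.
    have := @jmeas_sectr _ _ _ _ s (jmeas_continuous hT mN' cN' jt tauT).
    by rewrite /tau; have /andP[s0 sT'] := sT; rewrite (min_idPr sT') (max_idPr s0).
  under eq_integral do rewrite minC.
  apply: le_trans (stopped_sqr_le HF (bm_v0_ge0 HW) jsum sum0
    (ito_integrable hT HF jH' iN') mN' cN' _ sz sT) _.
    by move=> *; exact: (ito_sqr_le HF HW).
  rewrite (ito_at0 hT iN') add0e dintE integral0_eq ?mule0// => w _.
  rewrite sintE; apply/eqP; rewrite eq_le integral_ge0 ?andbT; last first.
    by move=> r _; rewrite lee_fin mulr_ge0.
  apply: (@le_trans _ _ (\int[@lebesgue_measure R]_(r in `]0%R, s]) (cst 0%E r))%E);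
    last by rewrite integral0.
  apply: ae_ge0_le_integral => //.
  - by move=> r _; rewrite lee_fin mulr_ge0.
  - apply/measurable_EFinP; apply: measurable_funTS.
    apply: (jmeas_sect w (h := fun r w => (r <= zeta w)%R%:R * \sum_j H' j r w ^+ 2)).
    by apply: jmeasM => //; apply: jmeas_le.
  (* The integrand is known to vanish strictly before zeta; the single time zeta itself is a
     Lebesgue null set. *)
  exists [set zeta w]; split; [exact: measurable_set1|exact: lebesgue_measure_set1|].
  move=> r /= hr; apply: contrapT => rz; apply: hr => _; rewrite lee_fin.
  have [rle|] := leP r (zeta w); last by rewrite mul0r.
  have rlt : r < zeta w by rewrite lt_neqAle rle andbT; apply/eqP.
  rewrite mul1r big1// => j _; rewrite /H'.
  have [ar|_] := ltP a r; last by rewrite !mul0r expr0n.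
  rewrite indicE; have [/set_mem Aw|_] := boolP (w \in A); last by rewrite mulr0 mul0r expr0n.
  by rewrite H0 ?ar// mulr0 expr0n.
apply: filterS => w hw Aw s /andP[as' sz'].
have sT : 0 <= s <= T.
  by rewrite (le_trans a0 as')/= (le_trans sz')//; case/andP: (zT w).
have := hw s sT; rewrite (min_idPr sz') /N' indicE mem_set// mul1r => /eqP.
by rewrite subr_eq0 => /eqP ->; rewrite (min_idPl as').
Qed.
End noise_free.

(** * The canonical space *)

Lemma measurable_lt_set d (Om : measurableType d) (R : realType) (g : Om -> R)
    (r : R) : measurable_fun setT g -> measurable [set w | r < g w].
Proof.
move=> mg; rewrite (_ : [set _ | _] = setT `&` g @^-1` `]r, +oo[).
  exact: mg.
by rewrite setTI; apply/seteqP; split => w /=; rewrite in_itv/= andbT.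
Qed.

Section normal_law.
Context d (Om : measurableType d) (R : realType) (mu : probability Om R).

Lemma normal_probN (s : R) (B : set R) : s != 0 -> measurable B ->
  normal_prob 0 s [set x | B (- x)] = normal_prob 0 s B.
Proof.
move=> s0 mB; rewrite /normal_prob.
have mpdf : measurable_fun setT (fun x => (normal_pdf 0 s x)%:E).
  by apply/measurable_EFinP; exact: measurable_normal_pdf.
have mopp : measurable_fun setT (-%R : measurableTypeR R -> measurableTypeR R).
  by apply: continuous_measurable_fun; exact: opp_continuous.
transitivity (\int[lebesgue_measure]_(x in -%R @^-1` B) (normal_pdf 0 s (- x))%:E)%E.
  by apply: eq_integral => x _; rewrite !normal_pdfE// /normal_fun !subr0 sqrrN.
rewrite -(ge0_integral_pushforward mopp lebesgue_measure mB
  (measurable_funTS mpdf))//; last by move=> x _; rewrite lee_fin normal_pdf_ge0.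
by apply: eq_measure_integral => A mA _; exact: lebesgue_measureN.
Qed.

(** The density with deviation s is 2 exp(-3 x^2 / (8 s^2)) times the density with deviation 2 s,
    since 1/2 - 1/8 = 3/8. On the tail the exponential is at most its value at x^2 = r, and the
    wider density has mass 1. *)
Lemma normal_prob_sqr_gt (s r : R) : 0 < s -> 0 <= r ->
  (normal_prob 0%R s [set x | r < x ^+ 2]%R <=
   (2 * expR (- (3 / 8 / s ^+ 2) * r))%:E)%E.
Proof.
move=> s0 r0; have sn : s != 0 by rewrite gt_eqF.
have s2n : 2 * s != 0 by rewrite mulf_neq0// pnatr_eq0.
have mS : measurable [set x : R | r < x ^+ 2].
  apply: (@measurable_lt_set _ (measurableTypeR R) R (fun x => x ^+ 2)).
  by apply: continuous_measurable_fun; exact: exprn_continuous.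
have peak : normal_peak s = 2 * normal_peak (2 * s).
  rewrite /normal_peak; have -> : (2 * s) ^+ 2 * pi *+ 2 = 2 ^+ 2 * (s ^+ 2 * pi *+ 2) by ring.
  rewrite sqrtrM ?sqr_ge0// sqrtr_sqr.
  by rewrite ger0_norm// invfM mulrA mulfV// mul1r.
apply: (@le_trans _ _ (\int[lebesgue_measure]_x
   ((2 * expR (- (3 / 8 / s ^+ 2) * r))%:E * (normal_pdf 0 (2 * s) x)%:E))%E); last first.
  rewrite ge0_integralZl//.
  - by rewrite integral_normal_pdf mule1.
  - by apply/measurable_EFinP; exact: measurable_normal_pdf.
  - by move=> x _; rewrite lee_fin normal_pdf_ge0.
rewrite /normal_prob integral_mkcond; apply: ge0_le_integral => //.
- by move=> x _; rewrite patchE; case: ifP => // _; rewrite lee_fin normal_pdf_ge0.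
- apply/(measurable_restrictT _ mS)/measurable_funTS/measurable_EFinP.
  exact: measurable_normal_pdf.
- by apply: measurable_funeM; apply/measurable_EFinP; exact: measurable_normal_pdf.
move=> x _; rewrite patchE; case: ifPn => [|_]; last first.
  by rewrite -EFinM lee_fin mulr_ge0 ?normal_pdf_ge0// mulr_ge0// expR_ge0.
rewrite inE/= => xr; rewrite -EFinM lee_fin !normal_pdfE// peak /normal_fun.
rewrite -!mulrA ler_pM2l// mulrCA ler_pM2l ?normal_peak_gt0// -expRD ler_expR.
rewrite !subr0 exprMn.
have s20 : 0 < s ^+ 2 by rewrite exprn_gt0.
have -> : - x ^+ 2 / (s ^+ 2 *+ 2) = - (3 / 8 / s ^+ 2) * x ^+ 2 + - x ^+ 2 / ((2 ^+ 2 * s ^+ 2) *+ 2).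
  by field.
rewrite lerD2r !mulNr lerN2 mulrA ler_wpM2l ?ltW//.
by rewrite divr_gt0// divr_gt0.
Qed.

Lemma ge0_integral_ccdf (X : Om -> R) : measurable_fun setT X ->
  (forall w, 0 <= X w) ->
  measurable_fun setT (fun r : R => mu [set w | r < X w]) /\
  (\int[mu]_w (X w)%:E =
   \int[@lebesgue_measure R]_(r in `[0%R, +oo[) mu [set w | (r < X w)%R])%E.
Proof.
move=> mX X0.
pose X' : {RV mu >-> R} := HB.pack X (@isMeasurableFun.Build _ _ _ _ X mX).
have E r : ccdf X' r = mu [set w | r < X w].
  by congr (mu _); apply/seteqP; split => w /=; rewrite in_itv/= andbT.
split.
  by apply: eq_measurable_fun (ccdf_measurable X') => r _; rewrite E.
have := @ge0_expectation_ccdf _ _ _ mu X' X0.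
by rewrite unlock => ->; apply: eq_integral => r _; rewrite E.
Qed.

Context (s : R) (s0 : 0 < s) (Y : Om -> R) (mY : measurable_fun setT Y).
Context (lY : forall B, measurable B -> mu (Y @^-1` B) = normal_prob 0 s B).

(** The tail bound is integrated by comparison with an exponential density of rate 3 / (8 s^2); 16/3
    is 2 divided by 3/8. *)
Lemma normal_sqr_le : (\int[mu]_w (Y w ^+ 2)%:E <= (16 / 3 * s ^+ 2)%:E)%E.
Proof.
have [|mc ->] := ge0_integral_ccdf (measurable_funX 2%N mY).
  by move=> w; rewrite sqr_ge0.
pose k := 3 / 8 / s ^+ 2.
have k0 : 0 < k by rewrite /k !divr_gt0// exprn_gt0.
have -> : (16 / 3 * s ^+ 2)%:E = ((2 / k)%:E *
    \int[@lebesgue_measure R]_(r in `[0%R, +oo[) (exponential_pdf k r)%:E)%E.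
  rewrite [X in (_ * X)%E](_ : _ = 1)%E.
    by rewrite mule1; congr EFin; rewrite /k; field; rewrite gt_eqF.
  rewrite integral_mkcond -[RHS](integral_exponential_pdf k0).
  apply: eq_integral => r _; rewrite patchE; case: ifPn => //.
  by rewrite /exponential_pdf patchE => /negbTE ->.
rewrite -ge0_integralZl//; last 3 first.
- by apply/measurable_EFinP/measurable_funTS; exact: measurable_exponential_pdf.
- by move=> r _; rewrite lee_fin exponential_pdf_ge0// ltW.
- by rewrite lee_fin divr_ge0// ltW.
apply: ge0_le_integral => //.
- exact: measurable_funTS.
- by apply: measurable_funeM; apply/measurable_EFinP/measurable_funTS;
    exact: measurable_exponential_pdf.
move=> r; rewrite /= in_itv/= andbT => r0.
rewrite exponential_pdfE// -EFinM mulrA mulfVK ?gt_eqF//.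
have -> : [set w | r < Y w ^+ 2] = Y @^-1` [set x | r < x ^+ 2] by [].
rewrite lY; first exact: normal_prob_sqr_gt.
apply: (@measurable_lt_set _ (measurableTypeR R) R (fun x => x ^+ 2)).
by apply: continuous_measurable_fun; exact: exprn_continuous.
Qed.

(** By symmetry of the law both parts have the same tail function, and the tail function determines
    the integral. *)
Lemma normal_parts :
  (\int[mu]_w (Num.max (Y w) 0)%:E = \int[mu]_w (Num.max (- Y w) 0)%:E)%E.
Proof.
have m1 : measurable_fun setT (fun w => Num.max (Y w) 0).
  by apply: measurable_maxr.
have m2 : measurable_fun setT (fun w => Num.max (- Y w) 0).
  by apply: measurable_maxr => //; exact: measurable_funN.
have [|_ ->] := ge0_integral_ccdf m1; first by move=> w; rewrite le_max lexx orbT.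
have [|_ ->] := ge0_integral_ccdf m2; first by move=> w; rewrite le_max lexx orbT.
apply: eq_integral => r; rewrite inE/= in_itv/= andbT => r0.
have -> : [set w | r < Num.max (Y w) 0] = Y @^-1` `]r, +oo[.
  by apply/seteqP; split => w /=; rewrite in_itv/= andbT lt_max (ltNge _ 0) r0 orbF.
have -> : [set w | r < Num.max (- Y w) 0] = Y @^-1` [set x | `]r, +oo[%classic (- x)].
  by apply/seteqP; split => w /=; rewrite in_itv/= andbT lt_max (ltNge _ 0) r0 orbF.
have mopp : measurable [set x : R | `]r, +oo[%classic (- x)].
  rewrite (_ : [set _ | _] = setT `&` -%R @^-1` `]r, +oo[); last by rewrite setTI.
  by apply: (continuous_measurable_fun opp_continuous) => //; exact: measurable_itv.
by rewrite !lY// normal_probN// gt_eqF.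
Qed.

Section independent_of_event.
Context (E : set Om) (mE : measurable E).
Context (iE : forall B, measurable B ->
  mu (E `&` Y @^-1` B) = (mu E * normal_prob 0 s B)%E).

Let G := preimage_set_system setT Y measurable.
Let Gs : sigma_algebra setT G.
Proof. by apply: sigma_algebra_preimage; exact: sigma_algebra_measurable. Qed.
Let Gm : G `<=` measurable.
Proof. by move=> _ [B mB <-]; exact: mY. Qed.

(** [ge0_integral_indep] with exchanged roles: the sigma-algebra is the one generated by Y, the
    weight is f(Y), and the indicator of E is the variable with constant conditional mean. *)
Let integral_event (f : R -> R) : measurable_fun setT f -> (forall x, 0 <= f x) ->
  (\int[mu]_(w in E) (f (Y w))%:E = mu E * \int[mu]_w (f (Y w))%:E)%E.
Proof.
move=> mf f0; rewrite (integral_indicM _ _ mE).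
have EE : (fine (mu E))%:E = mu E by rewrite fineK// fin_num_measure.
rewrite -EE -(ge0_integral_indep Gs Gm (Y := \1_E))//.
- by apply: eq_integral => w _; rewrite mulrC.
- by rewrite fine_ge0.
- move=> _ [B mB <-]; rewrite setTI integral_indic//; last by rewrite -[X in measurable X]setTI; exact: mY.
  by have := iE mB; rewrite -(lY mB) EE.
- move=> B mB; exists (f @^-1` B); last by rewrite setTI.
  by rewrite -[X in measurable X]setTI; exact: mf.
Qed.

Lemma integral_event_mean : (\int[mu]_(w in E) (Y w)%:E = 0)%E.
Proof.
rewrite integralE.
have -> : (\int[mu]_(w in E) ((fun w => (Y w)%:E)^\+ w) =
    \int[mu]_(w in E) (Num.max (Y w) 0)%:E)%E.
  by apply: eq_integral => w _; rewrite funeposE/= EFin_max.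
have -> : (\int[mu]_(w in E) ((fun w => (Y w)%:E)^\- w) =
    \int[mu]_(w in E) (Num.max (- Y w) 0)%:E)%E.
  by apply: eq_integral => w _; rewrite funenegE/= EFin_max.
rewrite (integral_event (f := fun x => Num.max x 0)); last 2 first.
- by apply: measurable_maxr.
- by move=> x; rewrite le_max lexx orbT.
rewrite (integral_event (f := fun x => Num.max (- x) 0)); last 2 first.
- by apply: measurable_maxr => //; exact: measurable_funN.
- by move=> x; rewrite le_max lexx orbT.
rewrite -normal_parts subee// fin_numM// ?fin_num_measure//.
rewrite ge0_fin_numE; last by apply: integral_ge0 => w _; rewrite lee_fin le_max lexx orbT.
apply: (@le_lt_trans _ _ (\int[mu]_w ((Y w ^+ 2)%:E + (cst 1 w)%:E)))%E.
  apply: ge0_le_integral => //.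
  - by move=> w _; rewrite lee_fin le_max lexx orbT.
  - by apply/measurable_EFinP; exact: measurable_maxr.
  - apply: emeasurable_funD; last by apply/measurable_EFinP; exact: measurable_cst.
    by apply/measurable_EFinP; exact: measurable_funX.
  - move=> w _; rewrite -EFinD lee_fin ge_max; have := sqr_ge0 (Y w - 1).
    by have := sqr_ge0 (Y w + 1); move=> h1 h2; apply/andP; split; rewrite /=; nra.
rewrite ge0_integralD//; last 3 first.
- by move=> w _; rewrite lee_fin sqr_ge0.
- by apply/measurable_EFinP; exact: measurable_funX.
- by apply/measurable_EFinP; exact: measurable_cst.
rewrite lte_add_pinfty//; last first.
  rewrite (_ : (fun x => _) = cst 1%E)//.
  by rewrite integral_cst//= probability_setT mule1 ltry.
by apply: (le_lt_trans normal_sqr_le); rewrite ltry.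
Qed.

Lemma integral_event_sqr :
  (\int[mu]_(w in E) (Y w ^+ 2)%:E = \int[normal_prob 0 s]_x (x ^+ 2)%:E * mu E)%E.
Proof.
rewrite (integral_event (f := fun x => x ^+ 2)); last 2 first.
- by apply: continuous_measurable_fun; exact: exprn_continuous.
- by move=> x; rewrite sqr_ge0.
rewrite muleC; congr (_ * _)%E.
pose Y' : Om -> measurableTypeR R := Y.
have mY' : measurable_fun setT Y' by exact: mY.
transitivity (\int[pushforward mu Y']_x (x ^+ 2)%:E)%E.
  rewrite (ge0_integral_pushforward mY' mu measurableT)//.
  - by apply/measurable_EFinP; apply: continuous_measurable_fun; exact: exprn_continuous.
  - by move=> x _; rewrite lee_fin sqr_ge0.
by apply: (eq_measure_integral (normal_prob 0 s)) => A mA _; exact: lY.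
Qed.

End independent_of_event.

End normal_law.

Lemma normal_variance (R : realType) (s : R) : 0 < s ->
  (0 <= \int[normal_prob 0%R s]_x (x ^+ 2)%:E <= (16 / 3 * s ^+ 2)%:E)%E.
Proof.
move=> s0; rewrite integral_ge0/=; last by move=> x _; rewrite lee_fin sqr_ge0.
exact: (@normal_sqr_le _ _ _ (normal_prob 0 s) s s0 id).
Qed.

(** * Completion and augmentation *)

Section completion.
Context d (S : measurableType d) (R : realType) (P : probability S R).

(** The augmented filtrations contain all null sets, so they are families of measurable sets here
    and not for the generated sigma-algebra. The stochastic calculus above is applied on this
    space. *)
Definition cspace : measurableType _ := caratheodory_type (P^*)%mu.

Definition cprob : set cspace -> \bar R :=
  @completed_measure_extension _ S R P.

HB.instance Definition _ := Measure.on cprob.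

Lemma measurable_cspace (A : set S) : measurable A -> measurable (A : set cspace).
Proof. by move=> mA; apply: sub_caratheodory; exact: sub_sigma_algebra. Qed.

Lemma cprobE (A : set S) : measurable A -> cprob A = P A.
Proof. by move=> mA; rewrite /cprob /completed_measure_extension/= measurable_mu_extE. Qed.

Let cprobT : cprob setT = 1%E.
Proof. by rewrite cprobE// probability_setT. Qed.

HB.instance Definition _ := @Measure_isProbability.Build _ _ _ cprob cprobT.

Lemma negligible_cprob (A : set S) : P.-negligible A ->
  measurable (A : set cspace) /\ cprob A = 0%E.
Proof.
move=> [B [mB PB AB]].
have A0 : cprob A = 0%E.
  apply/eqP; rewrite eq_le measure_ge0 andbT -PB -(cprobE mB).
  exact: le_mu_ext.
split=> //.
have := @measure_is_complete_caratheodory R S (P^*)%mu.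
apply; exists B; split => //; first exact: measurable_cspace.
by have := cprobE mB; rewrite PB.
Qed.

Lemma cprob_negligible (A : set S) : cprob A = 0%E -> P.-negligible A.
Proof.
move=> A0.
have H k : exists U : set S, [/\ measurable U, A `<=` U & (P U <= (k.+1%:R^-1)%:E)%E].
  have : (cprob A < (k.+1%:R^-1)%:E)%E by rewrite A0 lte_fin invr_gt0.
  rewrite /cprob /completed_measure_extension/= /mu_ext.
  move=> /ereal_inf_lt[_ [F [mF AF] <-]] h.
  exists (\bigcup_k F k); split => //; first exact: bigcup_measurable.
  apply: le_trans (ltW h).
  by apply: (measure_sigma_subadditive P) => //; exact: bigcup_measurable.
have /choice[U HU] := H.
exists (\bigcap_k U k); split.
- by apply: bigcap_measurable => // k _; have [] := HU k.
- apply/eqP; rewrite eq_le measure_ge0 andbT.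
  apply/lee_addgt0Pr => e e0; rewrite add0e.
  have [k _ /(_ k (leqnn _)) hk] := near_infty_natSinv_lt (PosNum e0).
  have [mU AU PU] := HU k.
  apply: (le_trans _ (le_trans PU _)); last by rewrite lee_fin ltW.
  apply: le_measure; rewrite ?inE//.
    by apply: bigcap_measurable => // j _; have [] := HU j.
  exact: bigcap_inf.
- by apply: sub_bigcap => k _; have [] := HU k.
Qed.

(** Solutions and admissibility are stated almost surely for P while the estimates live on the
    completion; the two have the same null sets. *)
Lemma ae_cprob (Q : S -> Prop) : {ae P, forall w, Q w} <-> {ae cprob, forall w : cspace, Q w}.
Proof.
split.
  move=> /negligible_cprob[m0 h0].
  by exists (~` [set w | Q w]); split.
move=> [B [mB PB QB]]; exact: (@negligibleS _ _ _ P B _ QB (cprob_negligible PB)).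
Qed.

End completion.
Arguments cprob {d S R} P _.

Lemma cprob_eq d (S : measurableType d) (R : realType) (P : probability S R)
    (A B : set S) :
  measurable (A : set (cspace P)) -> measurable (B : set (cspace P)) ->
  P.-negligible (A `\` B) -> P.-negligible (B `\` A) -> cprob P A = cprob P B.
Proof.
suff H (A' B' : set S) : measurable (A' : set (cspace P)) ->
    measurable (B' : set (cspace P)) -> P.-negligible (A' `\` B') ->
    (cprob P A' <= cprob P B')%E.
  by move=> mA mB AB BA; apply/eqP; rewrite eq_le !H.
move=> mA mB /negligible_cprob[mAB AB].
apply: (@le_trans _ _ (cprob P (B' `|` (A' `\` B') : set (cspace P)))).
  apply: le_measure; rewrite ?inE//; first exact: measurableU.
  by move=> w Aw; have [Bw|Bw] := pselect (B' w); [left|right].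
apply: le_trans (measureU2 _ mB mAB) _.
by rewrite [X in (_ + X)%E](_ : _ = 0%E) ?adde0.
Qed.

Section augmentation.
Context (R : realType) (T : R) (N : nat) (P : probability (Omega T N) R).

Lemma augmentation_sigma G : sigma_algebra setT (augmentation P G).
Proof. exact: smallest_sigma_algebra. Qed.

Lemma augmentation_negligible G A : P.-negligible A -> augmentation P G A.
Proof. by move=> nA; apply: sub_sigma_algebra; right. Qed.

Lemma augmentation_sub G A : <<s G >> A -> augmentation P G A.
Proof.
move: A; apply: smallest_sub; first exact: augmentation_sigma.
by move=> A GA; apply: sub_sigma_algebra; left.
Qed.

Lemma augmentation_min G (H : set (set (cpath T N))) : sigma_algebra setT H ->
  G `<=` H -> P.-negligible `<=` H -> augmentation P G `<=` H.
Proof. by move=> sH GH nH; apply: smallest_sub => // A [/GH|/nH]. Qed.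

Lemma augmentation_mono G G' : G `<=` augmentation P G' ->
  augmentation P G `<=` augmentation P G'.
Proof.
move=> GG; apply: augmentation_min => //; first exact: augmentation_sigma.
exact: augmentation_negligible.
Qed.

Lemma augmentation_measurable G :
  G `<=` (measurable : set (set (Omega T N))) ->
  augmentation P G `<=` (measurable : set (set (cspace P))).
Proof.
move=> mG; apply: augmentation_min; first exact: sigma_algebra_measurable.
  by move=> A /mG; exact: measurable_cspace.
by move=> A /negligible_cprob[].
Qed.

(** The sets that agree with some set of the generated sigma-algebra up to a null set form a
    sigma-algebra containing G and the null sets. *)
Lemma augmentation_approx G A : augmentation P G A ->
  exists A0, [/\ <<s G >> A0, P.-negligible (A `\` A0) & P.-negligible (A0 `\` A)].
Proof.
move: A; apply: augmentation_min.
- split.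
  + exists set0; rewrite setD0; split; [exact: sigma_algebra0|exact: negligible_set0..].
  + move=> A [A0 [GA0 h1 h2]]; exists (~` A0); split.
    * by rewrite -setTD; exact: sigma_algebraCD.
    * by apply: negligibleS h2 => w [[_ nA] /contrapT].
    * by apply: negligibleS h1 => w [nA0 nA]; split=> //; apply: contrapT => h; apply: nA.
  + move=> A /choice[A0 HA]; exists (\bigcup_k A0 k); split.
    * by apply: sigma_algebra_bigcup => k; have [] := HA k.
    * apply: (@negligibleS _ _ _ P (\bigcup_k (A k `\` A0 k))).
        by move=> w [[k _ Ak] nA0]; exists k => //; split=> // A0k; apply: nA0; exists k.
      by apply: negligible_bigcup => k; have [] := HA k.
    * apply: (@negligibleS _ _ _ P (\bigcup_k (A0 k `\` A k))).
        by move=> w [[k _ Ak] nA0]; exists k => //; split=> // A0k; apply: nA0; exists k.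
      by apply: negligible_bigcup => k; have [] := HA k.
- move=> A GA; exists A; rewrite setDv; split; [exact: sub_sigma_algebra|exact: negligible_set0..].
- move=> A nA; exists set0; rewrite setD0 set0D; split => //; [exact: sigma_algebra0|exact: negligible_set0].
Qed.

End augmentation.

(** * The Wiener process in its augmented filtration *)

Section wiener.
Context (R : realType) (T : R) (hT : 0 < T) (N : nat).
Context (P : probability (Omega T N) R) (hP : wiener_measure P).

Lemma path_events_mono (s t : R) : s <= t -> path_events T N s `<=` path_events T N t.
Proof.
move=> st A [r /= /andP[r0 rs] h]; exists r => //=.
by rewrite r0 (le_trans rs st).
Qed.

Lemma FW_filtered : filtered T (FW P : R -> set (set (cspace P))).
Proof.
split.
- by move=> s; exact: augmentation_sigma.
- move=> s /andP[s0 sT]; apply: augmentation_measurable => A As.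
  by apply: sub_sigma_algebra; exact: path_events_mono As.
- move=> s t s0 st tT; apply: augmentation_mono => A As.
  by apply: sub_sigma_algebra; left; exact: path_events_mono As.
Qed.

Lemma FW_coord (s r : R) (i : 'I_N) : 0 <= r <= s ->
  gmeas (FW P s) (fun w => W r w i ord0).
Proof.
move=> rs B mB; apply: sub_sigma_algebra; left; exists r => //.
by exists i, B.
Qed.

(** [wiener_measure] speaks of events generated by the path. An augmented event differs from such an
    event by a null set, which changes neither side. *)
Lemma FW_product (a b : R) A (B : 'I_N -> set R) : 0 <= a -> a < b -> b <= T ->
  FW P a A -> (forall i, measurable (B i)) ->
  cprob P (A `&` [set w | forall i, B i (W b w i ord0 - W a w i ord0)]) =
  (cprob P A * \prod_(i < N) normal_prob 0%R (Num.sqrt (b - a)) (B i))%E.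
Proof.
move=> a0 ab bT FA mB.
have aT : 0 <= a <= T by rewrite a0 (le_trans (ltW ab)).
have mA := filt_meas FW_filtered aT FA.
have [A0 [GA0 n1 n2]] := augmentation_approx FA.
have mA0 : measurable (A0 : set (Omega T N)).
  move: A0 GA0 {n1 n2}; apply: smallest_sub; first exact: sigma_algebra_measurable.
  by move=> A' hA'; apply: sub_sigma_algebra; apply: path_events_mono hA'; case/andP: aT.
set E := [set w | _].
have mE : measurable (E : set (Omega T N)).
  have mW (r : R) i : 0 <= r <= T -> measurable_fun setT (fun w : Omega T N => W r w i ord0).
    move=> rT _ C mC; rewrite setTI; apply: sub_sigma_algebra.
    by exists r => //; exists i, C.
  rewrite (_ : E = \bigcap_i [set w | B i (W b w i ord0 - W a w i ord0)]); last first.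
    by apply/seteqP; split => w /= h i; [move=> _; exact: h|exact: h].
  apply: fin_bigcap_measurable; first exact: finite_finset.
  move=> i _; rewrite -[X in measurable X]setTI.
  apply: (measurable_funB (mW b i _) (mW a i aT)) => //.
  by rewrite bT andbT (le_trans a0 (ltW ab)).
rewrite (@cprob_eq _ (Omega T N) _ _ A A0)//; last exact: measurable_cspace.
rewrite (@cprob_eq _ (Omega T N) _ _ (A `&` E) (A0 `&` E)); last 4 first.
- by apply: measurableI => //; exact: measurable_cspace.
- by apply: measurableI; exact: measurable_cspace.
- by apply: negligibleS n1 => w [[Aw Ew] h]; split => // A0w; apply: h.
- by apply: negligibleS n2 => w [[Aw Ew] h]; split => // A0w; apply: h.
rewrite !cprobE//; last exact: measurableI.
by case: hP => _; apply.
Qed.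

Lemma FW_brownian : brownian (cprob P) T (FW P) (fun j s w => W s w j ord0)
  (fun h => fine (\int[normal_prob 0%R (Num.sqrt h)]_x (x ^+ 2)%:E)) (16 / 3).
Proof.
have mW (j : 'I_N) (s : R) : 0 <= s <= T ->
    measurable_fun setT (fun w : cspace P => W s w j ord0).
  move=> sT; apply: (filt_gmeas_meas FW_filtered sT); apply: FW_coord.
  by case/andP: sT => -> _ /=.
have one (a b : R) (j : 'I_N) A B : 0 <= a -> a < b -> b <= T -> FW P a A ->
    measurable B -> cprob P (A `&` (fun w : cspace P => W b w j ord0 - W a w j ord0) @^-1` B) =
    (cprob P A * normal_prob 0%R (Num.sqrt (b - a)) B)%E.
  move=> a0 ab bT FA mB.
  have := @FW_product a b A (fun i => if i == j then B else setT) a0 ab bT FA.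
  rewrite (bigD1 j)//= eqxx big1 => [|i /negbTE ->]; last exact: probability_setT.
  rewrite mule1 => <-; last by move=> i; case: ifP.
  congr (cprob P (_ `&` _)); apply/seteqP; split => w /=; last by move=> /(_ j); rewrite eqxx.
  by move=> Bw i; case: eqP => // ->.
have s0 (a b : R) : a < b -> 0 < Num.sqrt (b - a) by move=> ab; rewrite sqrtr_gt0 subr_gt0.
have law (a b : R) (j : 'I_N) : 0 <= a -> a < b -> b <= T -> forall B, measurable B ->
    cprob P ((fun w : cspace P => W b w j ord0 - W a w j ord0) @^-1` B) =
    normal_prob 0%R (Num.sqrt (b - a)) B.
  move=> a0 ab bT B mB.
  have := @one a b j setT B a0 ab bT (salgT (filt_sigma FW_filtered a)) mB.
  by rewrite setTI probability_setT mul1e.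
have mD (a b : R) (j : 'I_N) : 0 <= a -> a <= b -> b <= T ->
    measurable_fun setT (fun w : cspace P => W b w j ord0 - W a w j ord0).
  move=> a0 ab bT; apply: measurable_funB; apply: mW.
    by rewrite (le_trans a0 ab).
  by rewrite a0 (le_trans ab bT).
have FAm (a : R) A : 0 <= a -> a <= T -> FW P a A -> measurable (A : set (cspace P)).
  by move=> a0 aT; apply: (filt_meas FW_filtered); rewrite a0.
split.
- by move=> j s /andP[s0' _]; apply: FW_coord; rewrite s0' lexx.
- move=> j a b a0; rewrite le_eqVlt => /orP[/eqP -> bT|ab bT].
    rewrite (_ : (fun w => _) = cst 0); last by apply/funext => w; rewrite subrr.
    exact: sqi_cst.
  split; first exact: mD (ltW ab) bT.
  apply: le_lt_trans (normal_sqr_le (s0 _ _ ab) (mD _ _ _ a0 (ltW ab) bT) (law _ _ _ a0 ab bT)) _.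
  by rewrite ltry.
- move=> j a b A a0; rewrite le_eqVlt => /orP[/eqP -> bT FA|ab bT FA].
    by rewrite integral0_eq// => w _; rewrite subrr.
  apply: (integral_event_mean (s0 _ _ ab) (mD _ _ _ a0 (ltW ab) bT) (law _ _ _ a0 ab bT)).
    by apply: FAm FA => //; exact: le_trans (ltW ab) bT.
  by move=> B mB; exact: one.
- move=> j l a b A jl a0; rewrite le_eqVlt => /orP[/eqP -> bT FA|ab bT FA].
    by rewrite integral0_eq// => w _; rewrite !subrr mulr0.
  set Yj := fun w : cspace P => W b w j ord0 - W a w j ord0.
  set Yl := fun w : cspace P => W b w l ord0 - W a w l ord0.
  have mA : measurable (A : set (cspace P)).
    by apply: FAm FA => //; exact: le_trans (ltW ab) bT.
  have mYj : measurable_fun setT Yj by exact: mD (ltW ab) bT.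
  have mYl : measurable_fun setT Yl by exact: mD (ltW ab) bT.
  have sqY (i : 'I_N) : sqi (cprob P) (fun w => W b w i ord0 - W a w i ord0).
    split; first exact: mD (ltW ab) bT.
    apply: le_lt_trans (normal_sqr_le (s0 _ _ ab) (mD _ _ _ a0 (ltW ab) bT) (law _ _ _ a0 ab bT)) _.
    by rewrite ltry.
  have two B B' : measurable B -> measurable B' ->
      cprob P (A `&` Yj @^-1` B `&` Yl @^-1` B') =
      (cprob P (A `&` Yj @^-1` B) * normal_prob 0%R (Num.sqrt (b - a)) B')%E.
    move=> mB mB'; rewrite [in RHS]one//.
    have := @FW_product a b A (fun i => if i == j then B else if i == l then B' else setT) a0 ab bT FA.
    rewrite (bigD1 j)//= eqxx (bigD1 l)//=; last by rewrite eq_sym.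
    rewrite eq_sym (negbTE jl) eqxx big1 => [|i /andP[/negbTE -> /negbTE ->]]; last exact: probability_setT.
    rewrite mule1 muleA => <-; last by move=> i; case: ifP => // _; case: ifP.
    rewrite -setIA; congr (cprob P (_ `&` _)); apply/seteqP; split => w /=.
      by move=> [Bj Bl] i; case: eqP => [->//|_]; case: eqP => // ->.
    by move=> h; have := h j; have := h l; rewrite !eqxx eq_sym (negbTE jl).
  rewrite (integral_indicM _ _ mA).
  pose G := preimage_set_system setT Yj measurable.
  have Gs : sigma_algebra setT G.
    by apply: sigma_algebra_preimage; exact: sigma_algebra_measurable.
  have Gm : G `<=` measurable by move=> _ [B mB <-]; exact: mYj.
  have bA w : `|\1_A w : R| <= 1.
    by rewrite indicE; case: (w \in A); rewrite ?normr1// normr0.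
  have m1 : measurable_fun setT (\1_A : cspace P -> R) by exact: measurable_indic.
  (* The covariance: Y_j is taken as the weight, and the indicator of A times Y_l has mean zero on
     every event {Y_j in B}, because Y_l is independent of A together with Y_j. *)
  under eq_integral do rewrite mulrCA.
  apply: (integral_indep0 Gs Gm (Y := fun w => \1_A w * Yl w)).
  + exact: sqi_integrable (sqiM m1 bA (sqY l)).
  + move=> _ [B mB <-]; rewrite setTI.
    have mB' : measurable (Yj @^-1` B) by rewrite -[X in measurable X]setTI; exact: mYj.
    rewrite (integral_indicM _ _ mB').
    under eq_integral do rewrite mulrA.
    transitivity (\int[cprob P]_(w in A `&` Yj @^-1` B) (Yl w)%:E)%E.
      rewrite (integral_indicM _ _ (measurableI _ _ mA mB')).
      by apply: eq_integral => w _; rewrite indicI/= [in RHS](mulrC (\1_A w)).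
    apply: (integral_event_mean (s0 _ _ ab) mYl (law _ _ _ a0 ab bT)); first exact: measurableI.
    by move=> B' mB''; exact: two.
  + by move=> B mB; exists B => //; rewrite setTI.
  + exact: sqiMi (sqY j) (sqiM m1 bA (sqY l)).
- move=> j a b A a0 ab bT FA.
  rewrite (integral_event_sqr (mD _ _ _ a0 (ltW ab) bT) (law _ _ _ a0 ab bT)).
  + rewrite fineK//; have /andP[h1 h2] := normal_variance (s0 _ _ ab).
    by rewrite ge0_fin_numE// (le_lt_trans h2)// ltry.
  + by apply: FAm FA => //; exact: le_trans (ltW ab) bT.
  + by move=> B mB; exact: one.
- move=> h h0; have sh0 : 0 < Num.sqrt h by rewrite sqrtr_gt0.
  have /andP[h1 h2] := normal_variance sh0.
  rewrite sqr_sqrtr in h2; last exact: ltW.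
  rewrite fine_ge0//=.
  by rewrite -lee_fin fineK// ge0_fin_numE// (le_lt_trans h2)// ltry.
Qed.

End wiener.

Section matrix_norms.
Context (R : realType) (p q : nat).
Implicit Type A : 'M[R]_(p, q).

Lemma coord_le_norm A i j : `|A i j| <= `|A|.
Proof. by rewrite [leRHS]/Num.Def.normr/= mx_normrE; apply/bigmax_geP; right => /=; exists (i, j). Qed.

Lemma norm_le_coord A (c : R) : 0 <= c -> (forall i j, `|A i j| <= c) -> `|A| <= c.
Proof.
move=> c0 h; rewrite [leLHS]/Num.Def.normr/= mx_normrE; apply/bigmax_leP; split => //= -[i j] _.
Qed.

Lemma enorm_ge0 A : 0 <= enorm A.
Proof. exact: sqrtr_ge0. Qed.

Lemma sqr_enorm A : enorm A ^+ 2 = \sum_i \sum_j A i j ^+ 2.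
Proof.
by rewrite sqr_sqrtr//; apply: sumr_ge0 => i _; apply: sumr_ge0 => j _; exact: sqr_ge0.
Qed.

Lemma sqr_coord_le_enorm A i j : A i j ^+ 2 <= enorm A ^+ 2.
Proof.
rewrite sqr_enorm (bigD1 i)//= (bigD1 j)//= -addrA lerDl.
by rewrite addr_ge0// sumr_ge0// => k _; rewrite ?sqr_ge0// sumr_ge0// => l _; exact: sqr_ge0.
Qed.

Lemma coord_le_enorm A i j : `|A i j| <= enorm A.
Proof.
rewrite -(ler_pXn2r (n := 2))// ?nnegrE ?enorm_ge0//.
by rewrite real_normK ?num_real// sqr_coord_le_enorm.
Qed.

Lemma norm_le_enorm A : `|A| <= enorm A.
Proof. by apply: norm_le_coord => [|i j]; [exact: enorm_ge0|exact: coord_le_enorm]. Qed.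

Lemma enorm_le_norm A : enorm A <= (p * q)%:R * `|A|.
Proof.
rewrite -(ler_pXn2r (n := 2))// ?nnegrE ?enorm_ge0 ?mulr_ge0//.
rewrite sqr_enorm exprMn.
apply: (@le_trans _ _ (\sum_(i < p) \sum_(j < q) `|A| ^+ 2)).
  apply: ler_sum => i _; apply: ler_sum => j _.
  by rewrite -(real_normK (num_real (A i j))) ler_pXn2r ?nnegrE// coord_le_norm.
under eq_bigr do rewrite sumr_const card_ord.
rewrite sumr_const card_ord -mulrnA -[leLHS]mulr_natl ler_wpM2r ?sqr_ge0//.
by rewrite -natrX ler_nat [leqLHS]mulnC; case: (p * q)%N => // k; rewrite expnS leq_pmulr.
Qed.

End matrix_norms.

(** phi is continuous only relative to D, so the preimage of an open interval is D cut by an open V.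
    This V is a countable union of boxes with rational centres, and a box is tested coordinatewise,
    which is how g and h are known to be measurable. *)
Lemma measurable_within_comp d (Z : measurableType d) (R : realType) (E : set Z)
    (n m : nat) (D : set ('cV[R]_n * 'cV[R]_m)) (phi : 'cV[R]_n * 'cV[R]_m -> R)
    (g : Z -> 'cV[R]_n) (h : Z -> 'cV[R]_m) :
  measurable E -> {within D, continuous phi} ->
  (forall i, measurable_fun E (fun z => g z i ord0)) ->
  (forall i, measurable_fun E (fun z => h z i ord0)) ->
  (forall z, E z -> D (g z, h z)) -> measurable_fun E (fun z => phi (g z, h z)).
Proof.
move=> mE cphi mg mh gh; apply: (measurability _ (RGenOpens.measurableE R)).
move=> _ [_ [lo [hi ->] <-]].
have := (continuousP (phi : subspace D -> R)).1 cphi _ (@interval_open _ (BRight lo) (BLeft hi) isT isT).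
move=> /open_subspaceP[V Vo VD].
pose box (a : 'cV[rat]_n * 'cV[rat]_m * nat) : set ('cV[R]_n * 'cV[R]_m) :=
  [set p : 'cV[R]_n * 'cV[R]_m | (forall i, `|p.1 i ord0 - ratr (a.1.1 i ord0)| < a.2.+1%:R^-1) /\
           (forall i, `|p.2 i ord0 - ratr (a.1.2 i ord0)| < a.2.+1%:R^-1)].
have VE : V = \bigcup_(a in [set a | box a `<=` V]) box a.
  apply/seteqP; split => [p Vp|p [a /= h1 h2]]; last exact: h1.
  have /nbhs_ballP[e /= e0 eV] : nbhs p V by exact: open_nbhs_nbhs.
  have [k _ /(_ k (leqnn _)) ke] := near_infty_natSinv_lt (PosNum (divr_gt0 e0 (ltr0n _ 2))).
  have k0 : 0 < (k.+1%:R^-1 : R) by rewrite invr_gt0.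
  have rat_near (c : R) : exists q : rat, `|c - ratr q| < k.+1%:R^-1.
    have : c - k.+1%:R^-1 < c + k.+1%:R^-1 by rewrite ltrD2l gtrN.
    move=> /rat_in_itvoo[q]; rewrite in_itv/= => /andP[q1 q2]; exists q.
    by rewrite distrC ltr_distl q1 q2.
  have /choice[q1 Hq1] := fun i => rat_near (p.1 i ord0).
  have /choice[q2 Hq2] := fun i => rat_near (p.2 i ord0).
  exists (\col_i q1 i, \col_i q2 i, k) => /=; last first.
    by split => i /=; rewrite mxE.
  move=> y [/= y1 y2]; apply: eV; split; split => // i j; rewrite (ord1 j) /=.
    rewrite /ball/= (le_lt_trans (ler_distD (ratr (q1 i)) _ _))//.
    rewrite [ltRHS](splitr e); apply: ltrD; first exact: lt_trans (Hq1 i) ke.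
    by rewrite distrC; have := y1 i; rewrite mxE => h'; exact: lt_trans h' ke.
  rewrite /ball/= (le_lt_trans (ler_distD (ratr (q2 i)) _ _))//.
  rewrite [ltRHS](splitr e); apply: ltrD; first exact: lt_trans (Hq2 i) ke.
  by rewrite distrC; have := y2 i; rewrite mxE => h'; exact: lt_trans h' ke.
have mcoord (f : Z -> R) (c e : R) : measurable_fun E f ->
    measurable (E `&` [set z | `|f z - c| < e]).
  move=> mf; have -> : [set z | `|f z - c| < e] = f @^-1` `]c - e, c + e[.
    by apply/seteqP; split => z /=; rewrite in_itv/= ltr_distl.
  exact: mf.
have mbox a : measurable (E `&` (fun z => (g z, h z)) @^-1` box a).
  rewrite (_ : _ `&` _ = (E `&` \bigcap_i (E `&` [set z | `|g z i ord0 - ratr (a.1.1 i ord0)| < a.2.+1%:R^-1]))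
    `&` (E `&` \bigcap_i (E `&` [set z | `|h z i ord0 - ratr (a.1.2 i ord0)| < a.2.+1%:R^-1]))).
    apply: measurableI; apply: measurableI => //; apply: fin_bigcap_measurable => // i _; exact: mcoord.
  apply/seteqP; split => z /=.
    by move=> [Ez [h1 h2]]; split; split => // i _; split => //=.
  move=> [[Ez h1] [_ h2]]; split => //; split => i; [exact: (h1 i I).2|exact: (h2 i I).2].
rewrite [X in measurable X](_ : _ = \bigcup_a (if pselect (box a `<=` V) then
    (E `&` (fun z => (g z, h z)) @^-1` box a) else set0)).
  apply: countable_bigcupT_measurable; first exact: countableP.
  by move=> a; case: pselect => aV /=; [exact: mbox|exact: measurable0].
apply/seteqP; split => z /=.
  move=> [Ez Oz]; have : (V `&` D) (g z, h z) by rewrite VD; split => //; exact: gh.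
  move=> [+ _]; rewrite [X in X _]VE => -[a /= aV az]; exists a => //.
  by case: (pselect (box a `<=` V)).
move=> [a _]; case: (pselect (box a `<=` V)) => // aV [Ez az]; split => //.
have : (V `&` D) (g z, h z) by split; [exact: aV|exact: gh].
by rewrite VD => -[].
Qed.

Section canonical_ito.
Context (R : realType) (T : R) (hT : 0 < T) (N : nat).
Context (P : probability (Omega T N) R) (hP : wiener_measure P).

Definition time_pos : set (R * cspace P) := [set z | 0 < z.1 <= T].

Lemma measurable_time_space : measurable (time_space : set (R * cspace P)).
Proof.
rewrite (_ : time_space = `[0, T]%classic `*` setT).
  by apply: measurableX.
by apply/seteqP; split => -[s w] /=; rewrite in_itv/=; [split|case].
Qed.

Lemma measurable_time_pos : measurable time_pos.
Proof.
rewrite (_ : time_pos = `]0, T]%classic `*` setT).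
  by apply: measurableX.
by apply/seteqP; split => -[s w] /=; rewrite in_itv/=; [split|case].
Qed.

Lemma predictable_measurable p q (H : R -> cpath T N -> 'M[R]_(p, q)) i j :
  predictable (FW P) H ->
  measurable_fun (time_space : set (R * cspace P)) (fun z => H z.1 z.2 i j).
Proof.
move=> pH _ B mB.
suff sub : <<s time_space, predictable_rectangles (FW P) >> `<=`
    (measurable : set (set (R * cspace P))).
  by apply: sub; exact: pH.
apply: smallest_sub.
  split => //; first by move=> A mA; apply: measurableD => //; exact: measurable_time_space.
  by move=> A mA; exact: bigcup_measurable.
have FWm (s : R) A : 0 <= s -> s <= T -> FW P s A -> measurable (A : set (cspace P)).
  by move=> s0 sT; apply: (filt_meas (FW_filtered P)); rewrite s0.
move=> D [[A F0A ->]|[s [r [A [s0 sr rT FA ->]]]]].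
  by apply: measurableX; [exact: measurable_set1|apply: (FWm 0) => //; exact: ltW].
apply: measurableX; last by apply: FWm FA => //; exact: le_trans sr rT.
by rewrite (_ : [set a | _] = `]s, r]%classic).
Qed.

Lemma jmeas_clip (h : R -> cspace P -> R) :
  measurable_fun time_pos (fun z => h z.1 z.2) ->
  jmeas (fun s w => (0 < s <= T)%R%:R * h s w).
Proof.
move=> mh; rewrite /jmeas (_ : (fun z => _) = (fun z => h z.1 z.2) \_ time_pos).
  exact/(measurable_restrictT _ measurable_time_pos).
apply/funext => -[s w]; rewrite patchE /=; case: ifPn; rewrite ?inE/=.
  by rewrite /time_pos/= => ->; rewrite mul1r.
by rewrite notin_setE => /negP/negbTE /= ->; rewrite mul0r.
Qed.

Lemma predictable_jmeas p q (H : R -> cpath T N -> 'M[R]_(p, q)) i j :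
  predictable (FW P) H ->
  @jmeas _ (cspace P) R (fun s w => (0 < s <= T)%R%:R * H s w i j).
Proof.
move=> pH; apply: (jmeas_clip (h := fun s w => H s w i j)).
apply: measurable_funS (predictable_measurable i j pH).
- exact: measurable_time_space.
- by move=> [s w]; rewrite /time_pos /time_space/= => /andP[/ltW -> ->].
Qed.

Definition wcoord (j : 'I_N) (s : R) (w : cspace P) : R := W s w j ord0.

Lemma expectation_barE (Y : cpath T N -> \bar R) :
  expectation_bar P Y = (\int[cprob P]_w Y w)%E.
Proof. by []. Qed.

Lemma cvge0_le (u v : (\bar R)^nat) : (forall k, 0 <= u k)%E ->
  (forall k, u k <= v k)%E -> v @ \oo --> 0%E -> u @ \oo --> 0%E.
Proof.
move=> u0 uv v0; apply: (squeeze_cvge _ (cvg_cst _) v0).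
by apply: nearW => k; rewrite u0 uv.
Qed.

(** A pair of a partition index and a noise coordinate becomes one scalar term, so that row i of the
    matrix integrand is a family over such pairs. Both errors are dominated by the Frobenius errors
    in [is_ito_integral]. *)
Lemma is_ito_ito p (H : R -> cpath T N -> 'M[R]_(p, N)) M i :
  is_ito_integral P H M ->
  ito (cprob P) T (FW P) wcoord
    (fun j s w => (0 < s <= T)%R%:R * H s w i j) (fun s w => M s w i ord0).
Proof.
move=> [pH aM cM [S [S1 S2]]].
pose e i k (a : 'I_(si_size (S k)) * 'I_N) : eterm (cspace P) R N :=
  ETerm a.2 (si_time (S k) a.1) (si_time (S k) a.1.+1)
    (fun w : cspace P => si_coef (S k) a.1 w i a.2).
have He i1 k a : @evalid _ (cspace P) R T (FW P) N (e i1 k a).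
  split => /=.
  - by case/andP: (si_time_range (S k) a.1).
  - exact: si_time_mono.
  - by case/andP: (si_time_range (S k) a.1.+1).
  - by move=> B mB; apply: si_coef_measurable.
  - have [K HK] := si_coef_bounded (S k); exists K => w.
    by apply: le_trans (coord_le_enorm _ _ _) _; exact: HK.
have procE i1 k j s w : eproc (e i1 k) j s w = si_process (S k) s w i1 j.
  rewrite /eproc /si_process summxE.
  rewrite (eq_bigl (fun a => a.2 == j)) //.
  rewrite -(pair_big_dep xpredT (fun _ l => l == j) (fun (k0 : 'I_(si_size (S k))) l =>
    (si_time (S k) k0 < s <= si_time (S k) k0.+1)%R%:R * si_coef (S k) k0 w i1 l))/=.
  apply: eq_bigr => k0 _; rewrite big_pred1_eq.
  by case: ifP; rewrite ?mul1r// mul0r mxE.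
have intE i1 k s w : eint wcoord (e i1 k) s w = si_integral (S k) s w i1 ord0.
  rewrite /eint /si_integral summxE.
  rewrite -(pair_bigA _ (fun (k0 : 'I_(si_size (S k))) l => si_coef (S k) k0 w i1 l *
    (W (Num.min (si_time (S k) k0.+1) s) w l ord0 -
     W (Num.min (si_time (S k) k0) s) w l ord0)))/=.
  by apply: eq_bigr => k0 _; rewrite mxE; apply: eq_bigr => l _; rewrite !mxE.
exists (fun k => ('I_(si_size (S k)) * 'I_N)%type), (e i); split; [exact: He| |].
- apply: cvge0_le S1.
    by move=> k; apply: dint_ge0 => *; apply: sumr_ge0 => *; exact: sqr_ge0.
  move=> k; rewrite expectation_barE dintE.
  pose g s (w : cspace P) : R :=
     \sum_i0 \sum_j (eproc (e i0 k) j s w - (0 < s <= T)%R%:R * H s w i0 j) ^+ 2.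
  have jg : jmeas g.
    apply: jmeas_sum => i0; apply: jmeas_sum => j; apply: jmeasX; apply: jmeasB.
      exact: (jmeas_eproc (FW_filtered P)).
    exact: predictable_jmeas.
  have g0 s w : 0 <= g s w.
    by apply: sumr_ge0 => *; apply: sumr_ge0 => *; exact: sqr_ge0.
  have gE (s : R) w : 0 < s <= T -> enorm (si_process (S k) s w - H s w) ^+ 2 = g s w.
    move=> sT; rewrite sqr_enorm; apply: eq_bigr => i0 _; apply: eq_bigr => j _.
    by rewrite !mxE procE sT mul1r.
  under [in leRHS]eq_integral => w _.
    rewrite (_ : (\int[_]_(_ in _) _)%E = sint g 0 T w); last first.
      rewrite sintE -integral_itv_obnd_cbnd.
        by apply: eq_integral => s; rewrite inE/= in_itv/= => sT; rewrite gE.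
      apply/measurable_EFinP.
      apply: (eq_measurable_fun (g ^~ w)).
        by move=> s; rewrite inE/= in_itv/= => sT; rewrite gE.
      by apply: measurable_funTS; exact: jmeas_sect.
    over.
  rewrite -dintE; apply: dint_le; [exact: measurableT| |exact: jg| |exact: g0|].
  + apply: jmeas_sum => j; apply: jmeasX; apply: jmeasB.
      exact: (jmeas_eproc (FW_filtered P)).
    exact: predictable_jmeas.
  + by move=> *; apply: sumr_ge0 => *; exact: sqr_ge0.
  + move=> s w _ _; rewrite /g (bigD1 i)//= lerDl.
    by apply: sumr_ge0 => *; apply: sumr_ge0 => *; exact: sqr_ge0.
- move=> s sT; apply: cvge0_le (S2 s sT).
    by move=> k; apply: integral_ge0 => w _; rewrite lee_fin sqr_ge0.
  move=> k; rewrite expectation_barE.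
  have mc i0 : measurable_fun setT (fun w : cspace P =>
      (si_integral (S k) s w - M s w) i0 ord0).
    rewrite (_ : (fun w => _) = fun w : cspace P =>
      eint wcoord (e i0 k) s w - M s w i0 ord0); last first.
      by apply/funext => w; rewrite !mxE intE.
    apply: measurable_funB; apply: (filt_gmeas_meas (FW_filtered P) sT).
      exact: (gmeas_eint (FW_filtered P) (FW_brownian hP) (He i0 k) sT).
    by move=> B mB; exact: aM.
  apply: ge0_le_integral; first exact: measurableT.
  + by move=> w _; rewrite lee_fin sqr_ge0.
  + apply/measurable_EFinP; apply: measurable_funX.
    by have := mc i; congr measurable_fun; apply/funext => w; rewrite !mxE intE.
  + apply/measurable_EFinP; rewrite (_ : (fun w => _) = fun w =>
      \sum_i0 \sum_j (si_integral (S k) s w - M s w) i0 j ^+ 2); last first.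
      by apply/funext => w; rewrite sqr_enorm.
    apply: measurable_sum => i0; apply: measurable_sum => j.
    by rewrite (ord1 j); apply: measurable_funX.
  + move=> w _; rewrite lee_fin intE.
    by have := sqr_coord_le_enorm (si_integral (S k) s w - M s w) i ord0; rewrite !mxE.
Qed.

End canonical_ito.
Arguments time_pos {R T N} P _.

(** * Controlled equations *)

Lemma lipschitz_fiber (R : realType) (d m p q : nat) (U : set 'cV[R]_m)
    (phi : 'cV[R]_d -> 'cV[R]_m -> 'M[R]_(p, q)) :
  [lipschitz phi p.1 p.2 | p in [set: 'cV[R]_d] `*` U] ->
  exists2 L : R, 0 <= L & forall x y u v, U u -> U v ->
    `|phi x u - phi y v| <= L * Num.max `|x - y| `|u - v|.
Proof.
move=> [L0 [L0r HL]]; exists (Num.max 0 (L0 + 1)); first by rewrite le_max lexx.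
move=> x y u v Uu Uv.
have L0M : L0 < Num.max 0 (L0 + 1) by rewrite lt_max ltrDl ltr01 orbT.
exact: (HL _ L0M ((x, u), (y, v))).
Qed.

Lemma compact_norm_bound (R : realType) (m : nat) (U : set 'cV[R]_m) : compact U ->
  exists2 K : R, 0 <= K & forall u, U u -> `|u| <= K.
Proof.
move=> /compact_bounded[K0 [K0r HK]]; exists (Num.max 0 (K0 + 1)).
  by rewrite le_max lexx.
by apply: HK; rewrite lt_max ltrDl ltr01 orbT.
Qed.

Section coefficients.
Context (R : realType) (d m p q : nat) (U : set 'cV[R]_m).
Context (phi : 'cV[R]_d -> 'cV[R]_m -> 'M[R]_(p, q)).

Record regular_coef (L : R) : Prop := {
  coef_lip : forall x y u, U u -> `|phi x u - phi y u| <= L * `|x - y| ;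
  coef_growth : forall x u, U u -> `|phi x u| <= L * (1 + `|x|) ;
  coef_cont : forall i j, {within [set: 'cV[R]_d] `*` U,
    continuous (fun p => phi p.1 p.2 i j)} }.

(** The conclusion is stated for all larger constants, so that a single L can serve both b and
    sigma. The growth bound uses that the compact U is bounded. *)
Lemma lipschitz_regular : compact U ->
  [lipschitz phi p.1 p.2 | p in [set: 'cV[R]_d] `*` U] ->
  exists2 L0 : R, 0 <= L0 & forall L, L0 <= L -> regular_coef L.
Proof.
move=> /compact_norm_bound[K K0 HK] /lipschitz_fiber[L1 L10 HL].
have [[u0 Uu0]|U0] := pselect (U !=set0); last first.
  exists 0 => // L _; split.
  - by move=> x y u Uu; exfalso; apply: U0; exists u.
  - by move=> x u Uu; exfalso; apply: U0; exists u.
  - move=> i j; apply/subspace_continuousP => -[x u] /= [_ Uu].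
    by exfalso; apply: U0; exists u.
exists (L1 + (`|phi 0 u0| + L1 * (K + K))) => [|L LL].
  by rewrite !addr_ge0// mulr_ge0// addr_ge0.
have h1 : L1 <= L by apply: le_trans LL; rewrite lerDl addr_ge0// mulr_ge0// addr_ge0.
split.
- move=> x y u Uu; apply: le_trans (HL x y u u Uu Uu) _.
  by rewrite subrr normr0 (max_idPl _)// ler_wpM2r.
- move=> x u Uu.
  have := HL x 0 u u0 Uu Uu0; rewrite subr0 => h.
  have h2 : Num.max `|x| `|u - u0| <= `|x| + (K + K).
    rewrite ge_max lerDl addr_ge0//=.
    apply: (le_trans (ler_normB _ _)); apply: (le_trans (lerD (HK _ Uu) (HK _ Uu0))).
    by rewrite lerDr.
  have h3 : `|phi x u| <= `|phi 0 u0| + L1 * (`|x| + (K + K)).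
    rewrite -[phi x u](subrK (phi 0 u0)); apply: (le_trans (ler_normD _ _)).
    by rewrite addrC lerD2l; apply: (le_trans h); rewrite ler_wpM2l.
  apply: (le_trans h3).
  have h4 : (L1 + (`|phi 0 u0| + L1 * (K + K))) * (1 + `|x|) <= L * (1 + `|x|).
    by rewrite ler_wpM2r// addr_ge0.
  apply: le_trans h4; have := normr_ge0 x; have := normr_ge0 (phi 0 u0).
  set z := `|x|; set c := `|phi 0 u0| => c0 z0.
  have : 0 <= (c + L1 * (K + K)) * z by rewrite mulr_ge0// addr_ge0// mulr_ge0// addr_ge0.
  by rewrite !mulrDr !mulrDl !mulr1; nra.
- move=> i j; apply/subspace_continuousP => -[x u] /= [_ Uu].
  apply/cvgrPdist_le => e e0.
  have Lp : 0 < L1 + 1 by rewrite ltr_wpDl.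
  near=> z.
  have Uz : U z.2 by near: z; rewrite near_withinE; apply: nearW => z [].
  apply: le_trans (_ : `|phi x u - phi z.1 z.2| <= _).
    by have := coord_le_norm (phi x u - phi z.1 z.2) i j; rewrite !mxE.
  apply: le_trans (HL _ _ _ _ Uu Uz) _.
  have : Num.max `|x - z.1| `|u - z.2| <= e / (L1 + 1).
    near: z; apply: (@cvg_within _ (nbhs (x, u))).
    apply/nbhs_ballP; exists (e / (L1 + 1)); first by rewrite /= divr_gt0.
    move=> [y v] [/=]; rewrite -!ball_normE/= ge_max => h h'.
    by rewrite !ltW.
  rewrite ler_pdivlMr// => h; apply: le_trans h; rewrite mulrC ler_wpM2l//.
  by rewrite lerDl.
Unshelve. all: by end_near. Qed.

End coefficients.

Section solutions.
Context (R : realType) (T : R) (hT : 0 < T) (N d m : nat).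
Context (P : probability (Omega T N) R) (hP : wiener_measure P).
Context (U : set 'cV[R]_m) (b : 'cV[R]_d -> 'cV[R]_m -> 'cV[R]_d).
Context (sigma : 'cV[R]_d -> 'cV[R]_m -> 'M[R]_(d, N)).
Context (L : R) (L0 : 0 <= L).
Context (rb : regular_coef U b L) (rs : regular_coef U sigma L).

Lemma coord_within_continuous p q (A : set R) (f : R -> 'M[R]_(p, q)) i j :
  {within A, continuous f} -> {within A, continuous (fun s => f s i j)}.
Proof.
move=> cf s; apply: (@continuous_comp _ _ _ (f : subspace A -> _) (fun B : 'M[R]_(p, q) => B i j)).
  exact: cf.
exact: coord_continuous.
Qed.

Lemma time_pos_sub : time_pos P `<=` (time_space : set (R * cspace P)).
Proof. by move=> [s w]; rewrite /time_pos /time_space/= => /andP[/ltW -> ->]. Qed.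

Lemma time_pos_lt_measurable (t : R) : measurable_fun (time_pos P) (fun z => (t < z.1)%R%:R : R).
Proof.
apply: measurable_funTS.
rewrite (_ : (fun _ => _) = (\1_(`]t, +oo[ : set R)) \o fst).
  apply: measurableT_comp; last exact: measurable_fst.
  exact: measurable_indic.
apply/funext => z; rewrite /= indicE; congr (nat_of_bool _)%:R; apply/idP/idP;
  by rewrite inE/= in_itv/= andbT.
Qed.

Lemma process_measurable (Y : R -> cpath T N -> 'cV[R]_d) i :
  adapted (FW P) Y -> continuous_process Y ->
  measurable_fun (time_space : set (R * cspace P)) (fun z => Y z.1 z.2 i ord0).
Proof.
move=> aY cY.
pose tau (s : R) (w : cspace P) : R := Num.max 0 (Num.min s T).
have jt : jmeas tau.
  apply: measurable_maxr; first exact: measurable_cst.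
  by apply: measurable_minr; [exact: measurable_fst|exact: measurable_cst].
have tT s w : 0 <= tau s w <= T by rewrite le_max lexx/= ge_max (ltW hT) ge_min lexx orbT.
have mY (s : R) : 0 <= s <= T -> measurable_fun setT (fun w : cspace P => Y s w i ord0).
  move=> sT; apply: (filt_gmeas_meas (FW_filtered P) sT) => B mB; exact: aY.
have cYi (w : cspace P) : {within `[0, T], continuous (fun s => Y s w i ord0)}.
  exact: coord_within_continuous (@cY w).
have h := jmeas_continuous hT mY cYi jt tT.
apply: eq_measurable_fun (measurable_funTS h) => -[s w]; rewrite inE /tau/= => /andP[/= s0 sT].
by rewrite (min_idPl sT) (max_idPr s0).
Qed.

Context (nu : R -> cpath T N -> 'cV[R]_m) (cnu : controls P U nu).

Lemma coef_measurable (phi : 'cV[R]_d * 'cV[R]_m -> R) (Y : R -> cpath T N -> 'cV[R]_d) :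
  {within [set: 'cV[R]_d] `*` U, continuous phi} ->
  adapted (FW P) Y -> continuous_process Y ->
  measurable_fun (time_space : set (R * cspace P))
    (fun z => phi (Y z.1 z.2, nu z.1 z.2)).
Proof.
move=> cphi aY cY; have [pnu Unu] := cnu.
have mE := @measurable_time_space R T N P.
have h := measurable_within_comp (g := fun z : R * cspace P => Y z.1 z.2)
  (h := fun z : R * cspace P => nu z.1 z.2) mE cphi.
apply: h.
- by move=> i; exact: process_measurable.
- by move=> i; exact: predictable_measurable.
- by move=> [s w] /= sT; split => //=; exact: Unu.
Qed.

(** The cutoff at t writes an equation started at t as an integral over ]0, s], whatever t is; the
    cutoff to ]0, T] gives joint measurability on the whole line. *)
Definition drift (Y : R -> cpath T N -> 'cV[R]_d) (t : R) (i : 'I_d) (s : R)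
    (w : cspace P) : R :=
  (0 < s <= T)%R%:R * ((t < s)%R%:R * b (Y s w) (nu s w) i ord0).

Definition diffusion (Y : R -> cpath T N -> 'cV[R]_d) (t : R) (i : 'I_d)
    (j : 'I_N) (s : R) (w : cspace P) : R :=
  (0 < s <= T)%R%:R * (if t < s then sigma (Y s w) (nu s w) else 0) i j.

Context (Y : R -> cpath T N -> 'cV[R]_d).
Context (aY : adapted (FW P) Y) (cY : continuous_process Y).

Lemma jmeas_drift t i : jmeas (drift Y t i).
Proof.
apply: (jmeas_clip (h := fun s w => (t < s)%R%:R * b (Y s w) (nu s w) i ord0)).
apply: measurable_funM; first exact: time_pos_lt_measurable.
have h : measurable_fun (time_space : set (R * cspace P))
    (fun z => b (Y z.1 z.2) (nu z.1 z.2) i ord0).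
  have h2 := coef_measurable (@coef_cont _ _ _ _ _ _ _ _ rb i ord0) aY cY.
  exact h2.
exact: (measurable_funS (@measurable_time_space R T N P) time_pos_sub h).
Qed.

Lemma jmeas_diffusion t i j : jmeas (diffusion Y t i j).
Proof.
have -> : diffusion Y t i j = fun s w => (0 < s <= T)%R%:R *
    ((t < s)%R%:R * sigma (Y s w) (nu s w) i j).
  apply/funext => s; apply/funext => w; rewrite /diffusion; congr (_ * _).
  by case: ifP => _; rewrite ?mul1r// mul0r mxE.
apply: (jmeas_clip (h := fun s w => (t < s)%R%:R * sigma (Y s w) (nu s w) i j)).
apply: measurable_funM; first exact: time_pos_lt_measurable.
have h : measurable_fun (time_space : set (R * cspace P))
    (fun z => sigma (Y z.1 z.2) (nu z.1 z.2) i j).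
  have h2 := coef_measurable (@coef_cont _ _ _ _ _ _ _ _ rs i j) aY cY.
  exact h2.
exact: (measurable_funS (@measurable_time_space R T N P) time_pos_sub h).
Qed.

Lemma process_bounded w : exists2 K : R, 0 <= K & forall s : R, 0 <= s <= T -> `|Y s w| <= K.
Proof.
have := continuous_compact (@cY w) (@segment_compact _ 0 T).
move=> /compact_norm_bound[K K0 HK]; exists K => // s sT.
by apply: HK; exists s => //=; rewrite in_itv.
Qed.

Lemma drift_bounded t i w : exists K : R, forall s, `|drift Y t i s w| <= K.
Proof.
have [K K0 HK] := process_bounded w; exists (L * (1 + K)) => s.
have LK0 : 0 <= L * (1 + K) by rewrite mulr_ge0// addr_ge0.
rewrite /drift; have [/andP[s0 sT]|_] := boolP (0 < s <= T); last by rewrite mul0r normr0.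
rewrite mul1r; case: (t < s); last by rewrite mul0r normr0.
rewrite mul1r; apply: (le_trans (coord_le_norm _ _ _)).
have sT' : 0 <= s <= T by rewrite ltW.
apply: (le_trans (coef_growth rb _ _)); first by have [_] := cnu; apply.
by rewrite ler_wpM2l// lerD2l HK.
Qed.

Lemma drift_integrable t i w (A : set R) : measurable A -> (lebesgue_measure A < +oo)%E ->
  lebesgue_measure.-integrable A (EFin \o (drift Y t i ^~ w)).
Proof.
move=> mA Afin; have [K HK] := drift_bounded t i w.
apply: measurable_bounded_integrable => //.
  by apply: measurable_funTS; exact: jmeas_sect (jmeas_drift t i).
exists K; split; first exact: num_real.
by move=> M KM s _; apply: (le_trans (HK s)); exact: ltW.
Qed.

(** For times s < t, [sde_solution] does not relate M to Y. That M vanishes there is a consequence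
    of the absence of noise before t, and it extends the equation to all of [0, T]. *)
Lemma is_ito_early p (H : R -> cpath T N -> 'M[R]_(p, N)) M (t : R) :
  0 <= t <= T -> is_ito_integral P H M -> (forall (r : R) w, 0 < r < t -> H r w = 0) ->
  {ae cprob P, forall w, forall i (s : R), 0 <= s <= t -> M s w i ord0 = 0}.
Proof.
move=> tT iM H0; have [pH aM cM _] := iM.
have iM' i := is_ito_ito hT hP i iM.
have mM i (s : R) : 0 <= s <= T -> measurable_fun setT (fun w : cspace P => M s w i ord0).
  by move=> sT; apply: (filt_gmeas_meas (FW_filtered P) sT) => B mB; exact: aM.
have h0 : 0 <= (0 : R) <= T by rewrite lexx ltW.
have M0 : {ae cprob P, forall w, forall i (s : R), 0 <= s <= t -> M s w i ord0 = M 0 w i ord0}.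
  apply: filter_forall => i.
  have st : stopping T (FW P) (fun _ : cspace P => t).
    split => // s sT; have [ts|st] := leP t s.
      rewrite (_ : [set _ | _] = setT); first exact: salgT (filt_sigma (FW_filtered P) s).
      by apply/seteqP; split.
    rewrite (_ : [set _ | _] = set0); first exact: salg0 (filt_sigma (FW_filtered P) s).
    by apply/seteqP; split.
  have cMi (w : cspace P) : {within `[0, T], continuous (fun s => M s w i ord0)}.
    exact: coord_within_continuous (@cM w).
  have := @ito_noise_free _ _ _ _ _ hT _ (FW_filtered P) _ _ _ _ (FW_brownian hP)
    _ _ (fun j => predictable_jmeas hT i j pH) (mM i) cMi (iM' i) 0 setT _ h0
    (salgT (filt_sigma (FW_filtered P) 0)) st.
  have D0 j (w : cspace P) (r : R) : setT w -> 0 < r < t -> (0 < r <= T)%R%:R * H r w i j = 0.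
    by move=> _ rt; rewrite H0// mxE mulr0.
  move=> /(_ D0); apply: filterS => w /(_ I); exact.
have M00 : {ae cprob P, forall w, forall i, M 0 w i ord0 = 0}.
  apply: filter_forall => i; apply: integral_sqr_eq0; first exact: mM.
  by rewrite (ito_at0 hT (iM' i)).
have Fae : Filter (almost_everywhere (cprob P)) by exact: ae_filter_ringOfSetsType.
by apply: (@filterS2 _ _ Fae _ _ _ _ M0 M00) => w h1 h2 i s st; rewrite h1.
Qed.

Lemma sde_ito (t : R) (x : 'cV[R]_d) : 0 <= t <= T ->
  sde_solution P b sigma nu t x Y -> exists M : R -> cspace P -> 'cV[R]_d,
  [/\ adapted (FW P) M, continuous_process M,
      (forall i, ito (cprob P) T (FW P) (@wcoord R T N P) (diffusion Y t i)
         (fun s w => M s w i ord0)) &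
      {ae cprob P, forall w, forall s : R, 0 <= s <= T -> forall i,
         Y s w i ord0 = x i ord0 +
           \int[@lebesgue_measure R]_(a in `]0, s]) drift Y t i a w + M s w i ord0}].
Proof.
move=> tT [_ _ [M [iM eqM]]]; have /andP[t0 tT'] := tT.
have [_ aM cM _] := iM.
have iM' i := is_ito_ito hT hP i iM.
exists M; split => //.
have M0 : {ae cprob P, forall w, forall i (s : R), 0 <= s <= t -> M s w i ord0 = 0}.
  by apply: (is_ito_early tT iM) => r w /andP[_ rt]; rewrite ltNge (ltW rt).
have eqM' := (ae_cprob P _).1 eqM.
have Fae : Filter (almost_everywhere (cprob P)) by exact: ae_filter_ringOfSetsType.
apply: (@filterS2 _ _ Fae _ _ _ _ eqM' M0) => w [e1 e2] hM s /andP[s0 sT] i.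
have [st|ts] := leP s t.
  rewrite e1 ?s0// hM ?s0// addr0.
  rewrite (_ : \int[_]_(_ in _) _ = 0) ?addr0//.
  rewrite /Rintegral integral0_eq// => a; rewrite /= in_itv/= => /andP[a0 as'].
  by rewrite /drift (ltNge t) (le_trans as' st)/= mul0r mulr0.
rewrite e2 ?(ltW ts)// !mxE; congr (_ + _ + _).
have sub : `]0, s]%classic `&` `]t, s]%classic = `]t, s]%classic.
  apply/seteqP; split => a /=; rewrite !in_itv/=; first by case.
  by move=> /andP[ta as']; rewrite ta as' (le_lt_trans t0 ta).
transitivity (\int[@lebesgue_measure R]_(a in `]t, s]) drift Y t i a w).
  rewrite -(Rintegral_itv_obnd_cbnd (f := fun a => b (Y a w) (nu a w) i ord0)); last first.
    apply: eq_integrable (drift_integrable t i w _ _) => //.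
      move=> a; rewrite inE/= in_itv/= => /andP[ta as'].
      by rewrite /drift ta (le_lt_trans t0 ta) (le_trans as' sT) !mul1r.
    by rewrite lebesgue_measure_itv/=; case: ifP => // _; rewrite -EFinB ltry.
  apply: eq_Rintegral => a; rewrite inE/= in_itv/= => /andP[ta as'].
  by rewrite /drift ta (le_lt_trans t0 ta) (le_trans as' sT) !mul1r.
rewrite -sub Rintegral_mkcondr; apply: eq_Rintegral => a.
rewrite inE/= in_itv/= => /andP[a0 as']; rewrite patchE; case: ifPn => //.
rewrite notin_setE/= in_itv/= as' andbT => /negP/negbTE ta.
by rewrite /drift ta mul0r mulr0.
Qed.

End solutions.

Lemma cprob_ae_filter d (S : measurableType d) (R : realType)
    (P : probability S R) : Filter (almost_everywhere (cprob P)).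
Proof. exact: ae_filter_ringOfSetsType. Qed.

Lemma gmeasB dd (Om : measurableType dd) (R : realType) (G : set (set Om)) (f g : Om -> R) :
  sigma_algebra setT G -> gmeas G f -> gmeas G g -> gmeas G (fun w => f w - g w).
Proof.
move=> Gs gf gg; apply/(gmeasP Gs).
by apply: measurable_funB; apply/(gmeasP Gs).
Qed.

(** * Local uniqueness of solutions *)

Section sde_estimates.
Context (R : realType) (T : R) (hT : 0 < T) (N d m : nat).
Context (P : probability (Omega T N) R) (hP : wiener_measure P).
Context (U : set 'cV[R]_m) (b : 'cV[R]_d -> 'cV[R]_m -> 'cV[R]_d).
Context (sigma : 'cV[R]_d -> 'cV[R]_m -> 'M[R]_(d, N)).
Context (L : R) (L0 : 0 <= L).
Context (rb : regular_coef U b L) (rs : regular_coef U sigma L).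

Lemma itv_lebesgue_fin (a c : R) : (lebesgue_measure (`]a, c] : set R) < +oo)%E.
Proof. by rewrite lebesgue_measure_itv/=; case: ifP => // _; rewrite -EFinB ltry. Qed.

Lemma sqr_norm_le_sum (x : 'cV[R]_d) : `|x| ^+ 2 <= \sum_i x i ord0 ^+ 2.
Proof.
have -> : \sum_i x i ord0 ^+ 2 = enorm x ^+ 2.
  by rewrite sqr_enorm; apply: eq_bigr => i _; rewrite big_ord1.
by rewrite ler_pXn2r ?nnegrE ?enorm_ge0// norm_le_enorm.
Qed.

Let zeroP : 0 <= (0 : R) <= T. Proof. by rewrite lexx ltW. Qed.

(** Uniqueness in [hX] compares two solutions for the same control; here two controls agree only up
    to th. Until th the Lipschitz bounds dominate the difference of the coefficients by the
    difference of the states, so the a priori bound stopped at th is 0. *)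
Lemma sde_local nu nu' (Y Y' : R -> cpath T N -> 'cV[R]_d) x (th : cspace P -> R) :
  controls P U nu -> controls P U nu' ->
  sde_solution P b sigma nu 0 x Y -> sde_solution P b sigma nu' 0 x Y' ->
  stopping T (FW P) th ->
  (forall w (s : R), 0 < s <= th w -> nu s w = nu' s w) ->
  {ae cprob P, forall w, forall s : R, 0 <= s <= th w -> Y s w = Y' s w}.
Proof.
move=> cnu cnu' sY sY' sth nn'.
have [aY cY _] := sY; have [aY' cY' _] := sY'.
have [M [aM cM iM eM]] := sde_ito hT hP L0 rb cnu aY cY zeroP sY.
have [M' [aM' cM' iM' eM']] := sde_ito hT hP L0 rb cnu' aY' cY' zeroP sY'.
have thT w : 0 <= th w <= T by have [] := sth.
pose D i s (w : cspace P) := Y s w i ord0 - Y' s w i ord0.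
pose NN i s (w : cspace P) := M s w i ord0 - M' s w i ord0.
pose beta i s (w : cspace P) := drift b nu Y 0 i s w - drift b nu' Y' 0 i s w.
pose H i j s (w : cspace P) := diffusion sigma nu Y 0 i j s w - diffusion sigma nu' Y' 0 i j s w.
have gB (Z Z' : R -> cpath T N -> 'cV[R]_d) i (s : R) : adapted (FW P) Z -> adapted (FW P) Z' ->
    0 <= s <= T -> gmeas (FW P s) (fun w : cspace P => Z s w i ord0 - Z' s w i ord0).
  move=> aZ aZ' sT; have Gs := filt_sigma (FW_filtered P) s.
  exact: (gmeasB Gs (aZ s sT i ord0) (aZ' s sT i ord0)).
have cB (Z Z' : R -> cpath T N -> 'cV[R]_d) i (w : cspace P) : continuous_process Z -> continuous_process Z' ->
    {within `[0, T], continuous (fun s => Z s w i ord0 - Z' s w i ord0)}.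
  move=> cZ cZ' s; apply: cvgB.
    exact: (coord_within_continuous (i := i) (j := ord0) (@cZ w)).
  exact: (coord_within_continuous (i := i) (j := ord0) (@cZ' w)).
have mMc (Z : R -> cpath T N -> 'cV[R]_d) i (s : R) : adapted (FW P) Z -> 0 <= s <= T ->
    measurable_fun setT (fun w : cspace P => Z s w i ord0).
  move=> aZ sT; apply: (filt_gmeas_meas (FW_filtered P) sT) => B mB.
  exact: (aZ s sT i ord0 B mB).
have key (s : R) : 0 <= s <= T ->
    (\int[cprob P]_w (\sum_i D i (Num.min s (th w)) w ^+ 2)%:E <= 0)%E.
  move=> sT.
  have LL0 : 0 <= L ^+ 2 by exact: sqr_ge0.
  refine (le_trans (@apriori _ _ _ _ _ hT _ (FW_filtered P) _ _ _ _ (FW_brownian hP) d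
      D beta NN H (fun=> 0) _ _ _ _ _ _ _ _ th sth 0 (L ^+ 2) (lexx 0) LL0 _ _ s sT) _).
    - by move=> i r rT; exact: gB.
    - by move=> i w; exact: cB.
    - by move=> i r rT; exact: gB.
    - by move=> i w; exact: cB.
    - by move=> i; apply: jmeasB; exact: (jmeas_drift hT rb).
    - by move=> i j; apply: jmeasB; exact: (jmeas_diffusion hT rs).
    - move=> i.
      exact: (ito_sub hT (FW_filtered P) (FW_brownian hP)
        (jmeas_diffusion hT rs cnu aY cY 0 i) (jmeas_diffusion hT rs cnu' aY' cY' 0 i)
        (fun r rT => mMc M i r aM rT) (fun r rT => mMc M' i r aM' rT) (iM i) (iM' i)).
    - apply: (@filterS2 _ _ (cprob_ae_filter P) _ _ _ _ eM eM') => w e e' r rT i.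
      have id (nu1 : R -> cpath T N -> 'cV[R]_m) (Y1 : R -> cpath T N -> 'cV[R]_d) :
          controls P U nu1 -> adapted (FW P) Y1 -> continuous_process Y1 ->
          lebesgue_measure.-integrable `]0, r] (EFin \o (drift b nu1 Y1 0 i ^~ w)).
        move=> c1 a1 c2; apply: (drift_integrable hT L0 rb c1 a1 c2 0 i w) => //.
        exact: itv_lebesgue_fin.
      rewrite /D /beta /NN (e r rT i) (e' r rT i) RintegralB//; [|exact: id..].
      by rewrite add0r; ring.
    - move=> i r w /andP[r0 rth]; rewrite add0r /beta /drift.
      have rT : 0 < r <= T by rewrite r0 (le_trans rth)//; case/andP: (thT w).
      rewrite rT r0 !mul1r -nn' ?r0//.
      have Unu : U (nu r w) by have [_] := cnu; apply; case/andP: rT => /ltW -> ->.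
      have := coef_lip rb (Y r w) (Y' r w) Unu; set B := b _ _ - b _ _ => hB.
      have -> : b (Y r w) (nu r w) i ord0 - b (Y' r w) (nu r w) i ord0 = B i ord0.
        by rewrite !mxE.
      have hBi : `|B i ord0| <= L * `|Y r w - Y' r w|.
        by apply: le_trans hB; exact: coord_le_norm.
      rewrite -(real_normK (num_real (B i ord0))).
      apply: (@le_trans _ _ ((L * `|Y r w - Y' r w|) ^+ 2)).
        by rewrite ler_pXn2r ?nnegrE// mulr_ge0.
      rewrite exprMn ler_wpM2l//; apply: le_trans (sqr_norm_le_sum _) _.
      by apply: ler_sum => k _; rewrite /D !mxE.
    - move=> i j r w /andP[r0 rth]; rewrite add0r /H /diffusion.
      have rT : 0 < r <= T by rewrite r0 (le_trans rth)//; case/andP: (thT w).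
      rewrite rT r0 !mul1r -nn' ?r0//.
      have Unu : U (nu r w) by have [_] := cnu; apply; case/andP: rT => /ltW -> ->.
      have := coef_lip rs (Y r w) (Y' r w) Unu; set B := sigma _ _ - sigma _ _ => hB.
      have -> : sigma (Y r w) (nu r w) i j - sigma (Y' r w) (nu r w) i j = B i j.
        by rewrite !mxE.
      have hBi : `|B i j| <= L * `|Y r w - Y' r w|.
        by apply: le_trans hB; exact: coord_le_norm.
      rewrite -(real_normK (num_real (B i j))).
      apply: (@le_trans _ _ ((L * `|Y r w - Y' r w|) ^+ 2)).
        by rewrite ler_pXn2r ?nnegrE// mulr_ge0.
      rewrite exprMn ler_wpM2l//; apply: le_trans (sqr_norm_le_sum _) _.
      by apply: ler_sum => k _; rewrite /D !mxE.
  by rewrite big1 ?mulr0 ?mul0r ?addr0 ?mulr0 ?mul0r// => i _; rewrite expr0n.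
have jDth i : @jmeas _ (cspace P) R (fun s w => D i (Num.min (th w) (Num.max 0 (Num.min s T))) w).
  apply: (jmeas_continuous hT (N := D i)).
  - by move=> r rT; apply: measurable_funB; exact: mMc.
  - by move=> w; exact: cB.
  - apply: measurable_minr; first by apply: jmeas_l; exact: stopping_meas (FW_filtered P) _ sth.
    apply: measurable_maxr; first exact: measurable_cst.
    by apply: measurable_minr; [exact: measurable_fst|exact: measurable_cst].
  - move=> s w; have /andP[t0 t1] := thT w.
    by rewrite le_min t0 ge_min t1 le_max lexx.
have : {ae cprob P, forall w, forall i (s : R), 0 <= s <= T -> D i (Num.min (th w) s) w = 0}.
  apply: filter_forall => i.
  apply: (ae_all_time hT (Z := fun s w => D i (Num.min (th w) s) w)).
    move=> w; apply: (within_itv_comp (f := fun s => D i s w)).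
    + by exact: cB.
    + exact: minr_continuous.
    + move=> s /andP[s0 sT]; have /andP[t0 t1] := thT w.
      by rewrite le_min t0 s0 ge_min t1.
  move=> s sT; have /andP[s0 sT'] := sT; apply: integral_sqr_eq0.
    by have := jmeas_sectr s (jDth i); rewrite (min_idPl sT') (max_idPr s0).
  apply: le_trans (key s sT); apply: ge0_le_integral; first exact: measurableT.
  - by move=> w _; rewrite lee_fin sqr_ge0.
  - apply/measurable_EFinP; apply: measurable_funX.
    by have := jmeas_sectr s (jDth i); rewrite (min_idPl sT') (max_idPr s0).
  - apply/measurable_EFinP; apply: measurable_sum => k; apply: measurable_funX.
    have := jmeas_sectr s (jDth k); rewrite (min_idPl sT') (max_idPr s0).
    by under eq_fun do rewrite minC.
  - move=> w _; rewrite lee_fin minC (bigD1 i)//= lerDl.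
    by apply: sumr_ge0 => *; exact: sqr_ge0.
apply: filterS => w hw s /andP[s0 sth']; apply/matrixP => i j; rewrite (ord1 j).
have sT : 0 <= s <= T by rewrite s0 (le_trans sth')//; case/andP: (thT w).
by have /eqP := hw i s sT; rewrite (min_idPr sth') subr_eq0 => /eqP.
Qed.

End sde_estimates.

(** * Moments and costs of solutions *)

Section sde_moments.
Context (R : realType) (T : R) (hT : 0 < T) (N d m : nat).
Context (P : probability (Omega T N) R) (hP : wiener_measure P).
Context (U : set 'cV[R]_m) (b : 'cV[R]_d -> 'cV[R]_m -> 'cV[R]_d).
Context (sigma : 'cV[R]_d -> 'cV[R]_m -> 'M[R]_(d, N)).
Context (L : R) (L0 : 0 <= L).
Context (rb : regular_coef U b L) (rs : regular_coef U sigma L).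

Lemma adapted_coord_measurable (Z : R -> cpath T N -> 'cV[R]_d) i (s : R) :
  adapted (FW P) Z -> 0 <= s <= T ->
  measurable_fun setT (fun w : cspace P => Z s w i ord0).
Proof.
move=> aZ sT; apply: (filt_gmeas_meas (FW_filtered P) sT) => B mB.
exact: (aZ s sT i ord0 B mB).
Qed.

Let coef_sqr p q (phi : 'cV[R]_d -> 'cV[R]_m -> 'M[R]_(p, q)) (x : 'cV[R]_d) u i j :
  regular_coef U phi L -> U u ->
  phi x u i j ^+ 2 <= 2 * L ^+ 2 + 2 * L ^+ 2 * \sum_k x k ord0 ^+ 2.
Proof.
move=> rphi Uu; have h1 := coef_growth rphi x Uu.
have h2 := le_trans (coord_le_norm (phi x u) i j) h1.
rewrite -(real_normK (num_real (phi x u i j))).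
apply: (@le_trans _ _ ((L * (1 + `|x|)) ^+ 2)).
  by rewrite ler_pXn2r ?nnegrE// mulr_ge0// addr_ge0.
have h3 := sqr_norm_le_sum x; rewrite exprMn.
have : 2 * L ^+ 2 * `|x| ^+ 2 <= 2 * L ^+ 2 * \sum_k x k ord0 ^+ 2.
  by rewrite ler_wpM2l// mulr_ge0// sqr_ge0.
have : L ^+ 2 * (1 + `|x|) ^+ 2 <= L ^+ 2 * (2 + 2 * `|x| ^+ 2).
  rewrite ler_wpM2l ?sqr_ge0//; have := sqr_ge0 (1 - `|x|).
  by rewrite !expr2; nra.
by move=> h4 h5; apply: (le_trans h4); rewrite mulrDr; lra.
Qed.

Let a : R := d%:R * (3 * T + 3 * (16 / 3) * N%:R).
Let E : R := expR (2 * (a * (2 * L ^+ 2) + 1) * T).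
(** The constant of [apriori] with kappa and the Lipschitz factor both equal to 2 L^2. It depends
    neither on the control nor on the starting point, which later makes the value function locally
    bounded. *)
Definition moment_cst : R := 2 * (3 + a * (2 * L ^+ 2) * T) * E.

Let a0 : 0 <= a.
Proof. by rewrite /a mulr_ge0// addr_ge0// !mulr_ge0// ltW. Qed.

Lemma moment_cst_ge0 : 0 <= moment_cst.
Proof.
rewrite /moment_cst mulr_ge0 ?expR_ge0// mulr_ge0// addr_ge0// mulr_ge0 ?(ltW hT)//.
by rewrite mulr_ge0// mulr_ge0// sqr_ge0.
Qed.

Lemma sde_moment nu (t : R) x (Y : R -> cpath T N -> 'cV[R]_d) :
  controls P U nu -> 0 <= t <= T -> sde_solution P b sigma nu t x Y ->
  forall s : R, 0 <= s <= T ->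
  (\int[cprob P]_w (\sum_i Y s w i ord0 ^+ 2)%:E <=
   (moment_cst * (1 + \sum_i x i ord0 ^+ 2))%:E)%E.
Proof.
move=> cnu tT sY s sT; have [aY cY _] := sY.
have [M [aM cM iM eM]] := sde_ito hT hP L0 rb cnu aY cY tT sY.
have k0 : 0 <= 2 * L ^+ 2 by rewrite mulr_ge0// sqr_ge0.
have sth : stopping T (FW P) (fun _ : cspace P => T).
  split=> [w|r rT]; first by rewrite lexx ltW.
  have [Tr|rT'] := leP T r.
    rewrite (_ : [set _ | _] = setT); first exact: salgT (filt_sigma (FW_filtered P) r).
    by apply/seteqP; split.
  rewrite (_ : [set _ | _] = set0); first exact: salg0 (filt_sigma (FW_filtered P) r).
  by apply/seteqP; split.
have gZ (Z : R -> cpath T N -> 'cV[R]_d) i (r : R) : adapted (FW P) Z -> 0 <= r <= T ->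
    gmeas (FW P r) (fun w : cspace P => Z r w i ord0).
  by move=> aZ rT; exact: (aZ r rT i ord0).
have cZ (Z : R -> cpath T N -> 'cV[R]_d) i (w : cspace P) : continuous_process Z ->
    {within `[0, T], continuous (fun r => Z r w i ord0)}.
  by move=> cZ; exact: (coord_within_continuous (i := i) (j := ord0) (@cZ w)).
have sum0 (r : R) (w : cspace P) : 0 <= \sum_k Y r w k ord0 ^+ 2.
  by apply: sumr_ge0 => *; exact: sqr_ge0.
have bound (r : R) (w : cspace P) (c : R) (u : R) :
    0 < r <= T -> u ^+ 2 <= 2 * L ^+ 2 + 2 * L ^+ 2 * \sum_k Y r w k ord0 ^+ 2 ->
    c = u \/ c = 0 -> c ^+ 2 <= 2 * L ^+ 2 + 2 * L ^+ 2 * \sum_k Y r w k ord0 ^+ 2.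
  by move=> rT h [->|->] //; rewrite expr0n addr_ge0// mulr_ge0.
have Unu (r : R) w : 0 < r <= T -> U (nu r w).
  by move=> /andP[r0 rT]; have [_] := cnu; apply; rewrite ltW.
have h := @apriori _ _ _ _ _ hT _ (FW_filtered P) _ _ _ _ (FW_brownian hP) d
  (fun i r (w : cspace P) => Y r w i ord0)
  (fun i r (w : cspace P) => drift b nu Y t i r w)
  (fun i r (w : cspace P) => M r w i ord0)
  (fun i j r (w : cspace P) => diffusion sigma nu Y t i j r w) (fun i => x i ord0)
  (fun i r rT => gZ Y i r aY rT) (fun i w => cZ Y i w cY)
  (fun i r rT => gZ M i r aM rT) (fun i w => cZ M i w cM)
  (fun i => jmeas_drift hT rb cnu aY cY t i)
  (fun i j => jmeas_diffusion hT rs cnu aY cY t i j) iM eM (fun=> T) sth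
  (2 * L ^+ 2) (2 * L ^+ 2) k0 k0.
have /andP[s0 sT'] := sT.
have h1 : forall (i : 'I_d) (r : R) (w : cspace P), 0 < r <= T ->
    drift b nu Y t i r w ^+ 2 <= 2 * L ^+ 2 + 2 * L ^+ 2 * \sum_k Y r w k ord0 ^+ 2.
  move=> i r w rT; apply: (bound r w _ _ rT (coef_sqr (Y r w) i ord0 rb (Unu r w rT))).
  by rewrite /drift rT mul1r; case: (t < r); [left; rewrite mul1r|right; rewrite mul0r].
have h2 : forall (i : 'I_d) j (r : R) (w : cspace P), 0 < r <= T ->
    diffusion sigma nu Y t i j r w ^+ 2 <= 2 * L ^+ 2 + 2 * L ^+ 2 * \sum_k Y r w k ord0 ^+ 2.
  move=> i j r w rT; apply: (bound r w _ _ rT (coef_sqr (Y r w) i j rs (Unu r w rT))).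
  by rewrite /diffusion rT mul1r; case: (t < r); [left|right; rewrite mxE].
have := h h1 h2 s sT; rewrite (min_idPl sT') => {}h.
apply: (le_trans h); rewrite lee_fin -/a -/E.
set S := \sum_i _; have S0 : 0 <= S by apply: sumr_ge0 => *; exact: sqr_ge0.
have E0 : 0 <= E by exact: expR_ge0.
set X := a * (2 * L ^+ 2) * T.
have X0 : 0 <= X by rewrite mulr_ge0 ?(ltW hT)// mulr_ge0.
have -> : moment_cst * (1 + S) = 2 * ((3 + X) * (1 + S)) * E.
  by rewrite /moment_cst -/X; ring.
rewrite ler_wpM2r// ler_wpM2l//; have := mulr_ge0 X0 S0; nra.
Qed.

Lemma sde_noise_free nu x (Y : R -> cpath T N -> 'cV[R]_d) (r : R) A
    (zeta : cspace P -> R) :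
  controls P U nu -> sde_solution P b sigma nu 0 x Y -> 0 <= r <= T ->
  FW P r A -> stopping T (FW P) zeta ->
  (forall w (s : R), A w -> r < s < zeta w -> sigma (Y s w) (nu s w) = 0) ->
  {ae cprob P, forall w, A w -> forall s : R, r <= s <= zeta w -> forall i,
    Y s w i ord0 = Y r w i ord0 +
      \int[@lebesgue_measure R]_(q in `]r, s]) b (Y q w) (nu q w) i ord0}.
Proof.
move=> cnu sY rT FA sz nf; have [aY cY _] := sY.
have h0 : 0 <= (0 : R) <= T by rewrite lexx ltW.
have [M [aM cM iM eM]] := sde_ito hT hP L0 rb cnu aY cY h0 sY.
have zT w : 0 <= zeta w <= T by have [] := sz.
have hM : {ae cprob P, forall w, forall i, A w -> forall s : R, r <= s <= zeta w ->
    M s w i ord0 = M r w i ord0}.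
  apply: filter_forall => i.
  apply: (ito_noise_free hT (FW_filtered P) (FW_brownian hP)
    (jmeas_diffusion hT rs cnu aY cY 0 i) (fun s sT => adapted_coord_measurable i aM sT)
    _ (iM i) rT FA sz).
    by move=> w; exact: (coord_within_continuous (i := i) (j := ord0) (@cM w)).
  move=> j w s Aw rsz; rewrite /diffusion nf//; case: ifP => _; by rewrite mxE mulr0.
apply: (@filterS2 _ _ (cprob_ae_filter P) _ _ _ _ eM hM) => w e hMw Aw s rsz i.
have /andP[rs' sz'] := rsz; have /andP[z0 zT'] := zT w.
have /andP[r0 rT'] := rT.
have sT : 0 <= s <= T by rewrite (le_trans r0 rs') (le_trans sz' zT').
rewrite (e s sT) (e r rT) (hMw i Aw s rsz).
have h := @Rintegral_itvB R (drift b nu Y 0 i ^~ w) (BRight 0) (BRight s) r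
  (drift_integrable hT L0 rb cnu aY cY 0 i w (measurable_itv _) (itv_lebesgue_fin _ _)).
have -> : \int[lebesgue_measure]_(q in `]r, s]) b (Y q w) (nu q w) i ord0 =
    \int[lebesgue_measure]_(q in `]r, s]) drift b nu Y 0 i q w.
  apply: eq_Rintegral => q; rewrite inE/= in_itv/= => /andP[rq qs].
  have q0 : 0 < q by exact: le_lt_trans rq.
  by rewrite /drift q0 (le_trans qs)//=; [rewrite !mul1r|case/andP: sT].
by rewrite -h ?bnd_simp//; ring.
Qed.

Section running_cost.
Context (f : 'cV[R]_d -> 'cV[R]_m -> R) (Fc : R).
Context (f0 : forall x u, U u -> 0 <= f x u).
Context (cf : {within [set: 'cV[R]_d] `*` U, continuous (fun p => f p.1 p.2)}).
Context (fg : forall x u, U u -> f x u <= Fc * (1 + `|x|)).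

Context (nu : R -> cpath T N -> 'cV[R]_m) (cnu : controls P U nu).
Context (Y : R -> cpath T N -> 'cV[R]_d).
Context (aY : adapted (FW P) Y) (cY : continuous_process Y).

Definition running (t : R) (s : R) (w : cspace P) : R :=
  (0 < s <= T)%R%:R * ((t < s)%R%:R * f (Y s w) (nu s w)).

Lemma running_ge0 t s w : 0 <= running t s w.
Proof.
rewrite /running; have [/andP[s0 sT]|_] := boolP (0 < s <= T); last by rewrite mul0r.
by rewrite !mulr_ge0// f0//; have [_] := cnu; apply; rewrite ltW.
Qed.

Lemma jmeas_running t : jmeas (running t).
Proof.
apply: (jmeas_clip (h := fun s w => (t < s)%R%:R * f (Y s w) (nu s w))).
apply: measurable_funM; first exact: time_pos_lt_measurable.
have h : measurable_fun (time_space : set (R * cspace P))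
    (fun z => f (Y z.1 z.2) (nu z.1 z.2)).
  exact: (coef_measurable hT cnu cf aY cY).
exact: (measurable_funS (@measurable_time_space R T N P) (@time_pos_sub R T N P) h).
Qed.

Lemma running_costE t (w : cspace P) : 0 <= t <= T ->
  (\int[@lebesgue_measure R]_(s in `[t, T]) (f (Y s w) (nu s w))%:E =
   sint (running t) 0 T w)%E.
Proof.
move=> /andP[t0 tT]; rewrite sintE.
have mr : measurable_fun setT (fun s => (running t s w)%:E).
  by apply/measurable_EFinP; exact: jmeas_sect (jmeas_running t).
have sub : `]0, T]%classic `&` `]t, T]%classic = `]t, T]%classic.
  apply/seteqP; split => c /=; rewrite !in_itv/=; first by case.
  by move=> /andP[tc cs]; rewrite tc cs (le_lt_trans t0 tc).
transitivity (\int[@lebesgue_measure R]_(s in `]t, T]) (running t s w)%:E)%E.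
  have rE s : s \in `]t, T]%classic -> (running t s w)%:E = (f (Y s w) (nu s w))%:E.
    rewrite inE/= in_itv/= => /andP[ts sT].
    by rewrite /running (le_lt_trans t0 ts) sT ts !mul1r.
  rewrite -integral_itv_obnd_cbnd.
    by apply/esym; apply: eq_integral => s /rE.
  by apply: eq_measurable_fun (measurable_funTS mr) => s /rE.
rewrite -sub integral_mkcondr; apply: eq_integral => s.
rewrite inE/= in_itv/= => /andP[s0 sT]; rewrite patchE; case: ifPn => //.
rewrite notin_setE/= in_itv/= sT andbT => /negP/negbTE ts.
by rewrite /running ts mul0r mulr0.
Qed.

Lemma cost_dint t : 0 <= t <= T ->
  expectation_bar P (fun w => \int[@lebesgue_measure R]_(s in `[t, T]) (f (Y s w) (nu s w))%:E)%E =
  dint (cprob P) (running t) setT 0 T.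
Proof.
move=> tT; rewrite expectation_barE dintE.
by apply: eq_integral => w _; exact: running_costE.
Qed.

Lemma cost_le t x : 0 <= Fc -> 0 <= t <= T -> sde_solution P b sigma nu t x Y ->
  (dint (cprob P) (running t) setT 0 T <=
   (Fc * T * (2 + moment_cst * (1 + \sum_i x i ord0 ^+ 2)))%:E)%E.
Proof.
move=> Fc0 tT sY.
(* The linear growth of f is absorbed in the second moment through 1 + |y| <= 2 + |y|^2. *)
pose q r (w : cspace P) : R := \sum_i ((0 < r <= T)%R%:R * Y r w i ord0) ^+ 2.
have jY i : @jmeas _ (cspace P) R (fun r w => (0 < r <= T)%R%:R * Y r w i ord0).
  apply: (jmeas_clip (h := fun r w => Y r w i ord0)).
  exact: (measurable_funS (@measurable_time_space R T N P) (@time_pos_sub R T N P)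
    (process_measurable hT i aY cY)).
have jq : jmeas q by apply: jmeas_sum => i; apply: jmeasX; exact: jY.
have q0 r w : 0 <= q r w by apply: sumr_ge0 => *; exact: sqr_ge0.
have j2 : @jmeas _ (cspace P) R (fun _ _ => 2) by exact: jmeas_cst.
have j2q : jmeas (fun r w => 2 + q r w) by exact: jmeasD.
have g0 r w : 0 <= Fc * (2 + q r w) by rewrite mulr_ge0// addr_ge0.
have jFc : @jmeas _ (cspace P) R (fun r w => Fc * (2 + q r w)).
  by apply: jmeasM => //; exact: jmeas_cst.
apply: (@le_trans _ _ (dint (cprob P) (fun r w => Fc * (2 + q r w))%R setT 0 T)).
  apply: dint_le; [exact: measurableT|exact: jmeas_running|exact: jFc|exact: running_ge0|exact: g0|].
  move=> r w _ rT; rewrite /running /q rT mul1r.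
  have Unu : U (nu r w) by have [_] := cnu; apply; case/andP: rT => /ltW -> ->.
  have S0 : 0 <= \sum_i (1%R * Y r w i ord0) ^+ 2 by apply: sumr_ge0 => *; exact: sqr_ge0.
  case: (t < r); last by rewrite mul0r mulr_ge0// addr_ge0.
  rewrite mul1r; apply: (le_trans (fg _ Unu)); rewrite ler_wpM2l//.
  have -> : \sum_i (true%:R * Y r w i ord0) ^+ 2 = \sum_i Y r w i ord0 ^+ 2.
    by apply: eq_bigr => i _; rewrite mul1r.
  have := sqr_norm_le_sum (Y r w).
  by have := sqr_ge0 (`|Y r w| - 1); nra.
rewrite dintZ//; last by move=> r w; rewrite addr_ge0.
rewrite dint_tonelli//; last by move=> r w; rewrite addr_ge0.
rewrite -mulrA EFinM lee_wpmul2l//.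
have mc : 0 <= moment_cst * (1 + \sum_i x i ord0 ^+ 2).
  by rewrite mulr_ge0 ?moment_cst_ge0// addr_ge0// sumr_ge0// => *; exact: sqr_ge0.
apply: (@le_trans _ _ (\int[@lebesgue_measure R]_(s in `]0%R, T])
    (cst (2 + moment_cst * (1 + \sum_i x i ord0 ^+ 2))%:E s))%E); last first.
  rewrite integral_cst//= lebesgue_measure_itv/= lte_fin hT sube0 -EFinM lee_fin.
  by rewrite mulrC.
apply: ge0_le_integral => //.
- by move=> r _; apply: integral_ge0 => w _; rewrite lee_fin addr_ge0.
- apply: measurable_funTS.
  apply: (@measurable_fun_fubini_tonelli_F _ _ _ _ _ (cprob P)
    (fun z : R * cspace P => (2 + q z.1 z.2)%:E)).
    by apply/measurable_EFinP; exact: j2q.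
  by move=> z; rewrite lee_fin addr_ge0.
move=> r; rewrite /= in_itv/= => rT.
have mq : measurable_fun setT (fun w => (q r w)%:E).
  by apply/measurable_EFinP; exact: (jmeas_sectr r jq).
under eq_integral do rewrite EFinD.
rewrite ge0_integralD//; last by move=> w _; rewrite lee_fin.
rewrite integral_cst//= probability_setT mule1 [leRHS]EFinD.
rewrite (@leeD2lE _ 2%:E)//.
have rT' : 0 <= r <= T by case/andP: rT => /ltW -> ->.
apply: le_trans (sde_moment cnu tT sY rT'); rewrite le_eqVlt; apply/orP; left; apply/eqP.
by apply: eq_integral => w _; rewrite /q rT; under eq_bigr do rewrite mul1r.
Qed.

End running_cost.

End sde_moments.

(** * Shift of the canonical space *)

Section measure_agreement.
Context d (S : measurableType d) (R : realType) (P Q : probability S R).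

Lemma agree_dynkin : dynkin [set A | measurable A /\ P A = Q A].
Proof.
split => /=.
- by split; [exact: measurableT|rewrite !probability_setT].
- move=> A [mA PA]; split; first exact: measurableC.
  by rewrite !probability_setC ?PA.
- move=> A tA mA; split; first by apply: bigcup_measurable => k _; have [] := mA k.
  rewrite !measure_semi_bigcup//; first by apply: eq_eseriesr => k _; have [] := mA k.
  + by move=> k; have [] := mA k.
  + by apply: bigcup_measurable => k _; have [] := mA k.
  + by move=> k; have [] := mA k.
  + by apply: bigcup_measurable => k _; have [] := mA k.
Qed.

Lemma agree_sigma (G : set (set S)) : setI_closed G -> G `<=` measurable ->
  (forall A, G A -> P A = Q A) -> forall A, <<s G >> A -> P A = Q A.
Proof.
move=> GI mG PQ A; rewrite -(setI_closed_g_dynkin_g_sigma_algebra GI) => GA.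
have : [set A | measurable A /\ P A = Q A] A.
  move: A GA; apply: smallest_sub; first exact: agree_dynkin.
  by move=> A GA; split; [exact: mG|exact: PQ].
by case.
Qed.

End measure_agreement.

Lemma salg_forall (X : Type) (G : set (set X)) (n : nat) (A : 'I_n -> set X) :
  sigma_algebra setT G -> (forall i, G (A i)) -> G [set x | forall i, A i x].
Proof.
move=> Gs GA; rewrite (_ : [set _ | _] =
    \bigcap_k (if insub k is Some i then A i else setT)).
  by apply: (salg_bigcap Gs) => k; case: insubP => // _; exact: (salgT Gs).
apply/seteqP; split => x /= h.
  by move=> k _; case: insubP.
by move=> i; have := h i I; rewrite valK.
Qed.

(** * Wiener measure under the cyclic shift *)

Section chains.
Context (R : realType) (T : R) (hT : 0 < T) (N : nat).
Context (P : probability (Omega T N) R) (hP : wiener_measure P).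

Record window := Window { wlo : R ; whi : R ; wbox : 'I_N -> set R }.

Definition in_window (v : window) : set (cpath T N) :=
  [set w | forall i, wbox v i (W (whi v) w i ord0 - W (wlo v) w i ord0)].

Definition weight (v : window) : \bar R :=
  (\prod_(i < N) normal_prob 0%R (Num.sqrt (whi v - wlo v)) (wbox v i))%E.

Fixpoint in_windows (l : seq window) : set (cpath T N) :=
  if l is v :: l' then in_window v `&` in_windows l' else setT.

Fixpoint ordered (s : R) (l : seq window) : Prop :=
  if l is v :: l' then [/\ s <= wlo v, wlo v < whi v,
    (forall i, measurable (wbox v i)) & ordered (whi v) l'] else s <= T.

Lemma ordered_le s l : ordered s l -> s <= T.
Proof.
elim: l s => //= v l IH s [h1 h2 _ /IH h3].
by apply: (le_trans h1); apply: (le_trans (ltW h2)).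
Qed.

Lemma ordered_cat s l1 l2 u : ordered s l1 -> all (fun v => whi v <= u) l1 ->
  s <= u -> ordered u l2 -> ordered s (l1 ++ l2).
Proof.
elim: l1 s => [|v l IH] s /=.
  move=> _ _ su; case: l2 => [|v l] /=; first exact: le_trans.
  by move=> [h1 h2 h3 h4]; split => //; exact: le_trans su h1.
move=> [h1 h2 h3 h4] /andP[vu al] su o2; split => //.
exact: IH.
Qed.

Lemma path_events_le (s : R) A : s <= T -> <<s path_events T N s >> A ->
  measurable (A : set (Omega T N)).
Proof.
move=> sT; move: A; apply: smallest_sub; first exact: sigma_algebra_measurable.
by move=> A hA; apply: sub_sigma_algebra; exact: path_events_mono hA.
Qed.

Lemma path_events_sigma_mono (s t : R) : s <= t ->
  <<s path_events T N s >> `<=` <<s path_events T N t >>.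
Proof. by move=> st; apply: sub_smallest2r => //; exact: path_events_mono. Qed.

Lemma path_coord (s r : R) (i : 'I_N) : 0 <= r <= s ->
  gmeas <<s path_events T N s >> (fun w => W r w i ord0).
Proof. by move=> rs B mB; apply: sub_sigma_algebra; exists r => //; exists i, B. Qed.

Lemma in_window_path v : 0 <= wlo v -> wlo v <= whi v -> whi v <= T ->
  (forall i, measurable (wbox v i)) -> <<s path_events T N (whi v) >> (in_window v).
Proof.
move=> v0 vlt vT mB.
have Gs : sigma_algebra setT <<s path_events T N (whi v) >> by exact: smallest_sigma_algebra.
have g i : gmeas <<s path_events T N (whi v) >> (fun w : Omega T N => W (whi v) w i ord0 - W (wlo v) w i ord0).
  by apply: (gmeasB (Om := Omega T N) Gs); apply: path_coord; rewrite ?v0 ?lexx ?vlt ?(le_trans v0 vlt).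
by apply: (salg_forall (A := fun i => [set w : cpath T N | wbox v i (W (whi v) w i ord0 - W (wlo v) w i ord0)]) Gs) => i; exact: g.
Qed.

(** The earliest window is absorbed into the past event, which then belongs to the past of the next
    window. *)
Lemma chain_prob l s A : 0 <= s -> ordered s l -> <<s path_events T N s >> A ->
  P (A `&` in_windows l) = (P A * \prod_(v <- l) weight v)%E.
Proof.
elim: l s A => [|v l IH] s A s0 /=.
  by move=> _ _; rewrite setIT big_nil mule1.
move=> [sv vlt mB ol] sA.
have v0 : 0 <= wlo v by exact: le_trans sv.
have vT := ordered_le ol.
have vA := path_events_sigma_mono sv sA.
rewrite setIA (IH (whi v)) ?big_cons//; last 2 first.
- by rewrite (le_trans v0)// ltW.
- apply: (salgI (@smallest_sigma_algebra _ _ (path_events T N (whi v)))).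
    exact: path_events_sigma_mono (ltW vlt) _ vA.
  by apply: in_window_path => //; exact: ltW.
have [_ hP2] := hP.
by rewrite (hP2 (wlo v) (whi v) A (wbox v)) ?muleA.
Qed.

Lemma measurable_in_windows l s : 0 <= s -> ordered s l ->
  measurable (in_windows l : set (Omega T N)).
Proof.
elim: l s => [|v l IH] s s0 /=; first by move=> _; exact: measurableT.
move=> [sv vlt mB ol]; apply: measurableI; last first.
  by apply: (IH (whi v)) => //; rewrite (le_trans s0)// (le_trans sv)// ltW.
apply: (@path_events_le (whi v)); first exact: ordered_le ol.
by apply: in_window_path => //; [exact: le_trans sv|exact: ltW|exact: ordered_le ol].
Qed.

End chains.

Lemma preimage_sigma (X Y : Type) (psi : X -> Y) (G : set (set Y)) (H : set (set X)) :
  sigma_algebra setT H -> (forall A, G A -> H (psi @^-1` A)) ->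
  forall A, <<s G >> A -> H (psi @^-1` A).
Proof.
move=> Hs GH; apply: (@smallest_sub _ (sigma_algebra setT) G [set A | H (psi @^-1` A)]) => //.
split => /=.
- by rewrite preimage_set0; exact: salg0.
- by move=> A HA; rewrite setTD preimage_setC; exact: salgC.
- by move=> A HA; rewrite preimage_bigcup; exact: salg_bigcup.
Qed.

Arguments W : simpl never.

Section cyclic_shift.
Context (R : realType) (T : R) (hT : 0 < T) (N : nat).
Context (P : probability (Omega T N) R) (hP : wiener_measure P).
Context (t : R) (tT : 0 <= t <= T).
Let c := T - t.

Let c0 : 0 <= c. Proof. by rewrite subr_ge0; case/andP: tT. Qed.
Let cT : c <= T. Proof. by rewrite gerBl; case/andP: tT. Qed.
Let t0 : 0 <= t. Proof. by case/andP: tT. Qed.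

(** Both moving times are clamped, so that one formula serves the two halves: up to T - t only the
    first increment moves, afterwards only the second. Subtracting the values at t and at 0 keeps
    the path continuous and starts it at 0. *)
Definition shift_fun (w : cpath T N) (s : R) : 'cV[R]_N :=
  if 0 <= s <= T then
    w (Num.min T (t + s)) - w t + w (Num.max 0 (s - (T - t))) - w 0
  else 0.

Lemma shift_fun_continuous w : {within `[0, T], continuous (shift_fun w)}.
Proof.
have c1 : {within `[0, T], continuous (fun s => w (Num.min T (t + s)))}.
  apply: (within_itv_comp (f := w) (g := fun s => Num.min T (t + s))) => //.
  - exact: cpath_continuous.
  - by move=> s; apply: continuous_min; [exact: cvg_cst|apply: cvgD; [exact: cvg_cst|exact: cvg_id]].
  - by move=> s /andP[s0 sT]; rewrite le_min (ltW hT) addr_ge0//= ge_min lexx.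
have c2 : {within `[0, T], continuous (fun s => w (Num.max 0 (s - (T - t))))}.
  apply: (within_itv_comp (f := w) (g := fun s => Num.max 0 (s - (T - t)))) => //.
  - exact: cpath_continuous.
  - move=> s; apply: (@continuous_comp _ _ _ (fun s => s - (T - t)) (fun x => Num.max 0 x)).
      by apply: cvgB; [exact: cvg_id|exact: cvg_cst].
    exact: maxr_continuous.
  - move=> s /andP[s0 sT]; rewrite le_max lexx/= ge_max (ltW hT)/=.
    by rewrite lerBlDr (le_trans sT)// lerDl.
have c3 : {within `[0, T], continuous (fun s => w (Num.min T (t + s)) - w t + w (Num.max 0 (s - (T - t))) - w 0)}.
  move=> s; apply: cvgB; last exact: cvg_cst.
  by apply: cvgD; [apply: cvgB; [exact: c1|exact: cvg_cst]|exact: c2].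
move=> s; apply/(subspace_eq_continuous _ c3) => x; rewrite inE/= in_itv/= => xT.
by rewrite /from_subspace /shift_fun xT.
Qed.

Lemma shift_fun_off w s : ~ (0 <= s <= T) -> shift_fun w s = 0.
Proof. by rewrite /shift_fun; case: ifP. Qed.

(* Moves the increments on [t, T] to [0, T - t] and those on [0, t] behind. *)
Definition shift (w : cpath T N) : cpath T N :=
  CPath (@shift_fun_continuous w) (@shift_fun_off w).

Lemma shift_early (w : cpath T N) s : 0 <= s <= T - t ->
  W s (shift w) = W (t + s) w - W t w.
Proof.
move=> /andP[s0 sc]; rewrite /W /= /shift_fun s0 (le_trans sc cT)/=.
have -> : Num.min T (t + s) = t + s by apply/min_idPr; rewrite -lerBrDl.
have -> : Num.max 0 (s - (T - t)) = 0 by apply/max_idPl; rewrite subr_le0.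
by rewrite addrK.
Qed.

Lemma shift_incr_early (w : cpath T N) a b : 0 <= a <= T - t -> 0 <= b <= T - t ->
  W b (shift w) - W a (shift w) = W (t + b) w - W (t + a) w.
Proof. by move=> ac bc; rewrite !shift_early// opprB addrA subrK. Qed.

Lemma shift_late (w : cpath T N) s : T - t <= s <= T ->
  W s (shift w) = W T w - W t w + W (s - (T - t)) w - W 0 w.
Proof.
move=> /andP[cs sT]; rewrite /W /= /shift_fun (le_trans c0 cs) sT/=.
have -> : Num.min T (t + s) = T by apply/min_idPl; rewrite addrC -lerBlDr.
by have -> : Num.max 0 (s - (T - t)) = s - (T - t) by apply/max_idPr; rewrite subr_ge0.
Qed.

Lemma shift_incr_late (w : cpath T N) a b : T - t <= a <= T -> T - t <= b <= T ->
  W b (shift w) - W a (shift w) = W (b - (T - t)) w - W (a - (T - t)) w.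
Proof.
move=> ac bc; rewrite !shift_late//.
by apply/matrixP => i j; rewrite !mxE; ring.
Qed.

Lemma shift_preimage_coord (r : R) (i : 'I_N) (B : set R) : 0 <= r <= T -> measurable B ->
  measurable (shift @^-1` [set w | B (W r w i ord0)] : set (Omega T N)).
Proof.
move=> /andP[r0 rT] mB.
have g (s : R) : 0 <= s <= T -> gmeas <<s path_events T N T >> (fun w : Omega T N => W s w i ord0).
  by move=> sT; exact: path_coord.
have Gs := @smallest_sigma_algebra _ setT (path_events T N T).
have [rc|cr] := leP r (T - t).
  rewrite (_ : _ @^-1` _ = [set w | B (W (t + r) w i ord0 - W t w i ord0)]).
    apply: (gmeasB (Om := Omega T N) Gs _ _ mB); apply: g => //.
    by rewrite addr_ge0//= -lerBrDl.
  by apply/seteqP; split => w /=; rewrite shift_early ?r0// !mxE.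
rewrite (_ : _ @^-1` _ = [set w | B ((W T w i ord0 - W t w i ord0) -
    (W 0 w i ord0 - W (r - (T - t)) w i ord0))]).
  apply: (gmeasB (Om := Omega T N) Gs _ _ mB); apply: (gmeasB (Om := Omega T N) Gs); apply: g.
  - by rewrite lexx ltW.
  - exact: tT.
  - by rewrite lexx ltW.
  - by rewrite subr_ge0 (ltW cr)/= lerBlDr (le_trans rT)// lerDl.
apply/seteqP; split => w /=; rewrite shift_late ?(ltW cr) ?rT// !mxE;
  by move=> h; apply: (eq_ind _ B h); ring.
Qed.

Lemma measurable_shift : measurable_fun setT (shift : Omega T N -> Omega T N).
Proof.
move=> _ A mA; rewrite setTI.
apply: (@preimage_sigma _ _ shift (path_events T N T) (measurable : set (set (Omega T N)))) => //.
  exact: sigma_algebra_measurable.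
by move=> _ [r rT [i [B [mB ->]]]]; exact: shift_preimage_coord.
Qed.

Let mshift := isMeasurableFun.Build _ _ _ _ _ measurable_shift.
Let shiftm : {mfun (Omega T N) >-> (Omega T N)} := HB.pack shift mshift.
Let Q := distribution P shiftm.

Let wbox0 (B : 'I_N -> set R) : set (cpath T N) := [set w | forall i, B i (W 0 w i ord0)].

Let wbox0_path B : (forall i, measurable (B i)) -> <<s path_events T N 0 >> (wbox0 B).
Proof.
move=> mB; apply: (salg_forall (A := fun i => [set w : cpath T N | B i (W 0 w i ord0)])
  (@smallest_sigma_algebra _ setT (path_events T N 0))) => i.
by apply: (@path_coord _ _ _ 0 0 i); rewrite ?lexx.
Qed.

Let cst_event (p : Prop) (s : R) : <<s path_events T N s >> [set w : cpath T N | p].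
Proof.
have Gs := @smallest_sigma_algebra _ setT (path_events T N s).
have [hp|hp] := pselect p.
  by rewrite (_ : [set _ | _] = setT); [exact: (salgT Gs)|apply/seteqP; split].
by rewrite (_ : [set _ | _] = set0); [exact: (salg0 Gs)|apply/seteqP; split].
Qed.

Let wbox0_prob B : (forall i, measurable (B i)) ->
  P (wbox0 B) = P [set w | forall i, B i 0].
Proof.
move=> mB; have [P0 _] := hP.
have mZ : measurable ([set w | W 0 w = 0] : set (Omega T N)).
  rewrite (_ : [set _ | _] = wbox0 (fun=> [set 0])).
    by apply: (@path_events_le _ T N 0); [exact: ltW|exact: wbox0_path].
  apply/seteqP; split => w /= h.
    by move=> i; rewrite h mxE.
  by apply/matrixP => i j; rewrite (ord1 j) (h i) mxE.
have PI (A : set (Omega T N)) : measurable A -> P A = P (A `&` [set w | W 0 w = 0]).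
  move=> mA; rewrite -[in LHS](setUIDK A [set w | W 0 w = 0]) measureU//.
  - rewrite [X in (_ + X)%E](_ : _ = 0%E) ?adde0//.
    apply/eqP; rewrite eq_le measure_ge0 andbT.
    apply: (@le_trans _ _ (P (~` [set w | W 0 w = 0]))).
      apply: le_measure; rewrite ?inE.
      - exact: measurableD.
      - exact: measurableC.
      - by move=> w [].
    by rewrite probability_setC// P0 subee.
  - exact: measurableI.
  - exact: measurableD.
  - by rewrite setDE setIACA setICr setI0.
rewrite PI; last by apply: (@path_events_le _ T N 0); [exact: ltW|exact: wbox0_path].
rewrite [RHS]PI; last by apply: (@path_events_le _ T N 0); [exact: ltW|exact: cst_event].
congr (P _); apply/seteqP; split => w /= [h1 h2]; split => // i; have := h1 i; by rewrite h2 mxE.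
Qed.

(* Shifting permutes the windows of a grid that passes through T - t. *)
Record grid (g : nat -> R) (n n1 : nat) : Prop := {
  grid0 : g 0%N = 0 ;
  grid_lt : forall k, (k < n)%N -> g k < g k.+1 ;
  grid_leT : g n <= T ;
  grid_cut : (n1 <= n)%N ;
  grid_at : g n1 = T - t }.

Let win (h : R) (g : nat -> R) (B : nat -> 'I_N -> set R) k : window R N :=
  Window (h + g k) (h + g k.+1) (B k.+1).

Let in_windows_map h g B m n (w : cpath T N) :
  in_windows [seq win h g B k | k <- iota m n] w <->
  forall k, (m <= k < m + n)%N -> in_window (win h g B k) w.
Proof.
elim: n m => [|n IH] m /=.
  by split => // _ k; rewrite addn0 => /andP[h1 h2]; rewrite ltnNge h1 in h2.
split.
  move=> [h1 /IH h2] k /andP[mk kn]; have [->//|km] := eqVneq k m.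
  by apply: h2; rewrite ltn_neqAle eq_sym km mk/= addSnnS.
move=> H; split; first by apply: H; rewrite leqnn/= addnS ltnS leq_addr.
by apply/IH => k /andP[mk kn]; apply: H; rewrite (ltnW mk) -addSnnS.
Qed.

Let ordered_win (h s : R) g B m n : (forall k, (m <= k < m + n)%N -> g k < g k.+1) ->
  s <= h + g m -> h + g (m + n)%N <= T -> (forall k i, measurable (B k i)) ->
  ordered T s [seq win h g B k | k <- iota m n].
Proof.
elim: n m s => [|n IH] m s H sm gT mB /=.
  by rewrite addn0 in gT; exact: le_trans gT.
split => //.
- by rewrite /= ltrD2l; apply: H; rewrite leqnn/= addnS ltnS leq_addr.
- apply: IH => //; last by rewrite addSnnS.
  by move=> k /andP[mk kn]; apply: H; rewrite (ltnW mk) -addSnnS.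
Qed.

Definition cyl (g : nat -> R) (n : nat) : set (set (Omega T N)) :=
  [set A | exists B : nat -> 'I_N -> set R, (forall k i, measurable (B k i)) /\
    A = wbox0 (B 0%N) `&` in_windows [seq win 0 g B k | k <- iota 0 n]].

Let cyl_setI g n : setI_closed (cyl g n).
Proof.
move=> _ _ [B [mB ->]] [B' [mB' ->]].
exists (fun k i => B k i `&` B' k i); split; first by move=> k i; exact: measurableI.
apply/seteqP; split => w /=.
  move=> [[h1 h2] [h3 h4]]; split; first by move=> i; split; [exact: h1|exact: h3].
  apply/in_windows_map => k kn i; split; first exact: ((in_windows_map _ _ _ _ _ _).1 h2 k kn i).
  exact: ((in_windows_map _ _ _ _ _ _).1 h4 k kn i).
move=> [h1 h2]; split; split; try by move=> i; have [] := h1 i.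
  by apply/in_windows_map => k kn i; have [] := (in_windows_map _ _ _ _ _ _).1 h2 k kn i.
by apply/in_windows_map => k kn i; have [] := (in_windows_map _ _ _ _ _ _).1 h2 k kn i.
Qed.

Let grid_mono g n n1 : grid g n n1 -> forall j k, (j <= k)%N -> (k <= n)%N -> g j <= g k.
Proof.
move=> G j k; elim: k => [|k IH]; first by rewrite leqn0 => /eqP ->.
rewrite leq_eqVlt => /orP[/eqP -> //|jk kn].
apply: (le_trans (IH jk (ltnW kn))); exact: ltW (grid_lt G kn).
Qed.

Let ordered_grid g n n1 B : grid g n n1 -> (forall k i, measurable (B k i)) ->
  ordered T 0 [seq win 0 g B k | k <- iota 0 n].
Proof.
move=> G mB; apply: ordered_win => //.
- by move=> k /andP[_ kn]; exact: (grid_lt G).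
- by rewrite add0r (grid0 G).
- by rewrite add0r add0n; exact: grid_leT G.
Qed.

Let cyl_measurable g n n1 : grid g n n1 -> cyl g n `<=` measurable.
Proof.
move=> G _ [B [mB ->]]; apply: measurableI.
  by apply: (@path_events_le _ T N 0); [exact: ltW|apply: wbox0_path].
by apply: (@measurable_in_windows _ T N _ 0) => //; exact: (ordered_grid G).
Qed.

Let weight_win h g B k : weight (win h g B k) = weight (win 0 g B k).
Proof.
rewrite /weight /=; have -> : h + g k.+1 - (h + g k) = 0 + g k.+1 - (0 + g k) by ring.
by [].
Qed.

(** Both probabilities are products of window weights. A weight depends only on the length of the
    window and on its box, so the shift merely permutes the factors. *)
Let cyl_agree g n n1 : grid g n n1 -> forall A, cyl g n A -> P A = Q A.
Proof.
move=> G _ [B [mB ->]].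
rewrite (chain_prob hP (lexx 0) (ordered_grid G mB) (wbox0_path (mB 0%N))) wbox0_prob//.
rewrite /Q /distribution /pushforward/=.
have n1n := grid_cut G; have gn1 := grid_at G; have gm := grid_mono G.
(* In the original path the windows of the shifted path after T - t lie in [0, t] and those before T
   - t lie in [t, T]; l1 followed by l2 is therefore the chronological order. *)
set l1 := [seq win (- (T - t)) g B k | k <- iota n1 (n - n1)].
set l2 := [seq win t g B k | k <- iota 0 n1].
have -> : shift @^-1` (wbox0 (B 0%N) `&` in_windows [seq win 0 g B k | k <- iota 0 n]) =
    [set w | forall i, B 0%N i 0] `&` in_windows (l1 ++ l2).
  have iw (l l' : seq (window R N)) (w : cpath T N) : in_windows (l ++ l') w <-> in_windows l w /\ in_windows l' w.
    elim: l => [|v l IH] /=; first by split => [|[]].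
    by split=> [[h1 /IH[h2 h3]]|[[h1 h2] h3]]; split => //; apply/IH.
  have early w k : (k < n1)%N ->
      in_window (win 0 g B k) (shift w) <-> in_window (win t g B k) w.
    move=> kn; rewrite /in_window /= !add0r.
    have h1 : 0 <= g k <= T - t.
      by rewrite -(grid0 G) -gn1 !gm// ?(ltnW kn)// (leq_trans (ltnW kn)).
    have h2 : 0 <= g k.+1 <= T - t.
      by rewrite -(grid0 G) -gn1 !gm// (leq_trans kn).
    have E i : W (g k.+1) (shift w) i ord0 - W (g k) (shift w) i ord0 =
        W (t + g k.+1) w i ord0 - W (t + g k) w i ord0.
      have := congr1 (fun A : 'cV[R]_N => A i ord0) (shift_incr_early w h1 h2).
      by rewrite !mxE.
    by split => h i; have := h i; rewrite E.
  have late w k : (n1 <= k < n)%N ->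
      in_window (win 0 g B k) (shift w) <-> in_window (win (- (T - t)) g B k) w.
    move=> /andP[nk kn]; rewrite /in_window /= !add0r.
    have h1 : T - t <= g k <= T.
      by rewrite -{1}gn1 gm ?(ltnW kn)//= (le_trans _ (grid_leT G))// gm// ltnW.
    have h2 : T - t <= g k.+1 <= T.
      by rewrite -{1}gn1 gm ?(leqW nk)//= (le_trans _ (grid_leT G))// gm.
    have E i : W (g k.+1) (shift w) i ord0 - W (g k) (shift w) i ord0 =
        W (- (T - t) + g k.+1) w i ord0 - W (- (T - t) + g k) w i ord0.
      have := congr1 (fun A : 'cV[R]_N => A i ord0) (shift_incr_late w h1 h2).
      by rewrite !mxE ![- (T - t) + _]addrC.
    by split => h i; have := h i; rewrite E.
  have zero w i : W 0 (shift w) i ord0 = 0.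
    by rewrite shift_early ?lexx// addr0 subrr mxE.
  apply/seteqP; split => w /= [h1 h2]; split.
  - by move=> i; have := h1 i; rewrite zero.
  - apply/iw; split; apply/in_windows_map => k kn.
      have kn' : (n1 <= k < n)%N by move: kn; rewrite subnKC.
      by apply/(late w k kn'); apply: ((in_windows_map _ _ _ _ _ _).1 h2); case/andP: kn'.
    apply/(early w k) => //; apply: ((in_windows_map _ _ _ _ _ _).1 h2).
    by rewrite add0n; exact: leq_trans kn n1n.
  - by move=> i; rewrite zero.
  - have [/in_windows_map h3 /in_windows_map h4] := (iw l1 l2 w).1 h2.
    apply/in_windows_map => k /= kn; have [kn1|nk] := ltnP k n1.
      by apply/early => //; apply: h4.
    have kn' : (n1 <= k < n)%N by rewrite nk.
    by apply/late => //; apply: h3; rewrite subnKC.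
have o : ordered T 0 (l1 ++ l2).
  apply: (@ordered_cat _ _ _ _ _ _ t) => //.
  - apply: ordered_win => //.
    + by move=> k /andP[_ kn]; apply: (grid_lt G); move: kn; rewrite subnKC.
    + by rewrite gn1 addNr.
    + rewrite subnKC//; have := grid_leT G; have := c0; rewrite /c; lra.
  - rewrite all_map; apply/allP => k; rewrite mem_iota subnKC// => /andP[nk kn] /=.
    have := le_trans (gm _ _ kn (leqnn n)) (grid_leT G); lra.
  - apply: ordered_win => //.
    + by move=> k /= kn; apply: (grid_lt G); exact: leq_trans kn n1n.
    + by rewrite (grid0 G) addr0.
    + by rewrite add0n gn1; lra.
rewrite (chain_prob hP (lexx 0) o (@cst_event (forall i, B 0%N i 0) 0)); congr (_ * _)%E.
rewrite big_cat/= muleC.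
have wl h m k : (\prod_(v <- [seq win h g B k | k <- iota m k]) weight v =
    \prod_(v <- [seq win 0 g B k | k <- iota m k]) weight v)%E.
  by rewrite !big_map; apply: eq_bigr => j _; exact: weight_win.
rewrite /l1 /l2 !wl -big_cat/= -map_cat.
by rewrite -{2}(add0n n1) -iotaD subnKC.
Qed.

Let cyl_coord g n n1 : grid g n n1 -> forall k, (k <= n)%N -> forall i,
  gmeas <<s cyl g n>> (fun w : Omega T N => W (g k) w i ord0).
Proof.
move=> G; have Gs := @smallest_sigma_algebra _ setT (cyl g n).
elim=> [|k IH] kn i.
  move=> B mB; apply: sub_sigma_algebra.
  exists (fun k' j => if (k' == 0%N) && (j == i) then B else setT); split.
    by move=> k' j; case: ifP.
  rewrite (grid0 G); apply/seteqP; split => w /=.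
    move=> Bw; split; first by rewrite /wbox0/= => j; case: eqP => // ->.
    by apply/in_windows_map => k' _ j.
  by move=> [h _]; have := h i; rewrite /= ?eqxx.
have gi : gmeas <<s cyl g n>> (fun w : Omega T N => W (g k.+1) w i ord0 - W (g k) w i ord0).
  move=> B mB; apply: sub_sigma_algebra.
  exists (fun k' j => if (k' == k.+1) && (j == i) then B else setT); split.
    by move=> k' j; case: ifP.
  apply/seteqP; split => w /=.
    move=> Bw; split => //; apply/in_windows_map => k' _ j.
    rewrite /= !add0r eqSS; have [->|//] := eqVneq k' k.
    by have [->|//] := eqVneq j i.
  move=> [_ /in_windows_map h]; have := h k; rewrite add0n kn => /(_ isT i).
  by rewrite /= !eqxx/= !add0r.
(* Closure under differences is what is available: W - W - W stands for -W, and subtracting it from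
   the increment adds W. *)
have gz : gmeas <<s cyl g n>> (fun w : Omega T N => W (g k) w i ord0 - W (g k) w i ord0 - W (g k) w i ord0).
  by apply: (gmeasB Gs) (IH (ltnW kn) i); apply: (gmeasB Gs); exact: IH (ltnW kn) i.
have := gmeasB Gs gi gz; congr gmeas.
by apply/funext => w; rewrite subrr sub0r opprK subrK.
Qed.

Let cyl_refine g n n1 g' n' n1' : grid g n n1 -> grid g' n' n1' ->
  (forall k, (k <= n)%N -> exists2 k', (k' <= n')%N & g' k' = g k) ->
  <<s cyl g n>> `<=` <<s cyl g' n'>>.
Proof.
move=> G G' r; have Gs := @smallest_sigma_algebra _ setT (cyl g' n').
have co k i : (k <= n)%N -> gmeas <<s cyl g' n'>> (fun w : Omega T N => W (g k) w i ord0).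
  by move=> /r[k' kn' <-]; exact: (cyl_coord G').
apply: smallest_sub => //.
move=> _ [B [mB ->]]; apply: (salgI Gs).
  apply: (salg_forall (A := fun i => [set w : cpath T N | B 0%N i (W 0 w i ord0)]) Gs) => i.
  by rewrite -(grid0 G); apply: co.
have : forall k, (k < n)%N -> <<s cyl g' n'>> (in_window (win 0 g B k)).
  move=> k kn; apply: (salg_forall (A := fun i => [set w : cpath T N |
      B k.+1 i (W (0 + g k.+1) w i ord0 - W (0 + g k) w i ord0)]) Gs) => i.
  by rewrite !add0r; apply: (gmeasB Gs) (mB _ _); apply: co => //; exact: ltnW.
have : forall m q, (m + q <= n)%N -> (forall k, (k < n)%N -> <<s cyl g' n'>> (in_window (win 0 g B k))) ->
    <<s cyl g' n'>> (in_windows [seq win 0 g B k | k <- iota m q]).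
  move=> m q + H; elim: q m => [|q IH] m mq /=; first exact: (salgT Gs).
  apply: (salgI Gs); first by apply: H; rewrite (leq_trans _ mq)// addnS ltnS leq_addr.
  by apply: IH; rewrite addSnnS.
by move=> h h'; exact: h.
Qed.

Let grid_of (l : seq R) : (forall r, r \in l -> 0 <= r <= T) ->
  exists g n n1, grid g n n1 /\ forall r, r \in l -> exists2 k, (k <= n)%N & g k = r.
Proof.
(* The points 0 and T - t are added so that the grid starts at 0 and passes through the cut. *)
move=> lT; pose S := sort <=%R (undup [:: 0, T - t & l]).
have memS r : (r \in S) = (r \in [:: 0, T - t & l]) by rewrite mem_sort mem_undup.
have ST r : r \in S -> 0 <= r <= T.
  rewrite memS !inE => /orP[/eqP ->|/orP[/eqP ->|/lT//]].
    by rewrite lexx ltW.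
  by rewrite c0 cT.
have sS : sorted <%R S by rewrite sort_lt_sorted undup_uniq.
have S0 : 0 \in S by rewrite memS inE eqxx.
have Sc : T - t \in S by rewrite memS !inE eqxx orbT.
have nS : (0 < size S)%N by apply: leq_ltn_trans (leq0n (index 0 S)) _; rewrite index_mem.
exists (nth 0 S), (size S).-1, (index (T - t) S); split; last first.
  move=> r rl; have rS : r \in S by rewrite memS !inE rl !orbT.
  by exists (index r S); [rewrite -ltnS prednK// index_mem|exact: nth_index].
have lt j k : (j < k)%N -> (k < size S)%N -> S`_j < S`_k.
  by move=> jk kS; apply: (sorted_ltn_nth lt_trans) => //; rewrite inE// (ltn_trans jk).
split.
- apply/eqP; rewrite eq_le; have /andP[-> _] := ST _ (mem_nth 0 nS); rewrite andbT.
  rewrite -[leRHS](nth_index 0 S0); have [->//|i0] := posnP (index 0 S).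
  by apply: ltW; apply: lt => //; rewrite index_mem.
- by move=> k kS; apply: lt => //; rewrite -(prednK nS) ltnS.
- by have /andP[] : 0 <= S`_(size S).-1 <= T by apply: ST; rewrite mem_nth// prednK.
- by rewrite -ltnS prednK// index_mem.
- exact: nth_index.
Qed.

Let cylinders : set (set (Omega T N)) :=
  [set A | exists g n n1, grid g n n1 /\ <<s cyl g n>> A].

(** Any two grids have a common refinement through the cut, and the cylinder sigma-algebras increase
    under refinement. *)
Let cylinders_setI : setI_closed cylinders.
Proof.
move=> A A' [g [n [n1 [G GA]]]] [g' [n' [n1' [G' GA']]]].
have gT h q q1 : grid h q q1 -> forall k, (k <= q)%N -> 0 <= h k <= T.
  move=> H k kq; rewrite -(grid0 H) (grid_mono H)//=.
  by apply: (le_trans _ (grid_leT H)); exact: grid_mono H _ _ kq _.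
have [|h [q [q1 [H hr]]]] := @grid_of ([seq g k | k <- iota 0 n.+1] ++ [seq g' k | k <- iota 0 n'.+1]).
  move=> r; rewrite mem_cat => /orP[] /mapP[k]; rewrite mem_iota add0n ltnS => /= kn ->.
    exact: gT G _ kn.
  exact: gT G' _ kn.
exists h, q, q1; split => //; apply: (salgI (@smallest_sigma_algebra _ setT (cyl h q))).
  apply: (cyl_refine G H) GA => k kn; apply: hr.
  by rewrite mem_cat map_f// mem_iota add0n ltnS.
apply: (cyl_refine G' H) GA' => k kn; apply: hr.
by rewrite mem_cat [X in _ || X]map_f ?orbT// mem_iota add0n ltnS.
Qed.

(** The uniqueness theorem for measures is used twice: on the cylinders of one grid, which are
    closed under intersection, and then on the union over all grids of the sigma-algebras so
    obtained. *)
Lemma shift_prob (A : set (Omega T N)) : measurable A -> P (shift @^-1` A) = P A.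
Proof.
move=> mA.
have mcyl : cylinders `<=` measurable.
  move=> B [g [n [n1 [G GB]]]]; move: B GB; apply: smallest_sub; last exact: (cyl_measurable G).
  exact: sigma_algebra_measurable.
have PQ : forall B, cylinders B -> P B = Q B.
  move=> B [g [n [n1 [G GB]]]]; apply: (agree_sigma (G := cyl g n)) GB => //.
  - exact: (cyl_measurable G).
  - exact: (cyl_agree G).
have : <<s cylinders >> A.
  move: A mA; apply: smallest_sub; first exact: smallest_sigma_algebra.
  move=> _ [r rT [i [B [mB ->]]]]; apply: sub_sigma_algebra.
  have [|g [n [n1 [G gr]]]] := @grid_of [:: r]; first by move=> r'; rewrite inE => /eqP ->.
  have [k kn <-] := gr r (mem_head _ _).
  by exists g, n, n1; split => //; exact: (cyl_coord G).
by move=> cA; rewrite (agree_sigma cylinders_setI mcyl PQ cA).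
Qed.

End cyclic_shift.

Section lebesgue_translation.
Context (R : realType).
Local Notation leb := (@lebesgue_measure R).

Lemma lebesgue_measure_shift (t : R) (A : set R) : measurable A ->
  pushforward leb (fun s : measurableTypeR R => s - t : measurableTypeR R) A = leb A.
Proof.
have mt : measurable_fun setT (fun s : measurableTypeR R => s - t : measurableTypeR R).
  by apply: measurable_funB => //; exact: measurable_id.
pose phi : {mfun (measurableTypeR R) >-> (measurableTypeR R)} :=
  HB.pack (fun s : measurableTypeR R => s - t : measurableTypeR R) (isMeasurableFun.Build _ _ _ _ _ mt).
move=> mA; apply/esym/(@lebesgue_measure_unique _ (pushforward leb phi)) => //= _ [[a b]] _ <-.
rewrite /pushforward/= (_ : _ @^-1` _ = `]a + t, b + t]%classic); last first.
  by apply/seteqP; split => s /=; rewrite !in_itv/= ltrBrDr lerBlDr.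
by rewrite !lebesgue_measure_itv/= !lte_fin ltrD2r -!EFinD opprD addrACA subrr addr0.
Qed.

Lemma ge0_integral_shift (t a b : R) (f : R -> \bar R) : measurable_fun setT f ->
  (forall s, 0 <= f s)%E ->
  (\int[leb]_(s in `](t + a)%R, (t + b)%R]) f (s - t)%R = \int[leb]_(s in `]a, b]) f s)%E.
Proof.
move=> mf f0.
have mt : measurable_fun setT (fun s : measurableTypeR R => s - t : measurableTypeR R).
  by apply: measurable_funB => //; exact: measurable_id.
have e : `]t + a, t + b]%classic = (fun s : measurableTypeR R => s - t : measurableTypeR R) @^-1` `]a, b].
  by apply/seteqP; split => s /=; rewrite !in_itv/= ltrBrDr lerBlDr ![_ + t]addrC.
rewrite e.
rewrite -(@ge0_integral_pushforward _ _ _ _ _ _ mt leb `]a, b]%classic f)//.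
- by apply: eq_measure_integral => A mA _; exact: lebesgue_measure_shift.
- exact: measurable_funTS.
Qed.

Lemma Rintegral_shift (t a b : R) (f : R -> R) : measurable_fun setT f ->
  \int[leb]_(s in `]t + a, t + b]) f (s - t) = \int[leb]_(s in `]a, b]) f s.
Proof.
move=> mf; have mf' : measurable_fun setT (EFin \o f) by exact/measurable_EFinP.
rewrite /Rintegral integralE [in RHS]integralE; congr (fine (_ - _)%E).
  transitivity (\int[leb]_(s in `](t + a)%R, (t + b)%R]) (fun s : R => (f s)%:E)^\+ (s - t)%R)%E.
  by apply: eq_integral => s _; rewrite ?funepos.unlock ?funeneg.unlock.
  exact: (ge0_integral_shift t a b (measurable_funepos mf') (fun s => funepos_ge0 (EFin \o f) s)).
transitivity (\int[leb]_(s in `](t + a)%R, (t + b)%R]) (fun s : R => (f s)%:E)^\- (s - t)%R)%E.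
  by apply: eq_integral => s _; rewrite ?funepos.unlock ?funeneg.unlock.
exact: (ge0_integral_shift t a b (measurable_funeneg mf') (fun s => funeneg_ge0 (EFin \o f) s)).
Qed.

End lebesgue_translation.

Section cspace_approximation.
Context d (S : measurableType d) (R : realType) (P : probability S R).

(** A measurable hull. It carries completed events through [shift], whose measurability is proved
    for the generated sigma-algebra. *)
Lemma cspace_cover (A : set S) : measurable (A : set (cspace P)) ->
  exists B : set S, [/\ measurable B, A `<=` B & P.-negligible (B `\` A)].
Proof.
move=> mA; have Afin : cprob P A \is a fin_num by exact: fin_num_measure.
have H k : exists U : set S, [/\ measurable U, A `<=` U & (P U <= cprob P A + (k.+1%:R^-1)%:E)%E].
  have : (cprob P A < cprob P A + (k.+1%:R^-1)%:E)%E.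
    by rewrite lteDl// lte_fin invr_gt0.
  rewrite {1}/cprob /completed_measure_extension/= {1}/mu_ext.
  move=> /ereal_inf_lt[_ [F [mF AF] <-]] h.
  exists (\bigcup_k F k); split => //; first exact: bigcup_measurable.
  apply: le_trans (ltW h).
  by apply: (measure_sigma_subadditive P) => //; exact: bigcup_measurable.
have /choice[U HU] := H.
have mB : measurable (\bigcap_k U k).
  by apply: bigcap_measurable => // k _; have [] := HU k.
have AB : A `<=` \bigcap_k U k by apply: sub_bigcap => k _; have [] := HU k.
exists (\bigcap_k U k); split => //.
apply: cprob_negligible; rewrite measureD//; last first.
- by rewrite (@le_lt_trans _ _ 1%E) ?ltry//; apply: (probability_le1 (cprob P)); exact: measurable_cspace.
- exact: measurable_cspace.
rewrite setIidr// (_ : _ (\bigcap_k U k) = cprob P A) ?subee//.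
apply/eqP; rewrite eq_le; apply/andP; split; last first.
  by apply: le_measure; rewrite ?inE//; exact: measurable_cspace.
apply/lee_addgt0Pr => e e0.
have [k _ /(_ k (leqnn _)) hk] := near_infty_natSinv_lt (PosNum e0).
have [mU AU PU] := HU k; have PB := cprobE P mB.
apply: (@le_trans _ _ (P (\bigcap_k U k))); first by rewrite -PB; exact: lexx.
apply: (@le_trans _ _ (P (U k))).
  by apply: le_measure; rewrite ?inE//; exact: bigcap_inf.
by apply: (le_trans PU); rewrite leeD2lE// lee_fin ltW.
Qed.

End cspace_approximation.

(** * Filtrations, integrands and integrals under the shift *)

Section shifted_space.
Context (R : realType) (T : R) (hT : 0 < T) (N : nat).
Context (P : probability (Omega T N) R) (hP : wiener_measure P).
Context (t : R) (tT : 0 <= t <= T).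
Local Notation psi := (@shift R T hT N t tT).

Lemma shift_negligible (A : set (cpath T N)) : P.-negligible A -> P.-negligible (psi @^-1` A).
Proof.
move=> [B [mB PB AB]]; exists (psi @^-1` B); split => //.
- by rewrite -[_ @^-1` _]setTI; exact: (measurable_shift hT tT).
- by rewrite -PB; exact: shift_prob.
- exact: preimage_subset.
Qed.

Lemma shift_ae (Q : cpath T N -> Prop) :
  {ae P, forall w, Q w} -> {ae P, forall w, Q (psi w)}.
Proof. by move=> h; exact: (shift_negligible h). Qed.

Lemma shift_cspace (A : set (cpath T N)) : measurable (A : set (cspace P)) ->
  measurable (psi @^-1` A : set (cspace P)) /\ cprob P (psi @^-1` A) = cprob P A.
Proof.
move=> mA; have [B [mB AB nBA]] := cspace_cover mA.
have mpB : measurable (psi @^-1` B : set (Omega T N)).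
  by rewrite -[_ @^-1` _]setTI; exact: (measurable_shift hT tT).
have nD := shift_negligible nBA.
have mpA : measurable (psi @^-1` A : set (cspace P)).
  rewrite (_ : _ @^-1` A = psi @^-1` B `\` psi @^-1` (B `\` A)).
    by apply: measurableD; [exact: measurable_cspace|have [] := negligible_cprob nD].
  apply/seteqP; split => w /=; first by move=> Aw; split; [exact: AB|case].
  by move=> [Bw h]; apply: contrapT => nA; exact: h.
split => //; transitivity (cprob P (psi @^-1` B)).
  apply: cprob_eq => //; first exact: measurable_cspace.
  rewrite (_ : _ `\` _ = set0); first exact: negligible_set0.
  by apply/seteqP; split => // w [/= Aw]; apply; exact: AB.
rewrite (cprobE P mpB) shift_prob// -(cprobE P mB); apply: cprob_eq => //.
  exact: measurable_cspace.
rewrite (_ : _ `\` _ = set0); first exact: negligible_set0.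
by apply/seteqP; split => // w [/= Aw]; apply; exact: AB.
Qed.

Lemma shift_integral (Z : cspace P -> \bar R) : measurable_fun setT Z ->
  (forall w, 0 <= Z w)%E ->
  (\int[cprob P]_w Z (psi w) = \int[cprob P]_w Z w)%E.
Proof.
move=> mZ Z0.
have mpsi : measurable_fun setT (psi : cspace P -> cspace P).
  by move=> _ A mA; rewrite setTI; have [] := shift_cspace mA.
transitivity (\int[pushforward (cprob P) (psi : cspace P -> cspace P)]_w Z w)%E.
  by rewrite (@ge0_integral_pushforward _ _ _ _ _ _ mpsi (cprob P) setT Z) ?preimage_setT.
apply: eq_measure_integral => A mA _.
by have [_] := shift_cspace mA.
Qed.

Lemma Ft_sub (s : R) : Ft P t s `<=` FW P s.
Proof.
apply: augmentation_mono => _ [r /= /andP[tr rs] [i [B [mB ->]]]].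
have h : gmeas (FW P s) (fun w : cspace P => W r w i ord0 - W t w i ord0).
  have /andP[t0 _] := tT.
  apply: (gmeasB (Om := cspace P) (@augmentation_sigma _ _ _ P _)); apply: FW_coord.
    by rewrite (le_trans t0 tr).
  by rewrite t0 (le_trans tr rs).
have := h B mB; rewrite /FW; congr (augmentation _ _).
by apply/seteqP; split => w /=; rewrite !mxE.
Qed.

(** Up to time a the shifted path consists of increments of W after t, which is exactly what
    generates [Ft P t] at time t + a. *)
Lemma shift_FW (a : R) A : 0 <= a <= T - t -> FW P a A -> Ft P t (t + a) (psi @^-1` A).
Proof.
move=> /andP[a0 ac]; apply: preimage_sigma; first exact: augmentation_sigma.
move=> B [|nB]; last by apply: augmentation_negligible; exact: shift_negligible.
move=> [r /= /andP[r0 ra] [i [D [mD ->]]]]; apply: sub_sigma_algebra; left.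
exists (t + r) => /=; first by rewrite lerDl r0 lerD2l.
exists i, D; split => //; apply/seteqP; split => w /=;
  by rewrite (@shift_early _ _ hT _ _ tT) ?r0// (le_trans ra ac).
Qed.

(** After T - t the shifted path replays [0, t], and its events are known only at the final time T.
    Hence the cap, which reappears in the partition points of [shift_simple]. *)
Lemma shift_FW_end (a : R) A : 0 <= a <= T -> FW P a A ->
  FW P (t + Num.min a (T - t)) (psi @^-1` A).
Proof.
move=> /andP[a0 aT] FA; have [ac|ca] := leP a (T - t).
  by apply: Ft_sub; apply: shift_FW => //; rewrite a0.
rewrite [t + _]addrC subrK; move: A FA; apply: augmentation_min.
- split => /=.
  + by rewrite preimage_set0; exact: (salg0 (@augmentation_sigma _ _ _ P _)).
  + move=> A hA; rewrite setTD preimage_setC.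
    exact: (salgC (@augmentation_sigma _ _ _ P _)).
  + move=> A hA; rewrite preimage_bigcup.
    exact: (salg_bigcup (@augmentation_sigma _ _ _ P _)).
- move=> _ [r /= /andP[r0 ra] [i [B [mB ->]]]]; apply: augmentation_sub.
  by apply: shift_preimage_coord => //; rewrite r0 (le_trans ra aT).
- by move=> A nA; apply: augmentation_negligible; exact: shift_negligible.
Qed.

(** Before t only events at time 0 are pulled back. The shifted path starts exactly at 0, so these
    are trivial up to null sets. *)
Lemma shift_FW_max (s : R) A : 0 <= s <= T -> FW P (Num.max 0 (s - t)) A ->
  FW P s (psi @^-1` A).
Proof.
move=> /andP[s0 sT]; have [ts|st] := ltP 0 (s - t).
  move=> FA; have -> : s = t + (s - t) by rewrite addrC subrK.
  apply: Ft_sub; apply: shift_FW => //.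
  by rewrite ltW//= lerD2r.
apply: preimage_sigma; first exact: augmentation_sigma.
move=> B [|nB]; last by apply: augmentation_negligible; exact: shift_negligible.
move=> [r /= /andP[r0 ra] [i [D [mD ->]]]].
have r00 : r = 0 by apply: le_anti; rewrite r0 ra.
have c0 : 0 <= T - t by rewrite subr_ge0; case/andP: tT.
have [D0|D0] := pselect (D 0).
  rewrite (_ : _ @^-1` _ = setT); first exact: (salgT (@augmentation_sigma _ _ _ P _)).
  apply/seteqP; split => // w _ /=.
  by rewrite r00 (@shift_early _ _ hT _ _ tT) ?lexx// addr0 subrr mxE.
rewrite (_ : _ @^-1` _ = set0); first exact: (salg0 (@augmentation_sigma _ _ _ P _)).
apply/seteqP; split => // w /=.
by rewrite r00 (@shift_early _ _ hT _ _ tT) ?lexx// addr0 subrr mxE.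
Qed.

(** K is the value before t: 0 for a diffusion coefficient, an element of U for a control. *)
Definition shifted p q (H : R -> cpath T N -> 'M[R]_(p, q)) (K : 'M[R]_(p, q))
    (s : R) (w : cpath T N) : 'M[R]_(p, q) :=
  if t < s then H (s - t) (psi w) else K.

Lemma predictable_mono (F F' : R -> set (set (cpath T N))) p q (H : R -> cpath T N -> 'M[R]_(p, q)) :
  (forall s : R, 0 <= s <= T -> F s `<=` F' s) -> predictable F H -> predictable F' H.
Proof.
move=> FF pH i j B mB.
apply: (@smallest_sub _ (sigma_algebra time_space) (predictable_rectangles F)
  <<s time_space, predictable_rectangles F' >> _ _ _ (pH i j B mB)).
  exact: smallest_sigma_algebra.
move=> D [[A FA ->]|[s [r [A [s0 sr rT FA ->]]]]]; apply: sub_sigma_algebra.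
  by left; exists A => //; apply: FF FA; rewrite lexx ltW.
by right; exists s, r, A; split => //; apply: FF FA; rewrite s0 (le_trans sr rT).
Qed.

Lemma predictable_shifted p q (H : R -> cpath T N -> 'M[R]_(p, q)) K :
  predictable (FW P) H -> predictable (Ft P t) (shifted H K).
Proof.
move=> pH i j B mB; have /andP[t0 tT'] := tT.
set GG := <<s time_space, predictable_rectangles (Ft P t) >>.
have Gs : sigma_algebra time_space GG by exact: smallest_sigma_algebra.
have [G0 GC GU] := Gs.
have GUI A A' : GG A -> GG A' -> GG (A `|` A').
  move=> GA GA'; rewrite -bigcup2E; apply: GU => -[|[|n]] //=.
have FtT s : Ft P t s setT by exact: (salgT (@augmentation_sigma _ _ _ P _)).
pose late : set (R * cpath T N) := [set z | t < z.1 <= T].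
have Glate : GG late.
  apply: sub_sigma_algebra; right; exists t, T, setT; split => //.
  by apply/seteqP; split => -[s w] /=; [split|case].
(* The preimage of A under the map that sends time s to s - t and shifts the path, cut to times
   after t. The sets A with predictable preimage form a sigma-algebra; complements are taken inside
   [late], whose predictability is shown first. *)
pose th (A : set (R * cpath T N)) : set (R * cpath T N) :=
  [set z | t < z.1 <= T /\ A (z.1 - t, psi z.2)].
have Gth : <<s time_space, predictable_rectangles (FW P) >> `<=` [set A | GG (th A)].
  apply: smallest_sub.
    split => /=.
    - by rewrite (_ : th set0 = set0)//; apply/seteqP; split => // z [].
    - move=> A GA; rewrite (_ : th _ = time_space `\` ((time_space `\` late) `|` th A)).
        by apply: (GC); apply: GUI => //; exact: GC.
      apply/seteqP; split => -[s w]; rewrite /th /time_space /late /=.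
        move=> [/andP[ts sT] [h1 h2]]; split; first by rewrite (le_trans t0 (ltW ts)).
        by move=> [[_]|[_]]//; rewrite ts sT.
      move=> [/andP[s0 sT] h].
      have ts : t < s by apply: contrapT => ts; apply: h; left; rewrite s0 sT; split => // /andP[].
      rewrite ts sT; split => //; split.
        by rewrite subr_ge0 (ltW ts)/= lerBlDr (le_trans sT)// lerDl.
      by move=> hA; apply: h; right; rewrite ts sT.
    - move=> A GA; rewrite (_ : th _ = \bigcup_k th (A k)); first exact: GU.
      apply/seteqP; split => z; first by move=> [h [k _ hk]]; exists k.
      by move=> [k _ [h hk]]; split => //; exists k.
  move=> D [[A FA ->]|[s [r [A [s0 sr rT FA ->]]]]] /=.
    rewrite (_ : th _ = set0)//; apply/seteqP; split => // -[s w] [/= /andP[ts _] [/eqP]].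
    by rewrite subr_eq0 => /eqP st; rewrite st ltxx in ts.
  have [tsT|Tts] := leP (t + s) T; last first.
    rewrite (_ : th _ = set0)//; apply/seteqP; split => // -[s' w] [/= /andP[ts s'T] [/andP[h1 _] _]].
    by move: h1; rewrite ltrBrDl => h1; have := lt_trans Tts h1; rewrite ltNge s'T.
  apply: sub_sigma_algebra; right; exists (t + s), (Num.min T (t + r)), (psi @^-1` A); split.
  - by rewrite addr_ge0.
  - by rewrite le_min tsT lerD2l.
  - by rewrite ge_min lexx.
  - by apply: shift_FW => //; rewrite s0 lerBrDl.
  - apply/seteqP; split => -[s' w] /=.
      by move=> [/andP[ts s'T] [/andP[h1 h2] h3]]; rewrite le_min s'T -ltrBrDl h1 -lerBlDl h2.
    move=> [/andP[h1]]; rewrite le_min => /andP[h2 h3] h4.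
    split; first by rewrite /= h2 andbT (le_lt_trans _ h1)// lerDl.
    by split => //=; rewrite ltrBrDl h1 lerBlDl h3.
have [BK|BK] := pselect (B (K i j)).
  rewrite (_ : _ `&` _ = th (time_space `&` [set z | B (H z.1 z.2 i j)]) `|` (time_space `\` late)).
    by apply: GUI; [exact: Gth (pH i j B mB)|exact: GC].
  apply/seteqP; split => -[s w]; rewrite /th /time_space /late/= /shifted.
    move=> [/andP[s0 sT]]; have [ts|st] := ltP t s; last first.
      by move=> _; right; rewrite s0 sT.
    by move=> h; left; rewrite sT subr_ge0 (ltW ts) lerBlDr (le_trans sT)// lerDl.
  move=> [[/andP[ts sT] [_ h]]|[/andP[s0 sT] h]].
    by rewrite ts sT (le_trans t0 (ltW ts)).
  by rewrite s0 sT; split => //; case: ltP => // ts; exfalso; apply: h; rewrite ts.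
rewrite (_ : _ `&` _ = th (time_space `&` [set z | B (H z.1 z.2 i j)])).
  exact: Gth (pH i j B mB).
apply/seteqP; split => -[s w]; rewrite /th /time_space/= /shifted.
  move=> [/andP[s0 sT]]; have [ts|st] := ltP t s => // h.
  by rewrite sT subr_ge0 (ltW ts) lerBlDr (le_trans sT)// lerDl.
by move=> [/andP[ts sT] [_ h]]; rewrite ts sT (le_trans t0 (ltW ts)).
Qed.

End shifted_space.

Section simple_measurability.
Context (R : realType) (T : R) (hT : 0 < T) (N : nat).
Context (P : probability (Omega T N) R).

Lemma rv_measurable_cspace (s : R) p q (xi : cpath T N -> 'M[R]_(p, q)) i j :
  0 <= s <= T -> rv_measurable (FW P s) xi ->
  measurable_fun setT (fun w : cspace P => xi w i j).
Proof.
move=> sT mxi; apply: (filt_gmeas_meas (FW_filtered P) sT) => B mB.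
exact: (mxi i j B mB).
Qed.

Lemma jmeas_si_process p (S : simple_integrand P p) i j :
  @jmeas _ (cspace P) R (fun s w => si_process S s w i j).
Proof.
rewrite (_ : (fun s w => _) = fun s (w : cspace P) => \sum_(k < si_size S)
    (si_time S k < s <= si_time S k.+1)%R%:R * si_coef S k w i j).
  apply: jmeas_sum => k; apply: jmeasM; first exact: jmeas_itv.
  apply: jmeas_l; exact: (@rv_measurable_cspace (si_time S k) _ _ _ _ _ (si_time_range S k) (@si_coef_measurable _ _ _ _ _ S k)).
apply/funext => s; apply/funext => w; rewrite /si_process summxE; apply: eq_bigr => k _.
by case: ifP; rewrite ?mul1r// mul0r mxE.
Qed.

Lemma measurable_si_integral p (S : simple_integrand P p) s i : 0 <= s <= T ->
  measurable_fun setT (fun w : cspace P => si_integral S s w i ord0).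
Proof.
move=> sT; have /andP[s0 sT'] := sT.
have mW (r : R) l : 0 <= r <= T -> measurable_fun setT (fun w : cspace P => W r w l ord0).
  move=> rT; apply: (filt_gmeas_meas (FW_filtered P) rT); apply: FW_coord.
  by rewrite lexx; case/andP: rT => ->.
rewrite (_ : (fun w => _) = fun w : cspace P => \sum_(k < si_size S) \sum_l
    si_coef S k w i l * (W (Num.min (si_time S k.+1) s) w l ord0 -
      W (Num.min (si_time S k) s) w l ord0)).
  apply: measurable_sum => k; apply: measurable_sum => l; apply: measurable_funM.
    exact: (@rv_measurable_cspace (si_time S k) _ _ _ _ _ (si_time_range S k) (@si_coef_measurable _ _ _ _ _ S k)).
  have mT k' : 0 <= Num.min (si_time S k') s <= T.
    by have /andP[h1 h2] := si_time_range S k'; rewrite le_min h1 s0/= ge_min h2.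
  by apply: measurable_funB; exact: mW.
apply/funext => w; rewrite /si_integral summxE; apply: eq_bigr => k _.
by rewrite mxE; apply: eq_bigr => l _; rewrite !mxE.
Qed.

Definition si_error p (S : simple_integrand P p) (H : R -> cpath T N -> 'M[R]_(p, N))
    (s : R) (w : cspace P) : R :=
  (0 < s <= T)%R%:R *
  \sum_i \sum_j (si_process S s w i j - (0 < s <= T)%R%:R * H s w i j) ^+ 2.

Lemma jmeas_si_error p (S : simple_integrand P p) H : predictable (FW P) H ->
  jmeas (si_error S H).
Proof.
move=> pH; apply: jmeasM; first exact: jmeas_itv.
apply: jmeas_sum => i; apply: jmeas_sum => j; apply: jmeasX; apply: jmeasB.
  exact: jmeas_si_process.
exact: predictable_jmeas.
Qed.

Lemma si_error_ge0 p (S : simple_integrand P p) H s w : 0 <= si_error S H s w.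
Proof.
by rewrite mulr_ge0//; apply: sumr_ge0 => *; apply: sumr_ge0 => *; exact: sqr_ge0.
Qed.

Lemma si_errorE p (S : simple_integrand P p) H (s : R) w : 0 < s <= T ->
  si_error S H s w = enorm (si_process S s w - H s w) ^+ 2.
Proof.
move=> sT; rewrite sqr_enorm /si_error sT mul1r; apply: eq_bigr => i _; apply: eq_bigr => j _.
by rewrite !mxE mul1r.
Qed.

Lemma si_error_sint p (S : simple_integrand P p) H (w : cspace P) : predictable (FW P) H ->
  (\int[@lebesgue_measure R]_(s in `[0%R, T])
      ((enorm (si_process S s w - H s w)) ^+ 2)%:E = sint (si_error S H) 0 T w)%E.
Proof.
move=> pH; have jg := jmeas_si_error S pH; rewrite sintE -integral_itv_obnd_cbnd.
  by apply: eq_integral => s; rewrite inE/= in_itv/= => sT; rewrite si_errorE.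
apply/measurable_EFinP; apply: (eq_measurable_fun (si_error S H ^~ w)).
  by move=> s; rewrite inE/= in_itv/= => sT; rewrite si_errorE.
by apply: measurable_funTS; exact: jmeas_sect.
Qed.

End simple_measurability.

Section shifted_integral.
Context (R : realType) (T : R) (hT : 0 < T) (N : nat).
Context (P : probability (Omega T N) R) (hP : wiener_measure P).
Context (t : R) (tT : 0 <= t <= T).
Local Notation psi := (@shift R T hT N t tT).
Local Notation delay s := (Num.max 0 (s - t)).

Let t0 : 0 <= t. Proof. by case/andP: tT. Qed.
Let c0 : 0 <= T - t. Proof. by rewrite subr_ge0; case/andP: tT. Qed.
Let cT : T - t <= T. Proof. by rewrite gerBl. Qed.

Lemma delay_range (s : R) : 0 <= s <= T -> 0 <= delay s <= T - t.
Proof.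
by move=> /andP[s0 sT]; rewrite le_max lexx/= ge_max c0/= lerD2r.
Qed.

Let delay_rangeT (s : R) : 0 <= s <= T -> 0 <= delay s <= T.
Proof. by move=> /delay_range /andP[-> h]; exact: le_trans cT. Qed.

Definition delayed p q (Y : R -> cpath T N -> 'M[R]_(p, q)) (s : R) (w : cpath T N) :=
  Y (delay s) (psi w).

Lemma adapted_delayed p q (Y : R -> cpath T N -> 'M[R]_(p, q)) :
  adapted (FW P) Y -> adapted (FW P) (delayed Y).
Proof.
move=> aY s sT i j B mB.
exact: (shift_FW_max hT hP tT sT (@aY _ (delay_rangeT sT) i j B mB)).
Qed.

Lemma continuous_delayed p q (Y : R -> cpath T N -> 'M[R]_(p, q)) :
  continuous_process Y -> continuous_process (delayed Y).
Proof.
move=> cY w; apply: (within_itv_comp (f := fun s => Y s (psi w)) (g := fun s => delay s)) => //.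
move=> s; apply: (@continuous_comp _ _ _ (fun s => s - t) (fun x => Num.max 0 x)).
  by apply: cvgB; [exact: cvg_id|exact: cvg_cst].
exact: maxr_continuous.
Qed.

Section simple.
Context (p : nat) (S : simple_integrand P p).

(** Partition points beyond T - t are capped to keep the translated partition inside [0, T]; the
    terms lying entirely there become empty. *)
Let time k : R := t + Num.min (si_time S k) (T - t).
Let coef k (w : cpath T N) := si_coef S k (psi w).

Let time_range k : 0 <= time k <= T.
Proof.
have /andP[h1 h2] := si_time_range S k.
apply/andP; split; first by rewrite addr_ge0// le_min h1.
by rewrite /time addrC -lerBrDr ge_min lexx orbT.
Qed.

Let time_mono k : time k <= time k.+1.
Proof. by rewrite lerD2l le_min !ge_min si_time_mono lexx !orbT. Qed.

Let coef_measurable' k : rv_measurable (FW P (time k)) (coef k).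
Proof.
move=> i j B mB.
exact: (shift_FW_end hT hP tT (si_time_range S k) (@si_coef_measurable _ _ _ _ _ S k i j B mB)).
Qed.

Let coef_bounded : exists K : R, forall k w, enorm (coef k w) <= K.
Proof. by have [K HK] := si_coef_bounded S; exists K => k w; exact: HK. Qed.

Definition shift_simple : simple_integrand P p :=
  SimpleIntegrand (si_size S) time_range time_mono coef_measurable' coef_bounded.

Lemma shift_simple_process (s : R) w : 0 <= s <= T ->
  si_process shift_simple s w = shifted hT tT (si_process S) 0 s w.
Proof.
move=> /andP[s0 sT]; rewrite /si_process /shifted /=.
have [ts|st] := ltP t s.
  apply: eq_bigr => k _; rewrite /time -!ltrBrDl -!lerBlDl gt_min le_min.
  by rewrite (ltNge (T - t)) !lerD2r sT orbF andbT.
apply: big1 => k _; rewrite /time ltNge (le_trans st)//.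
by rewrite lerDl le_min c0 andbT; case/andP: (si_time_range S k).
Qed.

Lemma shift_simple_integral (s : R) w : 0 <= s <= T ->
  si_integral shift_simple s w = delayed (si_integral S) s w.
Proof.
move=> sT; have /andP[s0 sT'] := sT; rewrite /si_integral /delayed /=.
apply: eq_bigr => k _; rewrite /coef; congr (_ *m _).
have rk k' : 0 <= si_time S k' by case/andP: (si_time_range S k').
have [ts|st] := ltP 0 (s - t).
  have E k' : Num.min (time k') s = t + Num.min (si_time S k') (s - t).
    have -> : Num.min (si_time S k') (s - t) =
        Num.min (Num.min (si_time S k') (T - t)) (s - t).
      by rewrite -minA (_ : Num.min (T - t) (s - t) = s - t)//; apply/min_idPr; rewrite lerD2r.
    by rewrite /time [RHS]addr_minr [t + (s - t)]addrC subrK.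
  rewrite !E -(@shift_incr_early _ _ hT _ _ tT)//;
    by rewrite le_min rk (ltW ts)/= ge_min lerD2r sT' orbT.
have E k' : Num.min (time k') s = s.
  apply/min_idPr; rewrite (@le_trans _ _ t)//; first by rewrite -subr_le0.
  by rewrite lerDl le_min rk.
by rewrite !E !(min_idPr (rk _)) !subrr.
Qed.

End simple.

(** By invariance of the measure, the error of the translated simple integral at time s equals the
    original error at the delayed time, and the energy error is an integral over a part of
    [0, T]. *)
Lemma is_ito_shift p (H : R -> cpath T N -> 'M[R]_(p, N)) M :
  is_ito_integral P H M -> is_ito_integral P (shifted hT tT H 0) (delayed M).
Proof.
move=> [pH aM cM [S [S1 S2]]]; split.
- apply: (@predictable_mono _ _ hT _ _ (FW P)) (predictable_shifted hT hP tT 0 pH).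
  by move=> s _; exact: Ft_sub.
- exact: adapted_delayed.
- exact: continuous_delayed.
exists (fun n => shift_simple (S n)); split.
  apply: cvge0_le S1 => k.
    by apply: integral_ge0 => w _; apply: integral_ge0 => s _; rewrite lee_fin sqr_ge0.
  rewrite 2!expectation_barE.
  pose g := si_error (S k) H.
  have jg : jmeas g by exact: jmeas_si_error.
  have g0 s w : 0 <= g s w by exact: si_error_ge0.
  have gE (s : R) w : 0 < s <= T -> enorm (si_process (S k) s w - H s w) ^+ 2 = g s w.
    by move=> sT; rewrite -si_errorE.
  have inner' (w : cspace P) : (\int[@lebesgue_measure R]_(s in `[0%R, T])
      ((enorm (si_process (shift_simple (S k)) s w - shifted hT tT H 0 s w)) ^+ 2)%:E =
      sint g 0 (T - t) (psi w))%E.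
    pose h (s : R) := (t < s)%R%:R * g (s - t) (psi w).
    have mh : measurable_fun setT h.
      apply: measurable_funM; last first.
        have mg := jmeas_sect (Om := cspace P) (psi w) jg.
        have ms : measurable_fun setT (fun s : R => s - t).
          by apply: measurable_funB => //; exact: measurable_id.
        exact: (measurableT_comp mg ms).
      rewrite (_ : (fun _ => _) = (\1_(`]t, +oo[ : set R))); first exact: measurable_indic.
      apply/funext => z; rewrite indicE; congr (nat_of_bool _)%:R; apply/idP/idP;
        by rewrite inE/= in_itv/= andbT.
    have hE (s : R) : 0 <= s <= T ->
        enorm (si_process (shift_simple (S k)) s w - shifted hT tT H 0 s w) ^+ 2 = h s.
      move=> sT; rewrite shift_simple_process// /h /shifted; have [ts|st] := ltP t s.
        by rewrite gE ?mul1r// subr_gt0 ts/= lerBlDr (le_trans (proj2 (andP sT)))// lerDl.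
      rewrite subrr mul0r sqr_enorm big1// => i _; rewrite big1// => j _.
      by rewrite mxE expr0n.
    transitivity (\int[@lebesgue_measure R]_(s in `[0%R, T]) (h s)%:E)%E.
      by apply: eq_integral => s; rewrite inE/= in_itv/= => sT; rewrite hE.
    rewrite -integral_itv_obnd_cbnd; last by apply/measurable_EFinP; exact: measurable_funTS.
    rewrite sintE -[RHS](ge0_integral_shift t); last 2 first.
    - by apply/measurable_EFinP; exact: (jmeas_sect (Om := cspace P) (psi w) jg).
    - by move=> s; rewrite lee_fin.
    rewrite addr0 [t + (T - t)]addrC subrK.
    have sub : `]0, T]%classic `&` `]t, T]%classic = `]t, T]%classic.
      apply/seteqP; split => a /=; rewrite !in_itv/=; first by case.
      by move=> /andP[ta aT]; rewrite ta aT (le_lt_trans t0 ta).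
    rewrite -sub integral_mkcondr; apply: eq_integral => a.
    rewrite inE/= in_itv/= => /andP[a0 aT]; rewrite patchE /h; case: ifPn.
      by rewrite inE/= in_itv/= => /andP[-> _]; rewrite mul1r.
    by rewrite notin_setE/= in_itv/= aT andbT => /negP/negbTE ->; rewrite mul0r.
  have inner (w : cspace P) := si_error_sint hT (S k) w pH.
  under eq_integral => w _ do rewrite inner'.
  under [in leRHS]eq_integral => w _ do rewrite inner.
  rewrite (shift_integral hT hP tT (Z := sint g 0 (T - t))).
  - have := dint_split (cprob P) measurableT jg g0 c0 cT; rewrite !dintE => ->.
    by apply: leeDl; apply: integral_ge0 => w _; exact: sint_ge0.
  - exact: measurable_sint.
  - by move=> w; exact: sint_ge0.
move=> s sT; have dT := delay_rangeT sT.
have := S2 _ dT; apply: cvg_trans; apply: near_eq_cvg; apply: nearW => k.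
rewrite !expectation_barE -(shift_integral hT hP tT (Z := fun w : cspace P =>
  ((enorm (si_integral (S k) (delay s) w - M (delay s) w)) ^+ 2)%:E)).
- by apply: eq_integral => w _; rewrite shift_simple_integral.
- apply/measurable_EFinP; rewrite (_ : (fun w => _) = fun w =>
    \sum_i \sum_j (si_integral (S k) (delay s) w i j - M (delay s) w i j) ^+ 2).
    have mM i : measurable_fun setT (fun w : cspace P => M (delay s) w i ord0).
      by apply: adapted_coord_measurable.
    apply: measurable_sum => i; apply: measurable_sum => j; have -> : j = ord0 by exact: ord1.
    apply: measurable_funX; apply: measurable_funB; first exact: measurable_si_integral.
    exact: mM.
  apply/funext => w; rewrite sqr_enorm; apply: eq_bigr => i _; apply: eq_bigr => j _.
  by rewrite !mxE.
- by move=> w; rewrite lee_fin sqr_ge0.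
Qed.

Section solution.
Context (d m : nat) (U : set 'cV[R]_m) (b : 'cV[R]_d -> 'cV[R]_m -> 'cV[R]_d).
Context (sigma : 'cV[R]_d -> 'cV[R]_m -> 'M[R]_(d, N)).
Context (L : R) (L0 : 0 <= L) (rb : regular_coef U b L) (rs : regular_coef U sigma L).
Context (nu : R -> cpath T N -> 'cV[R]_m) (cnu : controls P U nu) (u0 : 'cV[R]_m) (Uu0 : U u0).

Lemma controls_shifted : controls_from P U t (shifted hT tT nu u0).
Proof.
have [pnu Unu] := cnu; have pF := predictable_shifted hT hP tT u0 pnu.
split => //; split.
  by apply: (@predictable_mono _ _ hT _ _ (FW P)) pF => s _; exact: Ft_sub.
move=> s w /andP[s0 sT]; rewrite /shifted; case: ltP => // ts; apply: Unu.
by rewrite subr_ge0 ltW//= (le_trans _ cT)// lerD2r.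
Qed.

Lemma Rintegral_drift nu' (Y : R -> cpath T N -> 'cV[R]_d) (r s : R) i (w : cspace P) :
  controls P U nu' -> adapted (FW P) Y -> continuous_process Y -> 0 <= r -> s <= T ->
  \int[lebesgue_measure]_(a in `[r, s]) b (Y a w) (nu' a w) i ord0 =
  \int[lebesgue_measure]_(a in `]r, s]) @drift R T N d m P b nu' Y r i a w.
Proof.
move=> cnu' aY cY r0 sT.
have E (a : R) : r < a <= s -> @drift R T N d m P b nu' Y r i a w = b (Y a w) (nu' a w) i ord0.
  move=> /andP[ra as'].
  by rewrite /drift ra (le_lt_trans r0 ra) (le_trans as' sT) !mul1r.
rewrite -(Rintegral_itv_obnd_cbnd (f := fun a => b (Y a w) (nu' a w) i ord0)).
  by apply: eq_Rintegral => a; rewrite inE/= in_itv/= => /E.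
apply: eq_integrable (drift_integrable hT L0 rb cnu' aY cY r i w _ _) => //.
  by move=> a; rewrite inE/= in_itv/= => /E /= ->.
exact: itv_lebesgue_fin.
Qed.

Lemma sde_shift x (Y : R -> cpath T N -> 'cV[R]_d) :
  sde_solution P b sigma nu 0 x Y ->
  sde_solution P b sigma (shifted hT tT nu u0) t x (delayed Y).
Proof.
move=> [aY cY [M [iM eqM]]].
have [cnu' _] := controls_shifted.
split; [exact: adapted_delayed|exact: continuous_delayed|].
exists (delayed M); split.
  have := is_ito_shift iM; congr is_ito_integral.
  apply/funext => s; apply/funext => w; rewrite /shifted /delayed.
  case: ltP => // ts; rewrite subr_gt0 ts.
  by rewrite (max_idPr _)// subr_ge0 ltW.
have FP : Filter (almost_everywhere P) by exact: ae_filter_ringOfSetsType.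
have := shift_ae hT hP tT eqM; apply: (@filterS _ _ FP) => w [e1 e2].
have Y0 : Y 0 (psi w) = x by apply: e1; rewrite lexx.
split.
  move=> s /andP[s0 st]; rewrite /delayed (max_idPl _) ?subr_le0//.
move=> s /andP[ts sT]; have s0 := le_trans t0 ts.
have sT' : 0 <= s <= T by rewrite s0.
rewrite /delayed e2 ?delay_rangeT// (max_idPr _) ?subr_ge0//.
congr (_ + _ + _); apply/matrixP => i j; rewrite !mxE.
rewrite (@Rintegral_drift nu Y 0 (s - t) i (psi w))//; last first.
  by rewrite (le_trans _ cT)// lerD2r.
rewrite (@Rintegral_drift _ (delayed Y) t s i w cnu' (adapted_delayed aY) (continuous_delayed cY) t0 sT).
rewrite -(Rintegral_shift t); last exact: jmeas_sect (jmeas_drift hT rb cnu aY cY 0 i).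
rewrite addr0 [t + (s - t)]addrC subrK; apply: eq_Rintegral => a.
rewrite inE/= in_itv/= => /andP[ta as'].
rewrite /drift /delayed /shifted ta (le_lt_trans t0 ta) (le_trans as' sT) subr_gt0 ta.
rewrite (max_idPr _) ?subr_ge0 ?(ltW ta)//.
by rewrite lerBlDr (le_trans (le_trans as' sT))// lerDl.
Qed.

End solution.
End shifted_integral.

(** * Viable controls *)

Lemma contraction_continuous (R : realType) (d : nat) (g : 'cV[R]_d -> R) :
  (forall z z', g z <= g z' + `|z - z'|) -> continuous g.
Proof.
move=> gl z; apply/(@cvgrPdist_le _ _ _ _ (nbhs_filter z)) => e e0.
apply/(@nbhs_normP _ 'cV[R]_d z); exists e => //= z' /= zz; apply: (le_trans _ (ltW zz)).
rewrite ler_norml; apply/andP; split.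
  by rewrite lerNl opprB lerBlDl -(distrC z'); exact: gl.
by rewrite lerBlDl; exact: gl.
Qed.

Section inner_radius.
Context (R : realType) (d : nat) (O : set 'cV[R]_d).

(* The element 1 keeps the infimum meaningful when O is the whole space. *)
Definition inner_radius (z : 'cV[R]_d) : R :=
  inf [set e | e = 1 \/ exists2 y, ~ O y & e = `|z - y|].

Let rS z : has_inf [set e | e = 1 \/ exists2 y, ~ O y & e = `|z - y|].
Proof.
split; first by exists 1; left.
by exists 0 => e [->|[y _ ->]].
Qed.

Lemma inner_radius_lip z z' : inner_radius z <= inner_radius z' + `|z - z'|.
Proof.
rewrite -lerBlDr; apply: lb_le_inf; first by case: (rS z').
move=> e [->|[y Oy ->]]; rewrite lerBlDr.
  have := ge_inf (rS z).2 (or_introl erefl : [set e | _ \/ _] 1).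
  by move=> h; apply: (le_trans h); rewrite lerDl.
have := ge_inf (rS z).2 (or_intror (ex_intro2 _ _ y Oy erefl) : [set e | _ \/ _] `|z - y|).
have tri : `|z - y| <= `|z' - y| + `|z - z'|.
  by rewrite -{1}(subrK z' z) -addrA addrC; exact: ler_normD.
by move=> h; exact: le_trans tri.
Qed.

Lemma inner_radius_continuous : continuous inner_radius.
Proof. exact: contraction_continuous inner_radius_lip. Qed.

Lemma inner_radius_gt0 z : open O -> (0 < inner_radius z) <-> O z.
Proof.
move=> oO; split=> [h|Oz].
  apply: contrapT => nO; have := ge_inf (rS z).2
    (or_intror (ex_intro2 _ _ z nO erefl) : [set e | _ \/ _] `|z - z|).
  by rewrite subrr normr0 leNgt h.
have /nbhs_normP[e /= e0 eO] : nbhs z O by exact: open_nbhs_nbhs.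
apply: (@lt_le_trans _ _ (Num.min 1 e)); first by rewrite lt_min ltr01.
apply: lb_le_inf; first by case: (rS z).
move=> _ [->|[y Oy ->]]; first by rewrite ge_min lexx.
rewrite ge_min; apply/orP; right; rewrite leNgt; apply/negP => zy.
exact: Oy (eO _ zy).
Qed.

End inner_radius.

Section integral_curves.
Context (R : realType).
Local Notation leb := (@lebesgue_measure R).

Let integrable_cst_itv (a s c : R) :
  leb.-integrable `]a, s] (EFin \o (fun _ : R => c)).
Proof.
apply: measurable_bounded_integrable.
- exact: measurable_itv.
- exact: itv_lebesgue_fin.
- exact: measurable_cst.
- exact: bounded_cst.
Qed.

Lemma Rintegral_bound (g : R -> R) (a s B : R) : a <= s ->
  leb.-integrable `]a, s] (EFin \o g) ->
  (forall q, a < q <= s -> `|g q| <= B) ->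
  `|\int[leb]_(q in `]a, s]) g q| <= B * (s - a).
Proof.
move=> as_ ig gB; apply: (le_trans (le_normr_Rintegral _ ig)) => //.
have -> : B * (s - a) = \int[leb]_(q in `]a, s]) B.
  by rewrite Rintegral_cst//= lebesgue_measure_itv/= lte_fin; case: ltP => // h;
    rewrite (le_anti (introT andP (conj h as_))) subrr.
apply: le_Rintegral; first exact: measurable_itv.
- exact: integrable_norm ig.
- exact: integrable_cst_itv.
- by move=> q /=; rewrite in_itv/=; exact: gB.
Qed.

Lemma curve_bound d (y g : R -> 'cV[R]_d) (a s B : R) : 0 <= B -> a <= s ->
  (forall i, leb.-integrable `]a, s] (EFin \o (fun q => g q i ord0))) ->
  (forall i, y s i ord0 = y a i ord0 + \int[leb]_(q in `]a, s]) g q i ord0) ->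
  (forall q, a < q <= s -> `|g q| <= B) ->
  `|y s - y a| <= B * (s - a).
Proof.
move=> B0 as_ ig yE gB; apply: norm_le_coord; first by rewrite mulr_ge0// subr_ge0.
move=> i j; rewrite (ord1 j) !mxE yE addrAC subrr add0r.
apply: Rintegral_bound => // q qs; apply: le_trans (gB q qs); exact: coord_le_norm.
Qed.

Lemma curve_tangent d (y : R -> 'cV[R]_d) (v : 'cV[R]_d -> 'cV[R]_d) (a s B L : R) :
  0 <= B -> 0 <= L -> a <= s ->
  (forall z z', `|v z - v z'| <= L * `|z - z'|) ->
  (forall i, leb.-integrable `]a, s] (EFin \o (fun q => v (y q) i ord0))) ->
  (forall r, a <= r <= s -> forall i,
    y r i ord0 = y a i ord0 + \int[leb]_(q in `]a, r]) v (y q) i ord0) ->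
  (forall q, a < q <= s -> `|v (y q)| <= B) ->
  `|y s - (y a + (s - a) *: v (y a))| <= L * B * (s - a) ^+ 2.
Proof.
move=> B0 L0 as_ vL ig yE vB.
have igr r i : r <= s -> leb.-integrable `]a, r] (EFin \o (fun q => v (y q) i ord0)).
  move=> rs; apply: integrableS (ig i) => // q /=.
  by rewrite !in_itv/= => /andP[-> /le_trans->].
have near q : a < q <= s -> `|y q - y a| <= B * (s - a).
  move=> /andP[aq qs]; have h : `|y q - y a| <= B * (q - a).
    apply: (curve_bound (g := fun q => v (y q))) => //; first exact: ltW.
    - by move=> i; exact: igr.
    - by move=> i; apply: yE; rewrite (ltW aq).
    - by move=> q' /andP[h1 h2]; apply: vB; rewrite h1 (le_trans h2 qs).
  by apply: (le_trans h); rewrite ler_wpM2l// lerD2r.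
apply: norm_le_coord; first by rewrite mulr_ge0 ?sqr_ge0// mulr_ge0.
move=> i j; rewrite (ord1 j) !mxE yE ?as_ ?lexx//.
have icst := integrable_cst_itv a s.
have -> : (s - a) * v (y a) i ord0 = \int[leb]_(q in `]a, s]) (v (y a) i ord0).
  rewrite Rintegral_cst//= lebesgue_measure_itv/= lte_fin; case: ltP => [_|h].
    by rewrite mulrC.
  by rewrite (le_anti (introT andP (conj h as_))) subrr mul0r mulr0.
rewrite opprD addrACA subrr add0r -RintegralB//.
rewrite expr2 mulrA -(mulrA L).
apply: Rintegral_bound => //.
  have := @integrableB _ _ _ leb `]a, s]%classic (measurable_itv _) _ _ (ig i) (icst (v (y a) i ord0)); exact.
move=> q qs; apply: (@le_trans _ _ `|v (y q) - v (y a)|).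
  by have := coord_le_norm (v (y q) - v (y a)) i ord0; rewrite !mxE.
by apply: (le_trans (vL _ _)); rewrite ler_wpM2l// near.
Qed.

End integral_curves.

Lemma hit_ge_before d (Om : measurableType d) (R : realType) (T : R)
    (Z : R -> Om -> R) (eps : R) (th : Om -> R) w (s : R) : s <= T ->
  (forall r, th w <= r < s -> Z r w < eps) -> s <= hit T Z eps th w.
Proof.
move=> sT H; apply: lb_le_inf; first by exists T; left.
move=> r [->//|[/andP[tr rT] Zr]]; rewrite leNgt; apply/negP => rs.
by have := H r; rewrite tr rs => /(_ isT); rewrite ltNge Zr.
Qed.

(** A countable dense set of deterministic times in [0, T]. It turns statements from a fixed time
    on, each with its own null set, into statements from a random time on. *)
Lemma rational_times (R : realType) (T : R) : 0 < T -> exists a : nat -> R,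
  (forall n, 0 <= a n <= T) /\
  forall r s : R, 0 <= r -> r < s -> s <= T -> exists n, r < a n < s.
Proof.
move=> hT.
exists (fun n => if unpickle n is Some q then Num.max 0 (Num.min T (ratr (q : rat))) else 0); split.
  by move=> n; case: unpickle => [q|]; rewrite ?le_max ?ge_max ?ge_min ?lexx ?(ltW hT).
move=> r s r0 rs sT; have /rat_in_itvoo[q] := rs.
rewrite in_itv/= => /andP[tq qs]; exists (pickle q).
have e1 : Num.min T (ratr q) = ratr q by apply/min_idPr; exact: ltW (lt_le_trans qs sT).
have e2 : Num.max 0 (ratr q) = ratr q :> R by apply/max_idPr; exact: ltW (le_lt_trans r0 tq).
by rewrite pickleK e1 e2 tq.
Qed.

Section patching.
Context (R : realType) (T : R) (hT : 0 < T) (N m : nat).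
Context (P : probability (Omega T N) R) (U : set 'cV[R]_m).

Local Notation GG := <<s time_space, predictable_rectangles (FW P) >>.

Let Gs : sigma_algebra time_space GG. Proof. exact: smallest_sigma_algebra. Qed.

(** The open stochastic interval after th is a countable union of predictable rectangles, one for
    each time of a dense sequence. *)
Lemma predictable_late (th : cspace P -> R) : stopping T (FW P) th ->
  GG [set z | 0 <= z.1 <= T /\ th z.2 < z.1].
Proof.
move=> [thT sth]; have [G0 GC GU] := Gs.
have [a [aT aP]] := rational_times hT.
rewrite (_ : [set _ | _] = \bigcup_n ([set r | a n < r <= T] `*` [set w | th w <= a n])).
  apply: GU => n; apply: sub_sigma_algebra; right.
  have /andP[a0 a1] := aT n.
  by exists (a n), T, [set w | th w <= a n]; split => //; exact: sth.
apply/seteqP; split => -[s w] /=.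
  have /andP[t0 _] := thT w.
  move=> [/andP[s0 sT] ts]; have [n /andP[tq qs]] := aP _ _ t0 ts sT; exists n => //=.
  by rewrite qs sT (ltW tq).
move=> [n _ [/= /andP[h1 h2] h3]]; have /andP[a0 a1] := aT n.
by rewrite h2 (le_trans a0 (ltW h1)) (le_lt_trans h3 h1).
Qed.

Lemma controls_cst u : U u -> controls P U (fun _ _ => u).
Proof.
move=> Uu; split => // i j B mB; have [G0 GC GU] := Gs.
have [Bu|Bu] := pselect (B (u i j)).
  rewrite (_ : _ `&` _ = time_space `\` set0); first exact: GC.
  by apply/seteqP; split => z; [move=> [h _]; split|move=> [h _]].
by rewrite (_ : _ `&` _ = set0)//; apply/seteqP; split => // z [].
Qed.

Definition patch (nu : R -> cpath T N -> 'cV[R]_m) (th : cspace P -> R) (u : 'cV[R]_m)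
    (s : R) (w : cpath T N) := if s <= th w then nu s w else u.

Lemma controls_patch nu th u : controls P U nu -> stopping T (FW P) th -> U u ->
  controls P U (patch nu th u).
Proof.
move=> [pnu Unu] sth Uu; split; last by move=> s w sT; rewrite /patch; case: ifP => // _; exact: Unu.
move=> i j B mB; have [G0 GC GU] := Gs; have Gl := predictable_late sth.
have GUI A A' : GG A -> GG A' -> GG (A `|` A').
  by move=> GA GA'; rewrite -bigcup2E; apply: GU => -[|[|n]] //=.
set late := [set z | _] in Gl.
pose C1 := time_space `&` [set z : R * cpath T N | B (nu z.1 z.2 i j)].
pose C2 := time_space `&` [set z : R * cpath T N | B (u i j)].
rewrite (_ : _ `&` _ = (time_space `\` ((time_space `\` C1) `|` late)) `|`
   (time_space `\` ((time_space `\` C2) `|` (time_space `\` late)))).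
  apply: (GUI); apply: (GC); apply: (GUI) => //; apply: (GC) => //; first exact: pnu.
  by have [pu _] := controls_cst Uu; exact: (pu i j B mB).
apply/seteqP; split => -[s w]; rewrite /C1 /C2 /late /patch /time_space /=.
  move=> [sT]; case: leP => [st|ts] h; [left|right]; split => //.
    by move=> [[_ []]|[_]]//; rewrite ltNge st.
  by move=> [[_ []]|[_ []]].
move=> [[sT h]|[sT h]]; split => //.
  case: leP => [st|ts]; last by exfalso; apply: h; right.
  by apply: contrapT => nB; apply: h; left; split => // -[].
case: leP => [st|ts]; last by apply: contrapT => nB; apply: h; left; split => // -[].
by exfalso; apply: h; right; split => // -[_]; rewrite ltNge st.
Qed.

End patching.

Section exits.
Context (R : realType) (T : R) (hT : 0 < T) (N d : nat).
Context (P : probability (Omega T N) R).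
Context (Y : R -> cpath T N -> 'cV[R]_d) (aY : adapted (FW P) Y) (cY : continuous_process Y).
Context (g : 'cV[R]_d -> R) (cg : continuous g).

Lemma exit_continuous (w : cspace P) : {within `[0, T], continuous (fun s => g (Y s w))}.
Proof.
move=> s; apply: (@continuous_comp _ _ _ (Y ^~ w : subspace _ -> _) g); first exact: (@cY w).
exact: cg.
Qed.

Lemma exit_measurable (s : R) : 0 <= s <= T -> gmeas (FW P s) (fun w : cspace P => g (Y s w)).
Proof.
move=> sT; apply/(gmeasP (Om := cspace P) (@augmentation_sigma _ _ _ P _)).
(* A second argument of dimension 0 brings g into the form of [measurable_within_comp]. *)
pose phi (p : 'cV[R]_d * 'cV[R]_0) := g p.1.
have cphi : {within setT, continuous phi}.
  apply: continuous_subspaceT => p.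
  apply: (@continuous_comp _ _ _ fst g); [exact: cvg_fst|exact: cg].
apply: (@measurable_within_comp _ (g_sigma_algebraType (FW P s)) R setT d 0 setT phi (Y s) (fun=> 0)) => //.
move=> i; apply/(gmeasP (Om := cspace P) (@augmentation_sigma _ _ _ P _)) => B mB.
exact: (@aY s sT i ord0 B mB).
Qed.

Lemma exit_stopping eps th : stopping T (FW P) th ->
  stopping T (FW P) (hit T (fun s (w : cspace P) => g (Y s w)) eps th).
Proof.
move=> [thT sth]; apply: (hit_stopping (FW_filtered P)) => //.
- by move=> w; exact: exit_continuous.
- by move=> s sT; exact: exit_measurable.
Qed.

End exits.

Lemma stopping_min (Om : Type) (R : realType) (T : R) (F : R -> set (set Om)) th th' :
  (forall s, sigma_algebra setT (F s)) -> stopping T F th -> stopping T F th' ->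
  stopping T F (fun w => Num.min (th w) (th' w)).
Proof.
move=> Fs [t1 s1] [t2 s2]; split.
  move=> w; have /andP[a1 a2] := t1 w; have /andP[a3 a4] := t2 w.
  by rewrite le_min a1 a3 ge_min a2.
move=> s sT; rewrite (_ : [set _ | _] = [set w | th w <= s] `|` [set w | th' w <= s]).
  by apply: (salgU (Fs s)); [exact: s1|exact: s2].
apply/seteqP; split => w /=; rewrite ge_min; first by case/orP; [left|right].
by case=> ->; rewrite ?orbT.
Qed.

Lemma stopping_cst d (Om : measurableType d) (R : realType) (T : R) (F : R -> set (set Om)) (a : R) :
  filtered T F -> 0 <= a <= T -> stopping T F (fun=> a).
Proof.
move=> fF aT; split => // s sT; have [as_|sa] := leP a s.
  rewrite (_ : [set _ | _] = setT); first exact: salgT (filt_sigma fF s).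
  by apply/seteqP; split.
rewrite (_ : [set _ | _] = set0); first exact: salg0 (filt_sigma fF s).
by apply/seteqP; split.
Qed.

Lemma stopping_delay d (Om : measurableType d) (R : realType) (T : R) (F : R -> set (set Om)) th (h : R) :
  filtered T F -> 0 < T -> stopping T F th -> 0 <= h ->
  stopping T F (fun w => Num.min T (th w + h)).
Proof.
move=> fF hT [tT st] h0; split.
  move=> w; have /andP[t0 _] := tT w.
  by rewrite le_min (ltW hT) addr_ge0//= ge_min lexx.
move=> s /andP[s0 sT]; have [Ts|sT'] := leP T s.
  rewrite (_ : [set _ | _] = setT); first exact: salgT (filt_sigma fF s).
  by apply/seteqP; split => // w _ /=; rewrite ge_min Ts.
have [hs|sh] := leP h s.
  rewrite (_ : [set _ | _] = [set w | th w <= s - h]).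
    by apply: (filt_mono fF (s := s - h)); rewrite ?subr_ge0 ?gerBl//; apply: st;
      rewrite subr_ge0 hs/= (le_trans _ sT)// gerBl.
  by apply/seteqP; split => w /=; rewrite ge_min leNgt sT'/= lerBrDr.
rewrite (_ : [set _ | _] = set0); first exact: salg0 (filt_sigma fF s).
apply/seteqP; split => // w /=; rewrite ge_min leNgt sT'/= => h1.
have /andP[t0 _] := tT w.
by have := le_lt_trans h1 sh; rewrite gtrDr ltNge t0.
Qed.

Lemma le_hit d (Om : measurableType d) (R : realType) (T : R)
    (Z : R -> Om -> R) (eps : R) (th : Om -> R) w (s : R) :
  (forall w, 0 <= th w <= T) ->
  th w <= s -> eps <= Z s w -> hit T Z eps th w <= s.
Proof.
move=> thT ts Zs; rewrite leNgt; apply/negP => sh.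
by have := hit_before thT ts sh; rewrite ltNge Zs.
Qed.

(** * Zones and the stages spent in them *)

Section zones.
Context (R : realType) (T : R) (hT : 0 < T) (N d m : nat).
Context (P : probability (Omega T N) R) (hP : wiener_measure P).
Context (U : set 'cV[R]_m) (b : 'cV[R]_d -> 'cV[R]_m -> 'cV[R]_d).
Context (sigma : 'cV[R]_d -> 'cV[R]_m -> 'M[R]_(d, N)).
Context (L : R) (L0 : 0 <= L) (rb : regular_coef U b L) (rs : regular_coef U sigma L).
Context (C : set 'cV[R]_d).

(* A region {|y - zc| < zr} in which the constant control zu keeps the state in the
   interior of C until exit from the region or for the time zh. *)
Record zone := Zone { zc : 'cV[R]_d ; zr : R ; zu : 'cV[R]_m ; zh : R }.

(** The last two clauses limit the time step. With B the speed bound in the zone, the curve leaves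
    its tangent by at most L B s^2 in maximum norm; the dimension factor passes to the Euclidean
    norm, and for s up to [zh] the result is below r s, inside the ball of the cone condition. *)
Definition noise_free_zone (z : zone) (r : R) : Prop :=
  [/\ forall y, `|y - zc z| <= zr z -> C y -> sigma y (zu z) = 0,
      forall y s, `|y - zc z| <= zr z -> C y -> 0 < s < r ->
        eball (y + s *: b y (zu z)) (r * s) `<=` C°,
      zh z < r &
      (d * 1)%:R * (L * (L * (1 + `|zc z| + zr z))) * zh z < r].

Definition good_zone (z : zone) : Prop :=
  [/\ U (zu z), 0 < zh z &
      (forall y, `|y - zc z| <= zr z -> C° y) \/ exists r, noise_free_zone z r].

Section stage.
Context (nu : R -> cpath T N -> 'cV[R]_m) (cnu : controls P U nu) (x : 'cV[R]_d).
Context (Y : R -> cpath T N -> 'cV[R]_d) (sY : sde_solution P b sigma nu 0 x Y).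
Context (z : zone) (Uz : U (zu z)).

Let aY : adapted (FW P) Y. Proof. by case: sY. Qed.
Let cY : continuous_process Y. Proof. by case: sY. Qed.

Definition zone_dist (s : R) (w : cspace P) : R := `|Y s w - zc z|.
(** The sign turns the exit from the interior into reaching the level 0 from below, so that [hit]
    applies. *)
Let depth (s : R) (w : cspace P) : R := - inner_radius C° (Y s w).

Let cdist : continuous (fun y : 'cV[R]_d => `|y - zc z|).
Proof.
apply: contraction_continuous => y y'.
by rewrite -{1}(subrK y' y) -addrA addrC; exact: ler_normD.
Qed.

Let cdepth : continuous (fun y : 'cV[R]_d => - inner_radius C° y).
Proof.
move=> y; apply: (@continuous_comp _ _ _ (inner_radius C°) (fun v => - v)).
  exact: inner_radius_continuous.
exact: opp_continuous.
Qed.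

Let cZ1 w : {within `[0, T], continuous zone_dist ^~ w}.
Proof. exact: (exit_continuous cY cdist). Qed.

Let cZ2 w : {within `[0, T], continuous depth ^~ w}.
Proof. exact: (exit_continuous cY cdepth). Qed.

Let depthP (s : R) w : depth s w < 0 <-> C° (Y s w).
Proof. by rewrite /depth oppr_lt0; apply: inner_radius_gt0; exact: open_interior. Qed.

Lemma zone_exit_stopping (th : cspace P -> R) : stopping T (FW P) th ->
  stopping T (FW P) (hit T zone_dist (zr z) th).
Proof. exact: (exit_stopping aY cY cdist). Qed.

(** The starting time a is deterministic so that {th <= a} is an event of the filtration at time a,
    as [sde_noise_free] requires. The noise is off up to the exit from the zone or from the
    interior. *)
Lemma zone_flow (th : cspace P -> R) (a : R) :
  stopping T (FW P) th -> 0 <= a <= T ->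
  (forall w s, th w < s -> nu s w = zu z) ->
  (forall y, `|y - zc z| <= zr z -> C y -> sigma y (zu z) = 0) ->
  {ae cprob P, forall w, th w <= a -> forall s : R, a <= s <= T ->
    (forall r, a <= r < s -> zone_dist r w < zr z /\ C° (Y r w)) ->
    forall i, Y s w i ord0 = Y a w i ord0 +
      \int[@lebesgue_measure R]_(q in `]a, s]) b (Y q w) (zu z) i ord0}.
Proof.
move=> sth aT after s0; have [_ st] := sth.
have sa : stopping T (FW P) (fun _ : cspace P => a) by exact: stopping_cst (FW_filtered P) aT.
have saT : forall w : cspace P, 0 <= a <= T := sa.1.
pose ze w := Num.min (hit T zone_dist (zr z) (fun _ : cspace P => a) w) (hit T depth 0 (fun _ : cspace P => a) w).
have sze : stopping T (FW P) ze.
  apply: stopping_min; first exact: filt_sigma (FW_filtered P).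
    exact: (exit_stopping aY cY cdist (zr z) sa).
  exact: (exit_stopping aY cY cdepth 0 sa).
have nf (w : cpath T N) (s : R) : [set w | th w <= a] w -> a < s < ze w -> sigma (Y s w) (nu s w) = 0.
  move=> /= ta /andP[as_]; rewrite lt_min => /andP[s1 s2].
  rewrite after; last exact: le_lt_trans as_.
  have h1 := @hit_before _ _ _ _ _ _ _ saT w s (ltW as_) s1.
  have h2 := @hit_before _ _ _ _ _ _ _ saT w s (ltW as_) s2.
  by apply: s0; [exact: ltW|apply: interior_subset; exact/depthP].
have := sde_noise_free hT hP L0 rb rs cnu sY aT (st a aT) sze nf.
apply: (@filterS _ _ (cprob_ae_filter P)) => w H ta s /andP[as_ sT] Hr i.
rewrite H//; last first.
  rewrite as_ /ze le_min /=; apply/andP; split.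
    by apply: (hit_ge_before (Om := cspace P) sT) => r /Hr [].
  by apply: (hit_ge_before (Om := cspace P) sT) => r /Hr [_ h2]; exact/depthP.
congr (_ + _); apply: eq_Rintegral => q; rewrite inE/= in_itv/= => /andP[aq _].
by rewrite after// (le_lt_trans ta aq).
Qed.

Lemma zone_integrable (a s : R) (w : cspace P) i : 0 <= a -> s <= T ->
  (forall r, a < r <= s -> nu r w = zu z) ->
  lebesgue_measure.-integrable `]a, s] (EFin \o (fun q => b (Y q w) (zu z) i ord0)).
Proof.
move=> a0 sT after.
apply: eq_integrable (drift_integrable hT L0 rb cnu aY cY a i w _ _) => //; last first.
  exact: itv_lebesgue_fin.
move=> q; rewrite inE/= in_itv/= => /andP[aq qs].
by rewrite /drift aq (le_lt_trans a0 aq) (le_trans qs sT) !mul1r after// aq.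
Qed.

Lemma zone_speed y : `|y - zc z| <= zr z -> `|b y (zu z)| <= L * (1 + `|zc z| + zr z).
Proof.
move=> h; apply: (le_trans (coef_growth rb y Uz)); rewrite ler_wpM2l// -addrA lerD2l.
have tri : `|y| <= `|zc z| + `|y - zc z| by rewrite -{1}(subrK (zc z) y) addrC; exact: ler_normD.
by apply: (le_trans tri); rewrite lerD2l.
Qed.

(** The ball of radius r (s - c) around the tangent point lies in the interior, and the deviation of
    the curve from its tangent is smaller than that radius. *)
Lemma noise_free_step (y : R -> 'cV[R]_d) (r c s : R) : noise_free_zone z r ->
  c < s -> s - c <= zh z -> C° (y c) ->
  (forall q, c <= q <= s -> `|y q - zc z| <= zr z) ->
  (forall i, lebesgue_measure.-integrable `]c, s] (EFin \o (fun q => b (y q) (zu z) i ord0))) ->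
  (forall r', c <= r' <= s -> forall i, y r' i ord0 = y c i ord0 +
     \int[@lebesgue_measure R]_(q in `]c, r']) b (y q) (zu z) i ord0) ->
  C° (y s).
Proof.
move=> [zs zb zr' zB] cs csh Cc yZ iy flow.
have yc : `|y c - zc z| <= zr z by apply: yZ; rewrite lexx ltW.
have zr0 : 0 <= zr z := le_trans (normr_ge0 _) yc.
set B := L * (1 + `|zc z| + zr z).
have B0 : 0 <= B by rewrite mulr_ge0// !addr_ge0.
have tan := @curve_tangent _ _ y (fun v => b v (zu z)) c s B L B0 L0 (ltW cs)
  (fun v v' => coef_lip rb v v' Uz) iy flow.
have {tan} tan : `|y s - (y c + (s - c) *: b (y c) (zu z))| <= L * B * (s - c) ^+ 2.
  by apply: tan => q /andP[cq qs]; apply: zone_speed; apply: yZ; rewrite (ltW cq).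
have tau0 : 0 < s - c by rewrite subr_gt0.
apply: (zb (y c) (s - c) yc (interior_subset Cc)).
  by rewrite tau0 (le_lt_trans csh).
rewrite /eball/=; apply: (le_lt_trans (enorm_le_norm _)).
apply: (@le_lt_trans _ _ ((d * 1)%:R * (L * B * (s - c) ^+ 2))); first by rewrite ler_wpM2l.
have -> : (d * 1)%:R * (L * B * (s - c) ^+ 2) = (d * 1)%:R * (L * B) * (s - c) * (s - c) by ring.
rewrite ltr_pM2r//; apply: le_lt_trans zB; rewrite -/B ler_wpM2l//.
by rewrite mulr_ge0// mulr_ge0.
Qed.

Lemma first_exit (th : cspace P -> R) w s : stopping T (FW P) th ->
  C° (Y (th w) w) -> th w <= s <= T -> ~ C° (Y s w) ->
  exists s0, [/\ th w < s0, s0 <= s, ~ C° (Y s0 w) &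
    forall r, th w <= r < s0 -> C° (Y r w)].
Proof.
move=> sth Cth /andP[ts sT] nC; have thT : forall w : cspace P, 0 <= th w <= T := sth.1.
have ds : 0 <= depth s w by rewrite leNgt; apply/negP => /depthP.
have s0s := le_hit thT ts ds.
have nC0 : ~ C° (Y (hit T depth 0 th w) w).
  have [s0T|Ts0] := ltP (hit T depth 0 th w) T.
    by move=> /depthP; have := hit_reach cZ2 thT s0T; rewrite leNgt => /negbTE ->.
  by have -> : hit T depth 0 th w = s by apply: le_anti; rewrite s0s (le_trans sT Ts0).
exists (hit T depth 0 th w); split; [|exact: s0s|exact: nC0|].
  have := hit_ge depth 0 thT w; rewrite le_eqVlt => /orP[/eqP e|]; last exact.
  by exfalso; apply: nC0; rewrite -e.
by move=> r /andP[h1 h2]; apply/depthP; exact: (hit_before thT h1 h2).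
Qed.

(** Suppose the path leaves the interior before leaving the zone, and let s0 be the first such time.
    A rational time c between th and s0 is a deterministic start at an interior state; from c the
    path is an integral curve up to and including s0, so [noise_free_step] puts its value at s0 in
    the interior. *)
Lemma noise_free_stage (th : cspace P -> R) (r : R) : stopping T (FW P) th ->
  (forall w s, th w < s -> nu s w = zu z) -> noise_free_zone z r ->
  {ae cprob P, forall w, C° (Y (th w) w) -> zone_dist (th w) w < zr z ->
    forall s, th w <= s <= hit T zone_dist (zr z) th w -> s <= th w + zh z -> C° (Y s w)}.
Proof.
move=> sth after nz; have [zs _ _ _] := nz.
have thT : forall w : cspace P, 0 <= th w <= T := sth.1.
have [a [aT aP]] := rational_times hT.
have := @ae_foralln _ _ _ (cprob P) _ (fun n => zone_flow sth (aT n) after zs).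
apply: (@filterS _ _ (cprob_ae_filter P)) => w H Cth dth s /andP[ts sh] sth'.
have sT : s <= T := le_trans sh (hit_le zone_dist (zr z) thT w).
apply: contrapT => nC.
have [|s0 [ts0 s0s nC0 inC]] := first_exit sth Cth _ nC; first by rewrite ts sT.
have /andP[th0 _] := thT w.
have [n /andP[]] := aP _ _ th0 ts0 (le_trans s0s sT).
have {H} := H n; have /andP[c0 _] := aT n; move: (a n) c0 => c c0 H tq qs.
have inZ r' : th w <= r' -> r' <= s0 -> zone_dist r' w <= zr z.
  move=> h1 h2; apply: (hit_value_le cZ1 thT dth).
  by rewrite h1 (le_trans h2 (le_trans s0s sh)).
have hitZ r' : th w <= r' -> r' < s0 -> zone_dist r' w < zr z.
  move=> h1 h2; apply: (hit_before thT h1).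
  exact: lt_le_trans h2 (le_trans s0s sh).
have s0h : s0 <= th w + zh z := le_trans s0s sth'.
have s0T : s0 <= T := le_trans s0s sT.
clear s nC sh sth' ts sT s0s.
apply: nC0; apply: (@noise_free_step (fun q => Y q w) r c s0 nz qs).
- by rewrite lerBlDr (le_trans s0h)// addrC lerD2l ltW.
- by apply: inC; rewrite (ltW tq) qs.
- by move=> q /andP[cq qs0]; apply: inZ => //; exact: ltW (lt_le_trans tq cq).
- move=> i.
  have aft r' : c < r' <= s0 -> nu r' w = zu z.
    by move=> /andP[cr _]; apply: after; exact: lt_trans cr.
  have zi := zone_integrable i c0 s0T aft.
  exact: zi.
move=> r' /andP[cr rs0]; apply: (H (ltW tq)).
  by rewrite cr (le_trans rs0 s0T).
move=> r2 /andP[h1 h2]; have tr2 := le_trans (ltW tq) h1; split.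
  by apply: hitZ => //; exact: lt_le_trans rs0.
by apply: inC; rewrite tr2 (lt_le_trans h2 rs0).
Qed.

Lemma good_stage (th : cspace P -> R) : stopping T (FW P) th ->
  (forall w s, th w < s -> nu s w = zu z) -> good_zone z ->
  {ae cprob P, forall w, C° (Y (th w) w) ->
    forall s, th w <= s <= hit T zone_dist (zr z) th w -> s <= th w + zh z -> C° (Y s w)}.
Proof.
move=> sth after [_ _ gz]; have thT : forall w : cspace P, 0 <= th w <= T := sth.1.
(* A stage that starts outside the zone ends at once, so it consists of its initial time only. *)
have out w s : zr z <= zone_dist (th w) w ->
    th w <= s <= hit T zone_dist (zr z) th w -> s = th w.
  move=> h /andP[ts sh]; apply: le_anti; rewrite ts andbT (le_trans sh)//.
  exact: le_hit.
case: gz => [Cz|[r nz]].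
  apply: aeW => w Cth s sh _; have [dz|dz] := ltP (zone_dist (th w) w) (zr z).
    by apply: Cz; exact: (hit_value_le cZ1 thT dz sh).
  by rewrite (out _ _ dz sh).
apply: (@filterS _ _ (cprob_ae_filter P)) (noise_free_stage sth after nz) => w H Cth s sh st.
have [dz|dz] := ltP (zone_dist (th w) w) (zr z); first exact: H.
by rewrite (out _ _ dz sh).
Qed.

End stage.

(** Every small ball with centre near y is a zone, not just those centred at y; this allows rational
    centres and radii. The factor 2 in the radii accounts for moving the centre, the dimension
    factor for comparing norms. *)
Lemma good_zone_near (hC : closure C° = C)
  (hbd : forall x, boundary C x -> exists (u : 'cV[R]_m) (r eta : R),
     [/\ U u, 0 < r, 0 < eta,
         forall z, eball x eta z -> C z -> sigma z u = 0 &
         forall z s, eball x eta z -> C z -> 0 < s < r ->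
           eball (z + s *: b z u) (r * s) `<=` C°]) (hU0 : U !=set0) y :
  C y -> exists2 rho : R, 0 < rho & forall c e, `|y - c| < rho -> 0 < e < rho ->
    exists u h, good_zone (Zone c e u h).
Proof.
move=> Cy; have [u0 Uu0] := hU0.
have [Cy'|nCy] := pselect (C° y).
  have /nbhs_normP[e /= e0 eC] : nbhs y C° by apply: open_nbhs_nbhs; split => //; exact: open_interior.
  exists (e / 2); first by rewrite divr_gt0.
  move=> c e' yc /andP[e'0 e'e]; exists u0, 1; split => //; left => v /= vc.
  apply: eC; rewrite /= -(subrK c y) -addrA (le_lt_trans (ler_normD _ _))//.
  by rewrite [ltRHS]splitr ltr_leD// distrC (le_trans vc)// ltW.
have [u [r [eta [Uu r0 eta0 es eb]]]] : exists (u : 'cV[R]_m) (r eta : R),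
     [/\ U u, 0 < r, 0 < eta,
         forall z, eball y eta z -> C z -> sigma z u = 0 &
         forall z s, eball y eta z -> C z -> 0 < s < r ->
           eball (z + s *: b z u) (r * s) `<=` C°].
  apply: hbd; split => //; rewrite -hC.
  by apply: (@subset_closure _ _ _); rewrite hC.
have k0 : 0 < (d * 1)%:R + 1 :> R by rewrite ltr_wpDl.
exists (eta / ((d * 1)%:R + 1) / 2); first by rewrite !divr_gt0.
move=> c e yc /andP[e0 ee].
have near v : `|v - c| <= e -> eball y eta v.
  move=> vc; rewrite /eball/=; apply: (le_lt_trans (enorm_le_norm _)).
  have h : `|v - y| < eta / ((d * 1)%:R + 1).
    rewrite -(subrK c v) -addrA (le_lt_trans (ler_normD _ _))//.
    by rewrite [ltRHS]splitr ler_ltD// ?(le_trans vc) 1?ltW// distrC.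
  apply: (@le_lt_trans _ _ (((d * 1)%:R + 1) * `|v - y|)); first by rewrite ler_wpM2r// lerDl.
  by rewrite mulrC -ltr_pdivlMr.
pose K := (d * 1)%:R * (L * (L * (1 + `|c| + e))).
have K0 : 0 <= K by rewrite !mulr_ge0// !addr_ge0// ltW.
(* (K + 1) h = r/2 makes both h and K h smaller than r. *)
pose h := r / (K + 1) / 2.
have h0 : 0 < h by rewrite /h !divr_gt0// ltr_wpDl.
have hr : (K + 1) * h < r.
  rewrite /h mulrA [(K + 1) * _]mulrC divfK ?gt_eqF ?ltr_wpDl//.
  by rewrite ltr_pdivrMr// ltr_pMr// ltr1n.
exists u, h; split => //; right; exists r; split => /=.
- by move=> v /near; exact: es.
- by move=> v s /near; exact: eb.
- by apply: le_lt_trans hr; rewrite ler_peMl ?(ltW h0)// lerDr.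
- by apply: le_lt_trans hr; rewrite ler_wpM2r ?(ltW h0)// lerDl.
Qed.

End zones.

Lemma rational_vector (R : realType) (d : nat) (y : 'cV[R]_d) (e : R) : 0 < e ->
  exists q : 'cV[rat]_d, `|y - map_mx ratr q| < e.
Proof.
move=> e0; have e2 : 0 < e / 2 by rewrite divr_gt0.
have /choice[q qP] : forall i : 'I_d, exists q : rat, `|y i ord0 - ratr q| <= e / 2.
  move=> i; have : y i ord0 - e / 2 < y i ord0 + e / 2 by rewrite ltrD2l gtrN.
  move=> /rat_in_itvoo[q]; rewrite in_itv/= => /andP[q1 q2]; exists q.
  by rewrite ler_norml lerBrDr lerBlDr -lerBrDl; apply/andP; split; lra.
exists (\col_i q i); apply: (@le_lt_trans _ _ (e / 2)); last by rewrite ltr_pdivrMr// ltr_pMr// ltr1n.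
by apply: norm_le_coord => [|i j]; [exact: ltW|rewrite (ord1 j) !mxE].
Qed.

(** * Construction of a viable control *)

Section viability.
Context (R : realType) (T : R) (hT : 0 < T) (N d m : nat).
Context (P : probability (Omega T N) R) (hP : wiener_measure P).
Context (U : set 'cV[R]_m) (b : 'cV[R]_d -> 'cV[R]_m -> 'cV[R]_d).
Context (sigma : 'cV[R]_d -> 'cV[R]_m -> 'M[R]_(d, N)).
Context (L : R) (L0 : 0 <= L) (rb : regular_coef U b L) (rs : regular_coef U sigma L).
Context (C : set 'cV[R]_d).
Context (X : (R -> cpath T N -> 'cV[R]_m) -> R -> 'cV[R]_d -> R -> cpath T N -> 'cV[R]_d).
Context (hX : forall nu t x, controls P U nu -> 0 <= t <= T ->
  unique_sde_solution P b sigma nu t x (X nu t x)).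
Context (u0 : 'cV[R]_m) (Uu0 : U u0).

Let zeroT : 0 <= (0 : R) <= T. Proof. by rewrite lexx ltW. Qed.

(** Rational centres and radii 1/(n+1) leave countably many candidates. Each code is used infinitely
    often, because a limit of stage times must meet its zone again arbitrarily late. *)
Lemma zone_sequence : (forall y, C y -> exists2 rho : R, 0 < rho &
    forall c e, `|y - c| < rho -> 0 < e < rho ->
      exists u h, good_zone U b sigma L C (Zone c e u h)) ->
  exists zs : nat -> zone R d m, (forall k, good_zone U b sigma L C (zs k)) /\
    forall y, C y -> exists z, `|y - zc z| < zr z /\
      forall K, exists2 k, (K <= k)%N & zs k = z.
Proof.
move=> near.
(* A negative radius gives an empty region, for which the zone conditions are vacuous; it replaces
   candidates that are not good. *)
have dummy : good_zone U b sigma L C (Zone 0 (-1) u0 1).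
  split => //; left => y /= h; exfalso.
  by have := le_trans (normr_ge0 _) h; rewrite oppr_ge0 leNgt ltr01.
have /choice[f fP] : forall p : 'cV[rat]_d * nat, exists z, good_zone U b sigma L C z /\
    ((exists u h, good_zone U b sigma L C (Zone (map_mx ratr p.1) p.2.+1%:R^-1 u h)) ->
     zc z = map_mx ratr p.1 /\ zr z = p.2.+1%:R^-1).
  move=> p; have [[u [h g]]|ng] := pselect (exists u h,
    good_zone U b sigma L C (Zone (map_mx ratr p.1) p.2.+1%:R^-1 u h)).
    by exists (Zone (map_mx ratr p.1) p.2.+1%:R^-1 u h).
  by exists (Zone 0 (-1) u0 1); split.
(* The zone at stage k is coded by the exponent of 2 in k, which is unchanged under multiplication
   by an odd number; hence every code recurs beyond any K. *)
exists (fun k => if unpickle (logn 2 k) is Some p then f p else Zone 0 (-1) u0 1); split.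
  by move=> k; case: unpickle => [p|]//; have [] := fP p.
move=> y /near[rho rho0 H].
have [n _ /(_ n (leqnn _)) nr] := near_infty_natSinv_lt (PosNum rho0).
have n0 : 0 < n.+1%:R^-1 :> R by rewrite invr_gt0.
have [q qy] := rational_vector y n0.
have [_ [|fc fr]] := fP (q, n).
  by apply: H; [exact: lt_trans nr|rewrite n0].
exists (f (q, n)); split; first by rewrite fc fr.
move=> K; exists (2 ^ pickle (q, n) * K.*2.+1)%N.
  rewrite (@leq_trans K.*2.+1)//; first by rewrite leqW// -addnn leq_addr.
  by rewrite leq_pmull// expn_gt0.
rewrite lognM ?expn_gt0// pfactorK//.
have -> : logn 2 K.*2.+1 = 0%N.
  by apply/eqP; rewrite -leqn0 leqNgt logn_gt0 mem_primes/= dvdn2/= odd_double.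
by rewrite addn0 pickleK.
Qed.

Section construction.
Context (zs : nat -> zone R d m) (gzs : forall k, good_zone U b sigma L C (zs k)).
Context (x : 'cV[R]_d) (Cx : C° x).

(** The end of the stage is read off the solution for the control already modified after [p.2]. By
    [sde_local], later modifications almost surely leave that solution unchanged up to this end. *)
Definition next_stage (z : zone R d m) (p : (R -> cpath T N -> 'cV[R]_m) * (cspace P -> R)) :
    (R -> cpath T N -> 'cV[R]_m) * (cspace P -> R) :=
  let nu := patch p.1 p.2 (zu z) in
  (nu, fun w => Num.min (hit T (zone_dist (P := P) (X nu 0 x) z) (zr z) p.2 w)
                        (Num.min T (p.2 w + zh z))).

Fixpoint stages (k : nat) : (R -> cpath T N -> 'cV[R]_m) * (cspace P -> R) :=
  if k is k'.+1 then next_stage (zs k') (stages k') else (fun _ _ => u0, fun=> 0).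

Let nus k := (stages k).1.
Let ths k := (stages k).2.

Let hX0 nu : controls P U nu -> sde_solution P b sigma nu 0 x (X nu 0 x).
Proof. by move=> cnu; have [] := hX x cnu zeroT. Qed.

Let stages_valid k : controls P U (nus k) /\ stopping T (FW P) (ths k).
Proof.
elim: k => [|k [cnu sth]].
  by split; [exact: controls_cst|exact: stopping_cst (FW_filtered P) zeroT].
have [Uz hz _] := gzs k.
have cnu' : controls P U (nus k.+1) by exact: controls_patch.
split; first exact: cnu'.
apply: (@stopping_min _ _ T (FW P)); first exact: filt_sigma (FW_filtered P).
  by apply: zone_exit_stopping sth; exact: hX0.
exact: (stopping_delay (FW_filtered P) hT sth (ltW hz)).
Qed.

Let ths_range k w : 0 <= ths k w <= T. Proof. by have [_ []] := stages_valid k. Qed.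

Let ths_le k w : ths k w <= ths k.+1 w.
Proof.
have [_ hz _] := gzs k; have /andP[_ tT] := ths_range k w.
rewrite /ths /= le_min le_min tT lerDl (ltW hz) !andbT.
exact: (hit_ge _ _ (ths_range k)).
Qed.

Let ths_mono w j k : (j <= k)%N -> ths j w <= ths k w.
Proof.
elim: k => [|k IH]; first by rewrite leqn0 => /eqP ->.
by rewrite leq_eqVlt => /orP[/eqP ->//|/IH jk]; exact: le_trans (ths_le k w).
Qed.

Let nus_agree j k s w : (k <= j)%N -> s <= ths k w -> nus j s w = nus k s w.
Proof.
elim: j => [|j IH]; first by rewrite leqn0 => /eqP ->.
rewrite leq_eqVlt => /orP[/eqP ->//|kj] sk.
have kj' : (k <= j)%N by [].
by rewrite -IH// /nus /= /patch (le_trans sk (ths_mono w kj')).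
Qed.

(** Until the previous stage time [sde_local] transfers viability from the old control to the new
    one; afterwards [good_stage] takes over. *)
Let stages_viable k : {ae cprob P, forall w, forall s, 0 <= s <= ths k w ->
  C° (X (nus k) 0 x s w)}.
Proof.
elim: k => [|k IH].
  have [_ _ [M [_ eqM]]] := hX0 (stages_valid 0).1.
  have := (ae_cprob P _).1 eqM.
  apply: (@filterS _ _ (cprob_ae_filter P)) => w [h _] s s0; by rewrite h.
have [cnu sth] := stages_valid k; have [cnu' _] := stages_valid k.+1.
have [Uz hz _] := gzs k.
have after w s : ths k w < s -> nus k.+1 s w = zu (zs k).
  by rewrite /nus /= /patch leNgt => ->.
have loc := sde_local hT hP L0 rb rs cnu' cnu (hX0 cnu') (hX0 cnu) sth
  (fun w s h => nus_agree (leqnSn k) (proj2 (andP h))).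
have st := good_stage hT hP L0 rb rs cnu' (hX0 cnu') Uz sth after (gzs k).
apply: (@filterS3 _ _ (cprob_ae_filter P) _ _ _ _ _ IH loc st) => w h1 h2 h3 s /andP[s0 sk].
have /andP[t0 _] := ths_range k w.
have [st'|ts] := leP s (ths k w).
  by rewrite h2 ?s0//; apply: h1; rewrite s0.
move: sk; rewrite /ths /= !le_min => /andP[sh /andP[_ sz]].
apply: h3 => //; last by rewrite (ltW ts).
by rewrite h2 ?t0 ?lexx//; apply: h1; rewrite t0 lexx.
Qed.

(** All stages that have reached time s prescribe the same value, so the choice of k does not
    matter. The value u0 covers paths whose stage times never reach s, which form a null set in the
    end. *)
Definition limit_control (s : R) (w : cpath T N) : 'cV[R]_m :=
  if pselect (exists k, s <= ths k w) is left h then nus (projT1 (cid h)) s w else u0.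

Let limit_agree k s w : s <= ths k w -> limit_control s w = nus k s w.
Proof.
move=> sk; rewrite /limit_control; case: pselect => [h|]; last by case; exists k.
case: (cid h) => j /= sj; have [jk|kj] := leqP j k; first exact/esym/nus_agree.
exact: nus_agree (ltnW kj) sk.
Qed.

Let limit_controls : controls P U limit_control.
Proof.
split; last first.
  move=> s w sT; rewrite /limit_control; case: pselect => [h|//].
  by have [[_ +] _] := stages_valid (projT1 (cid h)); apply.
move=> i j B mB.
have Gs : sigma_algebra time_space <<s time_space, predictable_rectangles (FW P) >>.
  exact: smallest_sigma_algebra.
set GG := <<s _, _ >> in Gs *; have [G0 GC GU] := Gs.
have GUI A A' : GG A -> GG A' -> GG (A `|` A').
  by move=> GA GA'; rewrite -bigcup2E; apply: GU => -[|[|n]] //=.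
pose late k : set (R * cpath T N) := [set z | 0 <= z.1 <= T /\ ths k z.2 < z.1].
have Gl k : GG (late k) := predictable_late hT (stages_valid k).2.
pose A k := time_space `&` [set z : R * cpath T N | B (nus k z.1 z.2 i j)].
have GA k : GG (A k) by have [[pk _] _] := stages_valid k; exact: pk.
pose D := time_space `&` [set z : R * cpath T N | B (u0 i j)].
have GD : GG D by have [pk _] := controls_cst P Uu0; exact: pk.
rewrite (_ : _ `&` _ = \bigcup_k (time_space `\` ((time_space `\` A k) `|` late k)) `|`
   (time_space `\` ((time_space `\` D) `|` \bigcup_k (time_space `\` late k)))).
  apply: (GUI); first by apply: GU => k; apply: (GC); apply: (GUI) => //; exact: GC.
  apply: (GC); apply: (GUI); first exact: GC.
  by apply: GU => k; exact: GC.
apply/seteqP; split => -[s w]; rewrite /A /D /late /time_space /=.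
  move=> [sT h]; have [[k sk]|nk] := pselect (exists k, s <= ths k w).
    left; exists k => //=; split => //.
    rewrite (limit_agree sk) in h.
    by move=> [[_ []]|[_]]//; rewrite ltNge sk.
  right; split => //; move: h; rewrite /limit_control; case: pselect => [//|_] h.
  move=> [[_ []]//|[k _ /= [_ h']]]; apply: h'; split => //.
  by rewrite ltNge; apply/negP => sk; apply: nk; exists k.
move=> [[k _ /= [sT h]]|[sT h]]; split => //.
  have sk : s <= ths k w by rewrite leNgt; apply/negP => ts; apply: h; right.
  by rewrite (limit_agree sk); apply: contrapT => nB; apply: h; left; split => // -[].
have nk : ~ exists k, s <= ths k w.
  move=> [k sk]; apply: h; right; exists k => //=; split => // -[_].
  by rewrite ltNge sk.
rewrite /limit_control; case: pselect => // _.
by apply: contrapT => nB; apply: h; left; split => // -[].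
Qed.

Context (closedC : closed C).
Context (recurrent : forall y, C y -> exists z, `|y - zc z| < zr z /\
  forall K, exists2 k, (K <= k)%N & zs k = z).

(** Suppose no stage time equals T, and let l be their limit. The state at l lies in the closed C,
    hence strictly inside a zone z of the sequence. Take a late stage that uses z: its end state is
    still inside z, so it did not end by exit; and it started after l minus [zh z], so ending by
    lapse of time would pass l. *)
Let limit_viable : {ae cprob P, forall w, forall s, 0 <= s <= T ->
  C° (X limit_control 0 x s w)}.
Proof.
have sX := hX0 limit_controls; have [_ cX _] := sX.
have loc k := sde_local hT hP L0 rb rs limit_controls (stages_valid k).1 sX
  (hX0 (stages_valid k).1) (stages_valid k).2 (fun w s h => limit_agree (proj2 (andP h))).
have h1 := @ae_foralln _ _ _ (cprob P) _ loc.
have h2 := @ae_foralln _ _ _ (cprob P) _ stages_viable.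
apply: (@filterS2 _ _ (cprob_ae_filter P) _ _ _ _ h1 h2) => w {h1 h2} H1 H2.
suff [k kT] : exists k, ths k w = T.
  by move=> s sT; rewrite (H1 k) ?kT//; apply: H2; rewrite kT.
apply: contrapT => nk.
have lt k : ths k w < T.
  rewrite lt_neqAle; have /andP[_ ->] := ths_range k w; rewrite andbT.
  by apply/negP => /eqP e; apply: nk; exists k.
pose u k := ths k w.
have nd : nondecreasing_seq u by move=> j k; exact: ths_mono.
have bu : has_ubound (range u) by exists T => _ [k _ <-]; have /andP[] := ths_range k w.
have ul := nondecreasing_cvgn nd bu.
set l := sup (range u) in ul.
have u_le k : u k <= l by apply: ub_le_sup => //; exists k.
have lT : 0 <= l <= T.
  have /andP[t0 _] := ths_range 0 w; rewrite (le_trans t0 (u_le 0%N))/=.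
  by apply: ge_sup; [exists (u 0%N), 0%N|move=> _ [k _ <-]; have /andP[] := ths_range k w].
have yl : X limit_control 0 x (u k) w @[k --> \oo] --> X limit_control 0 x l w.
  exact: (within_itv_cvg (@cX w) (fun k => ths_range k w) lT ul).
have Cu k : C° (X limit_control 0 x (u k) w).
  have /andP[t0 _] := ths_range k w.
  by rewrite (H1 k) ?t0 ?lexx//; apply: H2; rewrite t0 lexx.
have Cl : C (X limit_control 0 x l w).
  apply: (closed_cvg _ closedC _ _ yl).
  by apply: nearW => k; exact: interior_subset.
have [z [zl rec]] := recurrent Cl.
have dl : `|X limit_control 0 x (u k) w - zc z| @[k --> \oo] --> `|X limit_control 0 x l w - zc z|.
  by apply: cvg_norm; apply: cvgB; [exact: yl|exact: cvg_cst].
have [_ hz _] : good_zone U b sigma L C z by have [k _ <-] := rec 0%N.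
have n1 : \forall k \near \oo, `|X limit_control 0 x (u k) w - zc z| < zr z.
  exact: cvgr_lt dl _ zl.
have n2 : \forall k \near \oo, l - zh z < u k.
  by apply: cvgr_gt ul _ _; rewrite gtrBl.
have [K _ HK] : \forall k \near \oo, `|X limit_control 0 x (u k) w - zc z| < zr z /\ l - zh z < u k.
  by near=> k; split; near: k.
have [k Kk zk] := rec K.
have [_ hk] := HK k Kk.
have [hk1 _] := HK k.+1 (leqW Kk).
have uk : u k.+1 = Num.min (hit T (zone_dist (P := P) (X (nus k.+1) 0 x) (zs k)) (zr (zs k)) (ths k) w)
    (Num.min T (ths k w + zh (zs k))) by [].
have /andP[t0 _] := ths_range k.+1 w.
have := lt k.+1; rewrite -/(u k.+1) => ltT.
have [e|e] := leP (hit T (zone_dist (P := P) (X (nus k.+1) 0 x) (zs k)) (zr (zs k)) (ths k) w)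
    (Num.min T (ths k w + zh (zs k))).
  have uE : u k.+1 = hit T (zone_dist (P := P) (X (nus k.+1) 0 x) (zs k)) (zr (zs k)) (ths k) w.
    by rewrite uk; apply/min_idPl.
  have [_ cX' _] := hX0 (stages_valid k.+1).1.
  have cd (w' : cspace P) : {within `[0, T], continuous (zone_dist (P := P) (X (nus k.+1) 0 x) (zs k)) ^~ w'}.
    have cX2 := @cX' w'; move=> s; apply: cvg_norm; apply: cvgB; [exact: cX2|exact: cvg_cst].
  have := hit_reach cd (ths_range k) (w := w) (eps := zr (zs k)); rewrite -uE => /(_ ltT).
  rewrite /zone_dist -(H1 k.+1); last by rewrite t0 /u lexx.
  by rewrite zk leNgt hk1.
have uE : u k.+1 = Num.min T (ths k w + zh (zs k)) by rewrite uk; apply/min_idPr; exact: ltW.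
have uE2 : u k.+1 = u k + zh z.
  by rewrite uE zk; apply/min_idPr; move: ltT; rewrite uE gt_min ltxx/= zk => /ltW.
by have := u_le k.+1; rewrite uE2 -lerBrDr leNgt hk.
Unshelve. all: by end_near. Qed.

Lemma viable_construction : exists nu, controls P U nu /\
  {ae P, forall w, forall s, 0 <= s <= T -> C° (X nu 0 x s w)}.
Proof.
exists limit_control; split; first exact: limit_controls.
exact: (ae_cprob P _).2 limit_viable.
Qed.

End construction.
End viability.

(** * Concatenation of controls *)

Section splicing.
Context (R : realType) (T : R) (hT : 0 < T) (N : nat).
Context (P : probability (Omega T N) R).
Context (F : R -> set (set (cpath T N))) (Fs : forall s, sigma_algebra setT (F s)).

Local Notation GG := <<s time_space, predictable_rectangles F >>.

Let Gs : sigma_algebra time_space GG. Proof. exact: smallest_sigma_algebra. Qed.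
Let GC A : GG A -> GG (time_space `\` A). Proof. by have [_ + _] := Gs; apply. Qed.
Let GU A B : GG A -> GG B -> GG (A `|` B).
Proof.
by move=> GA GB; rewrite -bigcup2E; have [_ _ +] := Gs; apply => -[|[|n]] //=; case: Gs.
Qed.

Lemma predictable_cst p q (K : 'M[R]_(p, q)) : predictable F (fun _ _ => K).
Proof.
move=> i j B mB; have [G0 _ _] := Gs.
have [Bu|Bu] := pselect (B (K i j)).
  rewrite (_ : _ `&` _ = time_space `\` set0); first exact: GC.
  by apply/seteqP; split => z; [move=> [h _]; split|move=> [h _]].
by rewrite (_ : _ `&` _ = set0)//; apply/seteqP; split => // z [].
Qed.

Lemma predictable_splice p q (H1 H2 : R -> cpath T N -> 'M[R]_(p, q)) A :
  GG (time_space `&` A) -> predictable F H1 -> predictable F H2 ->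
  predictable F (fun s w => if (s, w) \in A then H1 s w else H2 s w).
Proof.
move=> GA p1 p2 i j B mB.
rewrite (_ : _ `&` _ =
  (time_space `\` ((time_space `\` (time_space `&` A)) `|`
     (time_space `\` (time_space `&` [set z | B (H1 z.1 z.2 i j)])))) `|`
  (time_space `\` ((time_space `&` A) `|`
     (time_space `\` (time_space `&` [set z | B (H2 z.1 z.2 i j)]))))).
  by apply: GU; apply: GC; apply: GU => //; apply: GC => //; [exact: p1|exact: p2].
apply/seteqP; split => -[s w] /=.
  move=> [sT]; case: ifPn => [/set_mem sA|/negP sA] h; [left|right]; split => //.
    by case=> -[_]; apply; split.
  by case=> [[_ /mem_set]//|[_]]; apply; split.
move=> [[sT h]|[sT h]]; split => //.
  have sA : A (s, w) by apply: contrapT => nA; apply: h; left; split => // -[].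
  by rewrite mem_set//; apply: contrapT => nB; apply: h; right; split => // -[].
have sA : ~ A (s, w) by move=> sA; apply: h; left.
by rewrite memNset//; apply: contrapT => nB; apply: h; right; split => // -[].
Qed.

Lemma predictable_until (c : R) (N0 : set (cpath T N)) : 0 <= c <= T -> F c N0 ->
  GG (time_space `&` [set z | z.1 <= c \/ N0 z.2]).
Proof.
move=> /andP[c0 cT] FN.
rewrite (_ : _ `&` _ = time_space `\` ([set a | c < a <= T] `*` (~` N0))).
  apply: GC; apply: sub_sigma_algebra; right; exists c, T, (~` N0); split => //.
  exact: salgC (Fs c) _ FN.
apply/seteqP; split => -[s w] /=.
  move=> [sT h]; split => // -[/= /andP[cs _] nN]; case: h => //.
  by rewrite leNgt cs.
move=> [sT h]; split => //; have [sc|cs] := leP s c; [by left|right].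
apply: contrapT => nN; apply: h; split => //=; rewrite cs.
by move: sT; rewrite /time_space/= => /andP[_ ->].
Qed.

End splicing.

Section concatenation.
Context (R : realType) (T : R) (hT : 0 < T) (N d m : nat).
Context (P : probability (Omega T N) R) (hP : wiener_measure P).
Context (U : set 'cV[R]_m) (b : 'cV[R]_d -> 'cV[R]_m -> 'cV[R]_d).
Context (sigma : 'cV[R]_d -> 'cV[R]_m -> 'M[R]_(d, N)).
Context (L : R) (L0 : 0 <= L) (rb : regular_coef U b L).
Local Notation leb := (@lebesgue_measure R).

(** An increment after t' is a difference of two increments after t. *)
Lemma Ft_mono (t t' s : R) : t <= t' -> Ft P t' s `<=` Ft P t s.
Proof.
move=> tt; apply: augmentation_mono => _ [r /= /andP[tr rs] [i [B [mB ->]]]].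
have h : gmeas (Ft P t s) (fun w : cspace P => (W r w i ord0 - W t w i ord0) - (W t' w i ord0 - W t w i ord0)).
  have inc (r' : R) : t <= r' <= s -> gmeas (Ft P t s) (fun w : cspace P => W r' w i ord0 - W t w i ord0).
    move=> r's D mD; apply: sub_sigma_algebra; left; exists r' => //; exists i, D; split => //.
    by apply/seteqP; split => w /=; rewrite !mxE.
  apply: (gmeasB (Om := cspace P) (@augmentation_sigma _ _ _ P _)); apply: inc.
    by rewrite rs (le_trans tt tr).
  by rewrite tt (le_trans tr rs).
have := h B mB; rewrite /Ft; congr (augmentation _ _).
by apply/seteqP; split => w /=; rewrite !mxE opprB addrA subrK.
Qed.

Lemma is_ito_modify p (H H' : R -> cpath T N -> 'M[R]_(p, N)) M :
  is_ito_integral P H M -> predictable (FW P) H' ->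
  {ae cprob P, forall w, forall r, 0 < r <= T -> H' r w = H r w} ->
  is_ito_integral P H' M.
Proof.
move=> [pH aM cM [S [S1 S2]]] pH' ae.
split; [exact: pH'|exact: aM|exact: cM|exists S; split; last exact: S2].
apply: cvg_trans S1; apply: near_eq_cvg; apply: nearW => k; rewrite 2!expectation_barE.
under eq_integral => w _ do rewrite (si_error_sint hT (S k) w pH).
under [in RHS]eq_integral => w _ do rewrite (si_error_sint hT (S k) w pH').
apply: ge0_ae_eq_integral.
- exact: measurableT.
- apply: measurable_sint; [exact: jmeas_si_error|exact: si_error_ge0].
- apply: measurable_sint; [exact: jmeas_si_error|exact: si_error_ge0].
- by move=> w _; apply: sint_ge0 => s w'; exact: si_error_ge0.
- by move=> w _; apply: sint_ge0 => s w'; exact: si_error_ge0.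
apply: (@filterS _ _ (cprob_ae_filter P)) ae => w Hw _; rewrite !sintE.
apply: eq_integral => s; rewrite inE/= in_itv/= => sT.
by rewrite /si_error Hw.
Qed.

Context (s e : R) (s0 : 0 <= s) (e0 : 0 <= e) (seT : s + e <= T).
Context (u : 'cV[R]_m) (Uu : U u) (p : R -> 'cV[R]_d).
Context (cp : {within `[0, T], continuous p}).
Context (pb : forall r, 0 <= r <= e -> forall i, p r i ord0 = p 0 i ord0 +
  \int[leb]_(q in `]0, r]) b (p q) u i ord0).
Context (ps : forall r, 0 <= r <= e -> sigma (p r) u = 0).
Context (nu : R -> cpath T N -> 'cV[R]_m) (cnu : controls_from P U (s + e) nu).
Context (X : R -> cpath T N -> 'cV[R]_d) (sX : sde_solution P b sigma nu (s + e) (p e) X).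

Let c := s + e.
Let cT : 0 <= c <= T. Proof. by rewrite addr_ge0. Qed.
Let sc : s <= c. Proof. by rewrite lerDl. Qed.
Let sT : 0 <= s <= T. Proof. by rewrite s0 (le_trans sc)//; case/andP: cT. Qed.
Let eT : e <= T. Proof. by rewrite (le_trans _ seT)// lerDr. Qed.

(* The start condition of X only holds almost surely; the exceptional paths keep the
   control u so that the concatenation is continuous everywhere. *)
Let N0 : set (cpath T N) := [set w | X c w <> p e].
Let early : set (R * cpath T N) := [set z | z.1 <= c \/ N0 z.2].
(** Composed with it, p rests at its start before s and at its end after s + e, and is continuous on
    all of [0, T]. *)
Let clamp (r : R) : R := Num.min e (Num.max 0 (r - s)).

Definition concat_control (r : R) (w : cpath T N) : 'cV[R]_m :=
  if (r, w) \in early then u else nu r w.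

Definition concat_path (r : R) (w : cpath T N) : 'cV[R]_d :=
  if (r, w) \in early then p (clamp r) else X r w.

Let clamp_range r : 0 <= clamp r <= e.
Proof. by rewrite /clamp le_min e0 le_max lexx ge_min lexx. Qed.

Let clamp_eq r : s <= r <= c -> clamp r = r - s.
Proof.
move=> /andP[sr rc]; rewrite /clamp (max_idPr _) ?subr_ge0//.
by apply/min_idPr; rewrite lerBlDl.
Qed.

Let clamp_late r : c <= r -> clamp r = e.
Proof.
move=> cr; rewrite /clamp; apply/min_idPl.
by rewrite le_max lerBrDl cr orbT.
Qed.

Let clamp_early r : r <= s -> clamp r = 0.
Proof. by move=> rs; rewrite /clamp (max_idPl _) ?subr_le0//; apply/min_idPr. Qed.

Let cnu' : controls P U nu. Proof. by have [] := cnu. Qed.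
Let aX : adapted (FW P) X. Proof. by case: sX. Qed.
Let cX : continuous_process X. Proof. by case: sX. Qed.

Let N0_negligible : P.-negligible N0.
Proof.
have [_ _ [M [_ eqM]]] := sX.
apply: (negligibleS _ eqM) => w Nw [h _]; apply: Nw; apply: h.
by have /andP[-> _] := cT; rewrite lexx.
Qed.

Let ae_N0 : {ae cprob P, forall w, ~ N0 w}.
Proof. by apply/(ae_cprob P _); apply: (negligibleS _ N0_negligible) => w /contrapT. Qed.

Lemma concat_controls : controls_from P U s concat_control.
Proof.
have [[pnu Unu] pFt] := cnu.
have pF F : (forall r, sigma_algebra setT (F r)) -> F c N0 -> predictable F nu ->
    predictable F concat_control.
  move=> Fs FN pFn; apply: predictable_splice pFn; last exact: predictable_cst.
  exact: predictable_until.
split; first split.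
- apply: pF pnu; first by move=> r; exact: augmentation_sigma.
  exact: augmentation_negligible.
- by move=> r w rT; rewrite /concat_control; case: ifP => // _; exact: Unu.
apply: pF; first by move=> r; exact: augmentation_sigma.
  exact: augmentation_negligible.
apply: (@predictable_mono _ _ hT _ (Ft P c)) pFt => r _; exact: Ft_mono.
Qed.

Let concat_off w r : ~ N0 w -> c < r -> concat_control r w = nu r w /\ concat_path r w = X r w.
Proof.
move=> nN cr; have h : (r, w) \notin early.
  by rewrite notin_setE /early/= => -[|//]; rewrite leNgt cr.
by rewrite /concat_control /concat_path (negbTE h).
Qed.

Let concat_on w r : r <= c -> concat_control r w = u /\ concat_path r w = p (clamp r).
Proof.
move=> rc; have h : (r, w) \in early by rewrite inE; left.
by rewrite /concat_control /concat_path h.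
Qed.

Let concat_adapted : adapted (FW P) concat_path.
Proof.
move=> r rT i j B mB; have Gs := @augmentation_sigma _ _ _ P (path_events T N r).
have cst (Q : Prop) : FW P r [set w : cpath T N | Q].
  have [hQ|hQ] := pselect Q.
    by rewrite (_ : [set _ | _] = setT); [exact: (salgT Gs)|apply/seteqP; split].
  by rewrite (_ : [set _ | _] = set0); [exact: (salg0 Gs)|apply/seteqP; split].
have FN : FW P r N0 by exact: augmentation_negligible.
have [rc|cr] := leP r c.
  have := cst (B (p (clamp r) i j)); congr (FW P r).
  by apply/seteqP; split => w /=; have [_ ->] := concat_on w rc.
rewrite (_ : [set w | _] = (N0 `&` [set _ | B (p (clamp r) i j)]) `|`
   (~` N0 `&` [set w | B (X r w i j)])).
  have FNc : FW P r (~` N0) by apply: (salgC Gs); exact: FN.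
  apply: (salgU Gs); apply: (salgI Gs); [exact: FN|exact: cst|exact: FNc|].
  exact: (@aX r rT i j B mB).
apply/seteqP; split => w /=.
  have [Nw|Nw] := pselect (N0 w).
    by rewrite /concat_path mem_set//; [left|right].
  by have [_ ->] := concat_off Nw cr; right.
case=> [[Nw h]|[Nw h]]; last by have [_ ->] := concat_off Nw cr.
by rewrite /concat_path mem_set//; right.
Qed.

Let concat_continuous : continuous_process concat_path.
Proof.
move=> w; have cc : {within `[0, T], continuous (p \o clamp)}.
  apply: within_itv_comp => //.
    move=> r; apply: (@continuous_comp _ _ _ (fun r => Num.max 0 (r - s)) (fun v => Num.min e v)).
      apply: (@continuous_comp _ _ _ (fun r => r - s) (fun v => Num.max 0 v)).
        by apply: cvgB; [exact: cvg_id|exact: cvg_cst].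
      exact: maxr_continuous.
    exact: minr_continuous.
  by move=> r _; have /andP[-> h] := clamp_range r; rewrite (le_trans h).
have [Nw|Nw] := pselect (N0 w).
  rewrite (_ : (fun r => _) = p \o clamp)//; apply/funext => r.
  by rewrite /concat_path mem_set//; right.
have Xc : X c w = p e by exact: contrapT.
rewrite (_ : (fun r => _) = fun r => (p \o clamp) r + (X (Num.max c r) w - X c w)).
  have cXm : {within `[0, T], continuous (fun r => X (Num.max c r) w)}.
    apply: (within_itv_comp (@cX w) (@maxr_continuous _ c)) => r /andP[r0 rT].
    by have /andP[h1 h2] := cT; rewrite le_max h1 ge_max h2 rT.
  by move=> r; apply: cvgD; [exact: cc|apply: cvgB; [exact: cXm|exact: cvg_cst]].
apply/funext => r; have [rc|cr] := leP r c.
  by have [_ ->] := concat_on w rc; rewrite subrr addr0.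
have [_ ->] := concat_off Nw cr.
by rewrite /= (clamp_late (ltW cr)) -Xc addrC subrK.
Qed.

(** The martingale part M of X serves unchanged. Until s + e it vanishes, as does sigma along p;
    afterwards both coefficients are those of X. The integrands differ only on the null set of
    exceptional paths, which [is_ito_modify] absorbs. *)
Lemma concat_sde : sde_solution P b sigma concat_control s (p 0) concat_path.
Proof.
have [_ _ [M [iM eqM]]] := sX; have [ccn _] := concat_controls.
split; [exact: concat_adapted|exact: concat_continuous|exists M; split].
  have [pH _ _ _] := iM.
  have E : (fun r w => if s < r then sigma (concat_path r w) (concat_control r w) else 0) =
      (fun r w => if (r, w) \in early then 0 else
        (if c < r then sigma (X r w) (nu r w) else 0)).
    apply/funext => r; apply/funext => w; rewrite /concat_path /concat_control.
    have [h|h] := boolP ((r, w) \in early).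
      by case: ifP => // _; exact: ps.
    have cr : c < r by rewrite ltNge; apply/negP => rc; move/negP: h; apply; rewrite inE; left.
    by rewrite cr (le_lt_trans sc cr).
  rewrite E; apply: is_ito_modify iM _ _.
    apply: predictable_splice pH; last exact: predictable_cst.
    apply: predictable_until => //; first by move=> r; exact: augmentation_sigma.
    exact: augmentation_negligible.
  apply: (@filterS _ _ (cprob_ae_filter P)) ae_N0 => w Nw r _.
  case: ifPn => // /set_mem[/= rc|//]; by rewrite ltNge rc.
have M0 := is_ito_early hT hP cT iM (fun r w h => ifN _ _ (negbT (le_gtF (ltW (proj2 (andP h)))))).
apply/(ae_cprob P _).
apply: (@filterS3 _ _ (cprob_ae_filter P) _ _ _ _ _ ae_N0 ((ae_cprob P _).1 eqM) M0) => w Nw [e1 e2] hM.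
split.
  move=> r /andP[r0 rs]; have [_ ->] := concat_on w (le_trans rs sc).
  by rewrite clamp_early.
pose D i (q : R) := @drift R T N d m P b concat_control concat_path s i q w.
have DE i r : s <= r <= T ->
    \int[leb]_(a in `[s, r]) b (concat_path a w) (concat_control a w) i ord0 =
    \int[leb]_(a in `]s, r]) D i a.
  move=> /andP[sr rT]; exact: (Rintegral_drift hT L0 rb i w ccn concat_adapted concat_continuous s0 rT).
have iD i a' a : leb.-integrable `]a', a] (EFin \o D i).
  apply: (drift_integrable hT L0 rb ccn concat_adapted concat_continuous) => //.
  exact: itv_lebesgue_fin.
have first i r : s <= r <= c -> p (r - s) i ord0 = p 0 i ord0 + \int[leb]_(a in `]s, r]) D i a.
  move=> /andP[sr rc]; rewrite pb; last by rewrite subr_ge0 sr lerBlDl.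
  congr (_ + _).
  have mD : measurable_fun setT (D i).
    exact: (jmeas_sect (Om := cspace P) w (jmeas_drift hT rb ccn concat_adapted concat_continuous s i)).
  have := Rintegral_shift (- s) s r mD; rewrite addNr [- s + r]addrC => <-.
  apply: eq_Rintegral => q; rewrite inE/= in_itv/= opprK => /andP[q0 qr].
  have qsr : q + s <= r by rewrite -lerBrDr.
  have sq : s < q + s by rewrite ltrDr.
  have [hu hp] := concat_on w (le_trans qsr rc).
  rewrite /D /drift hu hp sq (le_lt_trans s0 sq) (le_trans (le_trans qsr rc) seT) !mul1r.
  by rewrite clamp_eq ?addrK// (ltW sq) (le_trans qsr rc).
move=> r /andP[sr rT]; have [rc|cr] := leP r c.
  have [_ ->] := concat_on w rc; rewrite clamp_eq ?sr//.
  apply/matrixP => i j; rewrite (ord1 j) !mxE first ?sr// DE ?sr//.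
  by rewrite hM ?addr0// (le_trans s0 sr).
have [_ ->] := concat_off Nw cr; rewrite e2 ?(ltW cr)//.
apply/matrixP => i j; rewrite !mxE (ord1 j); congr (_ + _).
have pe : p e i ord0 = p 0 i ord0 + \int[leb]_(a in `]s, c]) D i a.
  have <- : c - s = e by rewrite /c addrC addKr.
  by apply: first; rewrite sc lexx.
rewrite pe DE ?sr// -addrA; congr (_ + _).
have [c0' _] := andP cT.
rewrite (Rintegral_drift hT L0 rb i w cnu' aX cX c0' rT).
have := Rintegral_itvB (iD i s r) (x := c); rewrite !bnd_simp => /(_ sc (ltW cr)) h.
rewrite -[RHS](subrK (\int[leb]_(a in `]s, c]) D i a)) h addrC; congr (_ + _).
apply: eq_Rintegral => q; rewrite inE/= in_itv/= => /andP[cq qr].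
have [hu hp] := concat_off Nw cq.
by rewrite /D /drift hu hp cq (le_lt_trans sc cq).
Qed.

Lemma concat_viable (O : set 'cV[R]_d) : (forall r, 0 <= r <= e -> O (p r)) ->
  {ae P, forall w, forall r, 0 <= r <= T -> O (X r w)} ->
  {ae P, forall w, forall r, 0 <= r <= T -> O (concat_path r w)}.
Proof.
move=> Op; have FP : Filter (almost_everywhere P) by exact: ae_filter_ringOfSetsType.
apply: (@filterS _ _ FP) => w H r rT; rewrite /concat_path; case: ifP => _; last exact: H.
by apply: Op.
Qed.

Context (f : 'cV[R]_d -> 'cV[R]_m -> R) (Fb : R) (Fb0 : 0 <= Fb).
Context (f0 : forall x u, U u -> 0 <= f x u).
Context (cf : {within [set: 'cV[R]_d] `*` U, continuous (fun p => f p.1 p.2)}).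
Context (pf : forall r, 0 <= r <= e -> f (p r) u <= Fb).

(** Path by path, the running cost is at most Fb on ]s, s + e] and equals that of X afterwards; the
    almost sure identification of Z with the concatenated path suffices. *)
Lemma concat_cost Z : sde_solution P b sigma concat_control s (p 0) Z ->
  {ae P, forall w, forall r, 0 <= r <= T -> Z r w = concat_path r w} ->
  (dint (cprob P) (@running R T N d m P f concat_control Z s) setT 0 T <=
   (Fb * e)%:E + dint (cprob P) (@running R T N d m P f nu X c) setT 0 T)%E.
Proof.
move=> [aZ cZ _] /(ae_cprob P _).1 eqZ; have [ccn _] := concat_controls.
set r1 := @running _ _ _ _ _ _ _ _ Z _; set r2 := @running _ _ _ _ _ _ _ _ X _.
have j1 : jmeas r1 := jmeas_running hT cf ccn aZ cZ s.
have j2 : jmeas r2 := jmeas_running hT cf cnu' aX cX c.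
have p1 r w : 0 <= r1 r w := running_ge0 f0 ccn Z s r w.
have p2 r w : 0 <= r2 r w := running_ge0 f0 cnu' X c r w.
pose k (r : R) (w : cspace P) : R := (s < r <= c)%R%:R * Fb.
have jk : jmeas k by apply: jmeasM; [exact: jmeas_itv|exact: jmeas_cst].
have k0 r w : 0 <= k r w by rewrite mulr_ge0.
have kE (w : cspace P) : (sint k 0 T w <= (Fb * e)%:E)%E.
  have -> : (sint k 0 T w = \int[leb]_(r in `]0%R, T]) (Fb%:E * (\1_(`]s, c]%classic : set R) r)%:E))%E.
    rewrite sintE; apply: eq_integral => r _; rewrite -EFinM /k mulrC indicE; congr (_ * _)%:E.
    by congr (nat_of_bool _)%:R; apply/idP/idP; rewrite inE/= in_itv.
  rewrite ge0_integralZl//; last by apply/measurable_EFinP; exact: measurable_indic.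
  rewrite integral_indic// EFinM lee_wpmul2l ?lee_fin//.
  apply: (@le_trans _ _ (leb `]s, c]%classic)).
    by apply: le_measure; rewrite ?inE//; exact: measurableI.
  rewrite lebesgue_measure_itv/=; case: ifP => _; last by rewrite lee_fin.
  by rewrite -EFinB lee_fin /c addrAC subrr add0r.
have le w : (forall r, 0 <= r <= T -> Z r w = concat_path r w) -> ~ N0 w ->
    (sint r1 0 T w <= (Fb * e)%:E + sint r2 0 T w)%E.
  move=> hZ Nw; apply: (@le_trans _ _ (sint k 0 T w + sint r2 0 T w)%E); last exact: leeD2r.
  rewrite -sintD//; apply: sint_le => //; first exact: jmeasD.
  move=> r /andP[r0 rT]; rewrite /r1 /r2 /running r0 rT !mul1r /k.
  have [sr|rs] := ltP s r; last by rewrite mul0r addr_ge0// mulr_ge0// ?f0//; have [[_ h] _] := cnu; apply: h; rewrite ltW.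
  rewrite mul1r hZ ?(ltW r0)//; have [rc|cr] := leP r c.
    have [-> ->] := concat_on w rc; rewrite !mul1r mul0r addr0; exact: pf.
  by have [-> ->] := concat_off Nw cr; rewrite mul0r add0r mul1r.
rewrite !dintE.
have -> : ((Fb * e)%:E + \int[cprob P]_w sint r2 0 T w =
    \int[cprob P]_w ((Fb * e)%:E + sint r2 0 T w))%E.
  have hc (w : cspace P) : setT w -> (0 <= (Fb * e)%:E)%E by move=> _; rewrite lee_fin mulr_ge0.
  have hs (w : cspace P) : setT w -> (0 <= sint r2 0 T w)%E by move=> _; exact: sint_ge0.
  have ms : measurable_fun setT (sint r2 0 T) by exact: measurable_sint.
  rewrite (@ge0_integralD _ _ _ (cprob P) _ measurableT _ _ hc (measurable_cst _) hs ms).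
  congr (_ + _)%E; have := @integral_cst _ _ _ (cprob P) _ measurableT (Fb * e)%:E.
  have PT : cprob P [set: cspace P] = 1%E := etrans (cprobE P measurableT) (probability_setT P).
  move=> h; apply: esym; apply: (etrans h).
  exact: etrans (congr1 (fun a => (Fb * e)%:E * a)%E PT) (mule1 _).
apply: ae_ge0_le_integral.
- exact: measurableT.
- by move=> w _; exact: sint_ge0.
- exact: measurable_sint.
- by move=> w _; apply: adde_ge0; [rewrite lee_fin mulr_ge0|exact: sint_ge0].
- by apply: emeasurable_funD; [exact: measurable_cst|exact: measurable_sint].
- by apply: (@filterS2 _ _ (cprob_ae_filter P) _ _ _ _ eqZ ae_N0) => w h1 h2 _; exact: le.
Qed.

End concatenation.

(** * Flows at the boundary *)

Lemma ae_nonempty d (S : measurableType d) (R : realType) (P : probability S R)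
    (Q : S -> Prop) : {ae P, forall w, Q w} -> exists w, Q w.
Proof.
move=> [B [mB PB QB]]; apply: contrapT => nQ.
have : B = setT.
  by apply/seteqP; split => // w _; apply: QB => /= Qw; apply: nQ; exists w.
by move=> BT; move: PB; rewrite BT probability_setT => /eqP; rewrite onee_eq0.
Qed.

(* McShane's extension formula, one coordinate at a time. *)
Lemma lipschitz_limit (R : realType) (d : nat) (D : set 'cV[R]_d) (g : 'cV[R]_d -> 'cV[R]_d)
    (k : R) (x : 'cV[R]_d) : 0 <= k -> D !=set0 ->
  (forall y y', D y -> D y' -> `|g y - g y'| <= k * `|y - y'|) ->
  exists v, forall y, D y -> `|g y - v| <= k * `|y - x|.
Proof.
move=> k0 [y0 Dy0] gk.
pose E i := [set e | exists2 y, D y & e = g y i ord0 + k * `|y - x|].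
have low i y y' : D y -> D y' -> g y i ord0 - k * `|y - x| <= g y' i ord0 + k * `|y' - x|.
  move=> Dy Dy'; have h := le_trans (coord_le_norm (g y - g y') i ord0) (gk _ _ Dy Dy').
  have tri : `|y - y'| <= `|y - x| + `|y' - x|.
    by rewrite -(subrK x y) -addrA (le_trans (ler_normD _ _))// addrK lerD2l distrC.
  have := ler_norm ((g y - g y') i ord0); rewrite !mxE => h2.
  have h3 := ler_wpM2l k0 tri; move: h h2 h3; rewrite !mxE mulrDr; lra.
have hE i : has_inf (E i).
  split; first by exists (g y0 i ord0 + k * `|y0 - x|), y0.
  by exists (g y0 i ord0 - k * `|y0 - x|) => _ [y Dy ->]; exact: low.
exists (\col_i inf (E i)) => y Dy; apply: norm_le_coord; first by rewrite mulr_ge0.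
move=> i j; rewrite (ord1 j) !mxE.
have i1 : inf (E i) <= g y i ord0 + k * `|y - x|.
  by apply: ge_inf; [case: (hE i)|exists y].
have i2 : g y i ord0 - k * `|y - x| <= inf (E i).
  apply: lb_le_inf; first by case: (hE i).
  by move=> _ [y' Dy' ->]; exact: low.
move: (inf (E i)) i1 i2 => v i1 i2; rewrite ler_norml; apply/andP; split; lra.
Qed.

Section flows.
Context (R : realType) (d m : nat).
Context (b : 'cV[R]_d -> 'cV[R]_m -> 'cV[R]_d) (L : R) (L0 : 0 <= L) (u : 'cV[R]_m).
Context (bL : forall y y', `|b y u - b y' u| <= L * `|y - y'|).
Local Notation leb := (@lebesgue_measure R).

Definition integral_curve (p : R -> 'cV[R]_d) (h : R) : Prop :=
  [/\ {within `[0, h], continuous p},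
      forall i, leb.-integrable `]0, h] (EFin \o (fun q => b (p q) u i ord0)) &
      forall s, 0 <= s <= h -> forall i, p s i ord0 = p 0 i ord0 +
        \int[leb]_(q in `]0, s]) b (p q) u i ord0].

(** At the time of greatest distance D, the integral equation bounds D by the initial distance plus
    L h D, hence plus D/2. The short time replaces Gronwall's lemma and yields the factor 2. *)
Lemma integral_curve_lip (p p' : R -> 'cV[R]_d) (h : R) : 0 <= h -> L * h <= 1 / 2 ->
  integral_curve p h -> integral_curve p' h ->
  forall s, 0 <= s <= h -> `|p s - p' s| <= 2 * `|p 0 - p' 0|.
Proof.
move=> h0 Lh [cp ip ep] [cp' ip' ep'].
have cd : {within `[0, h], continuous (fun s => `|p s - p' s|)}.
  by move=> s; apply: cvg_norm; apply: cvgB; [exact: cp|exact: cp'].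
have [c + cmax] := EVT_max h0 cd; rewrite in_itv/= => /andP[c0 ch].
suff Dc : `|p c - p' c| <= 2 * `|p 0 - p' 0|.
  by move=> s sh; apply: le_trans Dc; apply: cmax; rewrite in_itv.
set D := `|p c - p' c| in cmax *.
have sub (s : R) : s <= h -> `]0, s]%classic `<=` `]0, h]%classic.
  by move=> sh q /=; rewrite !in_itv/= => /andP[-> /le_trans->].
have iq i : leb.-integrable `]0, c] (EFin \o (fun q => b (p q) u i ord0)).
  by apply: integrableS (ip i) => //; exact: sub.
have iq' i : leb.-integrable `]0, c] (EFin \o (fun q => b (p' q) u i ord0)).
  by apply: integrableS (ip' i) => //; exact: sub.
have key : `|(p c - p' c) - (p 0 - p' 0)| <= L * D * (c - 0).
  apply: (@curve_bound _ _ (fun q => p q - p' q) (fun q => b (p q) u - b (p' q) u)) => //.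
  - by rewrite mulr_ge0// normr_ge0.
  - move=> i; rewrite (_ : (fun q => _) = fun q => b (p q) u i ord0 - b (p' q) u i ord0).
      exact: (@integrableB _ _ _ leb `]0, c]%classic (measurable_itv _) _ _ (iq i) (iq' i)).
    by apply/funext => q; rewrite !mxE.
  - move=> i; rewrite !mxE ep ?c0// ep' ?c0//.
    rewrite (_ : (fun q => (b (p q) u - b (p' q) u) i ord0) =
        fun q => b (p q) u i ord0 - b (p' q) u i ord0).
      by rewrite RintegralB//; ring.
    by apply/funext => q; rewrite !mxE.
  - move=> q /andP[q0 qc]; apply: (le_trans (bL _ _)); rewrite ler_wpM2l//.
    by apply: cmax; rewrite in_itv/= (ltW q0) (le_trans qc).
have tri : D <= `|(p c - p' c) - (p 0 - p' 0)| + `|p 0 - p' 0|.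
  by rewrite /D -{1}(subrK (p 0 - p' 0) (p c - p' c)) ler_normD.
have Lc : L * D * (c - 0) <= D / 2.
  have -> : L * D * (c - 0) = D * (L * c) by ring.
  have -> : D / 2 = D * (1 / 2) by field.
  by rewrite ler_wpM2l ?normr_ge0// (le_trans _ Lh)// ler_wpM2l.
move: key Lc tri; lra.
Qed.

End flows.

(** * Flows from interior points near the boundary *)

Section boundary_flows.
Context (R : realType) (T : R) (hT : 0 < T) (N d m : nat).
Context (P : probability (Omega T N) R) (hP : wiener_measure P).
Context (U : set 'cV[R]_m) (b : 'cV[R]_d -> 'cV[R]_m -> 'cV[R]_d).
Context (sigma : 'cV[R]_d -> 'cV[R]_m -> 'M[R]_(d, N)).
Context (L : R) (L0 : 0 <= L) (rb : regular_coef U b L) (rs : regular_coef U sigma L).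
Context (C : set 'cV[R]_d).
Context (X : (R -> cpath T N -> 'cV[R]_m) -> R -> 'cV[R]_d -> R -> cpath T N -> 'cV[R]_d).
Context (hX : forall nu t x, controls P U nu -> 0 <= t <= T ->
  unique_sde_solution P b sigma nu t x (X nu t x)).

Let zeroT : 0 <= (0 : R) <= T. Proof. by rewrite lexx ltW. Qed.

(* The flow is read off one path of the controlled diffusion, which is deterministic as
   long as it stays in the zone. *)
Lemma zone_curve (z : zone R d m) (r h : R) (y : 'cV[R]_d) :
  U (zu z) -> noise_free_zone b sigma L C z r -> 0 <= h -> h <= T -> h <= zh z ->
  L * (1 + `|zc z| + zr z) * h < zr z / 2 -> C° y -> `|y - zc z| < zr z / 2 ->
  exists p : R -> 'cV[R]_d, [/\ {within `[0, T], continuous p}, p 0 = y,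
    integral_curve b (zu z) p h &
    forall s, 0 <= s <= h -> C° (p s) /\ `|p s - zc z| <= zr z].
Proof.
move=> Uz nz h0 hT' hz Bh Cy yz; have [zs _ _ _] := nz.
pose nu : R -> cpath T N -> 'cV[R]_m := fun _ _ => zu z.
have cnu : controls P U nu by exact: controls_cst.
have sY : sde_solution P b sigma nu 0 y (X nu 0 y) by have [] := hX y cnu zeroT.
set Y := X nu 0 y in sY; have [_ cY [M [_ eqM]]] := sY.
pose th (w : cspace P) : R := 0.
have sth : stopping T (FW P) th by exact: stopping_cst (FW_filtered P) zeroT.
have thT : forall w : cspace P, 0 <= th w <= T := sth.1.
have after (w : cpath T N) (s : R) : th w < s -> nu s w = zu z by [].
have nf := noise_free_stage hT hP L0 rb rs cnu sY Uz sth after nz.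
have zf := zone_flow hT hP L0 rb rs cnu sY sth zeroT after zs.
have [w [[e1 _] nfw zfw]] : exists w : cspace P,
    [/\ (forall s : R, 0 <= s <= 0 -> Y s w = y) /\ (forall s : R, 0 <= s <= T -> True),
      (C° (Y (th w) w) -> zone_dist Y z (th w) w < zr z ->
        forall s, th w <= s <= hit T (zone_dist (P := P) Y z) (zr z) th w -> s <= th w + zh z -> C° (Y s w)) &
      (th w <= 0 -> forall s : R, 0 <= s <= T ->
        (forall r, 0 <= r < s -> zone_dist (P := P) Y z r w < zr z /\ C° (Y r w)) ->
        forall i, Y s w i ord0 = Y 0 w i ord0 +
        \int[@lebesgue_measure R]_(q in `]0, s]) b (Y q w) (zu z) i ord0)].
  apply: (@ae_nonempty _ _ _ (cprob P)).
  apply: (@filterS3 _ _ (cprob_ae_filter P) _ _ _ _ _ ((ae_cprob P _).1 eqM) nf zf).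
  by move=> w [h1 _] h2 h3; split.
have Y0 : Y 0 w = y by apply: e1; rewrite lexx.
have zr0 : 0 < zr z by have := le_lt_trans (normr_ge0 _) yz; rewrite pmulr_lgt0// invr_gt0.
have d0 : zone_dist (P := P) Y z (th w) w < zr z.
  by rewrite /zone_dist /th Y0 (lt_trans yz)// ltr_pdivrMr// ltr_pMr// ltr1n.
have Cs : forall s, th w <= s <= hit T (zone_dist (P := P) Y z) (zr z) th w -> s <= th w + zh z -> C° (Y s w).
  by apply: nfw => //; rewrite /th Y0.
have cd (w' : cspace P) : {within `[0, T], continuous (zone_dist (P := P) Y z) ^~ w'}.
  have cY' := @cY w'; by move=> s; apply: cvg_norm; apply: cvgB; [exact: cY'|exact: cvg_cst].
have inz q := hit_value_le (r := q) cd thT d0.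
have bef q := @hit_before _ _ _ _ (zone_dist (P := P) Y z) (zr z) th thT w q.
have rea := hit_reach (eps := zr z) (w := w) cd thT.
have Hle := hit_le (zone_dist (P := P) Y z) (zr z) thT w.
have Hge := hit_ge (zone_dist (P := P) Y z) (zr z) thT w.
move: (hit T (zone_dist (P := P) Y z) (zr z) th w) Cs inz bef rea Hle Hge.
rewrite /th add0r => H Cs inz bef rea HT H0 {nfw}.
have flow s : 0 <= s -> s <= H -> s <= h -> forall i, Y s w i ord0 = Y 0 w i ord0 +
    \int[@lebesgue_measure R]_(q in `]0, s]) b (Y q w) (zu z) i ord0.
  move=> s0 sH sh; apply: zfw; first exact: lexx.
    by rewrite s0 (le_trans sH HT).
  move=> q /andP[q0 qs]; split; first by apply: bef => //; exact: lt_le_trans sH.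
  by apply: Cs; rewrite ?q0 (le_trans (ltW qs))// (le_trans sh).
have int s i : s <= T -> lebesgue_measure.-integrable `]0, s] (EFin \o (fun q => b (Y q w) (zu z) i ord0)).
  by move=> sT; have := zone_integrable hT L0 rb cnu sY (w := w) (a := 0) i (lexx 0) sT; apply.
(* The path starts within half the radius of the centre, and its speed bound times h is less than
   the other half, so it cannot leave the zone before h. *)
have hH : h <= H.
  rewrite leNgt; apply/negP => Hh.
  have := rea (lt_le_trans Hh hT'); rewrite leNgt => /negP; apply.
  have key : `|Y H w - Y 0 w| <= L * (1 + `|zc z| + zr z) * (H - 0).
    apply: (@curve_bound _ _ (fun q => Y q w) (fun q => b (Y q w) (zu z))) => //.
    - by rewrite mulr_ge0// !addr_ge0// ltW.
    - by move=> i; exact: int.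
    - by move=> i; apply: flow => //; exact: ltW.
    - move=> q /andP[q0 qH]; apply: (zone_speed L0 rb Uz).
      by apply: inz; rewrite (ltW q0).
  rewrite /zone_dist -(subrK (Y 0 w) (Y H w)) -addrA.
  apply: (le_lt_trans (ler_normD _ _)); rewrite [ltRHS]splitr; apply: ler_ltD; last by rewrite Y0.
  apply: (le_trans key); apply: (le_trans _ (ltW Bh)); rewrite subr0 ler_wpM2l ?(ltW Hh)//.
  by rewrite mulr_ge0// !addr_ge0// ltW.
exists (fun s => Y s w); split => //.
  split.
  - apply: continuous_subspaceW (@cY w) => s /=; rewrite !in_itv/= => /andP[-> /le_trans->//].
  - by move=> i; exact: int.
  - by move=> s /andP[s0 sh]; apply: flow => //; exact: le_trans hH.
move=> s /andP[s0 sh]; split.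
  by apply: Cs; rewrite ?s0 (le_trans sh).
by apply: inz; rewrite s0 (le_trans sh).
Qed.

(** psi is the flow from x itself, given as a limit because [zone_curve] needs an interior starting
    point. M bounds the distance from x, K the second-order deviation of psi from its tangent. *)
Record boundary_flow (x : 'cV[R]_d) (u : 'cV[R]_m) (h rho r K M : R)
    (phi : 'cV[R]_d -> R -> 'cV[R]_d) (psi : R -> 'cV[R]_d) : Prop := {
  flow_control : U u ;
  flow_time : 0 < h <= T ;
  flow_near : 0 < rho ;
  flow_speed : 0 < r ;
  flow_continuous : forall y, C° y -> `|y - x| < rho -> {within `[0, T], continuous (phi y)} ;
  flow_start : forall y, C° y -> `|y - x| < rho -> phi y 0 = y ;
  flow_curve : forall y, C° y -> `|y - x| < rho -> integral_curve b u (phi y) h ;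
  flow_inside : forall y s, C° y -> `|y - x| < rho -> 0 <= s <= h ->
    [/\ C° (phi y s), `|phi y s - x| <= M & sigma (phi y s) u = 0] ;
  flow_limit : forall y s, C° y -> `|y - x| < rho -> 0 <= s <= h ->
    `|phi y s - psi s| <= 2 * `|y - x| ;
  flow_tangent : forall s, 0 <= s <= h -> `|psi s - (x + s *: b x u)| <= K * s ^+ 2 ;
  flow_cone : forall y s, C y -> `|y - x| < rho -> 0 < s < h ->
    eball (y + s *: b y u) (r * s) `<=` C° }.

Context (hC : closure C° = C)
  (hbd : forall x, boundary C x -> exists (u : 'cV[R]_m) (r eta : R),
     [/\ U u, 0 < r, 0 < eta,
         forall z, eball x eta z -> C z -> sigma z u = 0 &
         forall z s, eball x eta z -> C z -> 0 < s < r ->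
           eball (z + s *: b z u) (r * s) `<=` C°]) (hU0 : U !=set0).

Lemma interior_near x e : C x -> 0 < e -> exists2 y, C° y & `|y - x| < e.
Proof.
rewrite -{1}hC => Cx e0.
have /Cx[y [Cy /= yx]] : nbhs x (ball x e) by exact: nbhsx_ballx.
by exists y => //; move: yx; rewrite -ball_normE/= distrC.
Qed.

Lemma boundary_flow_exists x : C x -> ~ C° x ->
  exists u h rho r K M phi psi, boundary_flow x u h rho r K M phi psi.
Proof.
move=> Cx nCx.
have [rho rho0 near] := good_zone_near L0 hC hbd hU0 Cx.
have [u [zh0 [Uu zhpos]]] : exists u h, good_zone U b sigma L C (Zone x (rho / 2) u h).
  apply: near; first by rewrite subrr normr0.
  by rewrite divr_gt0//= ltr_pdivrMr// ltr_pMr// ltr1n.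
case=> [/= /(_ x)|[r nz]]; first by rewrite subrr normr0 divr_ge0 ?(ltW rho0)// => /(_ isT) /nCx.
set z := Zone x (rho / 2) u zh0 in nz.
have zr0 : 0 < zr z by rewrite divr_gt0.
pose B := L * (1 + `|zc z| + zr z).
have B0 : 0 <= B by rewrite mulr_ge0// !addr_ge0// ltW.
(* The four entries respect, in turn, the time step of the zone, the horizon, the half radius that
   keeps the flow in the zone, and L h <= 1/2 for [integral_curve_lip]. *)
pose h := Num.min (Num.min zh0 T) (Num.min (zr z / 2 / (B + 1) / 2) (1 / 2 / (L + 1))).
have h0 : 0 < h by rewrite !lt_min zhpos hT !divr_gt0// ltr_wpDl.
have hT' : h <= T by rewrite !ge_min lexx !orbT.
have hz : h <= zh z by rewrite !ge_min lexx.
have hB : B * h < zr z / 2.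
  have h1 : h <= zr z / 2 / (B + 1) / 2 by rewrite !ge_min lexx !orbT.
  have h2 : (B + 1) * h <= zr z / 2 / 2.
    apply: (le_trans (ler_wpM2l _ h1)); first by rewrite addr_ge0.
    by rewrite mulrA [(B + 1) * _]mulrC divfK// gt_eqF// ltr_wpDl.
  have : zr z / 2 / 2 < zr z / 2 by rewrite ltr_pdivrMr ?ltr_pMr ?divr_gt0// ltr1n.
  move: h2; rewrite mulrDl mul1r; lra.
have hL : L * h <= 1 / 2.
  have h1 : h <= 1 / 2 / (L + 1) by rewrite !ge_min lexx !orbT.
  apply: (le_trans (ler_wpM2l L0 h1)).
  by rewrite mulrA ler_pdivrMr ?ltr_wpDl// mulrC ler_wpM2l// lerDl.
have hzr : h < r by have [_ _ + _] := nz; exact: le_lt_trans.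
have r0 := lt_trans h0 hzr.
have /choice[phi phiP] : forall y, exists p : R -> 'cV[R]_d, C° y -> `|y - x| < zr z / 2 ->
   [/\ {within `[0, T], continuous p}, p 0 = y, integral_curve b u p h &
    forall s, 0 <= s <= h -> C° (p s) /\ `|p s - x| <= zr z].
  move=> y; have [[Cy yx]|nD] := pselect (C° y /\ `|y - x| < zr z / 2); last first.
    by exists (fun=> 0) => Cy yx; exfalso; apply: nD.
  have [p pP] := zone_curve Uu nz (ltW h0) hT' hz hB Cy yx.
  by exists p.
pose D := [set y | C° y /\ `|y - x| < zr z / 2].
have D0 : D !=set0.
  have [y Cy yx] := interior_near Cx (divr_gt0 zr0 (ltr0n _ 2)).
  by exists y.
have bL y y' : `|b y u - b y' u| <= L * `|y - y'| by exact: (coef_lip rb).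
have lip s y y' : 0 <= s <= h -> D y -> D y' -> `|phi y s - phi y' s| <= 2 * `|y - y'|.
  move=> sh [Cy yx] [Cy' yx']; have [_ p0 ip _] := phiP y Cy yx; have [_ p0' ip' _] := phiP y' Cy' yx'.
  by have := integral_curve_lip L0 bL (ltW h0) hL ip ip' sh; rewrite p0 p0'.
(* At each fixed time the flow is 2-Lipschitz in its interior starting point, so it has a limit as
   that point tends to x. *)
have /choice[psi psiP] : forall s : R, exists v, 0 <= s <= h ->
    forall y, D y -> `|phi y s - v| <= 2 * `|y - x|.
  move=> s; have [sh|sh] := boolP (0 <= s <= h); last by exists 0.
  have [v vP] := @lipschitz_limit _ _ D (phi ^~ s) 2 x (ler0n _ 2) D0 (fun y y' => lip s y y' sh).
  by exists v => _.
exists u, h, (zr z / 2), r, (L * B), (zr z), phi, psi; split => //.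
- by rewrite h0.
- by rewrite divr_gt0.
- by move=> y Cy yx; have [] := phiP y Cy yx.
- by move=> y Cy yx; have [] := phiP y Cy yx.
- by move=> y Cy yx; have [] := phiP y Cy yx.
- move=> y s Cy yx sh; have [_ _ _ /(_ s sh)[h1 h2]] := phiP y Cy yx; split => //.
  have [zs _ _ _] := nz; apply: zs => //; exact: interior_subset.
- by move=> y s Cy yx sh; apply: psiP.
- move=> s sh; apply/ler_addgt0Pr => e e0.
  (* The tangent bound is passed to the limit in y. The distance |y - x| is counted twice in
     comparing phi with psi, once for the starting points and h L times for the velocities; 4 + h L
     covers all of this. *)
  pose e' := Num.min (zr z / 2) (e / (4 + h * L)).
  have hL0 : 0 <= h * L by rewrite mulr_ge0// ltW.
  have e'0 : 0 < e' by rewrite lt_min !divr_gt0// ltr_wpDr.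
  have [y Cy yx] := interior_near Cx e'0.
  have yz : `|y - x| < zr z / 2 by apply: (lt_le_trans yx); rewrite ge_min lexx.
  have ye : (4 + h * L) * `|y - x| <= e.
    by rewrite mulrC -ler_pdivlMr ?ltr_wpDr// (le_trans (ltW yx))// ge_min lexx orbT.
  have [_ p0 [cp ip ep] inp] := phiP y Cy yz; have /andP[s0 s1] := sh.
  have tan := @curve_tangent _ _ (phi y) (fun v => b v u) 0 s B L B0 L0 s0 bL.
  have {tan} tan : `|phi y s - (phi y 0 + (s - 0) *: b (phi y 0) u)| <= L * B * (s - 0) ^+ 2.
    apply: tan.
    + move=> i; apply: integrableS (ip i) => // q /=; rewrite !in_itv/= => /andP[-> /le_trans->//].
    + by move=> q /andP[q0 qs]; apply: ep; rewrite q0 (le_trans qs).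
    + move=> q /andP[q0 qs]; apply: (@zone_speed _ _ _ _ _ _ L0 rb z Uu).
      by have [] := inp q; rewrite ?(ltW q0) ?(le_trans qs).
  rewrite subr0 p0 in tan.
  have h1 := psiP s sh y (conj Cy yz).
  have h2 := bL y x.
  have -> : psi s - (x + s *: b x u) = - (phi y s - psi s) + ((phi y s - (y + s *: b y u)) +
      ((y - x) + s *: (b y u - b x u))).
    by rewrite scalerBr; apply/matrixP => i j; rewrite !mxE; ring.
  apply: (le_trans (ler_normD _ _)); rewrite normrN.
  have h3 : `|s *: (b y u - b x u)| <= h * L * `|y - x|.
    by rewrite normrZ (ger0_norm s0) -mulrA ler_pM.
  have h4 := ler_normD (phi y s - (y + s *: b y u)) ((y - x) + s *: (b y u - b x u)).
  have h5 := ler_normD (y - x) (s *: (b y u - b x u)).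
  have n0 := normr_ge0 (y - x).
  move: ye; rewrite mulrDl; lra.
- move=> y s Cy yx /andP[s0 sh]; have [_ zb _ _] := nz.
  apply: zb => //; last by rewrite s0 (lt_trans sh).
  by rewrite (le_trans (ltW yx))// ler_pdivrMr// ler_peMr ?(ltW zr0)// ler1n.
Qed.

End boundary_flows.

(** * The value function *)

Lemma linear_growth (R : realType) (d m : nat) (U : set 'cV[R]_m)
    (f : 'cV[R]_d -> 'cV[R]_m -> R) : compact U ->
  {within [set: 'cV[R]_d] `*` U, continuous (fun p => f p.1 p.2)} ->
  (exists K : R, forall u x y, U u -> `|f x u - f y u| <= K * enorm (x - y)) ->
  exists2 Fc : R, 0 <= Fc & forall x u, U u -> f x u <= Fc * (1 + `|x|).
Proof.
move=> cU cf [K HK].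
have cK : compact ([set (0 : 'cV[R]_d)] `*` U) by apply: compact_setX => //; exact: compact_set1.
have cf0 : {within [set (0 : 'cV[R]_d)] `*` U, continuous (fun p => f p.1 p.2)}.
  by apply: continuous_subspaceW cf => -[x u] /= [_ Uu].
have /compact_bounded[M0 [M0r HM]] := continuous_compact cf0 cK.
pose M := Num.max 0 (M0 + 1).
have fM u : U u -> f 0 u <= M.
  move=> Uu; apply: (le_trans (ler_norm _)); apply: (HM M).
    by rewrite lt_max ltrDl ltr01 orbT.
  by exists (0, u).
have M0' : 0 <= M by rewrite le_max lexx.
pose K' := `|K| * (d * 1)%:R.
have K0 : 0 <= K' by rewrite mulr_ge0.
exists (M + K') => [|x u Uu]; first by rewrite addr_ge0.
have h1 := fM u Uu; have h2 := le_trans (ler_norm _) (HK u x 0 Uu).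
have h3 : K * enorm (x - 0) <= K' * `|x|.
  rewrite subr0 /K' -mulrA; apply: (le_trans (ler_norm _)).
  by rewrite normrM ler_wpM2l// ger0_norm ?enorm_ge0// enorm_le_norm.
have n0 := normr_ge0 x.
have h4 : M * 1 <= M * (1 + `|x|) by rewrite ler_wpM2l// lerDl.
have h5 : 0 <= K' * 1 by rewrite mulr1.
rewrite mulrDl [K' * _]mulrDr; move: h1 h2 h3 h4 h5; lra.
Qed.

Lemma distr_le_of_bounds (R : realType) (v v' k c : R) :
  v' <= v + k -> v <= c + v' -> c <= k -> `|v - v'| <= k.
Proof. by move=> h1 h2 h3; rewrite ler_norml; apply/andP; split; lra. Qed.

Section value_function.
Context (R : realType) (T : R) (hT : 0 < T) (N d m : nat).
Context (P : probability (Omega T N) R) (hP : wiener_measure P).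
Context (U : set 'cV[R]_m) (b : 'cV[R]_d -> 'cV[R]_m -> 'cV[R]_d).
Context (sigma : 'cV[R]_d -> 'cV[R]_m -> 'M[R]_(d, N)).
Context (L : R) (L0 : 0 <= L) (rb : regular_coef U b L) (rs : regular_coef U sigma L).
Context (f : 'cV[R]_d -> 'cV[R]_m -> R) (Fc : R) (Fc0 : 0 <= Fc).
Context (f0 : forall x u, U u -> 0 <= f x u).
Context (cf : {within [set: 'cV[R]_d] `*` U, continuous (fun p => f p.1 p.2)}).
Context (fg : forall x u, U u -> f x u <= Fc * (1 + `|x|)).
Context (X : (R -> cpath T N -> 'cV[R]_m) -> R -> 'cV[R]_d -> R -> cpath T N -> 'cV[R]_d).
Context (hX : forall nu t x, controls P U nu -> 0 <= t <= T ->
  unique_sde_solution P b sigma nu t x (X nu t x)).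
Context (C : set 'cV[R]_d) (hC : closure C° = C)
  (hbd : forall x, boundary C x -> exists (u : 'cV[R]_m) (r eta : R),
     [/\ U u, 0 < r, 0 < eta,
         forall z, eball x eta z -> C z -> sigma z u = 0 &
         forall z s, eball x eta z -> C z -> 0 < s < r ->
           eball (z + s *: b z u) (r * s) `<=` C°]) (hU0 : U !=set0).

Local Notation V := (value P U f C X).

Let zeroT : 0 <= (0 : R) <= T. Proof. by rewrite lexx ltW. Qed.

Let hXs nu t x : controls P U nu -> 0 <= t <= T -> sde_solution P b sigma nu t x (X nu t x).
Proof. by move=> cnu tT; have [] := hX x cnu tT. Qed.

Lemma cost_running nu t x : controls P U nu -> 0 <= t <= T ->
  cost P f X nu t x = dint (cprob P) (@running R T N d m P f nu (X nu t x) t) setT 0 T.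
Proof.
move=> cnu tT; have [aX cX _] := hXs x cnu tT.
exact: (cost_dint hT cf cnu aX cX tT).
Qed.

Lemma cost_ge0 nu t x : controls P U nu -> 0 <= t <= T -> (0 <= cost P f X nu t x)%E.
Proof.
move=> cnu tT; rewrite cost_running//.
by apply: dint_ge0 => s w; exact: (running_ge0 f0 cnu).
Qed.

Lemma value_ge0 t x : 0 <= t <= T -> (0 <= V t x)%E.
Proof.
move=> tT; apply: le_ereal_inf_tmp => _ [nu [[cnu _] _] <-].
exact: cost_ge0.
Qed.

Lemma viable_from t x : 0 <= t <= T -> C° x -> exists nu, controls_from P U t nu /\
  {ae P, forall w, forall s, 0 <= s <= T -> C° (X nu t x s w)}.
Proof.
move=> tT Cx; have [u0 Uu0] := hU0.
have near := good_zone_near L0 hC hbd hU0.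
have [zs [gzs rec]] := zone_sequence Uu0 near.
have cC : closed C by rewrite -hC; exact: closed_closure.
have [nu [cnu vnu]] := viable_construction hT hP L0 rb rs hX Uu0 gzs Cx cC rec.
have cs := controls_shifted hT hP tT cnu Uu0.
have ss := sde_shift hT hP tT L0 rb cnu Uu0 (hXs x cnu zeroT).
exists (shifted hT tT nu u0); split; first exact: cs.
have [_ uniq] := hX x cs.1 tT; have /andP[t0 _] := tT.
have FP : Filter (almost_everywhere P) by exact: ae_filter_ringOfSetsType.
apply: (@filterS2 _ _ FP _ _ _ _ (uniq _ ss) (shift_ae hT hP tT vnu)) => w h1 h2 s sT.
rewrite -h1//; apply: h2; have /andP[-> h] := delay_range tT sT.
by rewrite /= (le_trans h)// gerBl.
Qed.

Lemma value_le t x : 0 <= t <= T -> C° x ->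
  (V t x <= (Fc * T * (2 + moment_cst T N d L * (1 + \sum_i x i ord0 ^+ 2)))%:E)%E.
Proof.
move=> tT Cx; have [nu [cnu vnu]] := viable_from tT Cx.
apply: ge_ereal_inf; exists (cost P f X nu t x); first by exists nu.
have [cnu' _] := cnu; have sX := hXs x cnu' tT; have [aX cX _] := sX.
by rewrite cost_running//; exact: (cost_le hT hP L0 rb rs f0 cf fg cnu' aX cX Fc0 tT sX).
Qed.

Lemma value_concat x u h rho r K M phi psi s e y :
  boundary_flow T U b sigma C x u h rho r K M phi psi ->
  C° y -> `|y - x| < rho -> 0 <= s -> 0 <= e <= h -> s + e <= T ->
  (V s y <= (Fc * (1 + (`|x| + M)) * e)%:E + V (s + e)%R (phi y e))%E.
Proof.
move=> BF Cy yx s0 /andP[e0 eh] seT.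
have Uu := flow_control BF.
have cp := flow_continuous BF Cy yx.
have p0 := flow_start BF Cy yx.
have [_ _ pb] := flow_curve BF Cy yx.
have ins q : 0 <= q <= e -> [/\ C° (phi y q), `|phi y q - x| <= M & sigma (phi y q) u = 0].
  by move=> /andP[q0 qe]; apply: (flow_inside BF Cy yx); rewrite q0 (le_trans qe).
have pb' q : 0 <= q <= e -> forall i, phi y q i ord0 = phi y 0 i ord0 +
    \int[@lebesgue_measure R]_(a in `]0, q]) b (phi y a) u i ord0.
  by move=> /andP[q0 qe]; apply: pb; rewrite q0 (le_trans qe).
have ps q : 0 <= q <= e -> sigma (phi y q) u = 0 by move=> /ins[].
have sT : 0 <= s <= T by rewrite s0 (le_trans _ seT)// lerDl.
have cT : 0 <= s + e <= T by rewrite addr_ge0.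
have M0 : 0 <= M by have [|_ h1 _] := ins 0; [rewrite lexx|exact: le_trans h1].
have Fb0 : 0 <= Fc * (1 + (`|x| + M)) by rewrite mulr_ge0// !addr_ge0.
have pf q : 0 <= q <= e -> f (phi y q) u <= Fc * (1 + (`|x| + M)).
  move=> /ins[_ h1 _]; apply: (le_trans (fg _ Uu)); rewrite ler_wpM2l// lerD2l.
  by rewrite -(subrK x (phi y q)) addrC (le_trans (ler_normD _ _))// lerD2l.
(* The finite running cost is moved to the other side so that the infimum defining the later value
   can be tested control by control, and back again. *)
rewrite -leeBlDl//; apply: le_ereal_inf_tmp => _ [nu [cnu vnu] <-].
rewrite leeBlDl//.
have [cnu' _] := cnu; have sX := hXs (phi y e) cnu' cT.
have cc := concat_controls hT s0 e0 seT Uu cnu sX.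
have cs := concat_sde hT hP L0 rb s0 e0 seT Uu cp pb' ps cnu sX.
have cv := concat_viable s e0 (O := C°) (fun q h => let: And3 h1 _ _ := ins q h in h1) vnu.
set nu2 := (X in controls_from _ _ _ X) in cc cs.
have [_ uniq] := hX y cc.1 sT.
have csy := cs; rewrite p0 in csy.
have FP : Filter (almost_everywhere P) by exact: ae_filter_ringOfSetsType.
have eqZ := uniq _ csy.
have eqZ' := @filterS _ _ FP _ _ (fun w h r rT => esym (h r rT)) eqZ.
apply: (@le_trans _ _ (cost P f X nu2 s y)).
  apply: ereal_inf_lbound; exists nu2; last by []; split; first exact: cc.
  by apply: (@filterS2 _ _ FP _ _ _ _ eqZ' cv) => w h1 h2 q qT; rewrite h1//; exact: h2.
rewrite !cost_running//; last exact: cc.1.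
apply: (concat_cost hT s0 e0 seT Uu cnu sX Fb0 f0 cf pf) eqZ'.
by rewrite p0; apply: hXs => //; exact: cc.1.
Qed.

(** * The upper semicontinuous envelope *)

Local Notation E := [set z : R * 'cV[R]_d | 0 <= z.1 <= T /\ C° z.2].
Local Notation Vs := (value_usc P U f C X).

Lemma usc_le t x (M : \bar R) (e : R) : 0 < e ->
  (forall s y, `|s - t| < e -> `|y - x| < e -> 0 <= s <= T -> C° y -> (V s y <= M)%E) ->
  (Vs t x <= M)%E.
Proof.
move=> e0 H; apply: ge_ereal_inf.
exists (ereal_sup ((fun z => V z.1 z.2) @` (ball (t, x) e `&` E))); last first.
  apply: ge_ereal_sup => _ [[s y] [[/= h1 h2] [h3 h4]] <-]; apply: H => //.
    by move: h1; rewrite /ball/= distrC.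
  by move: h2; rewrite -ball_normE/= distrC.
exists (ball (t, x) e `&` E) => //.
by rewrite /within/=; apply: filterS (nbhsx_ballx (t, x) e e0) => z hz Ez; split.
Qed.

Lemma usc_lt t x (M : \bar R) : (Vs t x < M)%E -> exists2 e : R, 0 < e &
  forall s y, `|s - t| < e -> `|y - x| < e -> 0 <= s <= T -> C° y -> (V s y <= M)%E.
Proof.
move=> /ereal_inf_lt[_ [A FA <-] AM].
have /nbhs_ballP[e /= e0 eA] := FA.
exists e => // s y h1 h2 sT Cy; apply: (le_trans _ (ltW AM)).
apply: ereal_sup_ubound; exists (s, y) => //; apply: eA; last by split.
split => /=; first by rewrite /ball/= distrC.
by rewrite -ball_normE/= distrC.
Qed.

(** Since x belongs to the closure of the interior, every neighbourhood contains admissible points;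
    a supremum over the empty set would be minus infinity. *)
Lemma usc_ge0 t x : 0 <= t <= T -> C x -> (0 <= Vs t x)%E.
Proof.
move=> tT Cx; apply: le_ereal_inf_tmp => _ [A FA <-].
have /nbhs_ballP[e /= e0 eA] := FA.
have [y Cy yx] := interior_near hC Cx e0.
apply: le_ereal_sup_tmp; exists (V t y); last exact: value_ge0.
exists (t, y) => //; apply: eA; last by split.
split => /=; first exact: ballxx.
by rewrite -ball_normE/= distrC.
Qed.

(** The moment bound for the value is uniform for starting points in a unit neighbourhood of x. *)
Lemma usc_fin t x : 0 <= t <= T -> C x -> Vs t x \is a fin_num.
Proof.
move=> tT Cx; have mc := moment_cst_ge0 hT N d L.
pose B := Fc * T * (2 + moment_cst T N d L * (1 + d%:R * (`|x| + 1) ^+ 2)).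
rewrite ge0_fin_numE; last exact: usc_ge0.
apply: (@le_lt_trans _ _ B%:E); last exact: ltry.
apply: (@usc_le t x B%:E 1) => // s y _ yx sT Cy; apply: (le_trans (value_le sT Cy)).
rewrite lee_fin /B ler_wpM2l ?mulr_ge0 ?(ltW hT)// lerD2l ler_wpM2l// lerD2l.
apply: (@le_trans _ _ (\sum_(i < d) (`|x| + 1) ^+ 2)); last first.
  by rewrite sumr_const card_ord mulr_natl lexx.
apply: ler_sum => i _; rewrite -real_normK ?num_real// ler_pXn2r ?nnegrE ?addr_ge0//.
apply: (le_trans (coord_le_norm _ _ _)).
by rewrite -(subrK x y) addrC (le_trans (ler_normD _ _))// lerD2l ltW.
Qed.

(** * The envelope along the boundary flow *)

Section at_boundary.
Context (t : R) (x : 'cV[R]_d) (tT : 0 <= t < T).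
Context (u : 'cV[R]_m) (h rho r K M : R) (phi : 'cV[R]_d -> R -> 'cV[R]_d) (psi : R -> 'cV[R]_d).
Context (BF : boundary_flow T U b sigma C x u h rho r K M phi psi).

Let Fb := Fc * (1 + (`|x| + M)).

Lemma flow_limit_in e : C x -> 0 <= e <= h -> C (psi e).
Proof.
move=> Cx eh; rewrite -hC => A /nbhs_ballP[a /= a0 aA].
have rho0 := flow_near BF.
have ra0 : 0 < Num.min rho (a / 2) by rewrite lt_min rho0 divr_gt0.
have [y Cy] := interior_near hC Cx ra0.
rewrite lt_min => /andP[yr ya]; have [Cp _ _] := flow_inside BF Cy yr eh.
exists (phi y e); split => //; apply: aA; rewrite -ball_normE/= distrC.
by apply: (le_lt_trans (flow_limit BF Cy yr eh)); rewrite mulrC -ltr_pdivlMr.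
Qed.

Lemma usc_flow e : C x -> 0 <= e <= h -> t + e < T -> 
  (Vs t x <= (Fb * e)%:E + Vs (t + e)%R (psi e))%E.
Proof.
move=> Cx /andP[e0 eh] teT; have /andP[t0 _] := tT.
apply/lee_addgt0Pr => k k0.
rewrite -addeA -leeBlDl//.
have [->|fin] := eqVneq (Vs (t + e)%R (psi e)) +oo%E; first by rewrite addye// leey.
have lt : (Vs (t + e)%R (psi e) < Vs (t + e)%R (psi e) + k%:E)%E.
  rewrite lteDl ?lte_fin// ge0_fin_numE; first by rewrite lt_neqAle fin leey.
  apply: usc_ge0; first by rewrite addr_ge0// ltW.
  by apply: flow_limit_in => //; rewrite e0.
have [a a0 aP] := usc_lt lt.
rewrite leeBlDl//.
have rho0 := flow_near BF.
(* The last entry keeps s + e at most T for all starting times s near t; a / 2 compensates the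
   Lipschitz factor 2 of the flow. *)
pose a' := Num.min (Num.min rho (a / 2)) (T - (t + e)).
have a'0 : 0 < a' by rewrite !lt_min rho0 divr_gt0//= subr_gt0.
apply: (@usc_le t x _ a' a'0) => s y st yx /andP[s0 sT] Cy.
move: st yx; rewrite !lt_min => /andP[/andP[_ st] st'] /andP[/andP[yr ya] _].
have eh' : 0 <= e <= h by rewrite e0.
have seT : s + e <= T.
  by move: (ler_norm (s - t)) st'; lra.
apply: (le_trans (value_concat BF Cy yr s0 eh' seT)); apply: leeD2l.
have [Cp _ _] := flow_inside BF Cy yr eh'.
apply: aP => //.
- have -> : s + e - (t + e) = s - t by ring.
  by apply: (lt_le_trans st); rewrite ler_pdivrMr// ler_peMr ?(ltW a0)// ler1n.
- by apply: (le_lt_trans (flow_limit BF Cy yr eh')); rewrite mulrC -ltr_pdivlMr.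
- by rewrite addr_ge0.
Qed.

Let S := `|b x u| + K * h.

Lemma flow_cst_ge0 : 0 <= K.
Proof.
have /andP[h0 _] := flow_time BF.
have := flow_tangent BF (_ : 0 <= h <= h); rewrite lexx ltW// => /(_ isT) hk.
by have := le_trans (normr_ge0 _) hk; rewrite pmulr_lge0// exprn_gt0.
Qed.

Lemma flow_speed_ge0 : 0 <= S.
Proof.
have /andP[h0 _] := flow_time BF; have K0 := flow_cst_ge0.
by rewrite addr_ge0// mulr_ge0// ltW.
Qed.

Lemma flow_limit_le e : 0 <= e <= h -> `|psi e - x| <= e * S.
Proof.
move=> /andP[e0 eh]; have K0 := flow_cst_ge0.
have := flow_tangent BF (_ : 0 <= e <= h); rewrite e0 eh => /(_ isT) tan.
have -> : psi e - x = (psi e - (x + e *: b x u)) + e *: b x u.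
  by rewrite opprD addrA subrK.
apply: (le_trans (ler_normD _ _)); rewrite normrZ (ger0_norm e0) addrC mulrDr lerD2l.
by apply: (le_trans tan); rewrite expr2 mulrCA ler_wpM2l// ler_wpM2l.
Qed.

(** The point (t + e, psi e) is close to (t, x), as psi moves away from x at speed at most S; a
    small neighbourhood of it lies in one of (t, x) on which V is almost bounded by the envelope. *)
Lemma usc_flow_upper (k : R) : C x -> 0 < k -> exists2 a : R, 0 < a &
  forall e, 0 < e < a -> (Vs (t + e)%R (psi e) <= Vs t x + k%:E)%E.
Proof.
move=> Cx k0; have /andP[t0 tT'] := tT; have S0 := flow_speed_ge0.
have /andP[h0 _] := flow_time BF.
have fin : Vs t x \is a fin_num by apply: usc_fin => //; rewrite t0 ltW.
have lt : (Vs t x < Vs t x + k%:E)%E by rewrite lteDl ?lte_fin.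
have [a a0 aP] := usc_lt lt.
have a2 : 0 < a / 2 by rewrite divr_gt0.
have S1 : 0 < S + 1 by rewrite ltr_wpDl.
exists (Num.min h (Num.min (a / 2) (a / 2 / (S + 1)))).
  by rewrite !lt_min h0 a2 divr_gt0.
move=> e /andP[e0]; rewrite !lt_min => /andP[eh /andP[ea eS]].
apply: (@usc_le _ _ _ (a / 2)) => // s y st yx sT Cy; apply: aP => //.
  have -> : s - t = (s - (t + e)) + e by ring.
  by rewrite (le_lt_trans (ler_normD _ _))// (ger0_norm (ltW e0)) [ltRHS]splitr ltrD.
rewrite -(subrK (psi e) y) -addrA (le_lt_trans (ler_normD _ _))//.
rewrite [ltRHS]splitr ltrD// (@le_lt_trans _ _ (e * S))//.
  by apply: flow_limit_le; rewrite !ltW.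
rewrite (@le_lt_trans _ _ (e * (S + 1)))//; first by rewrite ler_wpM2l ?ltW// ltrDl.
by rewrite -ltr_pdivlMr.
Qed.

Lemma usc_flow_cvg : C x ->
  fine (Vs (t + e) (x + (psi e - x))) @[e --> 0^'+] --> fine (Vs t x).
Proof.
move=> Cx; have /andP[t0 tT'] := tT.
have /andP[h0 _] := flow_time BF.
have fin : Vs t x \is a fin_num by apply: usc_fin => //; rewrite t0 ltW.
have Fb1 : 0 < `|Fb| + 1 by rewrite ltr_wpDl.
apply/cvgrPdist_le => k k0.
have [a a0 aP] := usc_flow_upper Cx k0.
have d0 : 0 < Num.min (Num.min h (T - t)) (Num.min a (k / (`|Fb| + 1))).
  by rewrite !lt_min h0 a0 subr_gt0 tT' divr_gt0.
near=> e.
have e0 : 0 < e by near: e; exact: nbhs_right_gt.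
have : e < Num.min (Num.min h (T - t)) (Num.min a (k / (`|Fb| + 1))).
  by near: e; exact: nbhs_right_lt.
rewrite !lt_min => /andP[/andP[eh eT] /andP[ea ek]].
rewrite [x + _]addrC subrK.
have teT : t + e < T by rewrite -ltrBrDl.
have eh' : 0 <= e <= h by rewrite !ltW.
have fin' : Vs (t + e)%R (psi e) \is a fin_num.
  by apply: usc_fin; [rewrite addr_ge0 ?(ltW e0)//= ltW|exact: flow_limit_in].
have e0a : 0 < e < a by rewrite e0.
have up := aP e e0a; have low := usc_flow Cx eh' teT.
rewrite -(fineK fin) -(fineK fin') in up low.
rewrite -EFinD lee_fin in up; rewrite -EFinD lee_fin in low.
have Fe : Fb * e <= k.
  have h1 : (`|Fb| + 1) * e <= k by rewrite mulrC -ler_pdivlMr// ltW.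
  by apply: le_trans h1; rewrite ler_wpM2r ?ltW// (le_lt_trans (ler_norm _))// ltrDl.
move: (fine (Vs t x)) (fine (Vs (t + e)%R (psi e))) up low => v v' up low.
exact: distr_le_of_bounds up low Fe.
Unshelve. all: by end_near. Qed.

Lemma flow_displacement_einf :
  (limf_einf (fun e : R => (e^-1 * enorm (psi e - x))%:E) 0^'+ < +oo)%E.
Proof.
have /andP[h0 _] := flow_time BF; have S0 := flow_speed_ge0.
apply: (@le_lt_trans _ _ ((d * 1)%:R * S)%:E); last exact: ltry.
rewrite /limf_einf leeNl; apply: le_ereal_inf_tmp => _ [A FA <-].
have [e [Ae e0 eh]] : exists e, [/\ A e, 0 < e & e < h].
  have : \forall e \near 0^'+, [/\ A e, 0 < e & e < h].
    near=> e; split; near: e; [exact: FA|exact: nbhs_right_gt|exact: nbhs_right_lt].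
  by move=> /filter_ex.
apply: le_ereal_sup_tmp; exists (- (e^-1 * enorm (psi e - x))%:E)%E; first by exists e.
rewrite leeN2 lee_fin mulrC ler_pdivrMr// (le_trans (enorm_le_norm _))//.
rewrite -mulrA ler_wpM2l// mulrC; apply: flow_limit_le.
by rewrite !ltW.
Unshelve. all: by end_near. Qed.

Lemma flow_cone_near : exists B : set 'cV[R]_d, open_nbhs x B /\
  forall o : R -> 'cV[R]_d, e^-1 *: o e @[e --> 0^'+] --> (0 : 'cV[R]_d) ->
    exists2 delta : R, 0 < delta & forall (y : 'cV[R]_d) (e : R), C° y -> B y ->
      0 < e < Num.min h delta -> C° (y + (psi e - x) + o e).
Proof.
have /andP[h0 _] := flow_time BF; have K0 := flow_cst_ge0.
have r0 := flow_speed BF; have rho0 := flow_near BF; have Uu := flow_control BF.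
pose D1 : R := (d * 1)%:R + 1.
have D10 : 0 < D1 by rewrite ltr_wpDl.
(* Three errors, from the curvature of psi, from the variation of b between x and y, and from o(e),
   are each at most e tau. Dividing by 4 leaves their sum strictly below the cone radius r e after
   the change of norm by D1. *)
pose tau := r / D1 / 4.
have tau0 : 0 < tau by rewrite !divr_gt0.
have L1 : 0 < L + 1 by rewrite ltr_wpDl.
have K1 : 0 < K + 1 by rewrite ltr_wpDl.
pose rho' := Num.min rho (tau / (L + 1)).
have rho'0 : 0 < rho' by rewrite lt_min rho0 divr_gt0.
exists (ball x rho')°; split; first by split; [exact: open_interior|exact: nbhsx_ballx].
move=> o /cvgrPdist_lt /(_ tau tau0) /nbhs_ballP[d0 /= d00 Hd].
exists (Num.min d0 (tau / (K + 1))); first by rewrite lt_min d00 divr_gt0.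
move=> y e Cy /interior_subset; rewrite -ball_normE/= distrC lt_min => /andP[yr yt] /andP[e0].
rewrite !lt_min => /andP[eh /andP[ed eK]].
have eh' : 0 < e < h by rewrite e0.
have eh2 : 0 <= e <= h by rewrite !ltW.
apply: (flow_cone BF (interior_subset Cy) yr eh').
rewrite /eball/=; apply: (le_lt_trans (enorm_le_norm _)).
have oe : `|o e| <= e * tau.
  have /= := Hd e; rewrite /ball/= sub0r normrN gtr0_norm// => /(_ ed e0).
  rewrite sub0r normrN normrZ ger0_norm; last by rewrite invr_ge0 ltW.
  by move=> /ltW h1; rewrite -ler_pdivrMl.
have tan := flow_tangent BF eh2.
have lip := coef_lip rb x y Uu.
have -> : y + (psi e - x) + o e - (y + e *: b y u) =
    (psi e - (x + e *: b x u)) + (e *: (b x u - b y u) + o e).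
  by rewrite scalerBr; apply/matrixP => i j; rewrite !mxE; ring.
have n1 := ler_normD (psi e - (x + e *: b x u)) (e *: (b x u - b y u) + o e).
have n2 := ler_normD (e *: (b x u - b y u)) (o e).
have n3 : `|e *: (b x u - b y u)| <= e * tau.
  rewrite normrZ (gtr0_norm e0) ler_wpM2l ?(ltW e0)//.
  have h1 : (L + 1) * `|y - x| <= tau by rewrite mulrC -ler_pdivlMr// ltW.
  apply: (le_trans lip); rewrite distrC; move: h1; rewrite mulrDl mul1r => h1.
  by have := normr_ge0 (y - x); lra.
have n4 : K * e ^+ 2 <= e * tau.
  have h1 : (K + 1) * e <= tau by rewrite mulrC -ler_pdivlMr// ltW.
  rewrite expr2 mulrCA ler_wpM2l ?(ltW e0)//; move: h1; rewrite mulrDl mul1r; lra.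
set v := (X in `|X|).
have vn : `|v| <= 3 * (e * tau) by move: n1 n2 n3 n4 tan oe; rewrite -/v; lra.
have e4 : D1 * (4 * (e * tau)) = r * e by rewrite /tau; field; rewrite gt_eqF.
rewrite -e4 (@le_lt_trans _ _ (D1 * `|v|))//; first by rewrite ler_wpM2r// lerDl.
have et : 0 < e * tau by rewrite mulr_gt0.
rewrite ltr_pM2l//; apply: (le_lt_trans vn); move: (e * tau) et => q; lra.
Qed.

End at_boundary.
End value_function.

(** The first conjunct gives [fine] its meaning in the second: the envelope is finite on all of
    [0, T] times C. *)
Theorem proposition4p8
  (R : realType) (T : R) (hT : 0 < T) (N d m : nat)
  (P : probability (Omega T N) R) (hP : wiener_measure P)
  (U : set 'cV[R]_m) (hU : compact U) (hU0 : U !=set0)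
  (b : 'cV[R]_d -> 'cV[R]_m -> 'cV[R]_d)
  (sigma : 'cV[R]_d -> 'cV[R]_m -> 'M[R]_(d, N))
  (f : 'cV[R]_d -> 'cV[R]_m -> R)
  (hb : [lipschitz b p.1 p.2 | p in [set: 'cV[R]_d] `*` U])
  (hsigma : [lipschitz sigma p.1 p.2 | p in [set: 'cV[R]_d] `*` U])
  (hf0 : forall x u, U u -> 0 <= f x u)
  (hfc : {within [set: 'cV[R]_d] `*` U, continuous (fun p => f p.1 p.2)})
  (hfl : exists K : R, forall u x y, U u -> `|f x u - f y u| <= K * enorm (x - y))
  (X : (R -> cpath T N -> 'cV[R]_m) -> R -> 'cV[R]_d -> R -> cpath T N -> 'cV[R]_d)
  (hX : forall nu t x, controls P U nu -> 0 <= t <= T ->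
     unique_sde_solution P b sigma nu t x (X nu t x))
  (C : set 'cV[R]_d) (hC0 : C° !=set0) (hC : closure C° = C)
  (hbd : forall x, boundary C x -> exists (u : 'cV[R]_m) (r eta : R),
     [/\ U u, 0 < r, 0 < eta,
         forall z, eball x eta z -> C z -> sigma z u = 0 &
         forall z s, eball x eta z -> C z -> 0 < s < r ->
           eball (z + s *: b z u) (r * s) `<=` C°]) :
  (forall t x, 0 <= t <= T -> C x -> value_usc P U f C X t x \is a fin_num) /\
  class_R T C° (fun t x => fine (value_usc P U f C X t x)).
Proof.
have [L1 L10 rb1] := lipschitz_regular hU hb.
have [L2 L20 rs2] := lipschitz_regular hU hsigma.
pose L := Num.max L1 L2.
have L0 : 0 <= L by rewrite le_max L10.
have rb : regular_coef U b L by apply: rb1; rewrite le_max lexx.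
have rs : regular_coef U sigma L by apply: rs2; rewrite le_max lexx orbT.
have [Fc Fc0 fg] := linear_growth hU hfc hfl.
split.
  by move=> t x tT Cx; exact: (usc_fin hT hP L0 rb rs Fc0 hf0 hfc fg hX hC hbd hU0 tT Cx).
move=> t x tT [Cx nCx]; rewrite hC in Cx.
(* The closure of the interior is C and the interior of the open set C° is C° itself, so x is a
   boundary point of C. *)
have {}nCx : ~ C° x by move=> h; apply: nCx; apply: open_nbhs_nbhs; split => //; exact: open_interior.
have [u [h [rho [r [K [M [phi [psi BF]]]]]]]] :=
  boundary_flow_exists hT hP L0 rb rs hX hC hbd hU0 Cx nCx.
exists (fun e => psi e - x); split.
  have [B [oB BP]] := flow_cone_near L0 rb BF.
  exists h, B; split => //.
  - by have /andP[] := flow_time BF.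
  - exact: (flow_displacement_einf BF).
(* Time advances together with the flow, so lambda is the identity. *)
exists id; split => //; first by apply: cvg_at_right_filter; exact: cvg_id.
exact: (usc_flow_cvg hT hP L0 rb rs Fc0 hf0 hfc fg hX hC hbd hU0 tT BF Cx).
Qed.
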